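(* Let $M$ be a Riemannian spin manifold of dimension $d$, $1\le d\ne4$, let $V=L^2(S^1,\mathbb{S})\otimes\mathbb{C}^d$ with its Lagrangian $L$ be as in the odd Fock extension of $L\mathrm{Spin}(d)$, and let $\mathcal{H}=(L\mathrm{Spin}(TM)\times V)/L\mathrm{Spin}(d)$ over $LM=C^\infty(S^1,M)$. Let $\gamma\in LM$. The two equivalence classes of Lagrangians in $\mathcal{H}_\gamma$, namely the one determined by the reduction $\mathrm{O}_L(\mathcal{H})$ (the class of the Lagrangians $\nu(L)$, $\nu\in\mathrm{O}_L(\mathcal{H})_\gamma$) and the one determined by the Dirac sublagrangian $\mathrm{Eig}_{>0}(D_\gamma)\subset\mathcal{H}_\gamma$, are equal.
   Context: Lagrangians. For a complex Hilbert space $V$ with real structure $\alpha$ (anti-unitary involution), a Lagrangian is a subspace $L\subset V$ with $V=L\oplus\alpha(L)$ orthogonally. Two Lagrangians $L_1,L_2$ are equivalent if $P_{L_1}-P_{L_2}$ is Hilbert–Schmidt (where $P_{L_i}$ is the orthogonal projection to $L_i$); equivalently, there is $g\in\mathrm{O}_{L_1}(V)$ with $g(L_1)=L_2$. Here $\mathrm{O}(V)$ is the group of unitaries commuting with $\alpha$, and $\mathrm{O}_L(V)=\{g\in\mathrm{O}(V):P_LgP_L^\perp\text{ is Hilbert–Schmidt}\}$. A sublagrangian is an isotropic subspace $L'$ (i.e. $L'\perp\alpha(L')$) such that $L'\oplus\alpha(L')$ has finite and even codimension; it is contained in some Lagrangian, and all Lagrangians containing it are equivalent; the class of these is the equivalence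 class determined by $L'$. Odd Fock extension. $\mathbb{S}\to S^1$ is the spinor bundle of the odd (connected, bounding) spin structure; smooth sections of $\mathbb{S}$ tensored with $\mathbb{C}^d$ are identified with smooth $2\pi$-antiperiodic functions $\mathbb{R}\to\mathbb{C}^d$. $V=L^2(S^1,\mathbb{S})\otimes\mathbb{C}^d$ has real structure $\alpha$ given by componentwise complex conjugation, orthonormal basis $\xi_{n,j}(t)=e^{-i(n+\frac12)t}e_j$ ($n\in\mathbb{Z}$, $j=1,\dots,d$, up to normalization), with $\alpha(\xi_{n,j})=\xi_{-n-1,j}$, and $L$ is the closed linear span of $\{\xi_{n,j}:n\ge0,\ j=1,\dots,d\}$. The loop group $L\mathrm{Spin}(d)$ acts on $V$ pointwise through $L\mathrm{SO}(d)$, by a smooth homomorphism $\omega:L\mathrm{Spin}(d)\to\mathrm{O}_L(V)$. Bundle. $\mathrm{Spin}(TM)$ is the given spin structure, $L\mathrm{Spin}(TM)$ its free loop space, a Fréchet principal $L\mathrm{Spin}(d)$-bundle over $LM$. $\mathcal{H}$ has the real structure induced by $\alpha$. $\mathrm{O}_L(\mathcal{H})=L\mathrm{Spin}(TM)\times_{L\mathrm{Spin}(d)}\mathrm{O}_L(V)$; an element $[\varphi,g]$ over $\gamma$ is the orthogonal frame $\nu:V\to\mathcal{H}_\gamma$, $v\mapsto[\varphi,gv]$. The fibre $\mathcal{H}_\gamma$ is identified with $L^2(S^1,\mathbb{S}\otimes\gamma^*TM_{\mathbb{C}})$ via $[\varphi,s\otimes w]\mapsto s\otimes\varphi_{\mathbb{C}}(w)$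 ($\varphi_{\mathbb{C}}(w)$ the pointwise application of the complexified frames $\varphi(t)_{\mathbb{C}}$ to $w\in\mathbb{C}^d$). Dirac operator. $D_\gamma$ is the twisted Dirac operator on $\mathcal{H}_\gamma$, i.e. $i$ times the covariant derivative along $t$ induced by $\frac{d}{dt}$ on $\mathbb{S}$ and the pullback along $\gamma$ of the Levi-Civita connection on $TM$ (acting on antiperiodic sections along $\gamma$). It has discrete spectrum: if $v_1,\dots,v_d$ is an orthonormal basis of $T_{\gamma(0)}M_{\mathbb{C}}$ diagonalizing parallel transport $\mathrm{pt}_\gamma(2\pi)$ around $\gamma$ with eigenvalues $e^{i\varphi_j}$, $\varphi_j\in[-\pi,\pi)$, then $\eta_{n,j}(t)=e^{-i(n+\frac12)t-i\frac{\varphi_j}{2\pi}t}\,\mathrm{pt}_\gamma(t)v_j$ are eigenvectors with eigenvalues $n+\frac12+\frac{\varphi_j}{2\pi}$, $n\in\mathbb{Z}$. $\mathrm{Eig}_{>0}(D_\gamma)$ is the closed span of the eigenvectors with positive eigenvalue; it is a sublagrangian of $\mathcal{H}_\gamma$, called the Dirac sublagrangian. *)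

(* Defs.v *)
From HB Require Import structures.
From mathcomp Require Import all_boot all_order all_algebra.
From mathcomp Require Import all_classical all_reals all_analysis.
From mathcomp.real_closed Require Export complex.
Set Implicit Arguments.
Unset Strict Implicit.
Unset Printing Implicit Defensive.
Import Order.TTheory GRing.Theory Num.Theory.
Import numFieldNormedType.Exports.
Local Open Scope classical_set_scope.
Local Open Scope complex_scope.
Local Open Scope ring_scope.

(* L^2-spaces are handled through representatives.  [hvec] is a vector space
   of functions, [hmem] selects the square-integrable ones, and [hdot] is a
   positive semidefinite form on them, linear in the first argument and
   conjugate-linear in the second.  The Hilbert space meant is the quotient of
   [hmem] by the vectors of norm zero, i.e. [heq] is its equality; [hconj] is
   the real structure.  The record carries data only: it is instantiated below
   with two concrete L^2-spaces. *)
Record hilbert (R : realType) := Hilbert {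
  hvec : lmodType R[i];
  hmem : set hvec;
  hdot : hvec -> hvec -> R[i];
  hconj : hvec -> hvec }.

Arguments hmem {R} _ _.
Arguments hdot {R} _ _ _.
Arguments hconj {R} _ _.

Section Lagrangians.
Context {R : realType} (H : hilbert R).
Implicit Types (x y : hvec H) (A B L W : set (hvec H)).
Implicit Types T : hvec H -> hvec H.

Definition nrm2 x : R := complex.Re (hdot H x x).

Definition heq x y : Prop := nrm2 (x - y) = 0.

Definition closed_span A : set (hvec H) :=
  [set x | hmem H x /\ forall e : R, 0 < e ->
    exists n (c : 'I_n -> R[i]) (a : 'I_n -> hvec H),
      (forall i, A (a i)) /\ nrm2 (x - \sum_(i < n) c i *: a i) < e].

(* Such an L is closed under [heq], hence is the full preimage of a closed
   linear subspace of the quotient. *)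
Definition closed_subspace L : Prop :=
  L `<=` hmem H /\ closed_span L `<=` L.

Definition orthogonal_sets A B : Prop :=
  forall x y, A x -> B y -> hdot H x y = 0.

Definition hsum A B : set (hvec H) :=
  [set x | hmem H x /\ exists a b, [/\ A a, B b & heq x (a + b)]].

Definition isotropic L : Prop := orthogonal_sets L (hconj H @` L).

Definition lagrangian L : Prop :=
  [/\ closed_subspace L, isotropic L & hsum L (hconj H @` L) = hmem H].

(* The orthogonal projection; its value is determined up to [heq]. *)
Definition proj L x : hvec H :=
  xget 0 [set y | L y /\ forall z, L z -> hdot H (x - y) z = 0].

Definition hilbert_basis (e : nat -> hvec H) : Prop :=
  [/\ forall n, hmem H (e n),
      forall m n, hdot H (e m) (e n) = (m == n)%:R
    & hmem H `<=` closed_span (range e)].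

Definition hilbert_schmidt T : Prop :=
  exists2 e, hilbert_basis e
           & (\sum_(0 <= k <oo) (nrm2 (T (e k)))%:E < +oo)%E.

Definition equivalent L1 L2 : Prop :=
  hilbert_schmidt (fun x => proj L1 x - proj L2 x).

Definition eq_class L : set (set (hvec H)) :=
  [set L' | lagrangian L' /\ equivalent L' L].

(* W has codimension n: the classes of some b_0, ..., b_(n-1) form a basis of
   the quotient by W. *)
Definition has_codim W (n : nat) : Prop :=
  exists b : 'I_n -> hvec H, (forall i, hmem H (b i)) /\
    forall x, hmem H x -> exists! c : 'rV[R[i]]_n,
      exists2 w, W w & heq x (w + \sum_(i < n) c 0 i *: b i).

Definition sublagrangian L : Prop :=
  [/\ closed_subspace L, isotropic L
    & exists m : nat, has_codim (hsum L (hconj H @` L)) m.*2].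

Definition sublagrangian_class L : set (set (hvec H)) :=
  [set L' | lagrangian L' /\
    exists L1, [/\ lagrangian L1, L `<=` L1 & equivalent L' L1]].

End Lagrangians.

Section OrthogonalMaps.
Context {R : realType}.

(* For K = H, these are the elements of O(H). *)
Definition orthogonal_map (H K : hilbert R) (f : hvec H -> hvec K) : Prop :=
  [/\ forall x, hmem H x -> hmem K (f x),
      forall (c : R[i]) x y, hmem H x -> hmem H y ->
        heq (f (c *: x + y)) (c *: f x + f y),
      forall x y, hmem H x -> hmem H y -> hdot K (f x) (f y) = hdot H x y,
      forall y, hmem K y -> exists2 x, hmem H x & heq (f x) y
    & forall x, hmem H x -> heq (f (hconj H x)) (hconj K (f x))].

(* The group O_L(V). *)
Definition restricted_orthogonal (V : hilbert R) (L : set (hvec V)) :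
    set (hvec V -> hvec V) :=
  [set g | orthogonal_map g /\
           hilbert_schmidt (fun v => proj L (g (v - proj L v)))].

Definition himage (H K : hilbert R) (f : hvec H -> hvec K) (A : set (hvec H)) :
    set (hvec K) :=
  [set y | hmem K y /\ exists2 x, A x & heq y (f x)].

End OrthogonalMaps.

Section SquareIntegrable.
Context {R : realType} {d : nat}.
Implicit Types u v : R -> 'cV[R[i]]_d.

Definition cplx m n (A : 'M[R]_(m, n)) : 'M[R[i]]_(m, n) :=
  map_mx (fun a => a%:C) A.

Definition conjmx m n (A : 'M[R[i]]_(m, n)) : 'M[R[i]]_(m, n) :=
  map_mx (@conjc R) A.

Definition antiperiodic u : Prop := forall t, u (t + 2 * pi) = - u t.

Definition cmeasurable (D : set R) u : Prop :=
  forall k, measurable_fun D (fun t => complex.Re (u t k 0) : R) /\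
            measurable_fun D (fun t => complex.Im (u t k 0) : R).

(* The Hermitian extension of the inner product with Gram matrix G. *)
Definition herm (G : 'M[R]_d) (x y : 'cV[R[i]]_d) : R[i] :=
  (x^T *m cplx G *m conjmx y) 0 0.

Definition cintegral (f : R -> R[i]) : R[i] :=
  Complex (\int[lebesgue_measure]_(t in `[0, 2 * pi]) (complex.Re (f t) : R))
          (\int[lebesgue_measure]_(t in `[0, 2 * pi]) (complex.Im (f t) : R)).

Definition L2_dot (G : R -> 'M[R]_d) u v : R[i] :=
  cintegral (fun t => herm (G t) (u t) (v t)).

Definition L2_finite (G : R -> 'M[R]_d) u : Prop :=
  (\int[lebesgue_measure]_(t in `[0%R, (2 * pi)%R])
     (complex.Re (herm (G t) (u t) (u t)) : R)%:E < +oo)%E.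

End SquareIntegrable.

(* V = L^2(S^1, S) (x) C^d, as C^d-valued antiperiodic functions. *)
Definition fockV (R : realType) (d : nat) : hilbert R :=
  @Hilbert R (R -> 'cV[R[i]]_d)
    [set u | [/\ antiperiodic u, cmeasurable setT u
               & L2_finite (fun=> 1%:M) u]]
    (L2_dot (fun=> 1%:M))
    (fun u t => conjmx (u t)).

Definition xi (R : realType) (d : nat) (n : int) (j : 'I_d) :
    R -> 'cV[R[i]]_d :=
  fun t => let a := (n%:~R + 2^-1) * t in
    Complex (cos a) (- sin a) *: delta_mx j 0.

Definition fockL (R : realType) (d : nat) : set (hvec (fockV R d)) :=
  @closed_span R (fockV R d)
    [set u | exists (n : nat) (j : 'I_d), u = xi n%:Z j].

Arguments fockL : clear implicits.

Section Smooth.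
Context {R : realType} {V W : normedModType R}.

(* C^k on an open set U, by iterated directional derivatives; used for
   finite-dimensional V and W only. *)
Fixpoint Ck_on (k : nat) (U : set V) (f : V -> W) : Prop :=
  match k with
  | 0 => forall x, U x -> {for x, continuous f}
  | k'.+1 => forall v, (forall x, U x -> derivable f x v) /\
                       Ck_on k' U (fun x => 'D_v f x)
  end.

Definition smooth_on (U : set V) (f : V -> W) : Prop :=
  forall k, Ck_on k U f.

End Smooth.

Definition jacobian_cv (R : realType) (d : nat) (f : 'cV[R]_d -> 'cV[R]_d)
    (x : 'cV[R]_d) : 'M[R]_d :=
  \matrix_(k, l) ('D_(delta_mx l 0) f x) k 0.

(* An orientation is given by an atlas whose transition maps have positive
   Jacobian determinant.  Every point p is assigned a preferred chart
   [chart_at p] around it. *)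
Record oriented_manifold (R : realType) (d : nat) := OrientedManifold {
  carrier :> topologicalType;
  chart_index : Type;
  chart_dom : chart_index -> set carrier;
  chart : chart_index -> carrier -> 'cV[R]_d;
  cinv : chart_index -> 'cV[R]_d -> carrier;
  chart_at : carrier -> chart_index;
  mfd_hausdorff : hausdorff_space carrier;
  mfd_second_countable : @second_countable carrier;
  dom_open : forall i, open (chart_dom i);
  dom_chart_at : forall p, chart_dom (chart_at p) p;
  image_open : forall i, open (chart i @` chart_dom i);
  chartK : forall i p, chart_dom i p -> cinv i (chart i p) = p;
  chart_continuous : forall i p, chart_dom i p -> {for p, continuous (chart i)};
  cinv_continuous : forall i x, (chart i @` chart_dom i) x ->
    {for x, continuous (cinv i)};
  transition_smooth : forall i j,
    smooth_on (chart j @` (chart_dom i `&` chart_dom j))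
      (fun x => chart i (cinv j x));
  transition_oriented : forall i j p, chart_dom i p -> chart_dom j p ->
    0 < \det (jacobian_cv (fun x => chart i (cinv j x)) (chart j p)) }.

Arguments chart_dom {R d} _ _ _.
Arguments chart {R d} _ _ _.
Arguments cinv {R d} _ _ _.
Arguments chart_at {R d} _ _.

(* A tangent vector at p is represented by its coordinate column in the
   preferred chart [chart_at p]; thus T_pM is 'cV[R]_d, its complexification is
   'cV[R[i]]_d, and [to_chart i p] converts to the coordinates in chart i. *)
Section Tangent.
Context {R : realType} {d : nat} (M : oriented_manifold R d).

(* The Jacobian of the change of coordinates from chart j to chart i. *)
Definition jacx (i j : chart_index M) (x : 'cV[R]_d) : 'M[R]_d :=
  jacobian_cv (fun y => chart M i (cinv M j y)) x.

Definition jac (i j : chart_index M) (p : M) : 'M[R]_d := jacx i j (chart M j p).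

Definition to_chart (i : chart_index M) (p : M) : 'M[R]_d := jac i (chart_at M p) p.

End Tangent.

(* [gram i x] is the Gram matrix of the coordinate frame of chart i at the
   point with coordinates x. *)
Record riemannian_metric (R : realType) (d : nat)
    (M : oriented_manifold R d) := RiemannianMetric {
  gram : chart_index M -> 'cV[R]_d -> 'M[R]_d;
  gram_smooth : forall i, smooth_on (chart M i @` chart_dom M i) (gram i);
  gram_sym : forall i p, chart_dom M i p ->
    (gram i (chart M i p))^T = gram i (chart M i p);
  gram_posdef : forall i p (v : 'cV[R]_d), chart_dom M i p -> v != 0 ->
    0 < (v^T *m gram i (chart M i p) *m v) 0 0;
  gram_change : forall i j p, chart_dom M i p -> chart_dom M j p ->
    gram j (chart M j p) =
    (jac i j p)^T *m gram i (chart M i p) *m jac i j p }.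

Definition metric_at (R : realType) (d : nat) (M : oriented_manifold R d)
    (g : riemannian_metric M) (p : M) : 'M[R]_d :=
  gram g (chart_at M p) (chart M (chart_at M p) p).

(* The (k, b) entry of [chris i a x] is the Christoffel symbol Gamma^k_(a b)
   in chart i; [conn_form chris i x u] is the connection matrix evaluated on
   the vector u. *)
Definition conn_form (R : realType) (d : nat) (I : Type)
    (chris : I -> 'I_d -> 'cV[R]_d -> 'M[R]_d) (i : I) (x u : 'cV[R]_d) :
    'M[R]_d :=
  \sum_a u a 0 *: chris i a x.

(* [conn_change] is the transformation rule J w_i(u) = d_u J + w_j(J u) J of
   connection matrices, where J is the Jacobian of the change of coordinates
   from chart i to chart j. *)
Record connection (R : realType) (d : nat) (M : oriented_manifold R d) :=
  Connection {
  chris : chart_index M -> 'I_d -> 'cV[R]_d -> 'M[R]_d;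
  chris_smooth : forall i a, smooth_on (chart M i @` chart_dom M i) (chris i a);
  conn_change : forall i j p (u : 'cV[R]_d), chart_dom M i p -> chart_dom M j p ->
    jac j i p *m conn_form chris i (chart M i p) u =
    'D_u (jacx j i) (chart M i p)
    + conn_form chris j (chart M j p) (jac j i p *m u) *m jac j i p }.

Section LeviCivita.
Context {R : realType} {d : nat} {M : oriented_manifold R d}.
Variables (g : riemannian_metric M) (nabla : connection M).

Definition torsion_free : Prop :=
  forall i p (a b k : 'I_d), chart_dom M i p ->
    chris nabla i a (chart M i p) k b = chris nabla i b (chart M i p) k a.

Definition metric_compatible : Prop :=
  forall i p (a : 'I_d), chart_dom M i p ->
    let x := chart M i p in
    'D_(delta_mx a 0) (gram g i) x =
    (chris nabla i a x)^T *m gram g i x + gram g i x *m chris nabla i a x.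

Definition levi_civita : Prop := torsion_free /\ metric_compatible.

End LeviCivita.

Section SpinGroup.
Context {R : realType} {d : nat}.

Local Notation N := #|{set 'I_d}|.

(* Left multiplication by the generator e_j on the Clifford algebra with
   e_j^2 = -1, in the basis of the ordered products e_S, S a subset of the
   index set: e_j e_S is +/- e_(S Delta {j}). *)
Definition cliff (j : 'I_d) : 'M[R]_N :=
  \matrix_(a, b)
    let T : {set 'I_d} := enum_val a in
    let S : {set 'I_d} := enum_val b in
    if T == (S :\: [set j]) :|: ([set j] :\: S) then
      (-1) ^+ (#|[set k in S | (k < j)%N]| + (j \in S))
    else 0.

Definition clifford (v : 'cV[R]_d) : 'M[R]_N := \sum_j v j 0 *: cliff j.

Definition unit_vector (v : 'cV[R]_d) : Prop := (v^T *m v) 0 0 = 1.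

(* Spin(d): even products of unit vectors in the Clifford algebra, embedded in
   matrices by the left regular representation (and topologized as such). *)
Definition Spin : set 'M[R]_N :=
  [set s | exists k (u : 'I_k.*2 -> 'cV[R]_d),
     (forall l, unit_vector (u l)) /\
     s = \big[mulmx/1%:M]_(l < k.*2) clifford (u l)].

(* A in SO(d) is the image of s under Spin(d) -> SO(d). *)
Definition spin_cover (s : 'M[R]_N) (A : 'M[R]_d) : Prop :=
  forall v : 'cV[R]_d, s *m clifford v = clifford (A *m v) *m s.

End SpinGroup.

Section SpinStructure.
Context {R : realType} {d : nat} {M : oriented_manifold R d}.
Variable g : riemannian_metric M.

(* The columns of F are an oriented orthonormal basis of T_pM. *)
Definition so_frame (p : M) (F : 'M[R]_d) : Prop :=
  F^T *m metric_at g p *m F = 1%:M /\ 0 < \det F.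

Definition smooth_frame_field (U : set M) (F : M -> 'M[R]_d) : Prop :=
  forall i, smooth_on (chart M i @` (U `&` chart_dom M i))
    (fun x => to_chart i (cinv M i x) *m F (cinv M i x)).

(* A principal Spin(d)-bundle [spin_total] with an equivariant map
   ([spin_base], [spin_frame]) to the bundle of oriented orthonormal frames.  In
   [spin_triv], [sigma] is a local section over U inducing the local
   trivialization U x Spin(d) -> total, with second component of the inverse
   given by [tau].  The map to the frame bundle being a double covering, it
   determines the smooth structure of [spin_total]. *)
Record spin_structure := SpinStructure {
  spin_total : topologicalType;
  spin_base : spin_total -> M;
  spin_frame : spin_total -> 'M[R]_d;
  spin_act : spin_total -> 'M[R]_(#|{set 'I_d}|) -> spin_total;
  spin_base_continuous : continuous spin_base;
  spin_frameP : forall q, so_frame (spin_base q) (spin_frame q);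
  spin_act1 : forall q, spin_act q 1%:M = q;
  spin_actM : forall q s s', Spin s -> Spin s' ->
    spin_act (spin_act q s) s' = spin_act q (s *m s');
  spin_base_act : forall q s, Spin s -> spin_base (spin_act q s) = spin_base q;
  spin_frame_act : forall q s A, Spin s -> spin_cover s A ->
    spin_frame (spin_act q s) = spin_frame q *m A;
  spin_triv : forall p : M, exists (U : set M) (sigma : M -> spin_total)
      (tau : spin_total -> 'M[R]_(#|{set 'I_d}|)),
    [/\ open U /\ U p,
        forall x, U x -> spin_base (sigma x) = x,
        smooth_frame_field U (fun x => spin_frame (sigma x)),
        {within [set z : M * 'M[R]_(#|{set 'I_d}|) | U z.1 /\ Spin z.2],
           continuous (fun z => spin_act (sigma z.1) z.2)}
      & [/\ forall q, U (spin_base q) ->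
              Spin (tau q) /\ spin_act (sigma (spin_base q)) (tau q) = q,
            forall x s, U x -> Spin s -> tau (spin_act (sigma x) s) = s
          & {within spin_base @^-1` U, continuous tau}]] }.

End SpinStructure.

Section Loops.
Context {R : realType} {d : nat} {M : oriented_manifold R d}.
Variable g : riemannian_metric M.

Definition smooth_loop (gamma : R -> M) : Prop :=
  [/\ continuous gamma,
      forall t, gamma (t + 2 * pi) = gamma t
    & forall i, smooth_on (gamma @^-1` chart_dom M i)
        (fun t => chart M i (gamma t))].

Definition smooth_along (gamma : R -> M) m (F : R -> 'M[R]_(d, m)) : Prop :=
  forall i, smooth_on (gamma @^-1` chart_dom M i)
    (fun t => to_chart i (gamma t) *m F t).

(* The fibre of LSpin(TM) over gamma. *)
Definition spin_loops (S : spin_structure g) (gamma : R -> M) :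
    set (R -> spin_total S) :=
  [set phi | [/\ continuous phi,
                 forall t, phi (t + 2 * pi) = phi t,
                 forall t, spin_base (phi t) = gamma t
               & smooth_along gamma (fun t => spin_frame (phi t))]].

(* The fibre of H over gamma, identified with L^2(S^1, S (x) gamma^*TM_C):
   the class [phi, v] is the section t |-> phi(t)_C v(t), see [assoc]. *)
Definition fibreH (gamma : R -> M) : hilbert R :=
  @Hilbert R (R -> 'cV[R[i]]_d)
    [set s | [/\ antiperiodic s,
                 forall i, cmeasurable (gamma @^-1` chart_dom M i)
                   (fun t => cplx (to_chart i (gamma t)) *m s t)
               & L2_finite (fun t => metric_at g (gamma t)) s]]
    (L2_dot (fun t => metric_at g (gamma t)))
    (fun s t => conjmx (s t)).

Definition assoc (S : spin_structure g) (gamma : R -> M) (phi : R -> spin_total S)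
    (v : hvec (fockV R d)) : hvec (fibreH gamma) :=
  fun t : R => cplx (spin_frame (phi t)) *m (v : R -> 'cV[R[i]]_d) t.

(* The fibre of O_L(H) over gamma: the frames [phi, h], v |-> [phi, h v]. *)
Definition OL_frames (S : spin_structure g) (gamma : R -> M) :
    set (hvec (fockV R d) -> hvec (fibreH gamma)) :=
  [set nu | exists (phi : R -> spin_total S) h, [/\ spin_loops gamma phi,
      restricted_orthogonal (fockL R d) h
    & nu = (fun v => assoc gamma phi (h v))]].

Definition smooth_section (gamma : R -> M) (s : R -> 'cV[R[i]]_d) : Prop :=
  smooth_along gamma (fun t => map_mx (@complex.Re R) (s t)) /\
  smooth_along gamma (fun t => map_mx (@complex.Im R) (s t)).

Definition cderive (u : R -> 'cV[R[i]]_d) (t : R) : 'cV[R[i]]_d :=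
  \col_k Complex ('D_1 (fun r : R => complex.Re (u r k 0) : R) t)
                 ('D_1 (fun r : R => complex.Im (u r k 0) : R) t).

(* The covariant derivative along gamma at t, computed in the preferred chart
   at gamma(t). *)
Definition covariant_derivative (nabla : connection M) (gamma : R -> M)
    (s : R -> 'cV[R[i]]_d) (t : R) : 'cV[R[i]]_d :=
  let i := chart_at M (gamma t) in
  let x := fun r : R => chart M i (gamma r) in
  cderive (fun r => cplx (to_chart i (gamma r)) *m s r) t
  + cplx (conn_form (chris nabla) i (x t) ('D_1 x t)) *m s t.

(* On smooth sections, which contain all the eigenvectors. *)
Definition dirac_operator (nabla : connection M) (gamma : R -> M)
    (s : R -> 'cV[R[i]]_d) (t : R) : 'cV[R[i]]_d :=
  Complex 0 1 *: covariant_derivative nabla gamma s t.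

Definition dirac_eigenvector (nabla : connection M) (gamma : R -> M)
    (lambda : R) (s : R -> 'cV[R[i]]_d) : Prop :=
  [/\ smooth_section gamma s, antiperiodic s, s <> (fun=> 0)
    & forall t, dirac_operator nabla gamma s t = lambda%:C *: s t].

Definition Eig_pos (nabla : connection M) (gamma : R -> M) :
    set (hvec (fibreH gamma)) :=
  @closed_span R (fibreH gamma)
    [set s | exists2 lambda : R, 0 < lambda
                               & dirac_eigenvector nabla gamma lambda s].

End Loops.

Arguments spin_loops {R d M g} S gamma.
Arguments OL_frames {R d M g} S gamma.
Arguments Eig_pos {R d M} g nabla gamma.

(* Main.v *)
Require Import Defs.
From HB Require Import structures.
From mathcomp Require Import all_boot all_order all_algebra.
From mathcomp Require Import all_classical all_reals all_analysis.
From mathcomp Require Import measurable_realfun zify ring lra.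

(** The two classes agree because both contain one explicit Lagrangian, obtained
    by a good choice of orthonormal frame along [gamma].

    A spin loop [phi] over [gamma] projects to a smooth periodic orthonormal frame
    [F] along [gamma].  Such a frame is a pointwise isometry that commutes with
    complex conjugation, so that [lift F] is an orthogonal map from the Fock space
    to the fibre ([lift_orthogonal]).  For [nu = lift F \o h] with [h] in the
    restricted orthogonal group, the images of the standard Lagrangian under [nu]
    and under [lift F] are equivalent: by the definition of that group, and because
    the complementary projection of a Lagrangian is its conjugate
    ([equivalent_restricted_image]).

    The frame is then improved.  The Levi-Civita connection has along [F] an
    antisymmetric periodic connection matrix ([conn_matrix_antisym]).  Parallel
    transport around the loop is a rotation, and every rotation lies on a
    one-parameter group whose generator has eigenvalues of absolute value at most
    1/2 ([rotation_log]).  Untwisting the parallel frame by this group gives a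
    smooth periodic frame [F Q] with constant connection matrix [B]
    ([adapted_frame_exists]).  Since [Q] is a smooth loop, its Fourier coefficients
    decay rapidly, and the images of the standard Lagrangian under [lift F] and
    [lift (F Q)] are equivalent ([equivalent_frame_change]).

    In the frame [F Q] the Dirac operator has constant coefficients.  For a unitary
    basis [w] of eigenvectors of [B], with eigenvalues [i beta], the modes of
    frequency [n + 1/2] with value [w j] are eigenvectors for the eigenvalues
    [n + 1/2 - beta j]; they are a basis, and any eigenvector is orthogonal to
    those with other eigenvalues, so that the Dirac sublagrangian is the closed
    span of the modes with positive eigenvalue ([Eig_pos_span]).  As [beta j] is at
    most 1/2 in absolute value, it is contained in the image of the standard
    Lagrangian, the span of the modes with [n >= 0].  The zero modes are finite in
    number, and evenly many by the symmetry of the spectrum of [B] under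
    conjugation; hence this is a sublagrangian and all Lagrangians containing it
    are equivalent ([dirac_spectrum]).

    Underneath lie the completeness of the Fock space ([fock_complete]) and of
    the Fourier system ([osc_total]), the solution of linear differential
    equations by Picard iteration ([linear_ode]), and the differentiability of
    functions with continuous partial derivatives ([partials_differentiable]),
    which gives the transformation rules for charts. *)

Set Implicit Arguments.
Unset Strict Implicit.
Unset Printing Implicit Defensive.
Import Order.TTheory GRing.Theory Num.Theory.
Import numFieldNormedType.Exports.
Local Open Scope classical_set_scope.
Local Open Scope ring_scope.
Local Notation proj := Defs.proj.
Local Notation conjmx := Defs.conjmx.

(** * Spaces with a hermitian form and a real structure *)

Section ComplexNumbers.
Context {R : realType}.
Implicit Types z w : R[i].

Definition csq z : R := complex.Re z ^+ 2 + complex.Im z ^+ 2.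

Lemma csq_ge0 z : 0 <= csq z.
Proof. by rewrite addr_ge0 ?sqr_ge0. Qed.

Lemma csq0 : csq 0 = 0.
Proof. by rewrite /csq /= expr0n addr0. Qed.

Lemma csqM z w : csq (z * w) = csq z * csq w.
Proof. by case: z w => a b [c e]; rewrite /csq /=; ring. Qed.

Lemma csq_conj z : csq (conjc z) = csq z.
Proof. by case: z => a b; rewrite /csq /= sqrrN. Qed.

Lemma csqE z : z * conjc z = (csq z)%:C%C.
Proof. by case: z => a b; apply/eqP; rewrite eq_complex /csq /=; apply/andP; split; apply/eqP; ring. Qed.

Lemma csqD z w : csq (z + w) <= 2 * csq z + 2 * csq w.
Proof.
case: z w => a b [c e]; rewrite /csq /= -subr_ge0.
have -> : 2 * (a ^+ 2 + b ^+ 2) + 2 * (c ^+ 2 + e ^+ 2)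
   - ((a + c) ^+ 2 + (b + e) ^+ 2) = (a - c) ^+ 2 + (b - e) ^+ 2 by ring.
by rewrite addr_ge0 ?sqr_ge0.
Qed.

Lemma csq_eq0 z : csq z = 0 -> z = 0.
Proof.
move/eqP; rewrite paddr_eq0 ?sqr_ge0 // !sqrf_eq0 => /andP[/eqP h1 /eqP h2].
by apply/eqP; rewrite eq_complex h1 h2 /= !eqxx.
Qed.

Lemma conjcM z w : conjc (z * w) = conjc z * conjc w.
Proof. exact: rmorphM. Qed.

Lemma ReD z w : complex.Re (z + w) = complex.Re z + complex.Re w.
Proof. by case: z w => ? ? []. Qed.
Lemma ImD z w : complex.Im (z + w) = complex.Im z + complex.Im w.
Proof. by case: z w => ? ? []. Qed.

End ComplexNumbers.

(** The axioms of a Hilbert space with real structure, for spaces given by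
    representatives: completeness is asked only of sequences with geometrically
    decreasing increments, the form that monotone convergence delivers. *)
Record is_hilbert (R : realType) (H : hilbert R) : Prop := IsHilbert {
  hmem0 : hmem H 0;
  hmem_lin : forall (c : R[i]) x y, hmem H x -> hmem H y -> hmem H (c *: x + y);
  hdot_lin : forall (c : R[i]) x y z, hmem H x -> hmem H y -> hmem H z ->
    hdot H (c *: x + y) z = c * hdot H x z + hdot H y z;
  hdot_sym : forall x y, hmem H x -> hmem H y -> hdot H y x = conjc (hdot H x y);
  nrm2_ge0 : forall x, hmem H x -> 0 <= nrm2 x;
  hcomplete : forall u : nat -> hvec H, (forall n, hmem H (u n)) ->
    (forall n, nrm2 (u n.+1 - u n) <= 4^-1 ^+ n) ->
    exists2 x, hmem H x & forall e : R, 0 < e ->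
      exists N, forall n, (N <= n)%N -> nrm2 (x - u n) < e;
  hconj_mem : forall x, hmem H x -> hmem H (hconj H x);
  hconj_lin : forall (c : R[i]) x y,
    hconj H (c *: x + y) = conjc c *: hconj H x + hconj H y;
  hconjK : involutive (hconj H);
  hdot_conj : forall x y, hmem H x -> hmem H y ->
    hdot H (hconj H x) (hconj H y) = conjc (hdot H x y) }.

Section HilbertBasics.
Context {R : realType} {H : hilbert R} (hH : is_hilbert H).
Implicit Types (x y z : hvec H) (c : R[i]) (A L : set (hvec H)).
Local Notation mem := (hmem H).
Local Notation dot := (hdot H).

Lemma hmemZ c x : mem x -> mem (c *: x).
Proof. by move=> hx; rewrite -[_ *: _]addr0; apply: hmem_lin => //; apply: hmem0. Qed.

Lemma hmemD x y : mem x -> mem y -> mem (x + y).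
Proof. by move=> hx hy; rewrite -[x]scale1r; apply: hmem_lin. Qed.

Lemma hmemN x : mem x -> mem (- x).
Proof. by move=> hx; rewrite -scaleN1r; apply: hmemZ. Qed.

Lemma hmemB x y : mem x -> mem y -> mem (x - y).
Proof. by move=> hx hy; apply: hmemD => //; apply: hmemN. Qed.

Lemma hmem_sum (I : Type) (r : seq I) (P : pred I) (F : I -> hvec H) :
  (forall i, P i -> mem (F i)) -> mem (\sum_(i <- r | P i) F i).
Proof. by move=> h; apply: big_ind => //; [exact: (hmem0 hH) | exact: hmemD]. Qed.

Lemma dot0l z : mem z -> dot 0 z = 0.
Proof.
move=> hz; have /eqP := hdot_lin hH 1 (hmem0 hH) (hmem0 hH) hz.
by rewrite scale1r addr0 mul1r -subr_eq0 opprD addNKr oppr_eq0 => /eqP.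
Qed.

Lemma dotDl x y z : mem x -> mem y -> mem z -> dot (x + y) z = dot x z + dot y z.
Proof. by move=> *; rewrite -{1}[x]scale1r hdot_lin // mul1r. Qed.

Lemma dotZl c x z : mem x -> mem z -> dot (c *: x) z = c * dot x z.
Proof.
move=> hx hz; rewrite -{1}[_ *: _]addr0 hdot_lin //; last exact: hmem0.
by rewrite dot0l // addr0.
Qed.

Lemma dotNl x z : mem x -> mem z -> dot (- x) z = - dot x z.
Proof. by move=> *; rewrite -scaleN1r dotZl // mulN1r. Qed.

Lemma dotBl x y z : mem x -> mem y -> mem z -> dot (x - y) z = dot x z - dot y z.
Proof. by move=> hx hy hz; rewrite dotDl ?dotNl //; apply: hmemN. Qed.

Lemma dot_suml (I : Type) (r : seq I) (P : pred I) (F : I -> hvec H) z :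
  (forall i, P i -> mem (F i)) -> mem z ->
  dot (\sum_(i <- r | P i) F i) z = \sum_(i <- r | P i) dot (F i) z.
Proof.
move=> h hz; suff [] : mem (\sum_(i <- r | P i) F i) /\
  dot (\sum_(i <- r | P i) F i) z = \sum_(i <- r | P i) dot (F i) z by [].
apply: (big_ind2 (fun a b => mem a /\ dot a z = b)) => [|a b a' b' [ha <-] [ha' <-]|i Pi].
- by split; [exact: hmem0 | rewrite dot0l].
- by split; [exact: hmemD | rewrite dotDl].
- by split => //; apply: h.
Qed.

Lemma dotDr x y z : mem x -> mem y -> mem z -> dot z (x + y) = dot z x + dot z y.
Proof.
move=> hx hy hz; rewrite (hdot_sym hH (hmemD hx hy) hz) dotDl // rmorphD /=.
by rewrite -!(hdot_sym hH).
Qed.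

Lemma dotZr c x z : mem x -> mem z -> dot z (c *: x) = conjc c * dot z x.
Proof.
move=> hx hz; rewrite (hdot_sym hH (hmemZ c hx) hz) dotZl // rmorphM /=.
by rewrite -(hdot_sym hH).
Qed.

Lemma dotNr x z : mem x -> mem z -> dot z (- x) = - dot z x.
Proof. by move=> *; rewrite -scaleN1r dotZr // rmorphN rmorph1 mulN1r. Qed.

Lemma dotBr x y z : mem x -> mem y -> mem z -> dot z (x - y) = dot z x - dot z y.
Proof. by move=> hx hy hz; rewrite dotDr ?dotNr //; apply: hmemN. Qed.

Lemma dot_sumr (I : Type) (r : seq I) (P : pred I) (F : I -> hvec H) z :
  (forall i, P i -> mem (F i)) -> mem z ->
  dot z (\sum_(i <- r | P i) F i) = \sum_(i <- r | P i) dot z (F i).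
Proof.
move=> h hz; rewrite (hdot_sym hH _ hz); last exact: hmem_sum.
rewrite dot_suml // rmorph_sum /=; apply: eq_bigr => i Pi.
by rewrite -(hdot_sym hH) //; apply: h.
Qed.

Lemma dot_self x : mem x -> dot x x = (nrm2 x)%:C%C.
Proof.
move=> hx; have := hdot_sym hH hx hx; rewrite /nrm2.
by case: (dot x x) => a b /= [] h; apply/eqP; rewrite eq_complex /= eqxx /=; apply/eqP; lra.
Qed.

Lemma nrm2_0 : nrm2 (0 : hvec H) = 0.
Proof. by rewrite /nrm2 dot0l //; apply: hmem0. Qed.

Lemma nrm2Z c x : mem x -> nrm2 (c *: x) = csq c * nrm2 x.
Proof.
move=> hx; rewrite /nrm2 dotZl ?dotZr //; last exact: hmemZ.
by rewrite mulrA csqE dot_self //= mul0r subr0.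
Qed.

Lemma nrm2N x : mem x -> nrm2 (- x) = nrm2 x.
Proof. by move=> hx; rewrite -scaleN1r nrm2Z // /csq /= oppr0 expr0n sqrrN expr1n addr0 mul1r. Qed.

Lemma nrm2BC x y : mem x -> mem y -> nrm2 (x - y) = nrm2 (y - x).
Proof. by move=> hx hy; rewrite -nrm2N ?opprB //; apply: hmemB. Qed.

Lemma nrm2_conj x : mem x -> nrm2 (hconj H x) = nrm2 x.
Proof. by move=> hx; rewrite /nrm2 hdot_conj //; case: (dot x x). Qed.

Lemma nrm2D x y : mem x -> mem y ->
  nrm2 (x + y) = nrm2 x + nrm2 y + 2 * complex.Re (dot x y).
Proof.
move=> hx hy; rewrite /nrm2 dotDl ?dotDr //; try exact: hmemD.
rewrite (hdot_sym hH hx hy).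
by case: (dot x y) (dot x x) (dot y y) => a b [c e] [f g] /=; ring.
Qed.

Lemma nrm2_pyth x y : mem x -> mem y -> dot x y = 0 ->
  nrm2 (x + y) = nrm2 x + nrm2 y.
Proof. by move=> hx hy h; rewrite nrm2D // h /= mulr0 addr0. Qed.

Lemma nrm2D_le x y : mem x -> mem y -> nrm2 (x + y) <= 2 * nrm2 x + 2 * nrm2 y.
Proof.
move=> hx hy; have := nrm2_ge0 hH (hmemB hx hy).
rewrite !nrm2D //; last exact: hmemN.
by rewrite nrm2N // dotNr //; case: (dot x y) => a b /=; lra.
Qed.

Lemma nrm2_tri x y z : mem x -> mem y -> mem z ->
  nrm2 (x - z) <= 2 * nrm2 (x - y) + 2 * nrm2 (y - z).
Proof.
move=> hx hy hz; have -> : x - z = (x - y) + (y - z) by rewrite addrA subrK.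
by apply: nrm2D_le; apply: hmemB.
Qed.

Lemma cauchy_schwarz x y : mem x -> mem y -> csq (dot x y) <= nrm2 x * nrm2 y.
Proof.
move=> hx hy.
have key (t : R) : 0 <= nrm2 x + t ^+ 2 * csq (dot x y) * nrm2 y - 2 * t * csq (dot x y).
  have hz : mem (- ((t%:C%C * dot x y) *: y)) by apply/hmemN/hmemZ.
  have := nrm2_ge0 hH (hmemD hx hz).
  rewrite nrm2D // nrm2N; last exact: hmemZ.
  rewrite nrm2Z // dotNr ?dotZr //; last exact: hmemZ.
  rewrite csqM conjcM conjc_real.
  by rewrite /csq; case: (dot x y) => a b /=; rewrite expr0n addr0; lra.
have hx0 := nrm2_ge0 hH hx; have hy0 := nrm2_ge0 hH hy; have c0 := csq_ge0 (dot x y).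
have [y0|y0] := eqVneq (nrm2 y) 0.
  rewrite y0 mulr0; rewrite leNgt; apply/negP => cp.
  have := key ((nrm2 x + 1) / csq (dot x y)).
  by rewrite y0 mulr0 addr0 -mulrA mulfVK ?gt_eqF //; lra.
have yp : 0 < nrm2 y by rewrite lt_neqAle eq_sym y0.
have := key (nrm2 y)^-1; move=> h.
have := mulr_ge0 hy0 h; set C := csq _ in c0 h *.
rewrite mulrBr mulrDr.
have -> : nrm2 y * ((nrm2 y)^-1 ^+ 2 * C * nrm2 y) = C by field.
have -> : nrm2 y * (2 / nrm2 y * C) = 2 * C by field.
by rewrite [nrm2 x * _]mulrC; lra.
Qed.

Lemma dot_null x y : mem x -> mem y -> nrm2 x = 0 -> dot x y = 0.
Proof.
move=> hx hy h; apply: csq_eq0; apply/le_anti; rewrite csq_ge0 andbT.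
by rewrite -[leRHS](mul0r (nrm2 y)) -h cauchy_schwarz.
Qed.

Lemma heq_dotl x x' y : mem x -> mem x' -> mem y -> heq x x' -> dot x y = dot x' y.
Proof.
move=> hx hx' hy /dot_null h; apply/eqP; rewrite -subr_eq0 -dotBl // h //.
exact: hmemB.
Qed.

Lemma heq_dotr x x' y : mem x -> mem x' -> mem y -> heq x x' -> dot y x = dot y x'.
Proof. by move=> hx hx' hy h; rewrite (hdot_sym hH hx hy) (heq_dotl hx hx' hy h) -(hdot_sym hH). Qed.

Lemma heq_refl x : heq x x.
Proof. by rewrite /heq subrr nrm2_0. Qed.

Lemma heq_sym x y : mem x -> mem y -> heq x y -> heq y x.
Proof. by move=> hx hy; rewrite /heq nrm2BC. Qed.

Lemma heq_trans x y z : mem x -> mem y -> mem z -> heq x y -> heq y z -> heq x z.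
Proof.
move=> hx hy hz h1 h2; apply/le_anti; rewrite nrm2_ge0 ?andbT //; last exact: hmemB.
by have := nrm2_tri hx hy hz; rewrite h1 h2 mulr0 addr0.
Qed.

Lemma heq_nrm2 x y : mem x -> mem y -> heq x y -> nrm2 x = nrm2 y.
Proof. by move=> hx hy h; rewrite /nrm2 (heq_dotl hx hy hx h) (heq_dotr hx hy hy h). Qed.

Lemma hconj0 : hconj H 0 = 0.
Proof.
have /eqP := hconj_lin hH 1 0 0.
by rewrite scale1r addr0 rmorph1 scale1r -subr_eq0 opprD addNKr oppr_eq0 => /eqP.
Qed.

Lemma hconjD x y : hconj H (x + y) = hconj H x + hconj H y.
Proof. by rewrite -{1}[x]scale1r hconj_lin // rmorph1 scale1r. Qed.

Lemma hconjZ c x : hconj H (c *: x) = conjc c *: hconj H x.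
Proof. by rewrite -{1}[_ *: _]addr0 hconj_lin // hconj0 addr0. Qed.

Lemma hconjB x y : hconj H (x - y) = hconj H x - hconj H y.
Proof. by rewrite hconjD -scaleN1r hconjZ rmorphN rmorph1 scaleN1r. Qed.

Lemma hdot_conjl x y : mem x -> mem y -> dot (hconj H x) y = dot (hconj H y) x.
Proof.
move=> hx hy; rewrite -[in LHS](hconjK hH y) hdot_conj //; last exact: hconj_mem.
by rewrite -(hdot_sym hH) //; apply: hconj_mem.
Qed.

End HilbertBasics.

(** * Closed spans and orthogonal projections *)

Section ClosedSpan.
Context {R : realType} {H : hilbert R} (hH : is_hilbert H).
Implicit Types (x y z : hvec H) (c : R[i]) (A B L : set (hvec H)).
Local Notation mem := (hmem H).
Local Notation dot := (hdot H).

Definition linear_set L : Prop :=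
  [/\ L `<=` mem, L 0 & forall c x y, L x -> L y -> L (c *: x + y)].

Lemma linear_setZ L c x : linear_set L -> L x -> L (c *: x).
Proof. by case=> _ h0 h hx; rewrite -[_ *: _]addr0; apply: h. Qed.

Lemma linear_setD L x y : linear_set L -> L x -> L y -> L (x + y).
Proof. by case=> _ _ h hx hy; rewrite -[x]scale1r; apply: h. Qed.

Lemma linear_setB L x y : linear_set L -> L x -> L y -> L (x - y).
Proof. by move=> hL hx hy; rewrite addrC -scaleN1r; case: hL => _ _; apply. Qed.

Lemma linear_set_sum L (I : Type) (r : seq I) (P : pred I) (F : I -> hvec H) :
  linear_set L -> (forall i, P i -> L (F i)) -> L (\sum_(i <- r | P i) F i).
Proof. by move=> hL h; apply: big_ind => //; [case: hL | move=> *; apply: linear_setD]. Qed.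

Lemma closed_span_mem A : closed_span A `<=` mem.
Proof. by move=> x []. Qed.

Lemma sub_closed_span A : A `<=` mem -> A `<=` closed_span A.
Proof.
move=> hA x Ax; split; first exact: hA.
move=> e e0; exists 1%N, (fun=> 1), (fun=> x); split => //.
by rewrite big_ord1 scale1r subrr nrm2_0.
Qed.

Lemma closed_spanS A B : A `<=` B -> closed_span A `<=` closed_span B.
Proof.
move=> h x [hx hs]; split => // e /hs [n [c [a [ha hn]]]].
by exists n, c, a; split => // i; apply: h.
Qed.

Lemma closed_span_linear A : A `<=` mem -> linear_set (closed_span A).
Proof.
move=> hA; split; first exact: closed_span_mem.
  split; first exact: hmem0.
  move=> e e0; exists 0%N, (fun=> 0), (fun=> 0); split; first by case.
  by rewrite big_ord0 subrr nrm2_0.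
move=> c x y [hx sx] [hy sy]; split; first exact: hmem_lin.
move=> e e0.
have q0 : 0 < 2 * csq c + 1 by have := csq_ge0 c; lra.
have [|n [cx [ax [hax nx]]]] := sx (e / 2 / (2 * csq c + 1)).
  by rewrite !divr_gt0.
have [|m [cy [ay [hay ny]]]] := sy (e / 4); first by rewrite divr_gt0.
exists (n + m)%N,
  (fun i => match fintype.split i with inl j => c * cx j | inr j => cy j end),
  (fun i => match fintype.split i with inl j => ax j | inr j => ay j end).
split; first by move=> i; case: (fintype.split i).
rewrite big_split_ord /=.
under eq_bigr do rewrite (unsplitK (inl _)) -scalerA.
under [X in _ - (_ + X)]eq_bigr do rewrite (unsplitK (inr _)).
rewrite -scaler_sumr.
have mx : mem (x - \sum_(i < n) cx i *: ax i).
  by apply: hmemB => //; apply: hmem_sum => // i _; apply: hmemZ => //; apply: hA.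
have my : mem (y - \sum_(i < m) cy i *: ay i).
  by apply: hmemB => //; apply: hmem_sum => // i _; apply: hmemZ => //; apply: hA.
have -> : c *: x + y - (c *: \sum_(i < n) cx i *: ax i + \sum_(i < m) cy i *: ay i)
  = c *: (x - \sum_(i < n) cx i *: ax i) + (y - \sum_(i < m) cy i *: ay i).
  by rewrite scalerBr opprD addrACA.
apply: (le_lt_trans (nrm2D_le hH (hmemZ hH c mx) my)).
rewrite nrm2Z //.
have n0 := nrm2_ge0 hH mx; have c0 := csq_ge0 c.
move: nx; rewrite ltr_pdivlMr // => nx.
move: ny nx n0; set p := nrm2 _; set q := nrm2 _; move: c0; set s := csq c.
by move=> s0 ny nx n0; nra.
Qed.

Lemma orthogonal_closed_span A y : A `<=` mem -> mem y ->
  (forall x, A x -> dot x y = 0) -> forall x, closed_span A x -> dot x y = 0.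
Proof.
move=> hA hy h x [hx sx]; apply: csq_eq0; apply/eqP; rewrite eq_le csq_ge0 andbT.
apply/ler_addgt0Pr => e e0; rewrite add0r.
have ny := nrm2_ge0 hH hy.
have [|n [c [a [ha hn]]]] := sx (e / (nrm2 y + 1)); first by rewrite divr_gt0 //; lra.
have hs : mem (\sum_(i < n) c i *: a i).
  by apply: hmem_sum => // i _; apply: hmemZ => //; apply: hA.
have -> : dot x y = dot (x - \sum_(i < n) c i *: a i) y.
  rewrite dotBl // dot_suml //; last by move=> i _; apply: hmemZ => //; apply: hA.
  rewrite big1 ?subr0 // => i _; rewrite dotZl ?h ?mulr0 //; exact: hA.
apply: (le_trans (cauchy_schwarz hH _ hy)); first exact: hmemB.
move: hn; rewrite ltr_pdivlMr; last lra.
have := nrm2_ge0 hH (hmemB hH hx hs).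
by move: (nrm2 _) (nrm2 _) ny => p q ny *; nra.
Qed.

Lemma closed_span_closed A : A `<=` mem -> closed_subspace (closed_span A).
Proof.
move=> hA; split; first exact: closed_span_mem.
move=> x [hx sx]; split => // e e0.
have [|n [c [a [ha hn]]]] := sx (e / 4); first by rewrite divr_gt0.
have [hs sz] : closed_span A (\sum_(i < n) c i *: a i).
  have lA := closed_span_linear hA.
  by apply: linear_set_sum => // i _; apply: linear_setZ.
have [|m [c' [a' [ha' hm]]]] := sz (e / 4); first by rewrite divr_gt0.
exists m, c', a'; split => //.
have hs' : mem (\sum_(i < m) c' i *: a' i).
  by apply: hmem_sum => // i _; apply: hmemZ => //; apply: hA.
by have := nrm2_tri hH hx hs hs'; lra.
Qed.

Lemma closed_span_heq A x y : mem y -> closed_span A x -> heq x y -> A `<=` mem ->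
  closed_span A y.
Proof.
move=> hy cx hxy hA; apply: (closed_span_closed hA).2; split => // e e0.
exists 1%N, (fun=> 1), (fun=> x); split => //.
by rewrite big_ord1 scale1r nrm2BC ?hxy //; case: cx.
Qed.

(** Closed subspaces enter only through this property; for the subspaces at hand
    it is proved directly, for Lagrangians and for spans of orthonormal vectors. *)
Definition projective L : Prop :=
  linear_set L /\
  forall x, mem x -> exists2 y, L y & forall z, L z -> dot (x - y) z = 0.

Lemma projP L x : projective L -> mem x ->
  L (proj L x) /\ forall z, L z -> dot (x - proj L x) z = 0.
Proof.
move=> [_ hL] /hL [y Ly hy]; rewrite /proj.
by case: xgetP => [z _ [Lz hz]|/(_ y) /= []].
Qed.

Lemma proj_mem L x : projective L -> mem x -> mem (proj L x).
Proof. by move=> hL /(projP hL) [h _]; case: hL => -[hL _ _] _; apply: hL. Qed.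

Lemma proj_uniq L x y : projective L -> mem x -> L y ->
  (forall z, L z -> dot (x - y) z = 0) -> heq (proj L x) y.
Proof.
move=> hL hx Ly hy; have [h1 h2] := projP hL hx.
have [lL _] := hL; have [Lm _ _] := lL.
have Ld : L (proj L x - y) by apply: linear_setB.
have my := Lm _ Ly; have mp := Lm _ h1; have md := Lm _ Ld.
rewrite /heq /nrm2.
have {1}-> : proj L x - y = (x - y) - (x - proj L x).
  by rewrite opprB [RHS]addrC addrA subrK.
by rewrite dotBl // ?hy ?h2 ?subr0 //; apply: hmemB.
Qed.

Lemma proj_id L x : projective L -> L x -> heq (proj L x) x.
Proof.
move=> hL Lx; have [[Lm _ _] _] := hL; apply: proj_uniq => //; first exact: Lm.
by move=> z Lz; rewrite subrr dot0l //; apply: Lm.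
Qed.

Lemma proj_orth L x : projective L -> mem x -> (forall z, L z -> dot x z = 0) ->
  heq (proj L x) 0.
Proof.
move=> hL hx h; have [[Lm L0 _] _] := hL; apply: proj_uniq => //.
by move=> z Lz; rewrite subr0 h.
Qed.

Lemma dot_proj L x y : projective L -> mem x -> mem y ->
  dot (proj L x) y = dot (proj L x) (proj L y).
Proof.
move=> hL hx hy; have [h1 _] := projP hL hx; have [_ h2] := projP hL hy.
have mp := proj_mem hL hx; have mq := proj_mem hL hy.
apply/eqP; rewrite -subr_eq0 -dotBr //.
by rewrite (hdot_sym hH (hmemB hH hy mq) mp) h2 // rmorph0.
Qed.

Lemma proj_selfadjoint L x y : projective L -> mem x -> mem y ->
  dot (proj L x) y = dot x (proj L y).
Proof.
move=> hL hx hy; have mp := proj_mem hL hx; have mq := proj_mem hL hy.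
by rewrite (dot_proj hL hx hy) (hdot_sym hH mq hx) (dot_proj hL hy hx) -(hdot_sym hH).
Qed.

Lemma hconj_image_mem L : L `<=` mem -> hconj H @` L `<=` mem.
Proof. by move=> hL _ [x Lx <-]; apply: hconj_mem => //; apply: hL. Qed.

Lemma hconj_imageP L x : (hconj H @` L) x <-> L (hconj H x).
Proof.
split; first by case=> y Ly <-; rewrite (hconjK hH).
by move=> h; exists (hconj H x) => //; rewrite (hconjK hH).
Qed.

(** In the decomposition [x = a + b] with [a] in [L] and [b] in its conjugate, the
    summand [a] is the projection of [x], by isotropy. *)
Lemma lagrangian_projective L : lagrangian L -> projective L.
Proof.
move=> [[Lm Lc] iL hs]; split.
  have [_ h0 hl] := closed_span_linear Lm; split => //; first by apply: Lc; exact: h0.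
  by move=> c x y Lx Ly; apply: Lc; apply: hl; apply: sub_closed_span.
move=> x; rewrite -hs => -[hx [a [b [La Lb hab]]]]; exists a => // z Lz.
have ma := Lm _ La; have mz := Lm _ Lz; have mb := hconj_image_mem Lm Lb.
rewrite (heq_dotl hH (y := z) (x := x - a) (x' := b)) //; first 1 last.
- exact: hmemB.
- by rewrite /heq -addrA -opprD.
by rewrite (hdot_sym hH mz mb) (iL z b) // rmorph0.
Qed.

End ClosedSpan.

(** * Orthonormal families *)

Section Orthonormal.
Context {R : realType} {H : hilbert R} (hH : is_hilbert H).
Implicit Types (x y z : hvec H) (P : pred nat) (c : nat -> R[i]).
Local Notation mem := (hmem H).
Local Notation dot := (hdot H).

Definition orthonormal (e : nat -> hvec H) : Prop :=
  (forall n, mem (e n)) /\ forall m n, dot (e m) (e n) = (m == n)%:R.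

Definition subfamily (e : nat -> hvec H) P : set (hvec H) := e @` [set k | P k].

Context {e : nat -> hvec H} (he : orthonormal e).

Let me k : mem (e k). Proof. exact: he.1. Qed.

Definition lincomb c P N : hvec H := \sum_(0 <= k < N | P k) c k *: e k.

Lemma lincomb_mem c P N : mem (lincomb c P N).
Proof. by apply: hmem_sum => // k _; apply: hmemZ. Qed.

Lemma subfamily_mem P : subfamily e P `<=` mem.
Proof. by move=> _ [k _ <-]; apply: me. Qed.

Lemma sum_delta c P N j :
  \sum_(0 <= k < N | P k) c k * (k == j)%:R = if P j && (j < N)%N then c j else 0.
Proof.
rewrite big_mkcond /=; elim: N => [|N IH]; first by rewrite big_geq // ltn0 andbF.
rewrite big_nat_recr //= IH ltnS [(j <= N)%N]leq_eqVlt.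
have [->|Nj] /= := eqVneq N j; first by rewrite ltnn andbF andbT add0r mulr1.
by rewrite mulr0 if_same addr0.
Qed.

Lemma dot_lincomb c P N j :
  dot (lincomb c P N) (e j) = if P j && (j < N)%N then c j else 0.
Proof.
rewrite /lincomb dot_suml //; last by move=> k _; apply: hmemZ.
rewrite -[RHS]sum_delta; apply: eq_bigr => k _.
by rewrite dotZl // he.2.
Qed.

Lemma dot_lincombr x c P N : mem x ->
  dot x (lincomb c P N) = \sum_(0 <= k < N | P k) conjc (c k) * dot x (e k).
Proof.
move=> hx; rewrite dot_sumr //; last by move=> k _; apply: hmemZ.
by apply: eq_bigr => k _; rewrite dotZr.
Qed.

Lemma nrm2_lincomb c P N : nrm2 (lincomb c P N) = \sum_(0 <= k < N | P k) csq (c k).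
Proof.
rewrite /nrm2 dot_lincombr; last exact: lincomb_mem.
rewrite big_seq_cond [RHS]big_seq_cond.
rewrite (eq_bigr (fun k => (csq (c k))%:C%C)).
  by rewrite -(raddf_sum (real_complex R)).
move=> k; rewrite mem_index_iota /= => /andP[kN Pk].
by rewrite dot_lincomb Pk kN mulrC csqE.
Qed.

Lemma lincomb_sub_orth x P N k : mem x -> P k -> (k < N)%N ->
  dot (x - lincomb (fun k => dot x (e k)) P N) (e k) = 0.
Proof.
move=> hx Pk kN; rewrite dotBl //; last exact: lincomb_mem.
by rewrite dot_lincomb Pk kN subrr.
Qed.

Lemma lincomb_sub_orthl x P N c : mem x ->
  dot (x - lincomb (fun k => dot x (e k)) P N) (lincomb c P N) = 0.
Proof.
move=> hx; have hl := lincomb_mem (fun k => dot x (e k)) P N.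
rewrite dot_lincombr; last exact: hmemB.
rewrite big_seq_cond big1 // => k; rewrite mem_index_iota /= => /andP[kN Pk].
by rewrite lincomb_sub_orth // mulr0.
Qed.

Lemma bessel_eq x P N : mem x ->
  nrm2 (x - lincomb (fun k => dot x (e k)) P N) =
  nrm2 x - \sum_(0 <= k < N | P k) csq (dot x (e k)).
Proof.
move=> hx; set l := lincomb _ _ _; have hl : mem l by apply: lincomb_mem.
have -> : nrm2 x = nrm2 ((x - l) + l) by rewrite subrK.
have hxl : mem (x - l) by apply: hmemB.
have h0 : dot (x - l) l = 0 by apply: lincomb_sub_orthl.
by rewrite (nrm2_pyth hH hxl hl h0) [nrm2 l]nrm2_lincomb addrK.
Qed.

Lemma bessel x P N : mem x ->
  \sum_(0 <= k < N | P k) csq (dot x (e k)) <= nrm2 x.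
Proof.
move=> hx; rewrite -subr_ge0 -bessel_eq // nrm2_ge0 //.
by apply: hmemB => //; apply: lincomb_mem.
Qed.

Lemma lincomb_closed_span c P N : closed_span (subfamily e P) (lincomb c P N).
Proof.
have sm := @subfamily_mem P.
have lA := closed_span_linear hH sm.
apply: linear_set_sum => // k Pk; apply: linear_setZ => //.
by apply: sub_closed_span => //; exists k.
Qed.

(** Riesz--Fischer: the Bessel bound makes the partial sums of the Fourier
    expansion Cauchy. *)
Lemma fourier_projection x P : mem x ->
  exists y, [/\ closed_span (subfamily e P) y,
    forall k, dot y (e k) = if P k then dot x (e k) else 0
    & forall d : R, 0 < d ->
        exists N, nrm2 (y - lincomb (fun k => dot x (e k)) P N) < d].
Proof.
move=> hx.
pose s N := \sum_(0 <= k < N | P k) csq (dot x (e k)).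
have s_nd : nondecreasing_seq s.
  move=> m n mn; rewrite /s [in leRHS](@big_cat_nat _ _ _ m) //= lerDl.
  by apply: sumr_ge0 => k _; apply: csq_ge0.
have s_cv : cvgn s.
  apply: nondecreasing_is_cvgn => //; exists (nrm2 x) => _ [N _ <-].
  exact: bessel.
have s_le N : s N <= limn s by apply: nondecreasing_cvgn_le.
have near_s (d : R) : 0 < d -> exists N, forall n, (N <= n)%N -> limn s - d < s n.
  move=> d0; have /cvgrPdist_lt /(_ d d0) [N _ hN] := s_cv.
  exists N => n Nn; have := hN n Nn; rewrite /= ltr_distl => /andP[_ +]; lra.
have /choice [g hg] (n : nat) : exists N, (n <= N)%N /\
    forall m, (N <= m)%N -> limn s - 4^-1 ^+ n < s m.
  have [|N hN] := near_s (4^-1 ^+ n); first by rewrite exprn_gt0 ?invr_gt0.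
  by exists (maxn n N); split; [exact: leq_maxl | move=> m hm; apply: hN; apply: leq_trans hm; apply: leq_maxr].
pose l N := lincomb (fun k => dot x (e k)) P N.
have hl N : mem (l N) by apply: lincomb_mem.
have lE m n : (m <= n)%N -> nrm2 (l n - l m) = s n - s m.
  move=> mn.
  have cat (V : nmodType) (F : nat -> V) : \sum_(0 <= k < n | P k) F k =
      \sum_(0 <= k < m | P k) F k + \sum_(m <= k < n | P k) F k.
    by rewrite (@big_cat_nat _ _ _ m).
  have tail (V : nmodType) (F : nat -> V) :
      \sum_(0 <= k < n | P k) (if (m <= k)%N then F k else 0) =
      \sum_(m <= k < n | P k) F k.
    rewrite cat big_nat_cond big1 ?add0r; last first.
      by move=> k /andP[/andP[_ km] _]; rewrite leqNgt km.
    rewrite big_nat_cond [RHS]big_nat_cond; apply: eq_bigr => k.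
    by case/andP => /andP[-> _] _.
  have -> : l n - l m = lincomb (fun k => if (m <= k)%N then dot x (e k) else 0) P n.
    rewrite {1}/l /lincomb cat addrC addKr -tail; apply: eq_bigr => k _.
    by case: ifP => // _; rewrite scale0r.
  rewrite nrm2_lincomb /s [in RHS]cat [RHS]addrC addKr -tail; apply: eq_bigr => k _.
  by case: ifP => // _; rewrite csq0.
have [|n|y my ly] := hcomplete hH (u := fun n => l (g n)); first by [].
  have p0 : (0 : R) < 4^-1 ^+ n by rewrite exprn_gt0 ?invr_gt0.
  have p1 : 4^-1 ^+ n.+1 <= 4^-1 ^+ n :> R by rewrite exprS; lra.
  have h1 := (hg n).2 _ (leqnn _); have h2 := (hg n.+1).2 _ (leqnn _).
  have h3 := s_le (g n); have h4 := s_le (g n.+1).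
  case: (leqP (g n) (g n.+1)) => [|/ltnW] h; last rewrite nrm2BC //.
    by rewrite lE //; lra.
  by rewrite lE //; lra.
exists y; split; last by move=> d /ly [N /(_ _ (leqnn _)) hN]; exists (g N).
  split => // d d0; have [N hN] := ly d d0.
  have [_ cl] := lincomb_closed_span (fun k => dot x (e k)) P (g N).
  have [|n [c [a [ha hn]]]] := cl (d / 4); first by rewrite divr_gt0.
  have ma : mem (\sum_(i < n) c i *: a i).
    by apply: hmem_sum => // i _; apply: hmemZ => //; apply: (@subfamily_mem P).
  have [|N' hN'] := ly (d / 4); first by rewrite divr_gt0.
  have [_ cl'] := lincomb_closed_span (fun k => dot x (e k)) P (g N').
  have [|n' [c' [a' [ha' hn']]]] := cl' (d / 4); first by rewrite divr_gt0.
  have ma' : mem (\sum_(i < n') c' i *: a' i).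
    by apply: hmem_sum => // i _; apply: hmemZ => //; apply: (@subfamily_mem P).
  exists n', c', a'; split => //.
  have := nrm2_tri hH my (hl (g N')) ma'; have := hN' N' (leqnn _).
  move: hn'; rewrite -/(l _); lra.
move=> k; apply/eqP; rewrite -subr_eq0; apply/eqP/csq_eq0/eqP.
rewrite eq_le csq_ge0 andbT; apply/ler_addgt0Pr => d d0; rewrite add0r.
have [N hN] := ly d d0.
set M := maxn N k.+1.
have kM : (k < g M)%N by apply: (leq_trans _ (hg M).1); apply: leq_maxr.
have -> : (if P k then dot x (e k) else 0) = dot (l (g M)) (e k).
  by rewrite dot_lincomb kM andbT.
rewrite -dotBl //.
apply: (le_trans (cauchy_schwarz hH _ _)) => //; first exact: hmemB.
have -> : nrm2 (e k) = 1 by rewrite /nrm2 he.2 eqxx.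
by rewrite mulr1 ltW // hN // leq_maxl.
Qed.

Lemma projective_subfamily P : projective (closed_span (subfamily e P)).
Proof.
have sm := @subfamily_mem P.
split; first exact: closed_span_linear.
move=> x hx; have [y [cy hy _]] := fourier_projection P hx.
have my := closed_span_mem cy.
exists y => // z cz; rewrite (hdot_sym hH _ (hmemB hH hx my)); last exact: closed_span_mem cz.
rewrite (orthogonal_closed_span hH sm (hmemB hH hx my) _ cz) ?rmorph0 // => _ [k Pk <-].
rewrite (hdot_sym hH (hmemB hH hx my)) // dotBl // hy.
by move: Pk => /= ->; rewrite subrr rmorph0.
Qed.

End Orthonormal.

(** * Hilbert bases and equivalence of subspaces *)

Section Bases.
Context {R : realType} {H : hilbert R} (hH : is_hilbert H).
Implicit Types (x y z : hvec H) (P : pred nat) (e f : nat -> hvec H).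
Local Notation mem := (hmem H).
Local Notation dot := (hdot H).

Lemma basis_orthonormal e : hilbert_basis e -> orthonormal e.
Proof. by case. Qed.

Lemma range_subfamily e : range e = subfamily e predT.
Proof. by apply/seteqP; split => _ [k _ <-]; exists k. Qed.

Lemma orthonormal_basis e : orthonormal e ->
  (forall x, mem x -> (forall k, dot x (e k) = 0) -> nrm2 x = 0) ->
  hilbert_basis e.
Proof.
move=> he h; split; [exact: he.1 | exact: he.2 | move=> x hx].
have [y [cy hy _]] := fourier_projection hH he predT hx.
have my := closed_span_mem cy.
rewrite range_subfamily; apply: (closed_span_heq hH hx cy); last exact: subfamily_mem.
apply: h => [|k]; first exact: hmemB.
by rewrite (dotBl hH my hx (he.1 k)) hy subrr.
Qed.

Lemma basis_total e x : hilbert_basis e -> mem x ->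
  (forall k, dot x (e k) = 0) -> nrm2 x = 0.
Proof.
move=> [he _ hs] hx h; suff -> : nrm2 x = complex.Re (0 : R[i]) by [].
congr complex.Re.
have hr : range e `<=` mem by move=> _ [k _ <-].
apply: (orthogonal_closed_span hH hr hx _ (hs _ hx)) => _ [k _ <-].
by rewrite (hdot_sym hH hx) // h rmorph0.
Qed.

(** Such a vector has the same coefficients as its projection to the span, and
    a basis is total. *)
Lemma basis_subfamily e P x : hilbert_basis e -> mem x ->
  (forall k, ~~ P k -> dot x (e k) = 0) -> closed_span (subfamily e P) x.
Proof.
move=> hb hx h; have he := basis_orthonormal hb.
have [y [cy hy _]] := fourier_projection hH he P hx.
have my := closed_span_mem cy.
apply: (closed_span_heq hH hx cy); last exact: subfamily_mem.
apply: (basis_total hb) => [|k]; first exact: hmemB.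
rewrite (dotBl hH my hx (he.1 k)) hy.
by case: ifP => Pk; rewrite ?subrr // h ?subr0 // Pk.
Qed.

Lemma dot_subfamily e P x k : orthonormal e -> closed_span (subfamily e P) x ->
  ~~ P k -> dot x (e k) = 0.
Proof.
move=> he cx Pk.
apply: (orthogonal_closed_span hH (subfamily_mem he (P := P)) (he.1 k) _ cx).
move=> _ [j Pj <-]; rewrite he.2; case: eqVneq => // jk.
by move: Pj; rewrite /= jk (negbTE Pk).
Qed.

Lemma orthogonal_subfamilies e P x y : orthonormal e ->
  closed_span (subfamily e P) x -> closed_span (subfamily e (predC P)) y ->
  dot x y = 0.
Proof.
move=> he cx cy; have mx := closed_span_mem cx; have my := closed_span_mem cy.
apply: (orthogonal_closed_span hH (subfamily_mem he (P := P)) my _ cx) => _ [k Pk <-].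
rewrite (hdot_sym hH my (he.1 k)) (dot_subfamily he cy) ?rmorph0 //=.
by rewrite negbK.
Qed.

Lemma parseval e x : hilbert_basis e -> mem x ->
  (\sum_(0 <= k <oo) (csq (dot x (e k)))%:E = (nrm2 x)%:E)%E.
Proof.
move=> hb hx; have he := basis_orthonormal hb.
have c0 k : true -> (0 <= (csq (dot x (e k)))%:E)%E by rewrite lee_fin csq_ge0.
have pE N : (\sum_(0 <= k < N) (csq (dot x (e k)))%:E =
   (\sum_(0 <= k < N) csq (dot x (e k)))%:E)%E by rewrite sumEFin.
apply/le_anti/andP; split.
  apply: lime_le; first by apply: is_cvg_nneseries => *; apply: c0.
  by near=> N; rewrite pE lee_fin (bessel hH he predT N hx).
have [y [cy hy ly]] := fourier_projection hH he predT hx.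
have my := closed_span_mem cy.
have nxy : nrm2 (x - y) = 0.
  apply: (basis_total hb) => [|k]; first exact: hmemB.
  by rewrite (dotBl hH hx my (he.1 k)) hy subrr.
apply/lee_addgt0Pr => d d0.
have [|N hN] := ly (d / 2); first by rewrite divr_gt0.
have ml := lincomb_mem hH he (fun k => dot x (e k)) predT N.
have h1 := nrm2_tri hH hx my ml.
have h2 := bessel_eq hH he predT N hx.
apply: (@le_trans _ _ ((\sum_(0 <= k < N) csq (dot x (e k)))%:E + d%:E)%E).
  by rewrite -EFinD lee_fin; lra.
rewrite leeD2r // -pE; apply: (nneseries_lim_ge N) => k _ _.
exact: c0.
Unshelve. all: by end_near.
Qed.

End Bases.

Section HilbertSchmidt.
Context {R : realType}.

(** By Parseval both sums equal the sum of the squares of all matrix entries. *)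
Lemma adjoint_hs (V W : hilbert R) (hV : is_hilbert V) (hW : is_hilbert W)
    (T : hvec V -> hvec W) (T' : hvec W -> hvec V) e f :
  (forall x, hmem V x -> hmem W (T x)) -> (forall y, hmem W y -> hmem V (T' y)) ->
  (forall x y, hmem V x -> hmem W y -> hdot W (T x) y = hdot V x (T' y)) ->
  hilbert_basis e -> hilbert_basis f ->
  (\sum_(0 <= k <oo) (nrm2 (T (e k)))%:E = \sum_(0 <= k <oo) (nrm2 (T' (f k)))%:E)%E.
Proof.
move=> mT mT' hT he hf.
have me k : hmem V (e k) by case: he.
have mf k : hmem W (f k) by case: hf.
transitivity (\sum_(0 <= k <oo) \sum_(0 <= j <oo) (csq (hdot W (T (e k)) (f j)))%:E)%E.
  by apply: eq_eseriesr => k _; rewrite parseval //; apply: mT.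
rewrite nneseries_interchange => [|k j]; last by rewrite lee_fin csq_ge0.
apply: eq_eseriesr => j _; rewrite -(parseval hV he); last exact: mT'.
apply: eq_eseriesr => k _.
by rewrite hT // (hdot_sym hV (mT' _ (mf j)) (me k)) csq_conj.
Qed.

Context {H : hilbert R} (hH : is_hilbert H).
Local Notation mem := (hmem H).
Local Notation dot := (hdot H).

Lemma nneseries_fin_le (a b : nat -> R) (C : R) : (forall k, 0 <= a k) ->
  (forall k, a k <= C * b k) -> 0 <= C -> (forall k, 0 <= b k) ->
  (\sum_(0 <= k <oo) (b k)%:E < +oo)%E -> (\sum_(0 <= k <oo) (a k)%:E < +oo)%E.
Proof.
move=> a0 ab C0 b0 hb.
apply: (@le_lt_trans _ _ (\sum_(0 <= k <oo) (C%:E * (b k)%:E))%E).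
  apply: lee_nneseries => k *; first by rewrite lee_fin.
  by rewrite -EFinM lee_fin.
rewrite nneseriesZl; last by move=> k _; rewrite lee_fin.
by rewrite lte_mul_pinfty.
Qed.

Lemma nneseries_fin_D (a b : nat -> R) : (forall k, 0 <= a k) -> (forall k, 0 <= b k) ->
  (\sum_(0 <= k <oo) (a k)%:E < +oo)%E -> (\sum_(0 <= k <oo) (b k)%:E < +oo)%E ->
  (\sum_(0 <= k <oo) (a k + b k)%:E < +oo)%E.
Proof.
move=> a0 b0 ha hb.
under eq_eseriesr do rewrite EFinD.
by rewrite nneseriesD ?lte_add_pinfty // => k *; rewrite lee_fin.
Qed.

Lemma projD_selfadjoint (L1 L2 : set (hvec H)) : projective L1 -> projective L2 ->
  forall x y, mem x -> mem y ->
  dot (proj L1 x - proj L2 x) y = dot x (proj L1 y - proj L2 y).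
Proof.
move=> p1 p2 x y hx hy.
have m1 := proj_mem p1; have m2 := proj_mem p2.
by rewrite (dotBl hH) ?(dotBr hH) ?(proj_selfadjoint hH p1) ?(proj_selfadjoint hH p2) //; auto.
Qed.

(** Since a difference of projections is self-adjoint, its Hilbert--Schmidt norm
    does not depend on the basis that computes it. *)
Lemma equivalent_any_basis (L1 L2 : set (hvec H)) f : projective L1 -> projective L2 ->
  hilbert_basis f -> equivalent L1 L2 ->
  (\sum_(0 <= k <oo) (nrm2 (proj L1 (f k) - proj L2 (f k)))%:E < +oo)%E.
Proof.
move=> p1 p2 hf [e he].
pose T x := proj L1 x - proj L2 x.
have mT x : mem x -> mem (T x) by move=> hx; apply: hmemB => //; apply: proj_mem.
by rewrite (adjoint_hs hH hH mT mT (projD_selfadjoint p1 p2) he hf).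
Qed.

Lemma equivalent_sym (L1 L2 : set (hvec H)) : projective L1 -> projective L2 ->
  equivalent L1 L2 -> equivalent L2 L1.
Proof.
move=> p1 p2 [e he hs]; exists e => //.
have me k : mem (e k) by case: he.
move: hs; congr (_ < _)%E; apply: eq_eseriesr => k _; congr (_%:E).
by apply: nrm2BC => //; apply: proj_mem.
Qed.

Lemma equivalent_trans (L1 L2 L3 : set (hvec H)) :
  projective L1 -> projective L2 -> projective L3 ->
  equivalent L1 L2 -> equivalent L2 L3 -> equivalent L1 L3.
Proof.
move=> p1 p2 p3 [e he h12] h23; exists e => //.
have me k : mem (e k) by case: he.
have h23' := equivalent_any_basis p2 p3 he h23.
have m1 k := proj_mem p1 (me k).
have m2 k := proj_mem p2 (me k).
have m3 k := proj_mem p3 (me k).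
apply: (@nneseries_fin_le _ (fun k => nrm2 (proj L1 (e k) - proj L2 (e k)) +
  nrm2 (proj L2 (e k) - proj L3 (e k))) 2) => //.
- by move=> k; apply: nrm2_ge0 => //; apply: hmemB.
- by move=> k; rewrite mulrDr; apply: nrm2_tri.
- by move=> k; apply: addr_ge0; apply: nrm2_ge0 => //; apply: hmemB.
- by apply: nneseries_fin_D => // k; apply: nrm2_ge0 => //; apply: hmemB.
Qed.

End HilbertSchmidt.

(** * Orthogonal maps and the restricted orthogonal group *)

Section OrthogonalMapTheory.
Context {R : realType} {V H : hilbert R} (hV : is_hilbert V) (hH : is_hilbert H).
Context {f : hvec V -> hvec H} (hf : orthogonal_map f).
Implicit Types (L : set (hvec V)).

Lemma om_mem x : hmem V x -> hmem H (f x).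
Proof. by case: hf => h _ _ _ _; apply: h. Qed.

Lemma om_dot x y : hmem V x -> hmem V y -> hdot H (f x) (f y) = hdot V x y.
Proof. by case: hf => _ _ h _ _; apply: h. Qed.

Lemma om_nrm2 x : hmem V x -> nrm2 (f x) = nrm2 x.
Proof. by move=> hx; rewrite /nrm2 om_dot. Qed.

Lemma om_nrm2B x y : hmem V x -> hmem V y -> nrm2 (f x - f y) = nrm2 (x - y).
Proof.
move=> hx hy; have fx := om_mem hx; have fy := om_mem hy.
have nx := hmemN hV hy; have nfy := hmemN hH fy.
rewrite (nrm2D hH fx nfy) (nrm2D hV hx nx) !nrm2N // !om_nrm2 //.
by rewrite (dotNr hH fy fx) (dotNr hV hy hx) om_dot.
Qed.

Lemma om_heq x y : hmem V x -> hmem V y -> heq x y -> heq (f x) (f y).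
Proof. by move=> hx hy; rewrite /heq om_nrm2B. Qed.

Lemma himage_mem L : himage f L `<=` hmem H.
Proof. by move=> y []. Qed.

Lemma himage_sub L x : L `<=` hmem V -> L x -> himage f L (f x).
Proof.
by move=> Lm Lx; split; [exact: om_mem (Lm _ Lx) | exists x => //; apply: heq_refl].
Qed.

Lemma himage_linear L : linear_set L -> linear_set (himage f L).
Proof.
move=> [Lm L0 hl]; split; first exact: himage_mem.
  split; first exact: hmem0.
  exists 0 => //; apply: heq_sym => //; [exact/om_mem/Lm | exact: hmem0|].
  by rewrite /heq subr0 om_nrm2 ?nrm2_0 //; apply: Lm.
move=> c y1 y2 [m1 [x1 L1 h1]] [m2 [x2 L2 h2]].
have v1 := Lm _ L1; have v2 := Lm _ L2.
have f1 := om_mem v1; have f2 := om_mem v2.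
split; first exact: hmem_lin.
exists (c *: x1 + x2); first exact: hl.
have mc := hmem_lin hV c v1 v2.
have m12 := hmem_lin hH c m1 m2; have mf := hmem_lin hH c f1 f2.
apply: (heq_trans hH m12 mf (om_mem mc)).
  rewrite /heq.
  have -> : c *: y1 + y2 - (c *: f x1 + f x2) = c *: (y1 - f x1) + (y2 - f x2).
    by rewrite scalerBr opprD addrACA.
  have d1 := hmemB hH m1 f1; have d2 := hmemB hH m2 f2.
  rewrite (nrm2D hH (hmemZ hH c d1) d2) (nrm2Z hH c d1) h1 h2 mulr0 !add0r.
  by rewrite (hdot_sym hH d2 (hmemZ hH c d1)) (dot_null hH d2 (hmemZ hH c d1) h2) rmorph0 mulr0.
apply: (heq_sym hH (om_mem mc) mf).
by case: hf => _ h _ _ _; apply: h.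
Qed.

Lemma himage_projective L : projective L -> projective (himage f L).
Proof.
move=> pL; have [[Lm L0 hl] _] := pL; split; first exact: himage_linear pL.1.
move=> y my; have [_ _ _ /(_ y my) [x mx hx] _] := hf.
have [h1 h2] := projP pL mx; have mp := proj_mem pL mx.
exists (f (proj L x)); first exact: himage_sub.
move=> z iz; have mz := himage_mem iz.
have mf := om_mem mx; have mfp := om_mem mp.
rewrite (dotBl hH my mfp mz) -(heq_dotl hH mf my mz hx) -(dotBl hH mf mfp mz).
case: iz => _ [z' Lz' hz]; have mz' := Lm _ Lz'.
rewrite (heq_dotr hH mz (om_mem mz') (hmemB hH mf mfp) hz).
by rewrite (dotBl hH mf mfp (om_mem mz')) !om_dot // -(dotBl hV) // h2.
Qed.

(** The image of the projection of [x] satisfies the defining conditions of the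
    projection of [f x], because [f] preserves inner products. *)
Lemma proj_himage L x : projective L -> hmem V x ->
  heq (proj (himage f L) (f x)) (f (proj L x)).
Proof.
move=> pL mx; have [[Lm L0 hl] _] := pL; have [h1 h2] := projP pL mx.
have mp := proj_mem pL mx; have mf := om_mem mx; have mfp := om_mem mp.
apply: (proj_uniq hH (himage_projective pL) mf); first exact: himage_sub.
move=> z iz; have mz := himage_mem iz.
case: iz => _ [z' Lz' hz]; have mz' := Lm _ Lz'.
rewrite (heq_dotr hH mz (om_mem mz') (hmemB hH mf mfp) hz).
by rewrite (dotBl hH mf mfp (om_mem mz')) !om_dot // -(dotBl hV) // h2.
Qed.

Lemma om_basis e : hilbert_basis e -> hilbert_basis (f \o e).
Proof.
move=> he; have [me ee _] := he.
apply: (orthonormal_basis hH); first by split=> [n|m n] /=; [exact: om_mem | rewrite om_dot].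
move=> y my h; have [_ _ _ /(_ y my) [x mx hx] _] := hf.
rewrite -(heq_nrm2 hH (om_mem mx) my hx) om_nrm2 //; apply: (basis_total hV he) => // k.
by rewrite -om_dot // (heq_dotl hH (om_mem mx) my (om_mem (me k)) hx) -/((f \o e) k) h.
Qed.

End OrthogonalMapTheory.

Section LagrangianProjections.
Context {R : realType} {H : hilbert R} (hH : is_hilbert H).
Local Notation mem := (hmem H).
Local Notation dot := (hdot H).
Local Notation conj := (hconj H).

Lemma conj_basis e : hilbert_basis e -> hilbert_basis (fun k => conj (e k)).
Proof.
move=> he; have [me ee _] := he.
apply: (orthonormal_basis hH).
  by split=> [n|m n]; [exact: hconj_mem | rewrite hdot_conj // ee rmorph_nat].
move=> x mx h; rewrite -(nrm2_conj hH mx); apply: (basis_total hH he) => [|k].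
  exact: hconj_mem.
by rewrite hdot_conjl // (hdot_sym hH mx) ?h ?rmorph0 //; apply: hconj_mem.
Qed.

(** On a Lagrangian [L], the complementary projection is the conjugate of the
    projection onto [L]. *)
Lemma lagrangian_compl L x : lagrangian L -> mem x ->
  heq (x - proj L x) (conj (proj L (conj x))).
Proof.
move=> lL mx; have pL := lagrangian_projective hH lL.
have [[Lm Lc] iL hs] := lL.
have [h1 h2] := projP pL mx; have mp := proj_mem pL mx.
have mcx := hconj_mem hH mx.
have : mem x by [].
rewrite -{1}hs => -[_ [a [b [La Lb hab]]]].
have ma := Lm _ La; have mb := hconj_image_mem hH Lm Lb.
have mab := hmemD hH ma mb.
have orth z : L z -> dot b z = 0.
  move=> Lz; have mz := Lm _ Lz; rewrite (hdot_sym hH mz mb) (iL z b) ?rmorph0 //.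
have e1 : heq (proj L x) a.
  apply: (proj_uniq hH pL mx La) => z Lz; have mz := Lm _ Lz.
  by rewrite (dotBl hH mx ma mz) (heq_dotl hH mx mab mz hab) (dotDl hH ma mb mz) orth // addr0 subrr.
have Lb' : L (conj b) by apply/(hconj_imageP hH).
have mb' := Lm _ Lb'.
have e2 : heq (proj L (conj x)) (conj b).
  apply: (proj_uniq hH pL mcx Lb') => z Lz; have mz := Lm _ Lz.
  have mcz := hconj_mem hH mz.
  rewrite -(hconjB hH) hdot_conjl //; last exact: hmemB.
  have e3 : heq (x - b) a by rewrite /heq -addrA -opprD addrC [b + a]addrC [- _ + _]addrC.
  have mxb := hmemB hH mx mb.
  rewrite (heq_dotr hH mxb ma mcz e3) (hdot_sym hH ma mcz).
  by rewrite (iL a (conj z)) ?rmorph0 //; exists z.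
have mcp := proj_mem pL mcx; have mccp := hconj_mem hH mcp.
have mxp := hmemB hH mx mp.
apply: (heq_trans hH mxp mb mccp).
  have mxa := hmemB hH mx ma; apply: (heq_trans hH mxp mxa mb).
    by rewrite /heq opprB addrC addrA subrK nrm2BC.
  by rewrite /heq -addrA -opprD.
apply: (heq_sym hH mccp mb).
by rewrite /heq -{1}[b](hconjK hH) -(hconjB hH) nrm2_conj //; apply: hmemB.
Qed.

End LagrangianProjections.

Section RestrictedOrthogonal.
Context {R : realType} {V H : hilbert R} (hV : is_hilbert V) (hH : is_hilbert H).

Lemma om_comp (h : hvec V -> hvec V) (u : hvec V -> hvec H) :
  orthogonal_map h -> orthogonal_map u -> orthogonal_map (fun v => u (h v)).
Proof.
move=> oh ou; have [mh lh dh sh ch] := oh; have [mu lu du su cu] := ou.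
split=> [x mx|c x y mx my|x y mx my|y my|x mx].
- exact/mu/mh.
- have m1 := mh _ mx; have m2 := mh _ my; have m3 := hmem_lin hV c mx my.
  have m4 := hmem_lin hV c m1 m2; have m5 := hmem_lin hH c (mu _ m1) (mu _ m2).
  apply: (heq_trans hH (mu _ (mh _ m3)) (mu _ m4) m5); last exact: lu.
  by apply: (om_heq hV hH ou); [exact: mh | | exact: lh].
- by rewrite du ?dh //; apply: mh.
- have [z mz hz] := su _ my; have [x mx hx] := sh _ mz; exists x => //.
  apply: (heq_trans hH (mu _ (mh _ mx)) (mu _ mz) my) => //.
  by apply: (om_heq hV hH ou) => //; apply: mh.
- have m1 := mh _ mx; have m2 := hconj_mem hV mx.
  have m3 := hconj_mem hV m1; have m4 := hconj_mem hH (mu _ m1).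
  apply: (heq_trans hH (mu _ (mh _ m2)) (mu _ m3) m4); last exact: cu.
  by apply: (om_heq hV hH ou) => //; [exact: mh | exact: ch].
Qed.

(** With [P] the projection onto [L], the difference of the two projections is
    conjugate to [h P - P h = (1 - P) h P - P h (1 - P)].  The second term is
    Hilbert--Schmidt by assumption; the first is the conjugate of the second
    under the real structure, as [h] is real and [L] is a Lagrangian. *)
Lemma equivalent_restricted_image (L : set (hvec V)) h (u : hvec V -> hvec H) :
  lagrangian L -> restricted_orthogonal L h -> orthogonal_map u ->
  equivalent (himage (fun v => u (h v)) L) (himage u L).
Proof.
move=> lL [oh [e he hs]] ou.
have pL := lagrangian_projective hV lL.
have ov := om_comp oh ou.
have [mh lh dh sh ch] := oh; have [mu lu du su cu] := ou.
have me k : hmem V (e k) by case: he.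
have mP x : hmem V x -> hmem V (proj L x) by apply: proj_mem.
pose B x := proj L (h (x - proj L x)).
have mB x : hmem V x -> hmem V (B x) by move=> mx; apply/mP/mh/hmemB => //; apply: mP.
have /choice [g hg] y : exists x, hmem V y -> hmem V x /\ heq (h x) y.
  by case: (pselect (hmem V y)) => [/sh [x mx hx]|ny]; [exists x | exists 0].
pose B' y := g (proj L y) - proj L (g (proj L y)).
have mg y : hmem V y -> hmem V (g y) by move=> /hg [].
have mB' y : hmem V y -> hmem V (B' y).
  by move=> my; apply: (hmemB hV); [exact/mg/mP | exact/mP/mg/mP].
have adj x y : hmem V x -> hmem V y -> hdot V (B x) y = hdot V x (B' y).
  move=> mx my; have mx' := hmemB hV mx (mP _ mx); have mhx := mh _ mx'.
  have mPy := mP _ my; have [mgy hgy] := hg _ mPy.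
  rewrite (proj_selfadjoint hV pL) // -(heq_dotr hV (mh _ mgy) mPy mhx hgy) dh //.
  rewrite (dotBl hV mx (mP _ mx) mgy) (dotBr hV mgy (mP _ mgy) mx).
  by rewrite (proj_selfadjoint hV pL).
have hs1 : (\sum_(0 <= k <oo) (nrm2 (B (e k)))%:E < +oo)%E by exact: hs.
have hs2 : (\sum_(0 <= k <oo) (nrm2 (B (hconj V (e k))))%:E < +oo)%E.
  have hc := conj_basis hV he.
  by rewrite (adjoint_hs hV hV mB mB' adj hc he) -(adjoint_hs hV hV mB mB' adj he he).
exists (fun k => u (h (e k))); first exact: (om_basis hV hH ov he).
apply: (@nneseries_fin_le _ _ (fun k => nrm2 (B (hconj V (e k))) + nrm2 (B (e k))) 2) => //.
- move=> k; apply: nrm2_ge0 => //; apply: hmemB => //.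
    exact: (proj_mem (himage_projective hV hH ov pL) (mu _ (mh _ (me k)))).
  exact: (proj_mem (himage_projective hV hH ou pL) (mu _ (mh _ (me k)))).
- move=> k; set x := e k; have mx : hmem V x := me k.
  have mhx := mh _ mx; have mPx := mP _ mx; have mhPx := mh _ mPx.
  have mPhx := mP _ mhx.
  have e1 := proj_himage hV hH ov pL mx.
  have e2 := proj_himage hV hH ou pL mhx.
  have m1 := proj_mem (himage_projective hV hH ov pL) (mu _ mhx).
  have m2 := proj_mem (himage_projective hV hH ou pL) (mu _ mhx).
  have m3 := mu _ mhPx; have m4 := mu _ mPhx.
  have -> : nrm2 (proj (himage (fun v => u (h v)) L) (u (h x)) - proj (himage u L) (u (h x)))
     = nrm2 (h (proj L x) - proj L (h x)).
    rewrite -(om_nrm2B hV hH ou) //; apply: (heq_nrm2 hH); try exact: hmemB.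
    rewrite /heq opprB.
    have d1 := hmemB hH m1 m3; have d2 := hmemB hH m4 m2.
    have n2 : nrm2 (u (proj L (h x)) - proj (himage u L) (u (h x))) = 0 by rewrite nrm2BC.
    set p := proj _ _ in e1 m1 d1 *; set q := proj _ _ in e2 m2 d2 n2 *.
    have -> : p - q + (u (proj L (h x)) - u (h (proj L x))) =
      (p - u (h (proj L x))) + (u (proj L (h x)) - q).
      by rewrite [u _ - u _]addrC addrACA [- q + _]addrC.
    by rewrite (nrm2D hH d1 d2) e1 n2 (dot_null hH d1 d2 e1) mulr0 !addr0.
  have mx' := hmemB hV mx mPx; have mhx' := mh _ mx'.
  have mBx := mB _ mx.
  have mc := hmemB hV mhPx (mP _ mhPx).
  have -> : nrm2 (h (proj L x) - proj L (h x)) =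
            nrm2 ((h (proj L x) - proj L (h (proj L x))) - B x).
    apply: (heq_nrm2 hV); [exact: hmemB| exact: hmemB |].
    suff e3 : heq (proj L (h x)) (proj L (h (proj L x)) + B x).
      have mPP := mP _ mhPx; have ms := hmemD hV mPP mBx.
      rewrite /heq -[h (proj L x) - _ - B x]addrA -opprD opprB.
      rewrite [h (proj L x) - proj L (h x) + _]addrC addrA subrK.
      by rewrite nrm2BC.
    have mPP := mP _ mhPx; have ms := hmemD hV mPP mBx.
    apply: (proj_uniq hV pL mhx); first exact: (linear_setD pL.1 (projP pL mhPx).1 (projP pL mhx').1).
    move=> z Lz; have mz : hmem V z by case: pL => -[Lm _ _] _; apply: Lm.
    have e4 : heq (h x) (h (proj L x) + h (x - proj L x)).
      have := lh 1 _ _ mPx mx'; rewrite !scale1r addrC subrK; exact.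
    rewrite (dotBl hV mhx ms mz) (heq_dotl hV mhx (hmemD hV mhPx mhx') mz e4).
    rewrite (dotDl hV mhPx mhx' mz) (dotDl hV mPP mBx mz) opprD addrACA.
    rewrite -(dotBl hV mhPx mPP mz) -(dotBl hV mhx' mBx mz).
    by rewrite (projP pL mhPx).2 // (projP pL mhx').2 // addr0.
  apply: (le_trans (nrm2D_le hV mc (hmemN hV mBx))); rewrite (nrm2N hV mBx) mulrDr.
  rewrite lerD2r ler_pM2l //.
  have mcx := hconj_mem hV mx.
  have mchPx := hconj_mem hV mhPx.
  rewrite (heq_nrm2 hV mc (hconj_mem hV (mP _ mchPx)) (lagrangian_compl hV lL mhPx)).
  rewrite (nrm2_conj hV) ?le_eqVlt; last exact: mP.
  apply/orP; left; apply/eqP.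
  have mcPx := hconj_mem hV mPx; have mcx' := hmemB hV mcx (mP _ mcx).
  suff e5 : heq (hconj V (h (proj L x))) (h (hconj V x - proj L (hconj V x))).
    have mhc := mh _ mcx'.
    apply: (heq_nrm2 hV (mP _ mchPx) (mP _ mhc)).
    apply: (proj_uniq hV pL mchPx (projP pL mhc).1) => z Lz.
    have mz : hmem V z by case: pL => -[Lm _ _] _; apply: Lm.
    rewrite (dotBl hV mchPx (mP _ mhc) mz) (heq_dotl hV mchPx mhc mz e5).
    by rewrite -(dotBl hV mhc (mP _ mhc) mz) (projP pL mhc).2.
  apply: (heq_trans hV mchPx (mh _ mcPx) (mh _ mcx')).
    by apply: (heq_sym hV (mh _ mcPx) mchPx); apply: ch.
  apply: (om_heq hV hV oh) => //.
  apply: (heq_sym hV mcx' mcPx).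
  have := lagrangian_compl hV lL mcx; rewrite (hconjK hV); exact.
- move=> k; apply: addr_ge0; apply: nrm2_ge0 => //; apply: mB => //.
  exact: hconj_mem.
- by apply: nneseries_fin_D => // k; apply: nrm2_ge0 => //; apply: mB => //; apply: hconj_mem.
Qed.

End RestrictedOrthogonal.

(** * Spectral subspaces and sublagrangians *)

Section SpectralSubspaces.
Context {R : realType} {H : hilbert R} (hH : is_hilbert H).
Implicit Types (x y z : hvec H) (P : pred nat).
Local Notation mem := (hmem H).
Local Notation dot := (hdot H).
Local Notation conj := (hconj H).

Lemma dot_proj_subfamily e P x k : hilbert_basis e -> mem x ->
  dot (proj (closed_span (subfamily e P)) x) (e k) = if P k then dot x (e k) else 0.
Proof.
move=> he mx; have oe := basis_orthonormal he.
have pL := projective_subfamily hH oe P; have [h1 h2] := projP pL mx.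
have mp := proj_mem pL mx.
case: ifP => Pk; last by rewrite (dot_subfamily hH oe h1) // Pk.
apply/eqP; rewrite eq_sym -subr_eq0 -(dotBl hH mx mp (oe.1 k)) h2 //.
by apply: (sub_closed_span hH); [exact: (subfamily_mem oe) | exists k].
Qed.

(** Comparing two orthonormal bases through their transition matrix: only the
    entries between an index in [P] and an index outside [P] enter the difference
    of the projections. *)
Lemma equivalent_subfamilies (f g : nat -> hvec H) P (a : nat -> R) :
  hilbert_basis f -> hilbert_basis g -> (forall k, 0 <= a k) ->
  (\sum_(0 <= k <oo) (a k)%:E < +oo)%E ->
  (forall k l, P k != P l -> csq (dot (g k) (f l)) <= a k * a l) ->
  equivalent (closed_span (subfamily g P)) (closed_span (subfamily f P)).
Proof.
move=> hf hg a0 sa h; exists g => //.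
have of_ := basis_orthonormal hf; have og := basis_orthonormal hg.
have pf := projective_subfamily hH of_ P; have pg := projective_subfamily hH og P.
set S := (\sum_(0 <= k <oo) (a k)%:E)%E in sa.
have S0 : (0 <= S)%E by apply: nneseries_ge0 => k _ _; rewrite lee_fin.
have Sfin : S \is a fin_num by rewrite ge0_fin_numE.
have mfg k : mem (proj (closed_span (subfamily f P)) (g k)) by apply: (proj_mem pf); apply: og.1.
have mgg k : mem (proj (closed_span (subfamily g P)) (g k)) by apply: (proj_mem pg); apply: og.1.
apply: (@nneseries_fin_le _ _ a (fine S)) => //; last by apply: fine_ge0.
  by move=> k; apply: nrm2_ge0 => //; apply: hmemB.
move=> k; rewrite -lee_fin -(parseval hH hf) //; last exact: hmemB.
rewrite EFinM fineK // muleC -nneseriesZl; last by move=> j _; rewrite lee_fin.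
apply: lee_nneseries => l _; first by rewrite lee_fin csq_ge0.
rewrite -EFinM lee_fin (dotBl hH) //; last exact: of_.1.
rewrite dot_proj_subfamily //; last exact: og.1.
have -> : dot (proj (closed_span (subfamily g P)) (g k)) (f l) =
          if P k then dot (g k) (f l) else 0.
  have mgk := og.1 k; have mfl := of_.1 l.
  case: ifP => Pk.
    rewrite (heq_dotl hH (mgg k) mgk mfl) //; apply: proj_id => //.
    by apply: (sub_closed_span hH (subfamily_mem og (P := P))); exists k.
  rewrite (heq_dotl hH (mgg k) (hmem0 hH) mfl) ?(dot0l hH mfl) //.
  apply: proj_orth => // z cz; have mz := closed_span_mem cz.
  by rewrite (hdot_sym hH mz mgk) (dot_subfamily hH og cz) ?rmorph0 // Pk.
case: (boolP (P k)) => Pk; case: (boolP (P l)) => Pl; rewrite ?subrr ?csq0 ?mulr_ge0 //.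
  by rewrite subr0 h // Pk (negbTE Pl).
by rewrite sub0r -mulN1r csqM /csq /= oppr0 expr0n sqrrN expr1n addr0 mul1r h // Pl (negbTE Pk).
Qed.

Lemma lagrangian_subfamily e P : hilbert_basis e ->
  (forall k l, P k = P l -> dot (conj (e k)) (e l) = 0) ->
  lagrangian (closed_span (subfamily e P)).
Proof.
move=> he h; have oe := basis_orthonormal he; have me := oe.1.
have sm Q : subfamily e Q `<=` mem by apply: (subfamily_mem oe).
have pL := projective_subfamily hH oe P.
have cj x k : closed_span (subfamily e P) x -> P k -> dot (conj x) (e k) = 0.
  move=> cx Pk; have mx := closed_span_mem cx; rewrite hdot_conjl //.
  have mce := hconj_mem hH (me k).
  rewrite (hdot_sym hH mx mce) (orthogonal_closed_span hH (sm P) mce _ cx) ?rmorph0 //.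
  by move=> _ [j Pj <-]; rewrite (hdot_sym hH mce (me j)) h ?rmorph0 // Pk Pj.
split; first exact: (closed_span_closed hH).
  move=> x _ cx [y cy <-]; have my := closed_span_mem cy.
  apply: (orthogonal_subfamilies hH oe cx); apply: basis_subfamily => //.
    exact: hconj_mem.
  by move=> k /=; rewrite negbK => Pk; apply: cj.
apply/seteqP; split=> [x []//|x mx]; split => //.
have [h1 h2] := projP pL mx; have mp := proj_mem pL mx; have mb := hmemB hH mx mp.
exists (proj (closed_span (subfamily e P)) x), (x - proj (closed_span (subfamily e P)) x).
split => //; last by rewrite addrC subrK; apply: heq_refl.
apply/(hconj_imageP hH); apply: basis_subfamily => // [|k Pk]; first exact: hconj_mem.
rewrite hdot_conjl // (hdot_sym hH mb); last exact: hconj_mem.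
rewrite h2 ?rmorph0 //; apply: basis_subfamily => // [|l Pl]; first exact: hconj_mem.
by rewrite h // (negbTE Pk) (negbTE Pl).
Qed.

(** A basis of eigenvectors of a self-adjoint operator that anticommutes with
    the real structure: [lam k] is the eigenvalue of [e k], and the hypothesis on
    [conj] says that it maps the eigenspace of [lam] to that of [- lam]. *)
Context {e : nat -> hvec H} (he : hilbert_basis e) {lam : nat -> R}.
Context (hlam : forall k l, lam k + lam l != 0 -> dot (conj (e k)) (e l) = 0).
Local Notation Eplus := (closed_span (subfamily e (fun k => 0 < lam k))).

Let oe : orthonormal e := basis_orthonormal he.
Let me k : mem (e k) := oe.1 k.
Let pE : projective Eplus := projective_subfamily hH oe _.

Let conj_Eplus x k : Eplus x -> 0 <= lam k -> dot (conj x) (e k) = 0.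
Proof.
move=> cx Pk; have mx := closed_span_mem cx; rewrite hdot_conjl //.
have mce := hconj_mem hH (me k).
have sm := @subfamily_mem _ _ _ oe (fun k => 0 < lam k).
rewrite (hdot_sym hH mx mce) (orthogonal_closed_span hH sm mce _ cx) ?rmorph0 //.
move=> _ [j Pj <-]; rewrite (hdot_sym hH mce (me j)) hlam ?rmorph0 //.
by rewrite gt_eqF // ltr_wpDl.
Qed.

(** The conjugates of the modes with positive eigenvalue span those with negative
    eigenvalue, so that only the zero modes are missing from the sum. *)
Lemma hsum_Eplus x : hsum Eplus (conj @` Eplus) x <->
  mem x /\ forall k, lam k = 0 -> dot x (e k) = 0.
Proof.
split.
  move=> [mx [a [b [ca [b' cb' <-] hab]]]]; split => // k k0.
  have ma := closed_span_mem ca; have mb' := closed_span_mem cb'.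
  have mb := hconj_mem hH mb'.
  rewrite (heq_dotl hH mx (hmemD hH ma mb) (me k) hab) (dotDl hH ma mb (me k)).
  by rewrite (dot_subfamily hH oe ca) ?k0 ?ltxx // conj_Eplus ?k0 // addr0.
move=> [mx h]; split => //.
have [h1 h2] := projP pE mx; have mp := proj_mem pE mx; have mb := hmemB hH mx mp.
exists (proj Eplus x), (x - proj Eplus x); split => //; last first.
  by rewrite addrC subrK; apply: heq_refl.
apply/(hconj_imageP hH); apply: basis_subfamily => // [|k]; first exact: hconj_mem.
rewrite -leNgt => k0.
rewrite hdot_conjl //.
have sm := @subfamily_mem _ _ _ oe (fun k => 0 <= lam k).
apply: (orthogonal_closed_span hH sm mb) => [_ [l /= l0 <-]|]; last first.
  apply: basis_subfamily => // [|l]; first exact: hconj_mem.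
  by rewrite -ltNge => l0; rewrite hlam // lt_eqF // ltr_wnDl.
rewrite (hdot_sym hH mb (me l)) (dotBl hH mx mp (me l)) dot_proj_subfamily //.
move: l0; rewrite le_eqVlt => /orP[/eqP l0|->]; last by rewrite subrr rmorph0.
by rewrite -l0 ltxx h // subrr rmorph0.
Qed.

(** The zero modes represent a basis of the quotient; [z] lists them, and their
    number is even. *)
Lemma sublagrangian_Eplus m (z : 'I_m.*2 -> nat) : injective z ->
  (forall k, lam k = 0 <-> exists i, z i = k) -> sublagrangian Eplus.
Proof.
move=> zinj zP; split.
- by apply: (closed_span_closed hH); apply: (subfamily_mem oe).
- move=> x _ cx [y cy <-]; apply: (orthogonal_subfamilies hH oe cx).
  have my := closed_span_mem cy.
  apply: basis_subfamily => // [|k /=]; first exact: hconj_mem.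
  by rewrite negbK => k0; rewrite conj_Eplus // ltW.
exists m, (fun i => e (z i)); split => // x mx.
have msum (c : 'rV_m.*2) : mem (\sum_(i < m.*2) c 0 i *: e (z i)).
  by apply: hmem_sum => // i _; apply: hmemZ.
have dsum (c : 'rV_m.*2) j : dot (\sum_(i < m.*2) c 0 i *: e (z i)) (e (z j)) = c 0 j.
  rewrite (dot_suml hH) //; last by move=> i _; apply: hmemZ.
  rewrite (bigD1 j) //= big1 ?addr0 => [|i ij].
    by rewrite (dotZl hH) // oe.2 eqxx mulr1.
  by rewrite (dotZl hH) // oe.2 (inj_eq zinj) (negbTE ij) mulr0.
exists (\row_i dot x (e (z i))); split.
  set s := \sum_(i < _) _; have ms : mem s by apply: msum.
  exists (x - s); last by rewrite subrK; apply: heq_refl.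
  apply/hsum_Eplus; split; first exact: hmemB.
  by move=> k /zP [i <-]; rewrite (dotBl hH mx ms (me _)) dsum mxE subrr.
move=> c [w /hsum_Eplus [mw hw] hxw]; apply/rowP => j; rewrite mxE.
rewrite (heq_dotl hH mx (hmemD hH mw (msum c)) (me _) hxw) (dotDl hH mw (msum c) (me _)).
by rewrite hw ?add0r ?dsum //; apply/zP; exists j.
Qed.

(** The projections onto [L1] and [L2] agree on every mode of nonzero eigenvalue,
    which leaves a finite sum of squared norms. *)
Lemma equivalent_Eplus (L1 L2 : set (hvec H)) (N : nat) :
  (forall k, lam k = 0 -> (k < N)%N) -> lagrangian L1 -> lagrangian L2 ->
  Eplus `<=` L1 -> Eplus `<=` L2 -> equivalent L1 L2.
Proof.
move=> hN l1 l2 s1 s2; exists e => //.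
have p1 := lagrangian_projective hH l1; have p2 := lagrangian_projective hH l2.
have key L : lagrangian L -> Eplus `<=` L -> forall k, lam k != 0 ->
    heq (proj L (e k)) (if 0 < lam k then e k else 0).
  move=> lL sL k k0; have pL := lagrangian_projective hH lL.
  have [[Lm _] iL _] := lL.
  case: ifP => kp.
    apply: proj_id => //; apply: sL; apply: (sub_closed_span hH) => //.
      exact: (subfamily_mem oe).
    by exists k.
  have kn : lam k < 0 by rewrite lt_neqAle k0 leNgt kp.
  have Lc : L (conj (e k)).
    apply: sL; apply: basis_subfamily => // [|l]; first exact: hconj_mem.
    by rewrite -leNgt => l0; rewrite hlam // lt_eqF // ltr_wnDr.
  apply: (proj_orth hH pL (me k)) => z Lz; have mz := Lm _ Lz.
  have Li : (conj @` L) (e k) by apply/(hconj_imageP hH).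
  by rewrite (hdot_sym hH mz (me k)) (iL z (e k)) ?rmorph0.
pose t k := nrm2 (proj L1 (e k) - proj L2 (e k)).
have t0 k : lam k != 0 -> t k = 0.
  move=> k0; have h1 := key _ l1 s1 k k0; have h2 := key _ l2 s2 k k0.
  have m1 := proj_mem p1 (me k); have m2 := proj_mem p2 (me k).
  have m3 : mem (if 0 < lam k then e k else 0) by case: ifP => // _; apply: hmem0.
  exact: (heq_trans hH m1 m3 m2 h1 (heq_sym hH m2 m3 h2)).
have tge k : 0 <= t k.
  by apply: nrm2_ge0 => //; apply: hmemB => //; [exact: (proj_mem p1) | exact: (proj_mem p2)].
rewrite (nneseries_split _ N); last by move=> k _; rewrite lee_fin; exact: tge.
rewrite eseries0 ?adde0.
  by rewrite sumEFin ltry.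
move=> k; rewrite add0n => Nk _; rewrite -/(t k) t0 //.
by apply/eqP => k0; move: (hN _ k0); rewrite ltnNge Nk.
Qed.

End SpectralSubspaces.

(** * Images of a basis under orthogonal maps *)

Section BasisImages.
Context {R : realType} {V H : hilbert R} (hV : is_hilbert V) (hH : is_hilbert H).
Context {f : nat -> hvec V} (hf : hilbert_basis f).
Implicit Types (u : hvec V -> hvec H) (P : pred nat).

Let mf k : hmem V (f k). Proof. by case: hf. Qed.

Lemma himage_subfamily u P : orthogonal_map u ->
  himage u (closed_span (subfamily f P)) = closed_span (subfamily (u \o f) P).
Proof.
move=> hu; have ob := basis_orthonormal hf.
have hib := om_basis hV hH hu hf.
apply/seteqP; split=> y.
  move=> [my [x cx hyx]]; have mx := closed_span_mem cx.
  apply: (basis_subfamily hH hib my) => k Pk /=.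
  rewrite (heq_dotl hH my (om_mem hu mx) (om_mem hu (mf k)) hyx) (om_dot hu mx (mf k)).
  exact: (dot_subfamily hV ob cx).
move=> cy; have my := closed_span_mem cy; split => //.
have [_ _ _ /(_ y my) [x mx hx] _] := hu.
exists x; last by apply: (heq_sym hH (om_mem hu mx) my).
apply: (basis_subfamily hV hf mx) => k Pk.
rewrite -(om_dot hu mx (mf k)) (heq_dotl hH (om_mem hu mx) my (om_mem hu (mf k)) hx).
exact: (dot_subfamily hH (basis_orthonormal hib) cy).
Qed.

Lemma dot_conj_image u x y : orthogonal_map u -> hmem V x -> hmem V y ->
  hdot H (hconj H (u x)) (u y) = hdot V (hconj V x) y.
Proof.
move=> hu mx my; have mcx := hconj_mem hV mx.
have [_ _ _ _ /(_ x mx) hc] := hu.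
rewrite -(heq_dotl hH (om_mem hu mcx) (hconj_mem hH (om_mem hu mx)) (om_mem hu my) hc).
exact: (om_dot hu mcx my).
Qed.

Lemma lagrangian_image u P : orthogonal_map u ->
  (forall k l, P k = P l -> hdot V (hconj V (f k)) (f l) = 0) ->
  lagrangian (himage u (closed_span (subfamily f P))).
Proof.
move=> hu h; rewrite (himage_subfamily P hu).
apply: (lagrangian_subfamily hH (om_basis hV hH hu hf)) => k l kl.
rewrite -(h k l kl); exact: (dot_conj_image hu (mf k) (mf l)).
Qed.

(** The bounded quantities are the entries of the transition matrix between the
    image bases, to which [equivalent_subfamilies] applies. *)
Lemma equivalent_images u u' P (a : nat -> R) : orthogonal_map u -> orthogonal_map u' ->
  (forall k, 0 <= a k) -> (\sum_(0 <= k <oo) (a k)%:E < +oo)%E ->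
  (forall k l, P k != P l -> csq (hdot H (u' (f k)) (u (f l))) <= a k * a l) ->
  equivalent (himage u' (closed_span (subfamily f P)))
             (himage u (closed_span (subfamily f P))).
Proof.
move=> hu hu' a0 sa h; rewrite (himage_subfamily P hu) (himage_subfamily P hu').
exact: (equivalent_subfamilies hH (om_basis hV hH hu hf) (om_basis hV hH hu' hf) a0 sa).
Qed.

Lemma om_scale u (c : R[i]) x : orthogonal_map u -> hmem V x -> heq (u (c *: x)) (c *: u x).
Proof.
move=> hu mx; have m0 := hmem0 hV; have [_ /(_ c x 0 mx m0) h _ _ _] := hu.
have mux := om_mem hu mx; have mu0 := om_mem hu m0; have mc := hmemZ hH c mux.
rewrite addr0 in h.
apply: (heq_trans hH (om_mem hu (hmemZ hV c mx)) (hmemD hH mc mu0) mc h).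
by rewrite /heq addrC addKr (om_nrm2 hu m0) nrm2_0.
Qed.

Lemma csq_dot_scale u u' (c : R[i]) x y : orthogonal_map u -> orthogonal_map u' ->
  hmem V x -> hmem V y ->
  csq (hdot H (u' (c *: x)) (u (c *: y))) = csq c * (csq c * csq (hdot H (u' x) (u y))).
Proof.
move=> hu hu' mx my.
have mcx := hmemZ hV c mx; have mcy := hmemZ hV c my.
have mx' := om_mem hu' mx; have my' := om_mem hu my.
rewrite (heq_dotl hH (om_mem hu' mcx) (hmemZ hH c mx') (om_mem hu mcy) (om_scale c hu' mx)).
rewrite (heq_dotr hH (om_mem hu mcy) (hmemZ hH c my') (hmemZ hH c mx') (om_scale c hu my)).
by rewrite (dotZl hH c mx' (hmemZ hH c my')) (dotZr hH c my' mx') !csqM csq_conj.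
Qed.

End BasisImages.

(** * Square-integrable antiperiodic functions *)

Section ComplexIntegral.
Context {R : realType}.
Local Notation mu := (@lebesgue_measure R).
Local Notation D := (`[0, 2 * pi]%classic : set R).
Implicit Types (f g : R -> R[i]) (c : R[i]).

Definition cintegrable f : Prop :=
  mu.-integrable D (fun t => (complex.Re (f t))%:E) /\
  mu.-integrable D (fun t => (complex.Im (f t))%:E).

Let mD : @measurable _ (measurableTypeR R) D. Proof. exact: measurable_itv. Qed.

Lemma cintegrableZ c f : cintegrable f -> cintegrable (fun t => c * f t).
Proof.
move=> [hr hi]; split.
  apply: (@eq_integrable _ _ _ _ _ mD
    (fun t => (complex.Re c)%:E * (complex.Re (f t))%:E - (complex.Im c)%:E * (complex.Im (f t))%:E)%E).
    by move=> t _; rewrite -!EFinM -EFinB; case: c (f t) => a b [].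
  by apply: integrableB => //; apply: integrableZl.
apply: (@eq_integrable _ _ _ _ _ mD
    (fun t => (complex.Re c)%:E * (complex.Im (f t))%:E + (complex.Im c)%:E * (complex.Re (f t))%:E)%E).
  by move=> t _; rewrite -!EFinM -EFinD; case: c (f t) => a b [x y] /=.
by apply: integrableD => //; apply: integrableZl.
Qed.

Lemma cintegrableD f g : cintegrable f -> cintegrable g ->
  cintegrable (fun t => f t + g t).
Proof.
move=> [hr hi] [hr' hi']; split.
  apply: (@eq_integrable _ _ _ _ _ mD (fun t => (complex.Re (f t))%:E + (complex.Re (g t))%:E)%E).
    by move=> t _; rewrite -EFinD ReD.
  exact: integrableD.
apply: (@eq_integrable _ _ _ _ _ mD (fun t => (complex.Im (f t))%:E + (complex.Im (g t))%:E)%E).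
  by move=> t _; rewrite -EFinD ImD.
exact: integrableD.
Qed.

Lemma cintegralZ c f : cintegrable f ->
  cintegral (fun t => c * f t) = c * cintegral f.
Proof.
move=> [hr hi]; rewrite /cintegral.
rewrite (@eq_Rintegral _ _ _ mu D (fun t => complex.Re c * complex.Re (f t) - complex.Im c * complex.Im (f t))); last first.
  by move=> t _; case: c (f t) => a b [].
rewrite (@eq_Rintegral _ _ _ mu D (fun t => complex.Re c * complex.Im (f t) + complex.Im c * complex.Re (f t)) (fun t => complex.Im (c * f t))); last first.
  by move=> t _; case: c (f t) => a b [].
have i1 a : mu.-integrable D (EFin \o (fun t => a * complex.Re (f t))).
  by apply: (@eq_integrable _ _ _ _ _ mD (fun t => a%:E * (complex.Re (f t))%:E)%E) => [t _|]; [rewrite -EFinM | apply: integrableZl].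
have i2 a : mu.-integrable D (EFin \o (fun t => a * complex.Im (f t))).
  by apply: (@eq_integrable _ _ _ _ _ mD (fun t => a%:E * (complex.Im (f t))%:E)%E) => [t _|]; [rewrite -EFinM | apply: integrableZl].
rewrite RintegralB // RintegralD // !RintegralZl //.
by case: c => a b.
Qed.

Lemma cintegralD f g : cintegrable f -> cintegrable g ->
  cintegral (fun t => f t + g t) = cintegral f + cintegral g.
Proof.
move=> [hr hi] [hr' hi']; rewrite /cintegral.
rewrite (@eq_Rintegral _ _ _ mu D (fun t => complex.Re (f t) + complex.Re (g t))); last first.
  by move=> t _; rewrite ReD.
rewrite (@eq_Rintegral _ _ _ mu D (fun t => complex.Im (f t) + complex.Im (g t)) (fun t => complex.Im (f t + g t))); last first.
  by move=> t _; rewrite ImD.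
by rewrite !RintegralD.
Qed.

Lemma eq_cintegral f g : {in D, f =1 g} -> cintegral f = cintegral g.
Proof.
by move=> h; rewrite /cintegral; congr Complex; apply: eq_Rintegral => t tD; rewrite h.
Qed.

Lemma cintegral_conj f : cintegrable f ->
  cintegral (fun t => conjc (f t)) = conjc (cintegral f).
Proof.
move=> [hr hi]; rewrite /cintegral /=; congr Complex.
  by apply: eq_Rintegral => t _; case: (f t).
rewrite (@eq_Rintegral _ _ _ mu D (fun t => -1 * complex.Im (f t))).
  by rewrite RintegralZl // mulN1r.
by move=> t _; case: (f t) => a b /=; rewrite mulN1r.
Qed.

End ComplexIntegral.

Section Herm.
Context {R : realType} {d : nat}.
Implicit Types x y z : 'cV[R[i]]_d.

Definition nsq x : R := \sum_k csq (x k 0).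

Lemma herm1E x y : herm 1%:M x y = \sum_k x k 0 * conjc (y k 0).
Proof.
rewrite /herm /cplx map_mx1 mulmx1 mxE; apply: eq_bigr => k _.
by rewrite !mxE.
Qed.

Lemma herm1_self x : herm 1%:M x x = (nsq x)%:C%C.
Proof. by rewrite herm1E /nsq rmorph_sum; apply: eq_bigr => k _; rewrite csqE. Qed.

Lemma nsq_ge0 x : 0 <= nsq x.
Proof. by apply: sumr_ge0 => k _; apply: csq_ge0. Qed.

Lemma nsq_lin c x y : nsq (c *: x + y) <= 2 * csq c * nsq x + 2 * nsq y.
Proof.
rewrite /nsq !mulr_sumr -big_split /=; apply: ler_sum => k _.
by rewrite !mxE (le_trans (csqD _ _)) // csqM mulrA.
Qed.

Lemma herm1_lin c x y z : herm 1%:M (c *: x + y) z = c * herm 1%:M x z + herm 1%:M y z.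
Proof.
rewrite !herm1E mulr_sumr -big_split /=; apply: eq_bigr => k _.
by rewrite !mxE mulrDl mulrA.
Qed.

Lemma herm1_sym x y : herm 1%:M y x = conjc (herm 1%:M x y).
Proof.
rewrite !herm1E rmorph_sum; apply: eq_bigr => k _ /=.
by rewrite conjcM conjcK mulrC.
Qed.

Lemma herm1_conj x y : herm 1%:M (conjmx x) (conjmx y) = conjc (herm 1%:M x y).
Proof.
rewrite !herm1E rmorph_sum; apply: eq_bigr => k _ /=.
by rewrite conjcM !mxE.
Qed.

Lemma conjmx_lin c x y : conjmx (c *: x + y) = conjc c *: conjmx x + conjmx y.
Proof. by apply/matrixP => i j; rewrite !mxE rmorphD /= conjcM. Qed.

Lemma conjmxK x : conjmx (conjmx x) = x.
Proof. by apply/matrixP => i j; rewrite !mxE conjcK. Qed.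

Lemma nsq_conj x : nsq (conjmx x) = nsq x.
Proof. by apply: eq_bigr => k _; rewrite mxE csq_conj. Qed.

Lemma norm_Re_herm1 x y : `|complex.Re (herm 1%:M x y)| <= nsq x + nsq y.
Proof.
rewrite herm1E (raddf_sum (@complex.Re R : Rcomplex R -> R)) /=.
apply: (le_trans (ler_norm_sum _ _ _)); rewrite /nsq -big_split /=.
apply: ler_sum => k _; case: (x k 0) (y k 0) => a b [e f]; rewrite /csq /=.
have := sqr_ge0 (a - e); have := sqr_ge0 (a + e); have := sqr_ge0 (b - f); have := sqr_ge0 (b + f).
rewrite ler_norml; move=> *; apply/andP; split; nra.
Qed.

Lemma norm_Im_herm1 x y : `|complex.Im (herm 1%:M x y)| <= nsq x + nsq y.
Proof.
rewrite herm1E (raddf_sum (@complex.Im R : Rcomplex R -> R)) /=.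
apply: (le_trans (ler_norm_sum _ _ _)); rewrite /nsq -big_split /=.
apply: ler_sum => k _; case: (x k 0) (y k 0) => a b [e f]; rewrite /csq /=.
have := sqr_ge0 (a - f); have := sqr_ge0 (a + f); have := sqr_ge0 (b - e); have := sqr_ge0 (b + e).
rewrite ler_norml; move=> *; apply/andP; split; nra.
Qed.

End Herm.

Section FockMem.
Context {R : realType} {d : nat}.
Local Notation mu := (@lebesgue_measure R).
Local Notation D := (`[0, 2 * pi]%classic : set R).
Local Notation V := (fockV R d).
Implicit Types u v w : R -> 'cV[R[i]]_d.

Let mD : @measurable _ (measurableTypeR R) D. Proof. exact: measurable_itv. Qed.

Lemma cmeasurable_lin (E : set R) c u v : cmeasurable E u -> cmeasurable E v ->
  cmeasurable E (fun t => c *: u t + v t).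
Proof.
move=> hu hv k; have [ur ui] := hu k; have [vr vi] := hv k; split.
  apply: (eq_measurable_fun (fun t => complex.Re c * complex.Re (u t k 0)
    - complex.Im c * complex.Im (u t k 0) + complex.Re (v t k 0))).
    by move=> t _; rewrite !mxE ReD; case: c (u t k 0) => a b [].
  by apply: measurable_funD => //; apply: measurable_funB; apply: measurable_funM.
apply: (eq_measurable_fun (fun t => complex.Re c * complex.Im (u t k 0)
    + complex.Im c * complex.Re (u t k 0) + complex.Im (v t k 0))).
  by move=> t _; rewrite !mxE ImD; case: c (u t k 0) => a b [].
by apply: measurable_funD => //; apply: measurable_funD; apply: measurable_funM.
Qed.

Lemma measurable_nsq (E : set R) u : cmeasurable E u -> measurable_fun E (fun t => nsq (u t)).
Proof.
move=> hu; apply: measurable_sum => k; have [ur ui] := hu k.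
by apply: measurable_funD; apply: measurable_funX.
Qed.

Lemma measurable_herm1 (E : set R) u v : cmeasurable E u -> cmeasurable E v ->
  measurable_fun E (fun t => complex.Re (herm 1%:M (u t) (v t))) /\
  measurable_fun E (fun t => complex.Im (herm 1%:M (u t) (v t))).
Proof.
move=> hu hv; split.
  apply: (eq_measurable_fun (fun t => \sum_k (complex.Re (u t k 0) * complex.Re (v t k 0)
     + complex.Im (u t k 0) * complex.Im (v t k 0)))).
    move=> t _; rewrite herm1E (raddf_sum (@complex.Re R : Rcomplex R -> R)) /=.
    by apply: eq_bigr => k _; case: (u t k 0) (v t k 0) => a b [e f] /=; ring.
  apply: measurable_sum => k; have [ur ui] := hu k; have [vr vi] := hv k.
  by apply: measurable_funD; apply: measurable_funM.
apply: (eq_measurable_fun (fun t => \sum_k (complex.Im (u t k 0) * complex.Re (v t k 0)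
     - complex.Re (u t k 0) * complex.Im (v t k 0)))).
  move=> t _; rewrite herm1E (raddf_sum (@complex.Im R : Rcomplex R -> R)) /=.
  by apply: eq_bigr => k _; case: (u t k 0) (v t k 0) => a b [e f] /=; ring.
apply: measurable_sum => k; have [ur ui] := hu k; have [vr vi] := hv k.
by apply: measurable_funB; apply: measurable_funM.
Qed.

Lemma fock_memP u : hmem V u <-> [/\ antiperiodic u, cmeasurable setT u &
  mu.-integrable D (fun t => (nsq (u t))%:E)].
Proof.
have E : (fun t => (complex.Re (herm 1%:M (u t) (u t)) : R)%:E) = (fun t => (nsq (u t))%:E).
  by apply/funext => t; rewrite herm1_self.
split=> -[h1 h2 h3]; split => //.
  apply/integrableP; split.
    by apply/measurable_EFinP; apply: measurable_funTS; apply: measurable_nsq.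
  rewrite (eq_integral (fun t : measurableTypeR R => (nsq (u t))%:E)); last first.
    by move=> t _; rewrite /= ger0_norm // nsq_ge0.
  by move: h3; rewrite /L2_finite E.
by rewrite /L2_finite E; apply: integrable_lty.
Qed.

Lemma fock_integrable u v : hmem V u -> hmem V v ->
  cintegrable (fun t => herm 1%:M (u t) (v t)).
Proof.
move=> /fock_memP[_ mu_ iu] /fock_memP[_ mv iv].
have [mr mi] := measurable_herm1 mu_ mv.
have iD := integrableD mD iu iv.
split.
  apply: (le_integrable mD _ _ iD).
    by apply/measurable_EFinP; apply: measurable_funTS.
  move=> t _; change (`|(complex.Re (herm 1%:M (u t) (v t)))%:E| <= `|(nsq (u t) + nsq (v t))%:E|)%E.
  by rewrite lee_fin [leRHS]ger0_norm ?norm_Re_herm1 // addr_ge0 ?nsq_ge0.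
apply: (le_integrable mD _ _ iD).
  by apply/measurable_EFinP; apply: measurable_funTS.
move=> t _; change (`|(complex.Im (herm 1%:M (u t) (v t)))%:E| <= `|(nsq (u t) + nsq (v t))%:E|)%E.
by rewrite lee_fin [leRHS]ger0_norm ?norm_Im_herm1 // addr_ge0 ?nsq_ge0.
Qed.

Lemma fock_mem_lin (c : R[i]) u v : hmem V u -> hmem V v -> hmem V ((c *: u + v) : hvec V).
Proof.
move=> /fock_memP[au mu_ iu] /fock_memP[av mv iv]; apply/fock_memP; split.
- by move=> t; rewrite !fctE au av scalerN opprD.
- exact: cmeasurable_lin.
- have i2 := integrableD mD (integrableZl mD (2 * csq c) iu) (integrableZl mD 2 iv).
  apply: (le_integrable mD _ _ i2).
    apply/measurable_EFinP; apply: measurable_funTS.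
    by apply: (@measurable_nsq setT); apply: cmeasurable_lin.
  move=> t _.
  change (`|(nsq (c *: u t + v t))%:E| <= `|(2 * csq c * nsq (u t) + 2 * nsq (v t))%:E|)%E.
  have h0 : 0 <= 2 * csq c * nsq (u t) + 2 * nsq (v t).
    by rewrite addr_ge0 // !mulr_ge0 // ?csq_ge0 ?nsq_ge0.
  by rewrite lee_fin (ger0_norm h0) ger0_norm ?nsq_ge0 ?nsq_lin.
Qed.

Lemma fock_nrm2E u : nrm2 (u : hvec V) = \int[mu]_(t in D) nsq (u t).
Proof. by apply: eq_Rintegral => t _; rewrite herm1_self. Qed.

Lemma fock_mem0 : hmem V 0.
Proof.
apply/fock_memP; split.
- by move=> t; rewrite oppr0.
- move=> k; split; apply: (eq_measurable_fun (fun=> (0 : R))) => //.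
  + by move=> t _; rewrite mxE.
  + by move=> t _; rewrite mxE.
- apply: (@eq_integrable _ _ _ _ _ mD (cst 0%E)); last exact: integrable0.
  by move=> t _; rewrite /nsq big1 // => k _; rewrite mxE csq0.
Qed.

Lemma fock_conj_mem u : hmem V u -> hmem V (hconj V u).
Proof.
move=> /fock_memP[au mu_ iu]; apply/fock_memP; split.
- by move=> t; rewrite /= au; apply/matrixP => i j; rewrite !mxE rmorphN.
- move=> k; have [ur ui] := mu_ k; split.
    by apply: (eq_measurable_fun (fun t => complex.Re (u t k 0))) => // t _; rewrite mxE; case: (u t k 0).
  apply: (eq_measurable_fun (fun t => - complex.Im (u t k 0))); last exact: measurable_funN.
  by move=> t _; rewrite mxE; case: (u t k 0).
- by apply: (@eq_integrable _ _ _ _ _ mD (fun t => (nsq (u t))%:E)) => // t _; rewrite nsq_conj.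
Qed.

End FockMem.

(** * Completeness of the Fock space *)

Lemma cvg_sumR (R : realType) (I T : Type) (F : set_system T) (FF : Filter F)
    (r : seq I) (f : I -> T -> R) (l : I -> R) :
  (forall i, f i @ F --> l i) ->
  (fun t => \sum_(i <- r) f i t) @ F --> \sum_(i <- r) l i.
Proof. by move=> h; apply: cvg_big => //; apply: add_continuous. Qed.

Section FockComplete.
Context {R : realType} {d : nat}.
Local Notation mu := (@lebesgue_measure R).
Local Notation D := (`[0, 2 * pi]%classic : set R).
Local Notation V := (fockV R d).
Implicit Types u v w : R -> 'cV[R[i]]_d.

Let mD : @measurable _ (measurableTypeR R) D. Proof. exact: measurable_itv. Qed.

Lemma fock_integral_nsq v : hmem V v ->
  (\int[mu]_(t in D) (nsq (v t))%:E = (nrm2 (v : hvec V))%:E)%E.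
Proof.
move=> /fock_memP[_ _ iv]; rewrite fock_nrm2E /Rintegral fineK //.
exact: integrable_fin_num.
Qed.

(** The first increment is split off by the parallelogram inequality, whose factor
    two the weights absorb. *)
Lemma nsq_telescope (x : nat -> 'cV[R[i]]_d) n M :
  2 ^+ n * nsq (x (n + M)%N - x n) <=
  2 * \sum_(n <= m < n + M) 2 ^+ m * nsq (x m.+1 - x m).
Proof.
elim: M n => [|M IH] n.
  by rewrite addn0 subrr big_geq // mulr0 /nsq big1 ?mulr0 // => k _; rewrite mxE csq0.
rewrite big_ltn ?addnS ?ltnS ?leq_addr //.
have -> : x (n + M).+1 - x n = 1 *: (x n.+1 - x n) + (x (n.+1 + M)%N - x n.+1).
  by rewrite scale1r addSn [RHS]addrC addrA subrK.
have := nsq_lin 1 (x n.+1 - x n) (x (n.+1 + M)%N - x n.+1).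
rewrite /csq /= expr1n expr0n addr0 mulr1 => h; have := IH n.+1.
rewrite addSn exprS mulrDr.
have p0 : (0 : R) < 2 ^+ n by rewrite exprn_gt0.
move: h; set p := 2 ^+ n in p0 *; set q := nsq (1 *: _ + _); set r := nsq _; set z := nsq _.
set w := \sum_(_ <= _ < _) _; nra.
Qed.

Lemma abs_le_sqr (n : nat) (a : R) : `|a| <= 2 ^+ n * a ^+ 2 + 2^-1 ^+ n.
Proof.
have p0 : (0 : R) < 2 ^+ n by rewrite exprn_gt0.
rewrite exprVn; have -> : a ^+ 2 = `|a| ^+ 2 by rewrite real_normK ?num_real.
set p := 2 ^+ n in p0 *; set b := `|a|.
have : 0 <= (p * b - 1) ^+ 2 / p + b by rewrite addr_ge0 ?divr_ge0 ?sqr_ge0 ?normr_ge0 // ltW.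
have -> : (p * b - 1) ^+ 2 / p + b = p * b ^+ 2 + p^-1 - b by field; rewrite gt_eqF.
by rewrite subr_ge0.
Qed.

Lemma sum_half_le n : \sum_(0 <= m < n) 2^-1 ^+ m <= 2 :> R.
Proof.
suff -> : \sum_(0 <= m < n) 2^-1 ^+ m = 2 - 2 * 2^-1 ^+ n :> R.
  by rewrite gerBl mulr_ge0 ?exprn_ge0.
elim: n => [|n IH]; first by rewrite big_geq // expr0 mulr1 subrr.
by rewrite big_nat_recr //= IH exprS; field.
Qed.

Lemma nneseries_half_le : (\sum_(0 <= m <oo) (2^-1 ^+ m : R)%:E <= 2%:E)%E.
Proof.
apply: lime_le; first by apply: is_cvg_nneseries => *; rewrite lee_fin exprn_ge0.
by apply: nearW => n; rewrite sumEFin lee_fin sum_half_le.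
Qed.

Lemma cvg_increments (x : nat -> R) : 
  (exists C, forall N, \sum_(0 <= m < N) `|x m.+1 - x m| <= C) -> cvgn x.
Proof.
move=> [C hC].
have h : cvgn (series (fun m => x m.+1 - x m)).
  apply: normed_cvg; apply: nondecreasing_is_cvgn.
    by apply: nondecreasing_series => m _ _; apply: normr_ge0.
  by exists C => _ [N _ <-]; apply: hC.
have -> : x = (fun n => series (fun m => x m.+1 - x m) n + x 0%N).
  by apply/funext => n; rewrite /series /= telescope_sumr // subrK.
by apply: is_cvgD => //; apply: is_cvg_cst.
Qed.

Lemma cvg_nsq (x : nat -> 'cV[R[i]]_d) (y z : 'cV[R[i]]_d) :
  (forall k, (fun n => complex.Re (x n k 0)) @ \oo --> complex.Re (y k 0)) ->
  (forall k, (fun n => complex.Im (x n k 0)) @ \oo --> complex.Im (y k 0)) ->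
  (fun n => nsq (x n - z)) @ \oo --> nsq (y - z).
Proof.
move=> hr hi; apply: cvg_sumR => k; rewrite /csq.
rewrite (_ : (fun n => _) = (fun n => (complex.Re (x n k 0) - complex.Re (z k 0)) ^+ 2
   + (complex.Im (x n k 0) - complex.Im (z k 0)) ^+ 2)); last first.
  by apply/funext => n; rewrite !mxE; case: (x n k 0) (z k 0) => a b [].
have -> : complex.Re ((y - z) k 0) ^+ 2 + complex.Im ((y - z) k 0) ^+ 2 =
  (complex.Re (y k 0) - complex.Re (z k 0)) ^+ 2 + (complex.Im (y k 0) - complex.Im (z k 0)) ^+ 2.
  by rewrite !mxE; case: (y k 0) (z k 0) => a b [].
have q (s : nat -> R) l c : s @ \oo --> l -> (fun n => (s n - c) ^+ 2) @ \oo --> (l - c) ^+ 2.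
  move=> hs; have h : (fun n => s n - c) @ \oo --> l - c by apply: cvgB => //; apply: cvg_cst.
  by rewrite expr2; apply: cvgM.
by apply: cvgD; apply: q.
Qed.

(** The series of [2 ^ n] times the squared norms of the increments has finite
    integral, hence is finite almost everywhere; there the sequence converges
    pointwise, and the tails of the series control the distance to the limit. *)
Lemma fock_complete (u : nat -> hvec V) : (forall n, hmem V (u n)) ->
  (forall n, nrm2 (u n.+1 - u n) <= 4^-1 ^+ n) ->
  exists2 x, hmem V x & forall e : R, 0 < e ->
    exists N, forall n, (N <= n)%N -> nrm2 (x - u n) < e.
Proof.
move=> mem_u hu.
have mem_B (v w : hvec V) : hmem V v -> hmem V w -> hmem V (v - w).
  by move=> hv hw; rewrite addrC -scaleN1r; apply: fock_mem_lin.
pose a n (t : R) : R := nsq ((u n.+1 : R -> _) t - (u n : R -> _) t).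
have a0 n t : 0 <= a n t by apply: nsq_ge0.
have ma n : measurable_fun (setT : set (measurableTypeR R)) (a n).
  have /fock_memP[_ m1 _] := mem_B _ _ (mem_u n.+1) (mem_u n).
  exact: (measurable_nsq m1).
have ia n : (\int[mu]_(t in D) (a n t)%:E = (nrm2 (u n.+1 - u n))%:E)%E.
  by rewrite -(fock_integral_nsq (mem_B _ _ (mem_u n.+1) (mem_u n))).
pose A n (t : measurableTypeR R) : \bar R := (2 ^+ n * a n t)%:E.
have A0 n t : (0 <= A n t)%E by rewrite lee_fin mulr_ge0 ?exprn_ge0.
have mA n : measurable_fun setT (A n).
  by apply/measurable_EFinP; apply: measurable_funM.
pose tail n t := (\sum_(0 <= m <oo) A (m + n)%N t)%E.
have tailE n t : tail n t = (\sum_(n <= m <oo) A m t)%E.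
  by rewrite /tail (nneseries_addn n (f := fun m => A m t)).
pose N : set (measurableTypeR R) := [set t | tail 0%N t < +oo]%E.
(* outside N every tail diverges *)
have tailN n t : ~ N t -> tail n t = +oo%E.
  move=> nN; apply/eqP; rewrite -leye_eq leNgt; apply/negP => h; apply: nN.
  rewrite /N /= tailE (nneseries_split 0 n); last by move=> k _; apply: A0.
  rewrite add0n -tailE lte_add_pinfty //.
  by apply: lte_sum_pinfty => k _; rewrite ltry.
have mtail n : measurable_fun setT (tail n).
  by apply: ge0_emeasurable_sum => // *; apply: A0.
have mN : measurable N.
  have := emeasurable_fun_infty_o measurableT (mtail 0%N) +oo%E.
  by rewrite setTI.
have inc_bound t : N t -> forall k n, \sum_(0 <= m < n)
    `|complex.Re ((u m.+1 : R -> 'cV_d) t k 0) - complex.Re ((u m : R -> 'cV_d) t k 0)| <= fine (tail 0%N t) + 2 /\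
    \sum_(0 <= m < n)
    `|complex.Im ((u m.+1 : R -> 'cV_d) t k 0) - complex.Im ((u m : R -> 'cV_d) t k 0)| <= fine (tail 0%N t) + 2.
  move=> Nt k n.
  have tf : tail 0%N t \is a fin_num.
    by rewrite ge0_fin_numE //; apply: nneseries_ge0 => *; apply: A0.
  have sA : \sum_(0 <= m < n) 2 ^+ m * a m t <= fine (tail 0%N t).
    rewrite -lee_fin fineK // -sumEFin tailE.
    by apply: (nneseries_lim_ge n) => *; apply: A0.
  have geo := sum_half_le n.
  have cs (z : 'cV[R[i]]_d) : csq (z k 0) <= nsq z.
    by rewrite /nsq (bigD1 k) //= lerDl sumr_ge0 // => j _; apply: csq_ge0.
  split.
    apply: (le_trans _ (lerD sA geo)); rewrite -big_split /=; apply: ler_sum => m _.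
    apply: (le_trans (abs_le_sqr m _)); rewrite lerD2r ler_wpM2l ?exprn_ge0 //.
    apply: (le_trans _ (cs _)); rewrite !mxE.
    by case: ((u m.+1 : R -> 'cV_d) t k 0) ((u m : R -> 'cV_d) t k 0) => p q [p' q'];
      rewrite /csq /= lerDl sqr_ge0.
  apply: (le_trans _ (lerD sA geo)); rewrite -big_split /=; apply: ler_sum => m _.
  apply: (le_trans (abs_le_sqr m _)); rewrite lerD2r ler_wpM2l ?exprn_ge0 //.
  apply: (le_trans _ (cs _)); rewrite !mxE.
  by case: ((u m.+1 : R -> 'cV_d) t k 0) ((u m : R -> 'cV_d) t k 0) => p q [p' q'];
    rewrite /csq /= lerDr sqr_ge0.
pose h n t k : R[i] := if t \in N then (u n : R -> 'cV_d) t k 0 else 0.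
have hr t k : cvgn (fun n => complex.Re (h n t k)).
  rewrite /h; case: (boolP (t \in N)) => [/set_mem Nt|_]; last exact: is_cvg_cst.
  apply: cvg_increments; exists (fine (tail 0%N t) + 2) => n.
  by have [] := inc_bound _ Nt k n.
have hi t k : cvgn (fun n => complex.Im (h n t k)).
  rewrite /h; case: (boolP (t \in N)) => [/set_mem Nt|_]; last exact: is_cvg_cst.
  apply: cvg_increments; exists (fine (tail 0%N t) + 2) => n.
  by have [] := inc_bound _ Nt k n.
pose x (t : R) : 'cV[R[i]]_d := \col_k
  Complex (limn (fun n => complex.Re (h n t k))) (limn (fun n => complex.Im (h n t k))).
have mx : cmeasurable setT x.
  have mh n k : measurable_fun (setT : set (measurableTypeR R)) (fun t => complex.Re (h n t k)) /\
      measurable_fun (setT : set (measurableTypeR R)) (fun t => complex.Im (h n t k)).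
    have /fock_memP[_ /(_ k) [m1 m2] _] := mem_u n.
    have [m1' m2'] : measurable_fun (setT : set (measurableTypeR R)) (fun t => \1_N t * complex.Re ((u n : R -> 'cV_d) t k 0)) /\
        measurable_fun (setT : set (measurableTypeR R)) (fun t => \1_N t * complex.Im ((u n : R -> 'cV_d) t k 0)).
      by split; apply: measurable_funM => //; apply: measurable_indic.
    split; [move: m1' | move: m2']; apply: eq_measurable_fun => t _; rewrite /h indicE;
      by case: ifP => _; rewrite ?mul1r ?mul0r.
  move=> k; split.
    apply: (measurable_fun_cvg (h := fun n t => complex.Re (h n t k))) => [n|t _].
      exact: (mh n k).1.
    by rewrite mxE; apply: hr.
  apply: (measurable_fun_cvg (h := fun n t => complex.Im (h n t k))) => [n|t _].
    exact: (mh n k).2.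
  by rewrite mxE; apply: hi.
have aN t : tail 0%N (t + 2 * pi) = tail 0%N t.
  apply: eq_eseriesr => n _; rewrite addn0 /A /a.
  have [a1 _ _] := mem_u n.+1; have [a2 _ _] := mem_u n.
  rewrite a1 a2; congr (_ * _)%:E; apply: eq_bigr => k _.
  by rewrite !mxE -opprD -mulN1r csqM /csq /= oppr0 expr0n sqrrN expr1n addr0 mul1r.
have ax : antiperiodic x.
  move=> t; apply/matrixP => k j; rewrite ord1 {j} !mxE.
  have hE n : h n (t + 2 * pi) k = - h n t k.
    have [a1 _ _] := mem_u n.
    have tE : (t + 2 * pi \in N) = (t \in N).
      by apply/idP/idP => /set_mem hN; apply/mem_set; [rewrite /N /= -aN | rewrite /N /= aN].
    rewrite /h tE a1 mxE.
    by case: (t \in N); rewrite ?oppr0.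
  have ->: (fun n => complex.Re (h n (t + 2 * pi) k)) = (fun n => - complex.Re (h n t k)).
    by apply/funext => n; rewrite hE; case: (h n t k).
  have ->: (fun n => complex.Im (h n (t + 2 * pi) k)) = (fun n => - complex.Im (h n t k)).
    by apply/funext => n; rewrite hE; case: (h n t k).
  by rewrite !limN.
have tail0 n t : (0 <= tail n t)%E by apply: nneseries_ge0 => *; apply: A0.
have xcv t : N t -> forall n, (fun M => nsq ((u M : R -> 'cV_d) t - (u n : R -> 'cV_d) t)) @ \oo
    --> nsq (x t - (u n : R -> 'cV_d) t).
  move=> Nt n; apply: cvg_nsq => k; rewrite mxE.
    rewrite (_ : (fun M => _) = (fun M => complex.Re (h M t k))); first exact: hr.
    by apply/funext => M; rewrite /h mem_set.
  rewrite (_ : (fun M => _) = (fun M => complex.Im (h M t k))); first exact: hi.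
  by apply/funext => M; rewrite /h mem_set.
have bd n t : ((2 ^+ n * nsq (x t - (u n : R -> 'cV_d) t))%:E <= 2%:E * tail n t)%E.
  have [tN|nN] := pselect (N t); last first.
    by rewrite tailN // gt0_muley ?leey // lte_fin.
  have [->|tf] := eqVneq (tail n t) +oo%E; first by rewrite gt0_muley ?leey // lte_fin.
  have tfin : tail n t \is a fin_num by rewrite (ge0_fin_numE (tail0 n t)) ltey.
  rewrite -(fineK tfin) -EFinM lee_fin.
  have cv : (fun M => 2 ^+ n * nsq ((u (n + M)%N : R -> 'cV_d) t - (u n : R -> 'cV_d) t)) @ \oo
      --> 2 ^+ n * nsq (x t - (u n : R -> 'cV_d) t).
    apply: cvgM; first exact: cvg_cst.
    have := xcv t tN n; rewrite -(cvg_shiftn n) /=.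
    by under eq_fun do rewrite addnC.
  rewrite -(cvg_lim _ cv) //; apply: limr_le; first by apply/cvg_ex; eexists; exact: cv.
  near=> M.
  apply: (le_trans (nsq_telescope (fun m => (u m : R -> 'cV_d) t) n M)).
  rewrite ler_pM2l // -lee_fin fineK // -sumEFin.
  rewrite tailE (nneseries_split n M (fun k _ => A0 k t)).
  apply: leeDl; apply: nneseries_ge0 => *; exact: A0.
have itail n : (\int[mu]_(t in D) tail n t <= (2 * 2^-1 ^+ n)%:E)%E.
  rewrite integral_nneseries //; last first.
    by move=> m; apply: measurable_funTS; apply: mA.
  apply: (@le_trans _ _ (\sum_(0 <= m <oo) ((2^-1 ^+ n)%:E * (2^-1 ^+ m)%:E)))%E.
    apply: lee_nneseries => m *; first by apply: integral_ge0 => *; apply: A0.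
    have mam : measurable_fun (D : set (measurableTypeR R)) (fun t => (a (m + n)%N t)%:E).
      by apply/measurable_EFinP; apply: measurable_funTS; apply: ma.
    have p0 : (0 <= (2 ^+ (m + n) : R)%:E)%E by rewrite lee_fin exprn_ge0.
    have am0 t : D t -> (0 <= (a (m + n)%N t)%:E)%E by move=> _; rewrite lee_fin.
    have -> : (\int[mu]_(t in D) A (m + n)%N t = (2 ^+ (m + n))%:E * (nrm2 (u (m + n).+1 - u (m + n)%N))%:E)%E.
      by rewrite -ia -(ge0_integralZl mu mD mam am0 p0).
    rewrite -!EFinM lee_fin.
    apply: (le_trans (ler_wpM2l _ (hu _))); first by rewrite exprn_ge0.
    rewrite -exprMn (_ : 2 * 4^-1 = 2^-1 :> R); last by field.
    by rewrite exprD mulrC.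
  rewrite nneseriesZl; last by move=> *; rewrite lee_fin exprn_ge0.
  rewrite [X in (_ <= X)%E]EFinM [X in (_ <= X)%E]muleC.
  by apply: lee_wpmul2l; [rewrite lee_fin exprn_ge0 | exact: nneseries_half_le].
have mxu n : cmeasurable setT (fun t => x t - (u n : R -> 'cV_d) t).
  have [_ mu_ _] := (fock_memP _).1 (mem_u n).
  have := cmeasurable_lin (-1) mu_ mx; congr (cmeasurable _ _).
  by apply/funext => t; rewrite scaleN1r addrC.
have mnsq n : measurable_fun (D : set (measurableTypeR R)) (fun t => (nsq (x t - (u n : R -> 'cV_d) t))%:E).
  by apply/measurable_EFinP; apply: measurable_funTS; apply: measurable_nsq (mxu n).
have nsq0 n t : (0 <= (nsq (x t - (u n : R -> 'cV_d) t))%:E)%E by rewrite lee_fin nsq_ge0.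
have ib n : (\int[mu]_(t in D) (nsq (x t - (u n : R -> 'cV_d) t))%:E <= (4 * 4^-1 ^+ n)%:E)%E.
  have p0 : (0 : R) < 2 ^+ n by rewrite exprn_gt0.
  have p0E : (0 <= (2 ^+ n : R)%:E)%E by rewrite lee_fin ltW.
  have two0 : (0 <= (2 : R)%:E)%E by rewrite lee_fin.
  have h1 : (\int[mu]_(t in D) ((2 ^+ n)%:E * (nsq (x t - (u n : R -> 'cV_d) t))%:E) <=
             \int[mu]_(t in D) (2%:E * tail n t))%E.
    apply: ge0_le_integral => //.
    - by move=> t _; rewrite -EFinM lee_fin mulr_ge0 ?nsq_ge0 // ltW.
    - by apply: emeasurable_funM => //; apply: measurable_cst.
    - by apply: emeasurable_funM; [exact: measurable_cst | apply: measurable_funTS; apply: mtail].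
    - by move=> t _; rewrite -EFinM bd.
  rewrite (ge0_integralZl mu mD (mnsq n) (fun t _ => nsq0 n t) p0E) in h1.
  rewrite (ge0_integralZl mu mD (measurable_funTS (mtail n)) (fun t _ => tail0 n t) two0) in h1.
  have h2 := le_trans h1 (lee_wpmul2l two0 (itail n)).
  have -> : (4 * 4^-1 ^+ n : R) = (2 ^+ n)^-1 * (2 * (2 * 2^-1 ^+ n)).
    rewrite !exprVn (_ : 4 = 2 * 2 :> R) ?exprMn; last by ring.
    by field; rewrite gt_eqF.
  by rewrite EFinM lee_pdivlMl // EFinM.
have memxu n : hmem V ((x : hvec V) - u n).
  have [au _ _] := (fock_memP _).1 (mem_u n).
  apply/fock_memP; split; first by move=> t; rewrite !fctE ax au opprB addrC opprK.
    exact: mxu.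
  apply/integrableP; split; first exact: mnsq.
  rewrite (eq_integral (fun t : measurableTypeR R => (nsq (x t - (u n : R -> 'cV_d) t))%:E)).
    by apply: (le_lt_trans (ib n)); rewrite ltry.
  by move=> t _; apply: (gee0_abs (nsq0 n t)).
exists x; first by rewrite -[x : hvec V](subrK (u 0%N)) -[_ - _]scale1r; apply: fock_mem_lin.
move=> e e0.
have c0 : (fun n : nat => (4 * 4^-1 ^+ n : R)) @ \oo --> (4 * 0 : R).
  by apply: cvgM; [exact: cvg_cst | apply: cvg_expr; rewrite ger0_norm //; lra].
rewrite mulr0 in c0.
have /cvgrPdist_lt /(_ e e0) [N0 _ hN0] := c0.
exists N0 => n /hN0 /=; rewrite sub0r normrN ger0_norm ?mulr_ge0 ?exprn_ge0 //.
apply: le_lt_trans; rewrite -lee_fin -fock_integral_nsq //; exact: ib.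
Unshelve. all: by end_near.
Qed.

End FockComplete.

(** * Integrable functions with vanishing Fourier coefficients *)

Section PeakFunctions.
Context {R : realType}.
Local Notation mu := (@lebesgue_measure R).
Local Notation D := (`[0, 2 * pi]%classic : set R).

Let mD : @measurable _ (measurableTypeR R) D. Proof. exact: measurable_itv. Qed.

Lemma bernoulli_ge (y : R) N : 0 <= y <= 1 -> 1 - N%:R * y <= (1 - y) ^+ N.
Proof.
move=> /andP[y0 y1]; elim: N => [|N IH]; first by rewrite mul0r subr0 expr0.
rewrite exprS; apply: (le_trans _ (ler_wpM2l _ IH)); last lra.
have := ler0n R N; rewrite -natr1; nra.
Qed.

Lemma bernoulli_le (y : R) N : 0 <= y <= 1 -> (1 - y) ^+ N * (N%:R * y) <= 1.
Proof.
move=> /andP[y0 y1].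
have h1 : 1 + N%:R * y <= (1 + y) ^+ N.
  elim: N => [|N IH]; first by rewrite mul0r addr0 expr0.
  rewrite exprS; apply: (le_trans _ (ler_wpM2l _ IH)); last lra.
  have := ler0n R N; rewrite -natr1; nra.
have p0 : 0 <= (1 - y) ^+ N by rewrite exprn_ge0 //; lra.
apply: (@le_trans _ _ ((1 - y) ^+ N * (1 + y) ^+ N)).
  by apply: ler_wpM2l => //; apply: le_trans h1; lra.
by rewrite -exprMn exprn_ile1 //; nra.
Qed.

(** Bernoulli's inequality: [2 ^ n * h ^ n = (2 * h) ^ n] tends to zero. *)
Lemma sharpen_cvg1 (h : R) : 0 <= h < 2^-1 ->
  (fun n => (1 - h ^+ n) ^+ (2 ^ n)) @ \oo --> (1 : R).
Proof.
move=> /andP[h0 h1].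
apply: (@squeeze_cvgr _ _ _ _ (fun n => 1 - (2 * h) ^+ n) (fun=> 1)); last exact: cvg_cst.
  apply: nearW => n.
  have hn : 0 <= h ^+ n <= 1 by rewrite exprn_ge0 // exprn_ile1 //; lra.
  apply/andP; split; last by move: hn => /andP[? ?]; rewrite exprn_ile1 //; lra.
  by rewrite exprMn -natrX; apply: bernoulli_ge.
rewrite -[X in _ --> X]subr0; apply: cvgB; first exact: cvg_cst.
by apply: cvg_expr; rewrite ger0_norm; lra.
Qed.

(** Bernoulli's inequality again: here [(2 * h) ^ n] tends to infinity. *)
Lemma sharpen_cvg0 (h : R) : 2^-1 < h <= 1 ->
  (fun n => (1 - h ^+ n) ^+ (2 ^ n)) @ \oo --> (0 : R).
Proof.
move=> /andP[h0 h1].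
apply: (@squeeze_cvgr _ _ _ _ (fun=> 0) (fun n => ((2 * h)^-1) ^+ n)); first last.
- apply: cvg_expr; rewrite ger0_norm ?invr_ge0; last lra.
  by rewrite invf_lt1; lra.
- exact: cvg_cst.
apply: nearW => n.
have hn : 0 <= h ^+ n <= 1 by rewrite exprn_ge0 ?exprn_ile1 //; lra.
apply/andP; split; first by move: hn => /andP[? ?]; rewrite exprn_ge0 //; lra.
rewrite exprVn -[leRHS]mul1r ler_pdivlMr ?exprn_gt0 //; last lra.
by rewrite exprMn -natrX; apply: bernoulli_le.
Qed.

Lemma cos_gt_arc (a b t : R) : 0 < a -> b < 2 * pi -> b - a < pi -> a < t < b ->
  cos ((b - a) / 2) < cos (t - (a + b) / 2).
Proof.
move=> a0 b2 bapi /andP[at_ tb].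
have [tc|tc] := leP ((a + b) / 2) t.
  by rewrite ltr_cos ?in_itv /=; try (apply/andP; split); lra.
by rewrite -[ltRHS]cosN ltr_cos ?in_itv /=; try (apply/andP; split); lra.
Qed.

Lemma cos_lt_arc (a b t : R) : 0 < a -> a < b -> b < 2 * pi -> b - a < pi ->
  0 <= t <= 2 * pi -> (t < a) || (b < t) ->
  cos (t - (a + b) / 2) < cos ((b - a) / 2).
Proof.
move=> a0 ab b2 bapi /andP[t0 t2] tab.
have key x : (b - a) / 2 < x -> x < 2 * pi - (b - a) / 2 -> cos x < cos ((b - a) / 2).
  move: tab => _ x1 x2; have [xpi|xpi] := leP x pi.
    by rewrite ltr_cos ?in_itv /=; try (apply/andP; split); lra.
  have -> : cos x = cos (2 * pi - x).
    by rewrite cosB mulr_natl cos2pi sin2pi mul1r mul0r addr0.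
  by rewrite ltr_cos ?in_itv /=; try (apply/andP; split); lra.
case/orP: tab => tab; last by apply: key; lra.
by rewrite -[ltLHS]cosN; apply: key; lra.
Qed.

(** The peak [h] in the proof exceeds 1/2 exactly on a given arc, so that
    [(1 - h ^ n) ^ (2 ^ n)] converges boundedly to the indicator of its
    complement.  Hence the integral of [g] over every short arc is zero. *)
Lemma integral_cos_algebra_eq0 (g : R -> R) (T : (R -> R) -> Prop) :
  mu.-integrable D (EFin \o g) ->
  T (fun=> 1) ->
  (forall p q, T p -> T q -> T (fun t => p t - q t)) ->
  (forall (r s c : R) p, T p -> T (fun t => (r + s * cos (t - c)) * p t)) ->
  (forall p, T p -> \int[mu]_(t in D) (p t * g t) = 0) ->
  ae_eq mu D (EFin \o g) (cst 0%E).
Proof.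
move=> ig T1 TB Tcos T0.
have ig0 E : measurable (E : set (measurableTypeR R)) -> E `<=` D -> mu.-integrable E (EFin \o g).
  by move=> mE ED; apply: integrableS ED ig.
have mg : measurable_fun (D : set (measurableTypeR R)) g by apply/measurable_EFinP; apply: (measurable_int _ ig).
have arc a b : 0 < a -> a < b -> b < 2 * pi -> b - a < pi ->
    \int[mu]_(t in `]a, b]) g t = 0.
  move=> a0 ab b2 bapi.
  set c := (a + b) / 2; set dl := (b - a) / 2.
  have cE : c = (a + b) / 2 by [].
  have dlE : dl = (b - a) / 2 by [].
  clearbody c dl.
  have dl0 : 0 < dl by lra.
  have dlpi : dl < pi / 2 by lra.
  have pi0 := @pi_gt0 R.
  have cdl0 : 0 <= cos dl by apply: cos_ge0_pihalf; apply/andP; split; lra.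
  have d1 : 0 < 1 + cos dl by lra.
  pose s := (2 * (1 + cos dl))^-1.
  have s0 : 0 < s by rewrite invr_gt0 mulr_gt0.
  pose h t := s + s * cos (t - c).
  have hE t : h t = (1 + cos (t - c)) / (2 * (1 + cos dl)).
    by rewrite -[(2 * _)^-1]/s mulrDl mul1r [cos _ * _]mulrC.
  have h01 t : 0 <= h t <= 1.
    have := cos_le1 (t - c); have := cos_geN1 (t - c) => c1 c2.
    rewrite hE; apply/andP; split; first by apply: divr_ge0; lra.
    by rewrite ler_pdivrMr ?mulr_gt0 // mul1r; lra.
  have Th n p : T p -> T (fun t => h t ^+ n * p t).
    move=> Tp; elim: n => [|n IH].
      by have -> : (fun t => h t ^+ 0 * p t) = p by apply/funext => t; rewrite expr0 mul1r.
    have -> : (fun t => h t ^+ n.+1 * p t) = (fun t => (s + s * cos (t - c)) * (h t ^+ n * p t)).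
      by apply/funext => t; rewrite exprS mulrA.
    exact: Tcos.
  have Tphi n m : T (fun t => (1 - h t ^+ n) ^+ m).
    elim: m => [|m IH].
      by have -> : (fun t => (1 - h t ^+ n) ^+ 0) = (fun=> 1) by apply/funext => t; rewrite expr0.
    have -> : (fun t => (1 - h t ^+ n) ^+ m.+1) =
      (fun t => (1 - h t ^+ n) ^+ m - h t ^+ n * (1 - h t ^+ n) ^+ m).
      by apply/funext => t; rewrite exprS mulrBl mul1r.
    by apply: TB => //; apply: Th.
  pose phi n t := (1 - h t ^+ n) ^+ (2 ^ n).
  have phi01 n t : 0 <= phi n t <= 1.
    have /andP[p1 p2] := h01 t.
    have q1 : 0 <= h t ^+ n by rewrite exprn_ge0.
    have q2 : h t ^+ n <= 1 by rewrite exprn_ile1.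
    by apply/andP; split; [apply: exprn_ge0; lra | apply: exprn_ile1; lra].
  have mphi n : measurable_fun (D : set (measurableTypeR R)) (phi n).
    apply: measurable_funTS; apply: measurable_funX; apply: measurable_funB => //.
    apply: measurable_funX; apply: measurable_funD => //; apply: measurable_funM => //.
    apply: measurableT_comp.
      by apply: continuous_measurable_fun; apply: continuous_cos.
    by apply: measurable_funB.
  (* the peak is above 1/2 inside the arc and below 1/2 outside *)
  have hgt t : a < t < b -> 2^-1 < h t.
    move=> atb; rewrite hE ltr_pdivlMr ?mulr_gt0 //.
    suff : cos dl < cos (t - c) by move: (cos _) (cos _) => *; lra.
    by rewrite cE dlE; apply: cos_gt_arc.
  have hlt t : 0 <= t <= 2 * pi -> (t < a) || (b < t) -> h t < 2^-1.
    move=> t02 tab; rewrite hE ltr_pdivrMr ?mulr_gt0 //.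
    suff : cos (t - c) < cos dl by move: (cos _) (cos _) => *; lra.
    by rewrite cE dlE; apply: cos_lt_arc.
  pose E := D `\` `]a, b]%classic.
  have mab : measurable (`]a, b]%classic : set (measurableTypeR R)) by exact: measurable_itv.
  have mE : measurable (E : set (measurableTypeR R)) by apply: measurableD.
  pose F t := \1_E t * g t.
  have mF : measurable_fun (D : set (measurableTypeR R)) (fun t => (F t)%:E).
    by apply/measurable_EFinP; apply: measurable_funM => //; apply: measurable_indic.
  have mpg n : measurable_fun (D : set (measurableTypeR R)) (fun t => (phi n t * g t)%:E).
    by apply/measurable_EFinP; apply: measurable_funM.
  have dom : {ae mu, forall t, D t -> (fun n => (phi n t * g t)%:E) @ \oo --> (F t)%:E}.
    exists ([set a] `|` [set b]); split.
    - by apply: measurableU; apply: measurable_set1.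
    - by apply: null_set_setU => //; exact: lebesgue_measure_set1.
    move=> t /= nt; apply: contrapT => /not_orP [ta tb]; apply: nt => Dt.
    apply: cvg_EFin; first by apply: nearW => n.
    rewrite /comp /=; apply: cvgM; last exact: cvg_cst.
    move: Dt; rewrite /D /= in_itv /= => Dt.
    rewrite indicE; have [tE|tE] := boolP (t \in E).
      apply: sharpen_cvg1; have /andP[-> _] := h01 t; apply: hlt => //.
      move: tE => /set_mem [_ /=]; rewrite in_itv /= => /negP.
      by rewrite negb_and -leNgt -ltNge le_eqVlt => /orP[/orP[/eqP//|->//]|->]; rewrite orbT.
    apply: sharpen_cvg0; have /andP[_ ->] := h01 t; rewrite andbT; apply: hgt.
    have : (`]a, b]%classic : set R) t.
      by apply: contrapT => nab; move/negP: tE; apply; apply/mem_set; split => //=; rewrite in_itv.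
    by rewrite /= in_itv /= => /andP[-> tb']; rewrite lt_neqAle tb' andbT; apply/eqP.
  have domg : {ae mu, forall t n, D t -> (`|(phi n t * g t)%:E| <= `|(g t)%:E|)%E}.
    apply: aeW => t n _; rewrite lee_fin normrM ger0_norm; last by have /andP[] := phi01 n t.
    by rewrite ler_piMl // ; have /andP[] := phi01 n t.
  have [_ _ cv] := @dominated_convergence _ (measurableTypeR R) R mu D mD
     _ _ _ mpg mF dom (integrable_abse ig) domg.
  have iphi n : (\int[mu]_(t in D) (phi n t * g t)%:E = 0)%E.
    have ip : mu.-integrable D (fun t => (phi n t * g t)%:E).
      apply: (le_integrable mD (mpg n) _ ig) => t _.
      rewrite lee_fin normrM ger0_norm; last by have /andP[] := phi01 n t.
      by rewrite ler_piMl //; have /andP[] := phi01 n t.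
    rewrite -(fineK (integrable_fin_num mD ip)); congr (_%:E).
    exact: (T0 _ (Tphi n _)).
  have FE0 : (\int[mu]_(t in D) (F t)%:E = 0)%E.
    apply: (cvg_unique _ cv) => //.
    rewrite (_ : (fun n => _) = (fun=> 0%E)); first exact: cvg_cst.
    by apply/funext => n; rewrite -(iphi n).
  have abD : `]a, b]%classic `<=` D.
    move=> t; rewrite /D /= !in_itv /= => /andP[ta tb].
    by rewrite (ltW (lt_trans a0 ta)) (le_trans tb (ltW b2)).
  have DE : D = E `|` `]a, b]%classic.
    apply/seteqP; split=> t.
      by move=> Dt; have [h'|h'] := pselect ((`]a, b]%classic : set R) t); [right | left].
    by case=> [[]//|]; apply: abD.
  have ED : E `<=` D by move=> t [].
  have gE0 : (\int[mu]_(t in E) (g t)%:E = 0)%E.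
    rewrite -FE0 integral_mkcond [in RHS]integral_mkcond; apply: eq_integral => t _.
    rewrite /F !patchE indicE; case: ifPn => tE.
      by rewrite mem_set ?mul1r //; apply: ED; apply: set_mem.
    by case: ifP => // _; rewrite mul0r.
  have gD0 : (\int[mu]_(t in D) (g t)%:E = 0)%E.
    rewrite -(fineK (integrable_fin_num mD ig)); congr (_%:E).
    transitivity (\int[mu]_(t in D) (1 * g t)); last exact: T0 _ T1.
    by apply: eq_Rintegral => t _; rewrite mul1r.
  rewrite /Rintegral.
  have := gD0; rewrite DE integral_setU //=.
  - by rewrite gE0 add0e => ->.
  - by rewrite -DE; apply: (measurable_int _ ig).
  - by rewrite disj_set2E; apply/eqP; rewrite /E setDE -setIA setICl setI0.
pose G := (g \_ D : R -> R).
have iG (A : set (measurableTypeR R)) : measurable A -> mu.-integrable A (EFin \o G).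
  move=> mA; apply: (@integrableS _ _ _ _ setT) => //.
  rewrite /G -restrict_EFin; exact/(integrable_mkcond _ mD).1.
have locG : locally_integrable [set: R] G.
  split.
  - by have /measurable_EFinP := measurable_int _ (iG _ measurableT).
  - exact: openT.
  - move=> K _ cK; have mK : measurable (K : set (measurableTypeR R)) by exact: compact_measurable.
    by have /integrableP[_] := iG _ mK.
have ftc := @FTC1 R G (BLeft 0) (fun y => iG _ (measurable_itv _)) locG.
pose F x := \int[mu]_(t in [set` Interval (BLeft 0) (BRight x)]) G t.
have Fc y x : 0 < y -> y < x -> x < 2 * pi -> x - y < pi -> F x = F y.
  move=> y0 yx x2 xy; apply/eqP; rewrite -subr_eq0; apply/eqP.
  rewrite /F Rintegral_itvB; last 3 first.
  - exact: iG.
  - by rewrite bnd_simp ltW.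
  - by rewrite bnd_simp ltW.
  rewrite -(arc y x) //; apply: eq_Rintegral => t; rewrite inE /= in_itv /= => /andP[t1 t2].
  by rewrite /G patchE mem_set // /D /= in_itv /=; apply/andP; split; lra.
have F0 x : 0 < x < 2 * pi -> 'D_1 F x = 0.
  move=> /andP[x0 x2]; have pi0 := @pi_gt0 R.
  suff nF : {near x, F =1 cst (F x)} by rewrite (near_eq_derive _ nF) derive_cst.
  have dpos : 0 < Num.min pi (Num.min x (2 * pi - x)) by rewrite !lt_min pi0 x0 /=; lra.
  near=> y.
  have : `|x - y| < Num.min pi (Num.min x (2 * pi - x)).
    by near: y; apply: cvgr_dist_lt => //; exact: cvg_id.
  rewrite !lt_min => /and3P[h1 h2 h3] /=.
  move: h1 h2 h3; rewrite !ltr_norml => /andP[a1 a2] /andP[b1 b2] /andP[c1 c2].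
  by have [yx|xy|->//] := ltgtP y x; [apply/esym|]; apply: Fc; lra.
have nul : mu.-negligible [set 0; 2 * pi].
  exists [set 0; 2 * pi]; split => //.
  - by apply: measurableU; apply: measurable_set1.
  - by apply: null_set_setU => //; exact: lebesgue_measure_set1.
have nz : {ae mu, forall x, x \notin [set 0; 2 * pi]}.
  by apply: negligibleS nul => x /= /negP; rewrite negbK => /set_mem.
apply: (@filterS2 _ _ (ae_filter_ringOfSetsType mu) _ _ _ _ ftc nz) => x hx xn Dx /=.
move: (Dx); rewrite /D /= in_itv /= => /andP[x0 x2].
have xo : 0 < x < 2 * pi.
  rewrite !lt_neqAle x0 x2 !andbT; apply/andP; split; apply/eqP => e; move/negP: xn; apply; apply/mem_set; [left|right] => //=.
have [_] := hx (proj1 (andP xo)).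
by rewrite derive1E F0 // /G patchE mem_set // => <-.
Unshelve. all: by end_near.
Qed.

End PeakFunctions.

(** * Calculus of complex-valued functions *)

Section ComplexDerivative.
Context {R : realType}.
Local Notation mu := (@lebesgue_measure R).
Local Notation D := (`[0, 2 * pi]%classic : set R).
Implicit Types (f g : R -> R[i]) (c : R[i]) (t : R).

Let mD : @measurable _ (measurableTypeR R) D. Proof. exact: measurable_itv. Qed.

Definition is_cderive f t (l : R[i]) : Prop :=
  is_derive t (1 : R) (fun s => complex.Re (f s) : R) (complex.Re l) /\
  is_derive t (1 : R) (fun s => complex.Im (f s) : R) (complex.Im l).

Definition ccontinuous f : Prop :=
  continuous (fun s => complex.Re (f s) : R) /\ continuous (fun s => complex.Im (f s) : R).

Lemma is_cderive_cst c t : is_cderive (fun=> c) t 0.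
Proof. by split; apply: is_derive_cst. Qed.

Lemma is_cderiveD f g t l m : is_cderive f t l -> is_cderive g t m ->
  is_cderive (fun s => f s + g s) t (l + m).
Proof.
move=> [h1 h2] [h3 h4]; rewrite /is_cderive ReD ImD; split.
  rewrite (_ : (fun s => _) = (fun s => complex.Re (f s) : R) + (fun s => complex.Re (g s) : R)).
    exact: is_deriveD.
  by apply/funext => s; rewrite ReD.
rewrite (_ : (fun s => _) = (fun s => complex.Im (f s) : R) + (fun s => complex.Im (g s) : R)).
  exact: is_deriveD.
by apply/funext => s; rewrite ImD.
Qed.

Lemma is_cderiveM f g t l m : is_cderive f t l -> is_cderive g t m ->
  is_cderive (fun s => f s * g s) t (l * g t + f t * m).
Proof.
move=> [h1 h2] [h3 h4]; split.
  rewrite (_ : (fun s => _) = (fun s => complex.Re (f s) : R) * (fun s => complex.Re (g s) : R)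
    - (fun s => complex.Im (f s) : R) * (fun s => complex.Im (g s) : R)).
    apply: is_derive_eq; rewrite ReD /GRing.scale /=.
    by case: l m (f t) (g t) h1 h2 h3 h4 => a b [a' b'] [x y] [x' y'] _ _ _ _ /=; ring.
  by apply/funext => s; rewrite !fctE; case: (f s) (g s) => a b [].
rewrite (_ : (fun s => _) = (fun s => complex.Re (f s) : R) * (fun s => complex.Im (g s) : R)
    + (fun s => complex.Im (f s) : R) * (fun s => complex.Re (g s) : R)).
  apply: is_derive_eq; rewrite ImD /GRing.scale /=.
  by case: l m (f t) (g t) h1 h2 h3 h4 => a b [a' b'] [x y] [x' y'] _ _ _ _ /=; ring.
by apply/funext => s; rewrite !fctE; case: (f s) (g s) => a b [].
Qed.

Lemma is_cderiveZ c f t l : is_cderive f t l -> is_cderive (fun s => c * f s) t (c * l).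
Proof.
move=> h; have := is_cderiveM (is_cderive_cst c t) h.
by rewrite mul0r add0r.
Qed.

Lemma is_cderive_sum (I : Type) (r : seq I) (F : I -> R -> R[i]) (l : I -> R[i]) t :
  (forall i, is_cderive (F i) t (l i)) ->
  is_cderive (fun s => \sum_(i <- r) F i s) t (\sum_(i <- r) l i).
Proof.
move=> h; elim: r => [|i r IH].
  rewrite big_nil (_ : (fun s => _) = fun=> 0); first exact: is_cderive_cst.
  by apply/funext => s; rewrite big_nil.
rewrite big_cons (_ : (fun s => _) = (fun s => F i s + \sum_(j <- r) F j s)); first exact: is_cderiveD.
by apply/funext => s; rewrite big_cons.
Qed.

Lemma is_cderive_real (f : R -> R) t (l : R) : is_derive t (1 : R) f l ->
  is_cderive (fun s => (f s)%:C%C) t l%:C%C.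
Proof. by move=> h; split => //=; apply: is_derive_cst. Qed.

Lemma is_cderive_conj f t l : is_cderive f t l ->
  is_cderive (fun s => conjc (f s)) t (conjc l).
Proof.
move=> [h1 h2]; split.
  rewrite (_ : (fun s => _) = (fun s => complex.Re (f s))); first by case: l h1 h2.
  by apply/funext => s; case: (f s).
rewrite (_ : (fun s => _) = - (fun s => complex.Im (f s) : R)).
  by apply: is_derive_eq; case: l h1 h2.
by apply/funext => s; rewrite !fctE; case: (f s).
Qed.

Lemma cderive_continuous f f' : (forall t, is_cderive f t (f' t)) -> ccontinuous f.
Proof.
move=> h; split => t.
  apply: differentiable_continuous; apply/derivable1_diffP.
  by have [[]] := h t.
apply: differentiable_continuous; apply/derivable1_diffP.
by have [_ []] := h t.
Qed.

Lemma ccontinuousM f g : ccontinuous f -> ccontinuous g ->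
  ccontinuous (fun t => f t * g t).
Proof.
move=> [h1 h2] [h3 h4]; split => t.
  rewrite (_ : (fun s => _) = (fun s => complex.Re (f s) * complex.Re (g s) - complex.Im (f s) * complex.Im (g s))).
    by apply: cvgB; apply: cvgM; [exact: h1|exact: h3|exact: h2|exact: h4].
  by apply/funext => s; case: (f s) (g s) => a b [].
rewrite (_ : (fun s => _) = (fun s => complex.Re (f s) * complex.Im (g s) + complex.Im (f s) * complex.Re (g s))).
  by apply: cvgD; apply: cvgM; [exact: h1|exact: h4|exact: h2|exact: h3].
by apply/funext => s; case: (f s) (g s) => a b [].
Qed.

Lemma ccontinuous_cst c : ccontinuous (fun=> c).
Proof. by split => t; apply: cvg_cst. Qed.

Lemma ccontinuousD f g : ccontinuous f -> ccontinuous g ->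
  ccontinuous (fun t => f t + g t).
Proof.
move=> [h1 h2] [h3 h4]; split => t.
  rewrite (_ : (fun s => _) = (fun s => complex.Re (f s) + complex.Re (g s))).
    by apply: cvgD; [exact: h1|exact: h3].
  by apply/funext => s; rewrite ReD.
rewrite (_ : (fun s => _) = (fun s => complex.Im (f s) + complex.Im (g s))).
  by apply: cvgD; [exact: h2|exact: h4].
by apply/funext => s; rewrite ImD.
Qed.

Lemma continuous_integrable (f : R -> R) : continuous f ->
  mu.-integrable D (fun t => (f t)%:E).
Proof.
move=> cf; apply: continuous_compact_integrable; first exact: segment_compact.
by apply: continuous_subspaceT => t; apply: cf.
Qed.

Lemma ccontinuous_cintegrable f : ccontinuous f -> cintegrable f.
Proof. by move=> [h1 h2]; split; apply: continuous_integrable. Qed.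

Lemma Rintegral_derive (f f' : R -> R) : (forall t, is_derive t (1 : R) f (f' t)) ->
  continuous f' -> \int[mu]_(t in D) f' t = f (2 * pi) - f 0.
Proof.
move=> hf cf'.
have cf : continuous f.
  by move=> t; apply: differentiable_continuous; apply/derivable1_diffP; have [] := hf t.
have p0 : 0 < 2 * pi :> R by rewrite mulr_gt0 // pi_gt0.
rewrite /Rintegral (continuous_FTC2 p0 (F := f)) //.
- by apply: continuous_subspaceT => t; apply: cf'.
- split; first by move=> t _; have [] := hf t.
  + by apply: cvg_at_right_filter; apply: cf.
  + by apply: cvg_at_left_filter; apply: cf.
- by move=> t _; rewrite derive1E; have [_] := hf t.
Qed.

Lemma cintegral_derive f f' : (forall t, is_cderive f t (f' t)) -> ccontinuous f' ->
  cintegral f' = f (2 * pi) - f 0.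
Proof.
move=> hf [c1 c2]; rewrite /cintegral.
rewrite (Rintegral_derive (fun t => (hf t).1) c1) (Rintegral_derive (fun t => (hf t).2) c2).
by case: (f (2 * pi)) (f 0) => a b [].
Qed.

(** The exponential of [i a], for real [a]. *)
Definition ce (a : R) : R[i] := Complex (cos a) (sin a).

Lemma ceD a b : ce (a + b) = ce a * ce b.
Proof. by rewrite /ce sinD cosD; apply/eqP; rewrite eq_complex /= eqxx /= addrC. Qed.

Lemma ce0 : ce 0 = 1.
Proof. by rewrite /ce cos0 sin0. Qed.

Lemma ceN a : ce (- a) = conjc (ce a).
Proof. by rewrite /ce cosN sinN. Qed.

Lemma csq_ce a : csq (ce a) = 1.
Proof. by rewrite /csq /= cos2Dsin2. Qed.

Lemma ce2pi_int (k : int) : ce (k%:~R * (2 * pi)) = 1.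
Proof.
have nat_case (n : nat) : ce (n%:R * (2 * pi)) = 1.
  elim: n => [|n IH]; first by rewrite mul0r ce0.
  rewrite -natr1 mulrDl mul1r ceD IH mul1r /ce mulr_natl cos2pi sin2pi //.
case: k => n; first exact: nat_case.
by rewrite NegzE mulrNz mulNr ceN pmulrn nat_case rmorph1.
Qed.

Lemma is_cderive_ce (a : R) t : is_cderive (fun s => ce (a * s)) t (Complex 0 a * ce (a * t)).
Proof.
have h : is_derive t (1 : R) (fun s : R => a * s) a.
  rewrite (_ : (fun s => _) = (a \*: (@id R))); last by apply/funext.
  by apply: is_derive_eq; rewrite /GRing.scale /= mulr1.
split => /=.
  rewrite (_ : (fun s => _) = cos \o (fun s => a * s)) //.
  apply: is_derive_eq.
  by rewrite mul0r sub0r /GRing.scale /= mulNr mulrC.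
rewrite (_ : (fun s => _) = sin \o (fun s => a * s)) //.
apply: is_derive_eq.
by rewrite mul0r add0r /GRing.scale /= mulrC.
Qed.

Lemma ccontinuous_ce (a : R) : ccontinuous (fun s => ce (a * s)).
Proof. exact: cderive_continuous (is_cderive_ce a). Qed.

Lemma cintegral_ce (k : int) :
  cintegral (fun t => ce (k%:~R * t)) = if k == 0 then (2 * pi)%:C%C else 0.
Proof.
have [->|k0] := eqVneq k 0.
  rewrite (@eq_cintegral _ _ (fun=> 1)); last by move=> t _; rewrite mul0r ce0.
  have E : lebesgue_measure D = (2 * pi)%:E.
    by rewrite lebesgue_measure_itv /= lte_fin mulr_gt0 ?pi_gt0 //= oppr0 addr0.
  rewrite /cintegral /= !Rintegral_cst // mul0r mul1r.
  by congr Complex; rewrite -[RHS]/(fine (2 * pi)%:E) -E.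
have ik : Complex 0 k%:~R != 0 :> R[i].
  by rewrite eq_complex /= intr_eq0 (negbTE k0) andbF.
have := @cintegral_derive (fun t => (Complex 0 k%:~R)^-1 * ce (k%:~R * t)) (fun t => ce (k%:~R * t)).
rewrite ce2pi_int mulr0 ce0 subrr; apply; last exact: ccontinuous_ce.
by move=> t; have := is_cderiveZ (Complex 0 k%:~R)^-1 (is_cderive_ce k%:~R t); rewrite mulKf.
Qed.

End ComplexDerivative.

(** * The Fourier system *)

Lemma fock_hilbert (R : realType) (d : nat) : is_hilbert (fockV R d).
Proof.
split.
- exact: fock_mem0.
- by move=> c x y; apply: fock_mem_lin.
- move=> c x y z mx my mz.
  rewrite -(cintegralZ c (fock_integrable mx mz)) -cintegralD //; last 2 first.
  + exact: cintegrableZ (fock_integrable mx mz).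
  + exact: fock_integrable my mz.
  by apply: eq_cintegral => t _; rewrite herm1_lin.
- move=> x y mx my; rewrite -(cintegral_conj (fock_integrable mx my)).
  by apply: eq_cintegral => t _; rewrite herm1_sym.
- move=> x mx; rewrite fock_nrm2E; apply: Rintegral_ge0 => t _; exact: nsq_ge0.
- exact: fock_complete.
- exact: fock_conj_mem.
- by move=> c x y; apply/funext => t; rewrite !fctE; apply: conjmx_lin.
- by move=> x; apply/funext => t; apply: conjmxK.
- move=> x y mx my; rewrite -(cintegral_conj (fock_integrable mx my)).
  by apply: eq_cintegral => t _; apply: herm1_conj.
Qed.

Section FourierBasis.
Context {R : realType} {d : nat}.
Local Notation mu := (@lebesgue_measure R).
Local Notation D := (`[0, 2 * pi]%classic : set R).
Local Notation V := (fockV R d).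
Implicit Types (n m : int) (w v : 'cV[R[i]]_d).

Let mD : @measurable _ (measurableTypeR R) D. Proof. exact: measurable_itv. Qed.
Let hV : is_hilbert V := fock_hilbert R d.

(** The Fourier mode [e^(-i (n + 1/2) t)] with an arbitrary vector as value; a
    constant change of the basis of values then acts on the argument only. *)
Definition osc n w : hvec V := fun t : R => ce (- ((n%:~R + 2^-1) * t)) *: w.

Lemma xi_osc n j : xi n j = osc n (delta_mx j 0).
Proof. by apply/funext => t; rewrite /xi /osc /ce cosN sinN. Qed.

Lemma osc_lin n c w v : osc n (c *: w + v) = c *: osc n w + osc n v.
Proof.
apply/funext => t; change (osc n (c *: w + v) t = c *: osc n w t + osc n v t).
by rewrite /osc scalerDr !scalerA mulrC.
Qed.

Lemma osc_sum (I : Type) (r : seq I) n (c : I -> R[i]) (w : I -> 'cV[R[i]]_d) :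
  osc n (\sum_(i <- r) c i *: w i) = \sum_(i <- r) c i *: osc n (w i).
Proof.
elim: r => [|i r IH]; last by rewrite !big_cons osc_lin IH.
by rewrite !big_nil; apply/funext => t; rewrite /osc scaler0.
Qed.

Lemma osc_conj n w : hconj V (osc n w) = osc (- n - 1) (conjmx w).
Proof.
apply/funext => t; apply/matrixP => i j; rewrite /osc !mxE conjcM -ceN opprK.
congr (ce _ * _); rewrite intrD rmorphN /= -mulNr; congr (_ * _).
by rewrite rmorphN rmorph1 /=; lra.
Qed.

Lemma herm1Z c c' w v : herm 1%:M (c *: w) (c' *: v) = c * conjc c' * herm 1%:M w v.
Proof.
rewrite !herm1E mulr_sumr; apply: eq_bigr => k _; rewrite !mxE conjcM; ring.
Qed.

Lemma herm_osc n m w v t :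
  herm 1%:M (osc n w t) (osc m v t) = herm 1%:M w v * ce ((m - n)%:~R * t).
Proof.
rewrite /osc herm1Z -ceN opprK -ceD mulrC; congr (_ * ce _).
by rewrite -mulNr -mulrDl intrD rmorphN /=; congr (_ * _); lra.
Qed.

Lemma ccontinuous_osc n w k : ccontinuous (fun t => osc n w t k 0).
Proof.
rewrite (_ : (fun t => _) = (fun t => w k 0 * ce ((- (n%:~R + 2^-1)) * t))).
  by apply: ccontinuousM; [exact: ccontinuous_cst | exact: ccontinuous_ce].
by apply/funext => t; rewrite /osc mxE mulrC mulNr.
Qed.

Lemma osc_antiperiodic n w : antiperiodic (osc n w).
Proof.
move=> t; rewrite /osc -[RHS]scaleNr; congr (_ *: _).
rewrite mulrDr opprD ceD -mulrN1; congr (_ * _).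
rewrite mulrDl opprD ceD ceN ce2pi_int rmorph1 mul1r.
have -> : 2^-1 * (2 * pi) = pi :> R by lra.
by rewrite ceN /ce cospi sinpi; apply/eqP; rewrite eq_complex /= oppr0 !eqxx.
Qed.

Lemma osc_mem n w : hmem V (osc n w).
Proof.
apply/fock_memP; split; first exact: osc_antiperiodic.
  by move=> k; have [c1 c2] := ccontinuous_osc n w k; split; apply: continuous_measurable_fun.
apply: (@eq_integrable _ _ _ _ _ mD (fun=> (nsq w)%:E)).
  move=> t _; congr (_%:E); apply: eq_bigr => k _.
  by rewrite /osc mxE csqM csq_ce mul1r.
by apply: continuous_integrable => t; apply: cvg_cst.
Qed.

Lemma dot_osc n m w v : hdot V (osc n w) (osc m v) =
  if n == m then herm 1%:M w v * (2 * pi)%:C%C else 0.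
Proof.
rewrite /= /L2_dot (@eq_cintegral _ _ (fun t => herm 1%:M w v * ce ((m - n)%:~R * t))).
  rewrite cintegralZ; last exact: ccontinuous_cintegrable (ccontinuous_ce _).
  by rewrite cintegral_ce subr_eq0 eq_sym; case: ifP; rewrite ?mulr0.
by move=> t _; apply: herm_osc.
Qed.

(** Multiplied by a half-integer mode, each coordinate becomes a periodic function
    whose integer Fourier coefficients vanish, so that it integrates to zero
    against all trigonometric polynomials ([integral_cos_algebra_eq0]). *)
Lemma osc_total (x : hvec V) : hmem V x ->
  (forall n w, hdot V x (osc n w) = 0) -> nrm2 x = 0.
Proof.
move=> mx hx; have [ax mmx ix] := (fock_memP _).1 mx.
pose f l t := (x : R -> 'cV_d) t l 0 * ce (2^-1 * t).
have csqf l t : csq (f l t) <= nsq ((x : R -> 'cV_d) t).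
  rewrite /f csqM csq_ce mulr1 /nsq (bigD1 l) //= lerDl.
  by apply: sumr_ge0 => k _; apply: csq_ge0.
have mf l : measurable_fun (D : set (measurableTypeR R)) (fun t => complex.Re (f l t)) /\
    measurable_fun (D : set (measurableTypeR R)) (fun t => complex.Im (f l t)).
  have [m1 m2] := mmx l; have [c1 c2] := @ccontinuous_ce R 2^-1.
  have m3 := continuous_measurable_fun c1; have m4 := continuous_measurable_fun c2.
  split; apply: measurable_funTS.
    apply: (eq_measurable_fun (fun t => complex.Re ((x : R -> 'cV_d) t l 0) * complex.Re (ce (2^-1 * t))
      - complex.Im ((x : R -> 'cV_d) t l 0) * complex.Im (ce (2^-1 * t)))).
      by move=> t _; rewrite /f; case: ((x : R -> 'cV_d) t l 0).
    by apply: measurable_funB; apply: measurable_funM.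
  apply: (eq_measurable_fun (fun t => complex.Re ((x : R -> 'cV_d) t l 0) * complex.Im (ce (2^-1 * t))
      + complex.Im ((x : R -> 'cV_d) t l 0) * complex.Re (ce (2^-1 * t)))).
    by move=> t _; rewrite /f; case: ((x : R -> 'cV_d) t l 0).
  by apply: measurable_funD; apply: measurable_funM.
have i1 : mu.-integrable D (fun t : measurableTypeR R => (1 + nsq ((x : R -> 'cV_d) t))%:E).
  apply: (@eq_integrable _ _ _ _ _ mD (fun t => (1 : R)%:E + (nsq ((x : R -> 'cV_d) t))%:E)%E).
    by move=> t _; rewrite -EFinD.
  by apply: integrableD => //; apply: continuous_integrable => t; apply: cvg_cst.
(* bounded measurable functions whose product with [f l] has vanishing integer
   Fourier coefficients *)
pose bdd (p : R -> R) := measurable_fun (setT : set (measurableTypeR R)) p /\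
  exists M, forall t, `|p t| <= M.
pose F l (p : R -> R) n t := (p t)%:C%C * (f l t * ce (n%:~R * t)).
have iF l p n : bdd p -> cintegrable (F l p n).
  move=> [mp [M hM]].
  have M0 : 0 <= M by apply: le_trans (hM 0); apply: normr_ge0.
  have [m1 m2] := mf l; have [c1 c2] := @ccontinuous_ce R n%:~R.
  have m3 := measurable_funTS (D := (D : set (measurableTypeR R))) (continuous_measurable_fun c1).
  have m4 := measurable_funTS (D := (D : set (measurableTypeR R))) (continuous_measurable_fun c2).
  have mp' := measurable_funTS (D := (D : set (measurableTypeR R))) mp.
  have iM := integrableZl mD M i1.
  have absle (a b c : R) : `|a| <= M -> b ^+ 2 <= c -> `|a * b| <= M * (1 + c).
    move=> h1 h2; rewrite normrM; apply: ler_pM => //.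
    have : `|b| ^+ 2 = b ^+ 2 by rewrite real_normK ?num_real.
    by move: h2; set z := `|b| => *; nra.
  have cfc t : csq (f l t * ce (n%:~R * t)) <= nsq ((x : R -> 'cV_d) t).
    by rewrite csqM csq_ce mulr1.
  have pos t : 0 <= M * (1 + nsq ((x : R -> 'cV_d) t)).
    by rewrite mulr_ge0 // addr_ge0 ?nsq_ge0.
  split; apply: (le_integrable mD _ _ iM).
  - apply/measurable_EFinP; apply: (eq_measurable_fun (fun t => p t * (complex.Re (f l t) * complex.Re (ce (n%:~R * t))
      - complex.Im (f l t) * complex.Im (ce (n%:~R * t))))).
      by move=> t _; rewrite /F; case: (f l t) => a b /=; ring.
    by apply: measurable_funM => //; apply: measurable_funB; apply: measurable_funM.
  - move=> t _; change (`|(complex.Re (F l p n t))%:E| <= `|(M * (1 + nsq ((x : R -> 'cV_d) t)))%:E|)%E.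
    rewrite lee_fin [leRHS]ger0_norm //.
    have -> : complex.Re (F l p n t) = p t * complex.Re (f l t * ce (n%:~R * t)).
      by rewrite /F; case: (_ * ce _) => a b /=; ring.
    apply: absle => //; apply: le_trans (cfc t); rewrite /csq lerDl; exact: sqr_ge0.
  - apply/measurable_EFinP; apply: (eq_measurable_fun (fun t => p t * (complex.Re (f l t) * complex.Im (ce (n%:~R * t))
      + complex.Im (f l t) * complex.Re (ce (n%:~R * t))))).
      by move=> t _; rewrite /F; case: (f l t) => a b /=; ring.
    by apply: measurable_funM => //; apply: measurable_funD; apply: measurable_funM.
  - move=> t _; change (`|(complex.Im (F l p n t))%:E| <= `|(M * (1 + nsq ((x : R -> 'cV_d) t)))%:E|)%E.
    rewrite lee_fin [leRHS]ger0_norm //.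
    have -> : complex.Im (F l p n t) = p t * complex.Im (f l t * ce (n%:~R * t)).
      by rewrite /F; case: (_ * ce _) => a b /=; ring.
    apply: absle => //; apply: le_trans (cfc t); rewrite /csq lerDr; exact: sqr_ge0.
pose T l p := bdd p /\ forall n, cintegral (F l p n) = 0.
have T1 l : T l (fun=> 1).
  split; first by split=> //; exists 1 => t; rewrite normr1.
  move=> n; rewrite -(hx n (delta_mx l 0)); apply: eq_cintegral => t _.
  rewrite /F mul1r herm1E (bigD1 l) //= big1 ?addr0 => [|k kl].
    rewrite /f /osc !mxE !eqxx conjcM rmorph1 mulr1 -ceN opprK mulrDl ceD; ring.
  by rewrite /osc !mxE (negbTE kl) mulr0 conjc0 mulr0.
have TB l p q : T l p -> T l q -> T l (fun t => p t - q t).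
  move=> [[mp [M hM]] Tp] [[mq [N hN]] Tq]; have bp : bdd p by split=> //; exists M.
  have bq : bdd q by split=> //; exists N.
  split.
    split; first exact: measurable_funB.
    by exists (M + N) => t; apply: le_trans (ler_normB _ _) (lerD _ _).
  move=> n; rewrite (@eq_cintegral _ _ (fun t => F l p n t + (-1) * F l q n t)); last first.
    by move=> t _; rewrite /F rmorphB /=; ring.
  by rewrite cintegralD ?cintegralZ ?Tp ?Tq ?mulr0 ?addr0 //; [exact: iF | exact: iF | apply: cintegrableZ; exact: iF].
have Tc l r s c p : T l p -> T l (fun t => (r + s * cos (t - c)) * p t).
  move=> [[mp [M hM]] Tp]; have bp : bdd p by split=> //; exists M.
  have M0 : 0 <= M by apply: le_trans (hM 0); apply: normr_ge0.
  split.
    split.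
      apply: measurable_funM => //; apply: measurable_funD => //; apply: measurable_funM => //.
      apply: measurableT_comp; last by apply: measurable_funB.
      by apply: continuous_measurable_fun; apply: continuous_cos.
    exists ((`|r| + `|s|) * M) => t; rewrite normrM; apply: ler_pM => //.
    apply: (le_trans (ler_normD _ _)); rewrite lerD2l normrM ler_piMr //.
    by rewrite ler_norml cos_geN1 cos_le1.
  move=> n; rewrite (@eq_cintegral _ _ (fun t => r%:C%C * F l p n t +
     ((s / 2)%:C%C * ce (- c) * F l p (n + 1) t + (s / 2)%:C%C * ce c * F l p (n - 1) t))); last first.
    move=> t _; rewrite /F !intrD rmorphN rmorph1 /= !mulrDl mulN1r mul1r !ceD.
    have -> : cos (t - c) = (cos t * cos c + sin t * sin c) by rewrite cosB.
    rewrite !ceN /ce.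
    by case: (f l t) => a b; apply/eqP; rewrite eq_complex /=; apply/andP; split; apply/eqP; field.
  have j n' := iF l p n' bp.
  have jz a n' := cintegrableZ a (j n').
  rewrite (cintegralD (jz _ _) (cintegrableD (jz _ _) (jz _ _))).
  rewrite (cintegralD (jz _ _) (jz _ _)) !(cintegralZ _ (j _)) !Tp.
  by rewrite !mulr0 !addr0.
have T0 l p : T l p -> \int[mu]_(t in D) (p t * complex.Re (f l t)) = 0 /\
    \int[mu]_(t in D) (p t * complex.Im (f l t)) = 0.
  move=> [_ /(_ 0)] [h1 h2]; split.
    rewrite -[RHS]h1; apply: eq_Rintegral => t _.
    by rewrite /F mul0r ce0 mulr1; case: (f l t) => a b /=; ring.
  rewrite -[RHS]h2; apply: eq_Rintegral => t _.
  by rewrite /F mul0r ce0 mulr1; case: (f l t) => a b /=; ring.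
have b1 : bdd (fun=> 1) by split=> //; exists 1 => t; rewrite normr1.
have fi l : mu.-integrable D (EFin \o (fun t => complex.Re (f l t))) /\
    mu.-integrable D (EFin \o (fun t => complex.Im (f l t))).
  have [j1 j2] := iF l _ 0 b1.
  split; [apply: eq_integrable j1 | apply: eq_integrable j2] => // t _;
    by rewrite /F mul1r mul0r ce0 mulr1.
have ae l : {ae mu, forall t, D t -> csq (f l t) = 0}.
  have [f1 f2] := fi l.
  have e1 := integral_cos_algebra_eq0 f1 (T1 l) (@TB l) (@Tc l) (fun p Tp => (T0 l p Tp).1).
  have e2 := integral_cos_algebra_eq0 f2 (T1 l) (@TB l) (@Tc l) (fun p Tp => (T0 l p Tp).2).
  apply: (@filterS2 _ _ (ae_filter_ringOfSetsType mu) _ _ _ _ e1 e2) => t h1 h2 Dt.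
  have [r0] := h1 Dt; have [i0] := h2 Dt.
  by rewrite /csq r0 i0 expr0n addr0.
have aen : {ae mu, forall t, D t -> nsq ((x : R -> 'cV_d) t) = 0}.
  have := @filter_forall _ _ _ _ (ae_filter_ringOfSetsType mu) ae.
  apply: (@filterS _ _ (ae_filter_ringOfSetsType mu)) => t h Dt.
  apply: big1 => l _; have := h l Dt.
  by rewrite /f csqM csq_ce mulr1.
rewrite fock_nrm2E /Rintegral (ae_eq_integral (cst 0%E)) ?integral0 //.
- by apply/measurable_EFinP; apply: measurable_funTS; apply: measurable_nsq mmx.
- apply: (@filterS _ _ (ae_filter_ringOfSetsType mu) _ _ _ aen) => t h Dt /=.
  by rewrite h.
Qed.

End FourierBasis.

(** * Enumeration of the Fourier modes *)

Section Enumeration.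
Context {d' : nat}.
Local Notation d := d'.+1.

(** The natural numbers are cut into blocks of length [d], one for each
    frequency, in the order 0, -1, 1, -2, 2 and so on. *)
Definition freq (k : nat) : int :=
  if odd (k %/ d) then Negz (k %/ d)./2 else Posz (k %/ d)./2.

Definition comp (k : nat) : 'I_d := Ordinal (ltn_pmod k (ltn0Sn d')).

Definition enum_index (n : int) (j : 'I_d) : nat :=
  (match n with Posz m => m.*2 | Negz m => m.*2.+1 end * d + j)%N.

Lemma freq_enum n j : freq (enum_index n j) = n.
Proof.
rewrite /freq /enum_index divnMDl // (divn_small (ltn_ord j)) addn0.
case: n => m /=; rewrite odd_double ?doubleK //=.
by rewrite uphalf_double.
Qed.

Lemma comp_enum n j : comp (enum_index n j) = j.
Proof. by apply: val_inj; rewrite /= /enum_index modnMDl modn_small. Qed.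

Lemma enum_freq k : enum_index (freq k) (comp k) = k.
Proof.
rewrite /enum_index [RHS](divn_eq k d) /=; congr (_ * _ + _)%N.
rewrite /freq; have := odd_double_half (k %/ d).
by case: (odd _) => /= h; rewrite -[RHS]h ?add1n ?add0n.
Qed.

Lemma freq_comp_inj k l : freq k = freq l -> comp k = comp l -> k = l.
Proof. by move=> h1 h2; rewrite -(enum_freq k) h1 h2 enum_freq. Qed.

(** Frequencies of opposite sign differ by the sum of their absolute values, whose
    square dominates the product of the indices; decay in the difference is thus bounded by a product
    of two summable sequences. *)
Lemma freq_sep k l : (0 <= freq k) != (0 <= freq l) ->
  freq k != freq l /\
  ((k.+1 * l.+1)%N <= 4 * d ^ 2 * `|freq k - freq l| ^ 2)%N.
Proof.
have q_ge m : (m.+1 <= (m %/ d).+1 * d)%N by rewrite -ltn_divLR.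
wlog kl : k l / (0 <= freq k) && (freq l < 0).
  move=> h; have [fk|fk] := boolP (0 <= freq k); have [fl|fl] := boolP (0 <= freq l) => //= _.
    by apply: h; rewrite ?fk ?ltNge ?fl ?(negbTE fl).
  have [|//|h1 h2] := h l k; first by rewrite fl ltNge fk.
    by rewrite fl (negbTE fk).
  by rewrite eq_sym h1 distnC mulnC.
move=> _; move: kl; rewrite /freq.
have hk := odd_double_half (k %/ d); have hl := odd_double_half (l %/ d).
have := q_ge k; have := q_ge l; move: hk hl.
move: (k %/ d)%N (l %/ d)%N => p q; case: (odd p) => //; case: (odd q) => //=.
rewrite add0n add1n => hp hq ql pk _; split => //.
rewrite -hp in pk; rewrite -hq in ql.
move: (p./2) (q./2) pk ql => a b pk ql {hp hq p q q_ge}.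
apply: (leq_trans (leq_mul pk ql)).
have -> : (4 * d ^ 2 * (a + b.+1) ^ 2 = (2 * (a + b.+1) * d) * (2 * (a + b.+1) * d))%N.
  by rewrite -!mulnn; lia.
by apply: leq_mul; rewrite leq_mul2r; apply/orP; right; lia.
Qed.

End Enumeration.

Section InverseSquares.
Context {R : realType}.

Lemma summable_inv_sqr : (\sum_(0 <= k <oo) ((k.+1%:R ^+ 2)^-1 : R)%:E < +oo)%E.
Proof.
apply: (@le_lt_trans _ _ (2%:E)%E); last exact: ltry.
apply: lime_le; first by apply: is_cvg_nneseries => *; rewrite lee_fin invr_ge0 exprn_ge0.
apply: nearW => n; rewrite sumEFin lee_fin.
apply: (@le_trans _ _ (\sum_(0 <= k < n.+1) (k.+1%:R ^+ 2)^-1)).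
  by rewrite big_nat_recr //= lerDl invr_ge0 exprn_ge0.
apply: (@le_trans _ _ (2 - (n.+1%:R)^-1)); last by rewrite gerBl invr_ge0.
elim: n => [|n IH]; first by rewrite big_nat1 expr1n invr1; lra.
rewrite big_nat_recr //=; apply: (le_trans (lerD IH (lexx _))).
have a0 : 0 < n.+1%:R :> R by rewrite ltr0n.
have -> : n.+2%:R = n.+1%:R + 1 :> R by rewrite -natr1.
set a : R := n.+1%:R in a0 *.
rewrite -subr_ge0.
have -> : 2 - (a + 1)^-1 - (2 - a^-1 + ((a + 1) ^+ 2)^-1) = (a * (a + 1) ^+ 2)^-1 :> R.
  by field; rewrite !gt_eqF //; lra.
by rewrite invr_ge0 mulr_ge0 ?exprn_ge0 //; lra.
Qed.

End InverseSquares.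

(** * The standard Lagrangian and its images *)

Section FockBases.
Context {R : realType} {d' : nat}.
Local Notation d := d'.+1.
Local Notation V := (fockV R d).
Let hV : is_hilbert V := fock_hilbert R d.
Implicit Types (w : 'I_d -> 'cV[R[i]]_d) (n m : int).
Local Notation freq := (@freq d').
Local Notation comp := (@comp d').

(** The expansion property replaces an argument on dimensions. *)
Definition unitary_frame w : Prop :=
  (forall i j, herm 1%:M (w i) (w j) = (i == j)%:R) /\
  forall v, v = \sum_j herm 1%:M v (w j) *: w j.

Definition std_frame (j : 'I_d) : 'cV[R[i]]_d := delta_mx j 0.

Lemma herm_std (v : 'cV[R[i]]_d) j : herm 1%:M v (std_frame j) = v j 0.
Proof.
rewrite herm1E (bigD1 j) //= big1 ?addr0 => [|k kj].
  by rewrite mxE !eqxx rmorph1 mulr1.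
by rewrite mxE (negbTE kj) conjc0 mulr0.
Qed.

Lemma std_frame_unitary : unitary_frame std_frame.
Proof.
split=> [i j|v]; first by rewrite herm_std mxE eqxx andbT eq_sym.
apply/matrixP => k l; rewrite ord1 summxE (bigD1 k) //= big1 ?addr0 => [|j jk].
  by rewrite herm_std !mxE !eqxx mulr1.
by rewrite !mxE eq_sym (negbTE jk) mulr0.
Qed.

(** The factor that normalizes the Fourier modes. *)
Definition oscn : R[i] := ((Num.sqrt (2 * pi))^-1)%:C%C.

Lemma oscn_sqr : oscn * conjc oscn * (2 * pi)%:C%C = 1.
Proof.
have p0 : 0 < 2 * pi :> R by rewrite mulr_gt0 // pi_gt0.
rewrite /oscn conjc_real -!rmorphM /= -[X in _ * X](sqr_sqrtr (ltW p0)).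
rewrite -expr2 -exprMn mulVf ?expr1n ?rmorph1 //.
by rewrite gt_eqF // sqrtr_gt0.
Qed.

Lemma oscn_neq0 : oscn != 0.
Proof. by apply/eqP => h; have := oscn_sqr; rewrite h !mul0r => /esym/eqP; rewrite oner_eq0. Qed.

Definition fock_basis w (k : nat) : hvec V := oscn *: osc (freq k) (w (comp k)).

Lemma fock_basis_mem w k : hmem V (fock_basis w k).
Proof. by apply: hmemZ => //; apply: osc_mem. Qed.

Lemma dot_fock_basisr w x k : hmem V x ->
  hdot V x (fock_basis w k) = conjc oscn * hdot V x (osc (freq k) (w (comp k))).
Proof. by move=> mx; exact: (dotZr hV _ (osc_mem _ _) mx). Qed.

Lemma dot_fock_basis w w' k l : hdot V (fock_basis w k) (fock_basis w' l) =
  if freq k == freq l then herm 1%:M (w (comp k)) (w' (comp l)) else 0.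
Proof.
rewrite dot_fock_basisr; last exact: fock_basis_mem.
rewrite (dotZl hV); [|exact: osc_mem|exact: osc_mem].
rewrite dot_osc; case: ifP => _; last by rewrite !mulr0.
rewrite -[RHS]mulr1 -oscn_sqr; ring.
Qed.

Lemma osc_expand w n v : unitary_frame w ->
  osc n v = \sum_j herm 1%:M v (w j) *: osc n (w j).
Proof. by move=> [_ hw]; rewrite -osc_sum -hw. Qed.

Lemma fock_basisP w : unitary_frame w -> hilbert_basis (fock_basis w).
Proof.
move=> hw; apply: (orthonormal_basis hV).
  split=> [k|k l]; first exact: fock_basis_mem.
  rewrite dot_fock_basis hw.1; have [e|e] := eqVneq (freq k) (freq l).
    congr (nat_of_bool _)%:R; apply/eqP/eqP => [e'|->//].
    exact: (freq_comp_inj e e').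
  have [kl|//] := eqVneq k l; by rewrite kl eqxx in e.
move=> x mx h; apply: osc_total => // n v.
have mo j : hmem V (herm 1%:M v (w j) *: osc n (w j)) := hmemZ hV _ (osc_mem _ _).
rewrite (osc_expand n v hw) (@dot_sumr _ _ hV _ _ _ _ _ (fun j _ => mo j) mx).
apply: big1 => j _; rewrite (dotZr hV _ (osc_mem _ _) mx).
have := h (enum_index n j); rewrite (dot_fock_basisr _ _ mx) freq_enum comp_enum.
by move/eqP; rewrite mulf_eq0 conjc_eq0 (negbTE oscn_neq0) /= => /eqP ->; rewrite mulr0.
Qed.

Lemma fock_basis_conjE w k : hconj V (fock_basis w k) =
  fock_basis (fun=> conjmx (w (comp k))) (enum_index (- freq k - 1) (comp k)).
Proof.
by rewrite /fock_basis (hconjZ hV) osc_conj freq_enum /oscn conjc_real.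
Qed.

Lemma fock_basis_conj w w' k l :
  hdot V (hconj V (fock_basis w k)) (fock_basis w' l) =
  if - freq k - 1 == freq l then herm 1%:M (conjmx (w (comp k))) (w' (comp l)) else 0.
Proof. by rewrite fock_basis_conjE dot_fock_basis freq_enum. Qed.

Local Notation nonneg := (fun k => 0 <= freq k).

(** For each frequency, the modes with values in one frame are finite combinations
    of those with values in the other. *)
Lemma fockL_subfamily w : unitary_frame w ->
  fockL R d = closed_span (subfamily (fock_basis w) nonneg).
Proof.
move=> hw; have hb := fock_basisP hw; have ob := basis_orthonormal hb.
have sm := @subfamily_mem _ _ _ ob nonneg.
have xm : [set u | exists (n : nat) (j : 'I_d), u = xi n%:Z j] `<=` hmem V.
  by move=> _ [n [j ->]]; rewrite xi_osc; apply: osc_mem.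
apply/seteqP; split.
  apply: subset_trans (closed_span_closed hV sm).2; apply: closed_spanS.
  move=> _ [n [j ->]]; rewrite xi_osc; apply: (basis_subfamily hV hb); first exact: osc_mem.
  move=> k; rewrite -ltNge => fk; rewrite dot_fock_basisr; last exact: osc_mem.
  rewrite dot_osc ifF ?mulr0 //; apply/eqP => e.
  by rewrite -e in fk.
apply: subset_trans (closed_span_closed hV xm).2; apply: closed_spanS.
have lx := closed_span_linear hV xm.
move=> _ [k nk <-]; apply: linear_setZ => //.
rewrite (osc_expand _ _ std_frame_unitary); apply: linear_set_sum => // j _.
apply: linear_setZ => //; apply: sub_closed_span => //.
move: nk => /=; case: (freq k) => // n _; exists n, j; by rewrite xi_osc.
Qed.

Lemma lagrangian_fockL_image (H : hilbert R) (hH : is_hilbert H)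
    (u : hvec V -> hvec H) : orthogonal_map u -> lagrangian (himage u (fockL R d)).
Proof.
move=> hu; have hs := std_frame_unitary; rewrite (fockL_subfamily hs).
apply: (lagrangian_image hV hH (fock_basisP hs) hu) => k l kl.
rewrite fock_basis_conj; case: eqP => // e; move: kl; rewrite -e.
by case: (lerP 0 (freq k)) => h; lia.
Qed.

(** Rapid decay of the transition coefficients makes the images of the
    Lagrangian equivalent. *)
Lemma equivalent_fockL_images (H : hilbert R) (hH : is_hilbert H)
    (u u' : hvec V -> hvec H) (C : R) :
  orthogonal_map u -> orthogonal_map u' -> 0 <= C ->
  (forall n m i j, n != m ->
    csq (hdot H (u' (osc n (std_frame i))) (u (osc m (std_frame j)))) * (n - m)%:~R ^+ 4 <= C) ->
  equivalent (himage u' (fockL R d)) (himage u (fockL R d)).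
Proof.
move=> hu hu' C0 hC; have hs := std_frame_unitary; rewrite (fockL_subfamily hs).
pose K : R := csq oscn * (4 * d ^ 2)%:R * Num.sqrt C.
have K0 : 0 <= K by rewrite /K !mulr_ge0 ?sqrtr_ge0 ?csq_ge0.
pose a k : R := K * (k.+1%:R ^+ 2)^-1.
have a0 k : 0 <= a k by rewrite mulr_ge0 ?invr_ge0 ?exprn_ge0.
have sa : (\sum_(0 <= k <oo) (a k)%:E < +oo)%E.
  under eq_eseriesr do rewrite EFinM.
  rewrite nneseriesZl; last by move=> *; rewrite lee_fin invr_ge0 exprn_ge0.
  by rewrite lte_mul_pinfty ?summable_inv_sqr // lee_fin.
apply: (equivalent_images hV hH (fock_basisP hs) hu hu' a0 sa) => k l /freq_sep [fkl].
set q := `|_|%N => bnd.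
rewrite (csq_dot_scale hV hH _ hu hu' (osc_mem _ _) (osc_mem _ _)).
have := hC _ _ (comp k) (comp l) fkl; set X := csq (hdot H _ _).
have -> : (freq k - freq l)%:~R ^+ 4 = q%:R ^+ 4 :> R.
  have e2 : (freq k - freq l)%:~R ^+ 2 = q%:R ^+ 2 :> R.
    by rewrite -[LHS]real_normK ?num_real // -intr_norm -natr_absz.
  by rewrite -[4%N]/(2 * 2)%N !exprM e2.
have q0 : 0 < q%:R :> R by rewrite ltr0n absz_gt0 subr_eq0.
rewrite -ler_pdivlMr ?exprn_gt0 // => h.
have s0 := csq_ge0 oscn.
apply: (le_trans (ler_wpM2l s0 (ler_wpM2l s0 h))).
have bR : (k.+1%:R * l.+1%:R : R) <= (4 * d ^ 2)%:R * q%:R ^+ 2.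
  by rewrite -natrX -!natrM ler_nat.
rewrite /a /K.
have k0 : 0 < k.+1%:R :> R by rewrite ltr0n.
have l0 : 0 < l.+1%:R :> R by rewrite ltr0n.
have sC : Num.sqrt C * Num.sqrt C = C by rewrite -expr2 sqr_sqrtr.
move: (k.+1%:R : R) (l.+1%:R : R) k0 l0 bR => A B A0 B0.
move: ((4 * d ^ 2)%:R : R) (csq oscn) s0 => e s s0 bR.
have -> : s * e * Num.sqrt C * (A ^+ 2)^-1 * (s * e * Num.sqrt C * (B ^+ 2)^-1) =
   s * (s * (C * (e ^+ 2 / (A * B) ^+ 2))).
  by move: (Num.sqrt C) sC => r <-; field; rewrite !gt_eqF.
rewrite ler_wpM2l // ler_wpM2l // ler_wpM2l //.
rewrite ler_pdivlMr ?exprn_gt0 ?mulr_gt0 // mulrC ler_pdivrMr ?exprn_gt0 //.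
have AB0 : 0 <= A * B by rewrite mulr_ge0 // ltW.
rewrite -[4%N]/(2 * 2)%N exprM -exprMn.
by rewrite ler_sqr ?nnegrE //; apply: le_trans AB0 bR.
Qed.

End FockBases.

(** * Functional calculus of real normal matrices *)

Section FunctionalCalculus.
Context {R : realType} {d : nat}.
Implicit Types (A B : 'M[R]_d) (M : 'M[R[i]]_d) (f g : R[i] -> R[i]).
Local Notation C := R[i].

Lemma cplxM m n p (A : 'M[R]_(m, n)) (B : 'M[R]_(n, p)) : cplx (A *m B) = cplx A *m cplx B.
Proof. exact: map_mxM. Qed.

Lemma cplx1 n : cplx 1%:M = 1%:M :> 'M[C]_n.
Proof. exact: map_mx1. Qed.

Lemma cplxD m n (A B : 'M[R]_(m, n)) : cplx (A + B) = cplx A + cplx B.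
Proof. exact: map_mxD. Qed.

Lemma cplxZ m n a (A : 'M[R]_(m, n)) : cplx (a *: A) = a%:C%C *: cplx A.
Proof. exact: map_mxZ. Qed.

Lemma cplxN m n (A : 'M[R]_(m, n)) : cplx (- A) = - cplx A.
Proof. exact: map_mxN. Qed.

Lemma conjmx_cplx m n (A : 'M[R]_(m, n)) : conjmx (cplx A) = cplx A.
Proof. by apply/matrixP => i j; rewrite !mxE conjc_real. Qed.

Lemma conjmxM m n p (A : 'M[C]_(m, n)) (B : 'M[C]_(n, p)) :
  conjmx (A *m B) = conjmx A *m conjmx B.
Proof. exact: map_mxM. Qed.

Lemma conjmxZ m n (c : C) (A : 'M[C]_(m, n)) : conjmx (c *: A) = conjc c *: conjmx A.
Proof. exact: map_mxZ. Qed.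

Lemma cplxT m n (A : 'M[R]_(m, n)) : conjmx (cplx A)^T = cplx A^T.
Proof. by apply/matrixP => i j; rewrite !mxE; apply: conjc_real. Qed.

Lemma cplx_inj m n : injective (@cplx R m n).
Proof.
move=> A B h; apply/matrixP => i j.
by have /matrixP /(_ i j) := h; rewrite !mxE => -[].
Qed.

Lemma real_cplx m n (M : 'M[C]_(m, n)) : conjmx M = M -> exists A : 'M[R]_(m, n), M = cplx A.
Proof.
move=> h; exists (map_mx (@complex.Re R) M); apply/matrixP => i j; rewrite !mxE.
have /matrixP /(_ i j) := h; rewrite mxE; case: (M i j) => a b [] hb.
by congr Complex; lra.
Qed.

(** The matrix [A] is real, its eigenvectors (the columns of [W]) and eigenvalues
    are complex. *)
Record eigenbasis (A : 'M[R]_d) (W : 'M[C]_d) (mu : 'I_d -> C) : Prop := {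
  eb_unitary : conjmx W^T *m W = 1%:M;
  eb_eigen : cplx A *m W = W *m diag_mx (\row_j mu j) }.

Lemma eigenbasis_exists A : A *m A^T = A^T *m A -> exists W mu, eigenbasis A W mu.
Proof.
move=> nA; have /orthomx_spectralP : cplx A \is normalmx.
  apply/normalmxP.
  have -> : map_mx Num.conj (cplx A)^T = cplx A^T.
    by apply/matrixP => i j; rewrite !mxE; apply: conjc_real.
  by rewrite -!cplxM nA.
set S := spectralmx _; set D := spectral_diag _ => hA.
have uS : S \is unitarymx by apply: spectral_unitarymx.
have invS := invmx_unitary uS.
have SS : S *m (map_mx Num.conj S^T) = 1%:M by apply/unitarymxP.
exists (map_mx Num.conj S^T), (fun j => D 0 j); split.
  suff -> : conjmx (map_mx Num.conj S^T)^T = S by [].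
  by apply/matrixP => i j; rewrite !mxE; apply: conjcK.
rewrite hA invS -!mulmxA SS mulmx1; congr (_ *m diag_mx _).
by apply/rowP => j; rewrite mxE.
Qed.

Section Calculus.
Context {A : 'M[R]_d} {W : 'M[C]_d} {mu : 'I_d -> C} (eb : eigenbasis A W mu).

(** The matrix [f(A)], for [A] with eigenbasis [W] and eigenvalues [mu]. *)
Definition fcalc f : 'M[C]_d := W *m diag_mx (\row_j f (mu j)) *m conjmx W^T.

Let W1 : conjmx W^T *m W = 1%:M := eb_unitary eb.

Let W2 : W *m conjmx W^T = 1%:M.
Proof. by apply: mulmx1C. Qed.

Lemma fcalcM f g : fcalc f *m fcalc g = fcalc (fun z => f z * g z).
Proof.
rewrite /fcalc -!mulmxA [conjmx _ *m (W *m _)]mulmxA W1 mul1mx [diag_mx _ *m (_ *m _)]mulmxA.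
rewrite mulmx_diag; congr (W *m (diag_mx _ *m _)).
by apply/rowP => j; rewrite !mxE.
Qed.

Lemma fcalc1 : fcalc (fun=> 1) = 1%:M.
Proof.
rewrite /fcalc (_ : \row_j 1 = const_mx 1) ?diag_const_mx ?mulmx1 ?W2 //.
by apply/rowP => j; rewrite !mxE.
Qed.

Lemma fcalc_id : fcalc id = cplx A.
Proof. by rewrite /fcalc -(eb_eigen eb) -mulmxA W2 mulmx1. Qed.

Lemma eq_fcalc f g : (forall j, f (mu j) = g (mu j)) -> fcalc f = fcalc g.
Proof. by move=> h; congr (W *m diag_mx _ *m _); apply/rowP => j; rewrite !mxE. Qed.

Lemma fcalcD f g : fcalc f + fcalc g = fcalc (fun z => f z + g z).
Proof.
rewrite /fcalc -mulmxDl -mulmxDr -raddfD /=; congr (W *m diag_mx _ *m _).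
by apply/rowP => j; rewrite !mxE.
Qed.

Lemma fcalcZ c f : c *: fcalc f = fcalc (fun z => c * f z).
Proof.
rewrite /fcalc scalemxAl scalemxAr -linearZ /=; congr (W *m diag_mx _ *m _).
by apply/rowP => j; rewrite !mxE.
Qed.

Lemma fcalc_adj f : conjmx (fcalc f)^T = fcalc (fun z => conjc (f z)).
Proof.
rewrite /fcalc !trmx_mul !conjmxM -!mulmxA.
have -> : conjmx (conjmx W^T)^T = W by apply/matrixP => i j; rewrite !mxE conjcK.
suff -> : conjmx (diag_mx (\row_j f (mu j)))^T = diag_mx (\row_j conjc (f (mu j))) by [].
by apply/matrixP => i j; rewrite !mxE rmorphMn /= eq_sym; case: eqVneq => [->|]; rewrite ?mulr0n.
Qed.

Lemma fcalc_col f (v : 'cV[C]_d) z : cplx A *m v = z *: v -> fcalc f *m v = f z *: v.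
Proof.
move=> hv; have [c cE vE] : exists2 c, conjmx W^T *m v = c & v = W *m c.
  by exists (conjmx W^T *m v) => //; rewrite mulmxA W2 mul1mx.
have cj j : mu j * c j 0 = z * c j 0.
  have : W *m (diag_mx (\row_j mu j) *m c) = W *m (z *: c).
    by rewrite mulmxA -(eb_eigen eb) -mulmxA -vE hv -scalemxAr -vE.
  move/(congr1 (mulmx (conjmx W^T))); rewrite !mulmxA W1 !mul1mx => /matrixP /(_ j 0).
  by rewrite mul_diag_mx !mxE.
rewrite /fcalc -!mulmxA cE [in RHS]vE scalemxAr; congr (W *m _).
apply/matrixP => j k; rewrite ord1 mul_diag_mx !mxE.
have [->|cn] := eqVneq (c j 0) 0; first by rewrite !mulr0.
by have /(mulIf cn) -> := cj j.
Qed.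

Lemma fcalc_inj f g : fcalc f = fcalc g -> forall j, f (mu j) = g (mu j).
Proof.
move=> h j; have : conjmx W^T *m fcalc f *m W = conjmx W^T *m fcalc g *m W by rewrite h.
rewrite /fcalc !mulmxA W1 !mul1mx -!mulmxA W1 !mulmx1 => /matrixP /(_ j j).
by rewrite !mxE eqxx !mulr1n.
Qed.

Lemma fcalc_eigen f (v : 'cV[C]_d) z : v != 0 -> fcalc f *m v = z *: v ->
  exists j, f (mu j) = z.
Proof.
move=> v0 hv; have [c cE vE] : exists2 c, conjmx W^T *m v = c & v = W *m c.
  by exists (conjmx W^T *m v) => //; rewrite mulmxA W2 mul1mx.
have [j cj] : exists j, c j 0 != 0.
  case: (pselect (exists j, c j 0 != 0)) => // h.
  case/eqP: v0; rewrite vE (_ : c = 0) ?mulmx0 //.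
  apply/matrixP => i k; rewrite ord1 mxE; apply: contrapT => hi.
  by apply: h; exists i; apply/eqP.
exists j; apply: (mulIf cj).
have : conjmx W^T *m (fcalc f *m v) = conjmx W^T *m (z *: v) by rewrite hv.
rewrite -scalemxAr cE /fcalc -!mulmxA cE mulmxA W1 mul1mx => /matrixP /(_ j 0).
by rewrite mul_diag_mx [LHS]mxE [(\row__ _) _ _]mxE [RHS]mxE.
Qed.

(** As [A] is real, the conjugate of [f(A)] is [g(A)] for [g] the conjugate of [f]
    composed with conjugation. *)
Lemma fcalc_real f : (forall z, f (conjc z) = conjc (f z)) ->
  exists B, fcalc f = cplx B.
Proof.
move=> hf; apply: real_cplx.
have colE : conjmx (fcalc f) *m conjmx W = fcalc f *m conjmx W.
  apply/matrixP => i j.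
  have ej : cplx A *m col j W = mu j *: col j W.
    have /matrixP h := eb_eigen eb; apply/matrixP => k l; have := h k j.
    rewrite mul_mx_diag !mxE => hk; rewrite mulrC -hk.
    by apply: eq_bigr => r _; rewrite !mxE.
  have ej' : cplx A *m conjmx (col j W) = conjc (mu j) *: conjmx (col j W).
    by rewrite -conjmxZ -ej conjmxM conjmx_cplx.
  have h1 := fcalc_col f ej; have h2 := fcalc_col f ej'.
  have /matrixP /(_ i 0) : conjmx (fcalc f) *m conjmx (col j W) = fcalc f *m conjmx (col j W).
    by rewrite -conjmxM h1 h2 conjmxZ hf.
  rewrite !mxE => h; rewrite -[LHS]/(\sum_k _) in h *.
  transitivity (\sum_k conjmx (fcalc f) i k * conjmx (col j W) k 0).
    by apply: eq_bigr => k _; rewrite !mxE.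
  by rewrite h; apply: eq_bigr => k _; rewrite !mxE.
have W3 : conjmx W *m W^T = 1%:M.
  transitivity (conjmx (W *m conjmx W^T)).
    rewrite conjmxM; suff -> : conjmx (conjmx W^T) = W^T by [].
    by apply/matrixP => i j; rewrite !mxE conjcK.
  by rewrite W2; apply/matrixP => i j; rewrite !mxE; case: (i == j); rewrite ?conjc1 ?conjc0.
by rewrite -[LHS]mulmx1 -[RHS]mulmx1 -W3 !mulmxA colE.
Qed.

End Calculus.

End FunctionalCalculus.

(** * Complex structures on even-dimensional subspaces *)

Section ComplexStructure.
Context {R : realType} {d : nat}.
Implicit Types (x y z w u : 'cV[R]_d) (P J : 'M[R]_d).

Lemma outerM x y z w :
  (x *m y^T) *m (z *m w^T) = ((y^T *m z) 0 0) *: (x *m w^T).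
Proof.
rewrite -!mulmxA [y^T *m (z *m _)]mulmxA.
have {1}-> : y^T *m z = ((y^T *m z) 0 0)%:M by apply/matrixP => i j; rewrite !ord1 !mxE eqxx mulr1n.
by rewrite mul_scalar_mx scalemxAr.
Qed.

Lemma outerT x y : (x *m y^T)^T = y *m x^T.
Proof. by rewrite trmx_mul trmxK. Qed.

Lemma dotT x y : (x^T *m y) 0 0 = (y^T *m x) 0 0.
Proof. by rewrite -[y^T *m x]trmxK trmx_mul trmxK [RHS]mxE. Qed.

Lemma det_reflection u : (u^T *m u) 0 0 = 1 -> \det (1%:M - 2 *: (u *m u^T)) = -1 :> R.
Proof.
move=> hu; pose v := 2 *: u^T.
have h1 : block_mx 1%:M v u 1%:M = block_mx 1%:M 0 u 1%:M *m block_mx 1%:M v 0 (1%:M - u *m v).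
  by rewrite mulmx_block !(mul0mx, mul1mx, mulmx0, mulmx1, addr0) addrC subrK.
have h2 : block_mx 1%:M v u 1%:M = block_mx (1%:M - v *m u) v 0 1%:M *m block_mx 1%:M 0 u 1%:M.
  by rewrite mulmx_block !(mul0mx, mul1mx, mulmx0, mulmx1, add0r) subrK.
have : \det (block_mx 1%:M v u 1%:M) = \det (1%:M - u *m v).
  by rewrite h1 det_mulmx det_lblock det_ublock !det1 !mul1r.
rewrite h2 det_mulmx det_lblock det_ublock !det1 !mulr1 /v -scalemxAr => <-.
rewrite -scalemxAl (_ : u^T *m u = 1%:M); last first.
  by apply/matrixP => i j; rewrite !ord1 hu mxE.
by rewrite det_mx11 !mxE !eqxx mulr1 /= mulr1n; lra.
Qed.

Definition projection P : Prop := P^T = P /\ P *m P = P.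

(** On the range of the projection [P], [J] is an isometry of square -1; it
    vanishes on the kernel. *)
Definition complex_structure_on P J : Prop :=
  [/\ J^T = - J, J *m J = - P, P *m J = J & J *m P = J].

Lemma projection_tr P : projection P -> \tr P = \sum_i \sum_j P i j ^+ 2.
Proof.
move=> [pT pp]; rewrite -{1}pp; apply: eq_bigr => i _; rewrite mxE.
by apply: eq_bigr => j _; rewrite expr2 -{2}pT mxE.
Qed.

Lemma projection_split P u : projection P -> P *m u = u -> (u^T *m u) 0 0 = 1 ->
  [/\ projection (P - u *m u^T), (P - u *m u^T) *m u = 0,
      \tr (P - u *m u^T) = \tr P - 1
    & \det (1%:M - 2 *: P) = - \det (1%:M - 2 *: (P - u *m u^T))].
Proof.
move=> [pT pp] pu hu.
have uP : u^T *m P = u^T by rewrite -{2}pu trmx_mul pT.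
have uuu : u *m u^T *m u = u.
  by rewrite -mulmxA (_ : u^T *m u = 1%:M) ?mulmx1 //; apply/matrixP => i j; rewrite !ord1 hu mxE.
have Pu0 : (P - u *m u^T) *m u = 0 by rewrite mulmxBl pu uuu subrr.
split => //.
- split; first by rewrite linearB /= pT outerT.
  rewrite mulmxBr mulmxBl pp mulmxA Pu0 mul0mx subr0 -mulmxA uP.
  by [].
- rewrite linearB /=; congr (_ - _).
  rewrite mxtrace_mulC (_ : u^T *m u = 1%:M) ?mxtrace1 //.
  by apply/matrixP => i j; rewrite !ord1 hu mxE.
- rewrite -mulN1r -(det_reflection hu) mulrC -det_mulmx; congr (\det _).
  rewrite mulmxBr mulmx1 -scalemxAr mulmxBl mul1mx -scalemxAl mulmxA Pu0 mul0mx scaler0 subr0.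
  by rewrite scalerBr opprB addrA addrAC addrK.
Qed.

(** A projection of even rank carries a complex structure; the parity of the rank
    is read off from the determinant of the reflection.  Unit vectors are split
    off one at a time, and an odd step remembers the vector to be paired next. *)
Lemma complex_structure_or_odd P : projection P ->
  (exists2 J, complex_structure_on P J & \det (1%:M - 2 *: P) = 1) \/
  (exists u J, [/\ (u^T *m u) 0 0 = 1, P *m u = u,
     complex_structure_on (P - u *m u^T) J & \det (1%:M - 2 *: P) = -1]).
Proof.
have [n] : exists n : nat, \tr P <= n%:R.
  by exists (Num.bound `|\tr P|); apply: (le_trans (ler_norm _)); apply: ltW; apply: archi_boundP; apply: normr_ge0.
have case0 : complex_structure_on (0 : 'M[R]_d) 0 /\ \det (1%:M - 2 *: (0 : 'M[R]_d)) = 1.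
  by split; [split; rewrite ?trmx0 ?mulmx0 ?mul0mx ?oppr0 | rewrite scaler0 subr0 det1].
elim: n P => [|n IH] P.
  move=> t0 pP; have h := projection_tr pP.
  have pos k : 0 <= \sum_j P k j ^+ 2 by apply: sumr_ge0 => l _; apply: sqr_ge0.
  have P0 : P = 0.
    apply/matrixP => i j; rewrite mxE.
    have e0 : \sum_i \sum_j P i j ^+ 2 = 0.
      by apply/le_anti; rewrite sumr_ge0 // andbT -h.
    move/eqP: e0; rewrite psumr_eq0 // => /allP /(_ i (mem_index_enum _)) /=.
    rewrite psumr_eq0 => [/allP /(_ j (mem_index_enum _)) /=|l _]; last exact: sqr_ge0.
    by rewrite sqrf_eq0 => /eqP.
  by left; exists 0; rewrite P0; case: case0.
move=> tn pP.
have [P0|Pn0] := eqVneq P 0.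
  by left; exists 0; rewrite P0; case: case0.
have [u hu pu] : exists2 u : 'cV[R]_d, (u^T *m u) 0 0 = 1 & P *m u = u.
  have [j wn0] : exists j, col j P != 0.
    case: (pselect (exists j, col j P != 0)) => // h.
    case/eqP: Pn0; apply/matrixP => i j; rewrite mxE.
    have : col j P = 0 by apply: contrapT => hj; apply: h; exists j; apply/eqP.
    by move/matrixP => /(_ i 0); rewrite !mxE.
  set w := col j P in wn0.
  have Pw : P *m w = w by rewrite /w colE mulmxA pP.2.
  pose s := (w^T *m w) 0 0.
  have s0 : 0 < s.
    rewrite /s mxE lt_neqAle sumr_ge0 ?andbT => [|k _]; last by rewrite mxE -expr2 sqr_ge0.
    apply/negP => /eqP /esym /eqP; rewrite psumr_eq0 => [|k _]; last by rewrite mxE -expr2 sqr_ge0.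
    move=> /allP h; move/eqP: wn0; apply; apply/matrixP => k l; rewrite ord1 [RHS]mxE.
    by have := h k (mem_index_enum _); rewrite /= mxE -expr2 sqrf_eq0 => /eqP.
  exists ((Num.sqrt s)^-1 *: w); last by rewrite -scalemxAr Pw.
  rewrite -scalemxAr [(_ *: w)^T]linearZ /= -scalemxAl scalerA mxE -/s.
  have := sqr_sqrtr (ltW s0); have : 0 < Num.sqrt s by rewrite sqrtr_gt0.
  by move: (Num.sqrt s) => r r0 <-; field; rewrite gt_eqF.
have [pP' P'u trE detE] := projection_split pP pu hu.
have [|[J hJ dJ]|[u' [J [hu' pu' [JT JJ PJ JP] dJ]]]] := IH _ _ pP'.
- by rewrite trE -natr1 in tn *; lra.
- by right; exists u, J; split => //; rewrite detE dJ.
left; exists (J + (u *m u'^T - u' *m u^T)); last by rewrite detE dJ opprK.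
have [_ P''u' _ _] := projection_split pP' pu' hu'.
have u'u : (u'^T *m u) 0 0 = 0.
  by rewrite -{1}pu' trmx_mul -mulmxA pP'.1 P'u mulmx0 mxE.
have Ju : J *m u = 0.
  rewrite -JP -mulmxA mulmxBl P'u -mulmxA (_ : u'^T *m u = 0) ?mulmx0 ?subr0 ?mulmx0 //.
  by apply/matrixP => i j; rewrite !ord1 u'u mxE.
have Ju' : J *m u' = 0 by rewrite -JP -mulmxA P''u' mulmx0.
have uJ : u^T *m J = 0 by rewrite -[J]opprK -JT mulmxN -trmx_mul Ju trmx0 oppr0.
have u'J : u'^T *m J = 0 by rewrite -[J]opprK -JT mulmxN -trmx_mul Ju' trmx0 oppr0.
pose K := u *m u'^T - u' *m u^T.
have KK : K *m K = - (u *m u^T) - u' *m u'^T.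
  rewrite /K mulmxBl !mulmxBr !outerM hu hu' u'u dotT u'u !scale0r !scale1r.
  by rewrite sub0r subr0.
have JK : J *m K = 0 by rewrite mulmxBr !mulmxA Ju Ju' !mul0mx subr0.
have KJ : K *m J = 0 by rewrite mulmxBl -!mulmxA uJ u'J !mulmx0 subr0.
have KT : (J + K)^T = - (J + K).
  by rewrite linearD linearB /= JT !outerT opprD opprB.
have PE : P = (P - u *m u^T - u' *m u'^T) + (u *m u^T + u' *m u'^T).
  by rewrite -[P - _ - _]addrA -opprD subrK.
have Pu' : P *m u' = u'.
  have : (P - u *m u^T) *m u' = u' by [].
  rewrite mulmxBl -mulmxA (_ : u^T *m u' = 0) ?mulmx0 ?subr0 //.
  by apply/matrixP => i j; rewrite !ord1 dotT u'u mxE.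
have PK : P *m (J + K) = J + K.
  rewrite mulmxDr {1}PE mulmxDl PJ mulmxDl -!mulmxA uJ u'J !mulmx0 !addr0.
  by rewrite mulmxBr !mulmxA pu Pu'.
rewrite -/K; clearbody K; split => //.
- rewrite mulmxDl !mulmxDr JK KJ addr0 add0r JJ KK [in RHS]PE !opprD !opprK.
  by [].
- by rewrite -[LHS]trmxK trmx_mul KT pP.1 mulmxN PK linearN /= KT opprK.
Qed.

End ComplexStructure.

(** * Logarithms of rotations *)

Section MatrixDerivative.
Context {R : realType}.

Definition mderive m n (F : R -> 'M[R]_(m, n)) (t : R) (F' : 'M[R]_(m, n)) : Prop :=
  forall i j, is_derive t (1 : R) (fun s => F s i j : R) (F' i j).

Lemma mderive_cst m n (A : 'M[R]_(m, n)) t : mderive (fun=> A) t 0.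
Proof. by move=> i j; rewrite mxE; apply: is_derive_cst. Qed.

Lemma is_derive_sumR (I : Type) (r : seq I) (F : I -> R -> R) (l : I -> R) (t : R) :
  (forall i, is_derive t (1 : R) (F i) (l i)) ->
  is_derive t (1 : R) (fun s => \sum_(i <- r) F i s) (\sum_(i <- r) l i).
Proof.
move=> h; elim: r => [|i r IH].
  rewrite big_nil (_ : (fun s => _) = fun=> 0); first exact: is_derive_cst.
  by apply/funext => s; rewrite big_nil.
rewrite big_cons (_ : (fun s => _) = F i + (fun s => \sum_(j <- r) F j s)).
  exact: is_deriveD.
by apply/funext => s; rewrite big_cons.
Qed.

Lemma is_derive_mulR (f g : R -> R) (t a b : R) : is_derive t (1 : R) f a ->
  is_derive t (1 : R) g b -> is_derive t (1 : R) (fun s => f s * g s) (a * g t + f t * b).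
Proof.
move=> hf hg; rewrite (_ : (fun s => _) = f * g); last by [].
by apply: is_derive_eq; rewrite /GRing.scale /=; ring.
Qed.

Lemma mderiveM m n p (F : R -> 'M[R]_(m, n)) (G : R -> 'M[R]_(n, p)) t F' G' :
  mderive F t F' -> mderive G t G' ->
  mderive (fun s => F s *m G s) t (F' *m G t + F t *m G').
Proof.
move=> hF hG i j; rewrite !mxE -big_split /=.
rewrite (_ : (fun s => _) = (fun s => \sum_k F s i k * G s k j)).
  by apply: is_derive_sumR => k; apply: is_derive_mulR.
by apply/funext => s; rewrite mxE.
Qed.

Lemma mderiveT m n (F : R -> 'M[R]_(m, n)) t F' : mderive F t F' ->
  mderive (fun s => (F s)^T) t F'^T.
Proof.
move=> hF i j; rewrite mxE (_ : (fun s => _) = (fun s => F s j i)) //.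
by apply/funext => s; rewrite mxE.
Qed.

Lemma mderive_comp m n (F : R -> 'M[R]_(m, n)) (h : R -> R) t F' (h' : R) :
  mderive F (h t) F' -> is_derive t (1 : R) h h' ->
  mderive (fun s => F (h s)) t (h' *: F').
Proof.
move=> hF hh i j; rewrite mxE.
rewrite (_ : (fun s => _) = (fun s => F s i j : R) \o h) //.
by have := hF i j => hij; apply: is_derive_eq; rewrite /GRing.scale /= mulrC.
Qed.

Lemma is_derive_shift1 (a t : R) : is_derive t (1 : R) (fun s : R => s + a) 1.
Proof.
rewrite (_ : (fun s => _) = (@id R) + cst a) //.
by apply: is_derive_eq; rewrite addr0.
Qed.

Lemma is_derive_opp1 (t : R) : is_derive t (1 : R) (fun s : R => - s) (- 1).
Proof. by rewrite (_ : (fun s => _) = - (@id R)) //; apply: is_derive_eq. Qed.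

Lemma mderive_shift m n (F : R -> 'M[R]_(m, n)) (a t : R) F' :
  mderive F (t + a) F' -> mderive (fun s => F (s + a)) t F'.
Proof.
move=> h; rewrite -[F']scale1r.
exact: (@mderive_comp _ _ F (fun s => s + a) t F' 1 h (is_derive_shift1 a t)).
Qed.

Lemma mderive_opp m n (F : R -> 'M[R]_(m, n)) (t : R) F' :
  mderive F (- t) F' -> mderive (fun s => F (- s)) t (- F').
Proof.
move=> h; rewrite -scaleN1r.
exact: (@mderive_comp _ _ F (fun s => - s) t F' (-1) h (is_derive_opp1 t)).
Qed.

Lemma mderive_uniq m n (F : R -> 'M[R]_(m, n)) t A B :
  mderive F t A -> mderive F t B -> A = B.
Proof.
move=> h1 h2; apply/matrixP => i j.
by have [_ <-] := h1 i j; have [_ <-] := h2 i j.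
Qed.

Lemma mderive0_cst m n (F : R -> 'M[R]_(m, n)) : (forall t, mderive F t 0) ->
  forall s t, F s = F t.
Proof.
move=> h s t; apply/matrixP => i j.
apply: (@is_derive_0_is_cst _ (fun s => F s i j)) => x.
by have := h x i j; rewrite mxE.
Qed.

Lemma mderive_eq m n (F : R -> 'M[R]_(m, n)) t A B : mderive F t A -> A = B -> mderive F t B.
Proof. by move=> h <-. Qed.

End MatrixDerivative.

Section OrthogonalLog.
Context {R : realType} {d : nat}.
Implicit Types (A B : 'M[R]_d) (z : R[i]).

(** The argument of a unit complex number, except that it is zero at [-1], where
    no choice is compatible with conjugation. *)
Definition arg z : R :=
  if complex.Im z == 0 then 0
  else if 0 < complex.Im z then acos (complex.Re z) else - acos (complex.Re z).

Lemma arg_conj z : arg (conjc z) = - arg z.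
Proof.
case: z => a b; rewrite /arg /= oppr_eq0; case: eqP => [_|/eqP b0]; first by rewrite oppr0.
rewrite oppr_gt0; case: (ltgtP b 0) b0 => //; by rewrite ?opprK.
Qed.

Lemma ce_arg z : csq z = 1 -> complex.Im z != 0 -> ce (arg z) = z.
Proof.
case: z => a b; rewrite /csq /arg /= => hab b0; rewrite (negbTE b0).
have b2 : 0 < b ^+ 2 by rewrite exprn_even_gt0.
have a1 : -1 <= a <= 1 by apply/andP; split; nra.
have sb : Num.sqrt (1 - a ^+ 2) = `|b| by rewrite -sqrtr_sqr; congr Num.sqrt; lra.
rewrite /ce; case: ltP => hb.
  by rewrite acosK ?sin_acos ?in_itv //= sb gtr0_norm.
rewrite cosN sinN acosK ?sin_acos ?in_itv //= sb ler0_norm ?opprK //.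
Qed.

Lemma arg_lt z : csq z = 1 -> `|arg z| < pi.
Proof.
case: z => a b; rewrite /csq /arg /= => hab.
case: eqP => [_|/eqP b0]; first by rewrite normr0 pi_gt0.
have b2 : 0 < b ^+ 2 by rewrite exprn_even_gt0.
have a1 : -1 < a <= 1 by apply/andP; split; nra.
have a1' : -1 <= a <= 1 by case/andP: a1 => /ltW -> ->.
by case: ifP => _; rewrite ?normrN ger0_norm ?acos_ge0 ?acos_ltpi.
Qed.

(** An orthogonal matrix [A] without the eigenvalue -1 has determinant one: the
    identity [A + 1 = A (A + 1)^T] gives it, divided by the determinant of [A + 1]. *)
Lemma det_orthogonal_unit A : A^T *m A = 1%:M -> A + 1%:M \in unitmx -> \det A = 1.
Proof.
move=> hA; rewrite unitmxE unitfE => h.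
have hA' : A *m A^T = 1%:M by apply: mulmx1C.
apply: (mulIf h); rewrite mul1r.
rewrite -[in RHS]det_tr -[in RHS](det_tr (_ : 'M[R]_d)) trmxK.
have {2}-> : A + 1%:M = A *m (A + 1%:M)^T by rewrite linearD /= trmx1 mulmxDr hA' mulmx1 addrC.
by rewrite det_mulmx det_tr.
Qed.

(** Every rotation lies on a one-parameter group whose generator has spectrum
    between [- i / 2] and [i / 2] (for the period [2 pi]): away from the
    eigenvalue [-1] the logarithm is a function of the matrix, and on the
    eigenspace of [-1], which has even dimension, it is half a complex
    structure. *)
Theorem rotation_log A : A^T *m A = 1%:M -> \det A = 1 ->
  exists (E : R -> 'M[R]_d) B,
    [/\ B^T = - B, E 0 = 1%:M, E (2 * pi) = A,
        forall t, mderive E t (B *m E t) /\ B *m E t = E t *m B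
      & forall (v : 'cV[R[i]]_d) (b : R), v != 0 -> cplx B *m v = Complex 0 b *: v ->
          `|b| <= 2^-1].
Proof.
move=> hA dA.
have hA' : A *m A^T = 1%:M by apply: mulmx1C.
have [|W [mu eb]] := @eigenbasis_exists _ _ A; first by rewrite hA hA'.

have p0 : 0 < 2 * pi :> R by rewrite mulr_gt0 // pi_gt0.
have conj_id : @fcalc R d W mu (fun z => conjc z) = cplx A^T.
  have <- := @fcalc_adj R d W mu id; rewrite (fcalc_id eb).
  by apply/matrixP => i j; rewrite !mxE conjc_real.
have unit_mu j : csq (mu j) = 1.
  have : @fcalc R d W mu (fun z => conjc z * z) = @fcalc R d W mu (fun=> 1).
    by rewrite -(fcalcM eb) (fcalc_id eb) conj_id -cplxM hA cplx1 (fcalc1 eb).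
  move/(fcalc_inj eb) => /(_ j); rewrite mulrC csqE => h.
  by apply: (@complexI R); rewrite h.
(* [f t] and [g] are the exponential and the logarithm, trivial at the
   eigenvalue -1; [pr] projects to the eigenspace of the latter *)
pose f t z := ce (arg z * (t / (2 * pi))).
pose g z : R[i] := Complex 0 (arg z / (2 * pi)).
pose pr z : R[i] := (z == -1)%:R.
have f_conj t z : f t (conjc z) = conjc (f t z) by rewrite /f arg_conj mulNr ceN.
have g_conj z : g (conjc z) = conjc (g z).
  by rewrite /g arg_conj mulNr; apply/eqP; rewrite eq_complex /= !eqxx.
have pr_conj z : pr (conjc z) = conjc (pr z).
  rewrite /pr rmorph_nat; congr (nat_of_bool _)%:R; apply/eqP/eqP => [h|->].
    by rewrite -[z]conjcK h rmorphN rmorph1.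
  by rewrite rmorphN rmorph1.
have /choice [E1 hE1] t := fcalc_real eb (f_conj t).
have [B1 hB1] := fcalc_real eb g_conj.
have [P hP] := fcalc_real eb pr_conj.
have comb1 a b : @fcalc R d W mu a *m @fcalc R d W mu b = @fcalc R d W mu b *m @fcalc R d W mu a.
  by rewrite !(fcalcM eb); apply: eq_fcalc => j; rewrite mulrC.
have prE z : pr z != 0 -> z = -1 by rewrite /pr; case: (z =P -1) => // _; rewrite eqxx.
have pP : projection P.
  split; apply: cplx_inj.
    rewrite -cplxT -hP fcalc_adj; apply: eq_fcalc => j.
    by rewrite -pr_conj /pr; congr (nat_of_bool _)%:R; apply/eqP/eqP => h;
      [rewrite -[mu j]conjcK h rmorphN rmorph1 | rewrite h rmorphN rmorph1].
  rewrite cplxM -hP (fcalcM eb); apply: eq_fcalc => j.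
  by rewrite /pr -natrM mulnb andbb.
have cplx0 : cplx 0 = 0 :> 'M[R[i]]_d by apply: map_mx0.
have fcalc0 : @fcalc R d W mu (fun=> 0) = 0.
  by rewrite -[RHS](scale0r (@fcalc R d W mu (fun=> 0))) fcalcZ; apply: eq_fcalc => j; rewrite mul0r.
have PB1 : P *m B1 = 0.
  apply: cplx_inj; rewrite cplxM -hP -hB1 (fcalcM eb) cplx0 -fcalc0; apply: eq_fcalc => j.
  have [->|/prE ->] := eqVneq (pr (mu j)) 0; first by rewrite mul0r.
  by rewrite /g /arg /= oppr0 eqxx mul0r mulr0.
have PE1 t : P *m E1 t = P.
  apply: cplx_inj; rewrite cplxM -hP -hE1 (fcalcM eb); apply: eq_fcalc => j.
  have [->|/prE ->] := eqVneq (pr (mu j)) 0; first by rewrite mul0r.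
  by rewrite /f /arg /= oppr0 eqxx mul0r ce0 mulr1.
have B1E1 t : B1 *m E1 t = E1 t *m B1.
  by apply: cplx_inj; rewrite !cplxM -hB1 -hE1 comb1.
have E1P t : E1 t *m P = P.
  by apply: cplx_inj; rewrite -{2}(PE1 t) !cplxM -hP -hE1 comb1.
have B1P : B1 *m P = 0.
  by apply: cplx_inj; rewrite -PB1 !cplxM -hP -hB1 comb1.
have dE1 t : mderive E1 t (B1 *m E1 t).
  move=> i j.
  have fcE h : @fcalc R d W mu h i j = \sum_k W i k * h (mu k) * conjmx W^T k j.
    by rewrite /fcalc mxE; apply: eq_bigr => k _; rewrite mul_mx_diag mxE [(\row__ _) _ _]mxE.
  have E1E s : E1 s i j = complex.Re (\sum_k W i k * f s (mu k) * conjmx W^T k j).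
    by rewrite -fcE hE1 mxE.
  have B1E1E : (B1 *m E1 t) i j =
      complex.Re (\sum_k W i k * (g (mu k) * f t (mu k)) * conjmx W^T k j).
    by rewrite -(fcE (fun z => g z * f t z)) -(fcalcM eb) hB1 hE1 -cplxM [in RHS]mxE.
  rewrite B1E1E (_ : (fun s => _) =
    (fun s => complex.Re (\sum_k W i k * f s (mu k) * conjmx W^T k j))); last by apply/funext.
  apply: (proj1 (is_cderive_sum _ _)) => k.
  have fE s z : f s z = ce (arg z / (2 * pi) * s) by rewrite /f; congr ce; rewrite mulrA mulrAC.
  have -> : W i k * (g (mu k) * f t (mu k)) * conjmx W^T k j =
     conjmx W^T k j * W i k * (Complex 0 (arg (mu k) / (2 * pi)) * ce (arg (mu k) / (2 * pi) * t)).
    by rewrite [LHS]mulrC fE /g !mulrA.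
  rewrite (_ : (fun s => _) = (fun s => conjmx W^T k j * W i k * ce (arg (mu k) / (2 * pi) * s))).
    exact: is_cderiveZ (is_cderive_ce _ t).
  by apply/funext => s; rewrite [LHS]mulrC fE !mulrA.
have E1_0 : E1 0 = 1%:M.
  apply: cplx_inj; rewrite -hE1 cplx1 -(fcalc1 eb); apply: eq_fcalc => j.
  by rewrite /f mul0r mulr0 ce0.
have f2pi z : f (2 * pi) z = ce (arg z) by rewrite /f divff ?mulr1 // gt_eqF.
have E1_2pi : E1 (2 * pi) *m (1%:M - 2 *: P) = A.
  apply: cplx_inj; rewrite cplxM cplxD cplxN cplxZ cplx1 -hE1 -hP -(fcalc_id eb) -(fcalc1 eb).
  rewrite fcalcZ -scaleN1r fcalcZ fcalcD (fcalcM eb); apply: eq_fcalc => j.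
  rewrite f2pi; have := unit_mu j; have [i0|i0] := eqVneq (complex.Im (mu j)) 0; last first.
    move=> h; rewrite (ce_arg h i0) /pr; case: (mu j =P -1) i0 => [->|_ _]; last by rewrite !mulr0 addr0 mulr1.
    by rewrite /= oppr0 eqxx.
  rewrite /arg i0 eqxx ce0 mul1r /pr; case: (mu j) i0 => a b /= ->.
  rewrite /csq /= expr0n addr0 => /eqP; rewrite sqrf_eq1 => /orP[/eqP ->|/eqP ->].
    rewrite (_ : Complex 1 0 = 1) // (_ : 1 == -1 = false) ?mulr0 ?addr0 //.
    by apply/negbTE; rewrite -subr_eq0 opprK -mulr2n pnatr_eq0.
  rewrite (_ : Complex (-1) 0 = -1); last by apply/eqP; rewrite eq_complex /= oppr0 !eqxx.
  by rewrite eqxx; apply/eqP; rewrite eq_complex /=; apply/andP; split; apply/eqP; ring.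
have B1T : B1^T = - B1.
  apply: cplx_inj; rewrite -cplxT -hB1 fcalc_adj cplxN -hB1 -scaleN1r fcalcZ.
  by apply: eq_fcalc => j; rewrite mulN1r; apply/eqP; rewrite eq_complex /= oppr0 !eqxx.
have [J [JT JJ PJ JP]] : exists J, complex_structure_on P J.
  have d1 : \det (E1 (2 * pi)) = 1.
    apply: det_orthogonal_unit.
      apply: cplx_inj; rewrite cplxM -cplxT -hE1 fcalc_adj (fcalcM eb) cplx1 -(fcalc1 eb).
      by apply: eq_fcalc => j; rewrite mulrC csqE csq_ce.
    rewrite -(map_unitmx (real_complex R)).
    suff h : @fcalc R d W mu (fun z => f (2 * pi) z + 1) *m @fcalc R d W mu (fun z => (f (2 * pi) z + 1)^-1) = 1%:M.
      have := mulmx1_unit h; case; rewrite -fcalcD hE1 (fcalc1 eb) -cplx1 -cplxD; by [].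
    rewrite (fcalcM eb) -(fcalc1 eb); apply: eq_fcalc => j; rewrite f2pi divff //.
    have [i0|i0] := eqVneq (complex.Im (mu j)) 0.
      by rewrite /arg i0 eqxx ce0 -mulr2n pnatr_eq0.
    rewrite (ce_arg (unit_mu j) i0); apply/eqP => h.
    by move/eqP: i0; apply; have /(congr1 (@complex.Im R)) := h; rewrite ImD /= addr0.
  have dP : \det (1%:M - 2 *: P) = 1 by have := dA; rewrite -E1_2pi det_mulmx d1 mul1r.
  have [[J hJ _]|[u [J [_ _ _ h]]]] := complex_structure_or_odd pP; first by exists J.
  have e : (1 : R) = -1 by rewrite -{1}dP h.
  by have := pnatr_eq0 R 2; rewrite mulr2n {2}e subrr eqxx.
(* rotation by the angle [t / 2] in the planes of [J] *)
pose E2 t := 1%:M - P + cos (2^-1 * t) *: P + sin (2^-1 * t) *: J.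
have dhalf t : is_derive t (1 : R) (fun s : R => 2^-1 * s) 2^-1.
  rewrite (_ : (fun s => _) = 2^-1 \*: (@id R)) //.
  by apply: is_derive_eq; rewrite /GRing.scale /= mulr1.
have JE2 t : J *m E2 t = cos (2^-1 * t) *: J - sin (2^-1 * t) *: P.
  by rewrite /E2 mulmxDr mulmxDr mulmxBr mulmx1 JP subrr add0r -!scalemxAr JP JJ scalerN.
have E2J t : E2 t *m J = J *m E2 t.
  by rewrite JE2 /E2 !mulmxDl mulNmx mul1mx PJ subrr add0r -!scalemxAl PJ JJ scalerN.
have dE2 t : mderive E2 t (2^-1 *: (J *m E2 t)).
  move=> i j; rewrite JE2.
  rewrite (_ : (fun s => _) = cst ((1%:M - P) i j) + (P i j \*: (cos \o (fun s : R => 2^-1 * s)))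
     + (J i j \*: (sin \o (fun s : R => 2^-1 * s)))); last first.
    by apply/funext => s; rewrite !mxE !fctE /= [cos _ * _]mulrC [sin _ * _]mulrC.
  have d0 := dhalf t.
  apply: is_derive_eq; rewrite !mxE /GRing.scale /=; ring.
have E1J t : E1 t *m J = J by rewrite -PJ mulmxA E1P.
have JE1 t : J *m E1 t = J by rewrite -JP -mulmxA PE1.
have B1J : B1 *m J = 0 by rewrite -PJ mulmxA B1P mul0mx.
have JB1 : J *m B1 = 0 by rewrite -JP -mulmxA PB1 mulmx0.
have B1E2 t : B1 *m E2 t = B1.
  by rewrite /E2 !mulmxDr mulmxN mulmx1 -!scalemxAr B1P B1J !scaler0 subr0 !addr0.
have E2B1 t : E2 t *m B1 = B1.
  by rewrite /E2 !mulmxDl mulNmx mul1mx -!scalemxAl PB1 JB1 !scaler0 subr0 !addr0.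
exists (fun t => E1 t *m E2 t), (B1 + 2^-1 *: J); split.
- by rewrite linearD linearZ /= B1T JT scalerN opprD.
- by rewrite E1_0 mul1mx /E2 mulr0 cos0 sin0 scale1r scale0r addr0 subrK.
- rewrite -[RHS]E1_2pi; congr (_ *m _); rewrite /E2.
  have -> : 2^-1 * (2 * pi) = pi :> R by lra.
  rewrite cospi sinpi scaleN1r scale0r addr0 -addrA -opprD; congr (_ - _).
  by rewrite -mulr2n scaler_nat.
- move=> t; split.
    apply: (mderive_eq (mderiveM (dE1 t) (dE2 t))).
    rewrite mulmxDl -mulmxA; congr (_ + _).
    by rewrite -scalemxAl -scalemxAr !mulmxA E1J JE1.
  rewrite mulmxDl [_ *m (B1 + _)]mulmxDr ![B1 *m _]mulmxA; congr (_ + _).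
    by rewrite B1E1 -!mulmxA B1E2 E2B1.
  by rewrite -scalemxAl -scalemxAr -[_ *m E2 t *m J]mulmxA E2J !mulmxA E1J JE1.
- move=> v b v0 hv.
  (* with a nonzero component [p] in the range of [P], the eigenvalue is that of
     [J / 2]; otherwise it is the logarithm of an eigenvalue other than -1 *)
  pose p := cplx P *m v.
  have hPB : P *m (B1 + 2^-1 *: J) = 2^-1 *: J by rewrite mulmxDr PB1 add0r -scalemxAr PJ.
  have Jp : cplx J *m p = Complex 0 (2 * b) *: p.
    have : cplx (2^-1 *: J) *m v = Complex 0 b *: p.
      by rewrite -hPB cplxM -mulmxA hv -scalemxAr.
    rewrite cplxZ -scalemxAl => h.
    have -> : Complex 0 (2 * b) = 2%:C%C * Complex 0 b :> R[i].
      by apply/eqP; rewrite eq_complex /=; apply/andP; split; apply/eqP; ring.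
    rewrite -scalerA -h scalerA -rmorphM /= mulfV ?pnatr_eq0 // scale1r.
    by rewrite /p mulmxA -cplxM JP.
  have [p0'|pn0] := eqVneq p 0.
    have Jv : cplx J *m v = 0 by rewrite -JP cplxM -mulmxA -/p p0' mulmx0.
    have B1v : @fcalc R d W mu g *m v = Complex 0 b *: v.
      by rewrite -hv hB1 cplxD mulmxDl cplxZ -scalemxAl Jv scaler0 addr0.
    have [j [hj]] := fcalc_eigen eb v0 B1v.
    rewrite -hj normrM normfV (gtr0_norm p0) ler_pdivrMr //.
    have := arg_lt (unit_mu j); lra.
  have : cplx (J *m J) *m p = - p.
    by rewrite JJ cplxN mulNmx /p mulmxA -cplxM pP.2.
  rewrite cplxM -mulmxA Jp -scalemxAr Jp scalerA => h.
  have /eqP : (Complex 0 (2 * b) * Complex 0 (2 * b) + 1) *: p = 0.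
    by rewrite scalerDl h scale1r addNr.
  rewrite scaler_eq0 (negbTE pn0) orbF eq_complex /= => /andP[/eqP h1 _].
  have b2 : b ^+ 2 = (2^-1) ^+ 2 by rewrite expr2; nra.
  by rewrite -(@ler_pXn2r _ 2) ?nnegrE // real_normK ?num_real // b2.
Qed.

End OrthogonalLog.

(** * Partial derivatives and differentiability *)

Section DirectionalDerivative.
Context {R : realType} {V : normedModType R}.
Implicit Types (f : V -> R) (x v : V).

Lemma is_derive_along f x v (s l : R) : is_derive (x + s *: v) v f l ->
  is_derive s (1 : R) (fun u : R => f (x + u *: v)) l.
Proof.
move=> [h1 h2].
have E : (fun h : R => h^-1 *: (f (h *: v + (x + s *: v)) - f (x + s *: v))) =
         (fun h : R => h^-1 *: (f (x + (h *: (1 : R) + s) *: v) - f (x + s *: v))).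
  apply/funext => h; congr (_ *: (f _ - _)).
  by rewrite [h *: 1]mulr1 scalerDl addrCA.
by split; [move: h1; rewrite /derivable E | move: h2; rewrite /derive E].
Qed.

(** The derivative along [c *: v] is the chain rule for the substitution of
    [c * s] for [s] on the line through [x]. *)
Lemma is_derive_scale_dir f x v (c l : R) : is_derive x v f l ->
  is_derive x (c *: v) f (c * l).
Proof.
move=> hf.
have h0 : is_derive (c * 0) (1 : R) (fun u : R => f (x + u *: v)) l.
  by apply: is_derive_along; rewrite mulr0 scale0r addr0.
have hc : is_derive (0 : R) (1 : R) (fun s : R => c * s) c.
  rewrite (_ : (fun s => _) = c \*: (@id R)) //.
  by apply: is_derive_eq; rewrite /GRing.scale /= mulr1.
have [h1 h2] : is_derive (0 : R) (1 : R) ((fun u : R => f (x + u *: v)) \o (fun s : R => c * s)) (c * l).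
  by apply: is_derive_eq; rewrite /GRing.scale /= mulrC.
have E : (fun h : R => h^-1 *: (f (h *: (c *: v) + x) - f x)) =
  (fun h : R => h^-1 *: (((fun u : R => f (x + u *: v)) \o (fun s : R => c * s)) (h *: (1 : R) + 0)
     - ((fun u : R => f (x + u *: v)) \o (fun s : R => c * s)) 0)).
  apply/funext => h /=; rewrite mulr0 scale0r !addr0 [h *: 1]mulr1.
  by congr (_ *: (f _ - _)); rewrite addrC scalerA [h * c]mulrC.
by split; [rewrite /derivable E | rewrite /derive E].
Qed.

End DirectionalDerivative.

(** A differential has to be exhibited as a linear map; at a flat point it is
    zero, and the general case reduces to this one by subtracting a linear
    function. *)
Lemma flat_differentiable {R : realType} {V W : normedModType R} (f : V -> W) x :
  (forall e : R, 0 < e -> \forall h \near (0 : V), `|f (h + x) - f x| <= e * `|h|) ->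
  differentiable f x.
Proof.
move=> H.
have rem : f \o shift x = cst (f x) + (\0 : V -> W) +o_ 0 id.
  apply/eqaddoP => e e0; have := H e e0; apply: filterS => h.
  by rewrite !fctE /= addr0.
have d0 : 'd f x = (\0 : V -> W) :> (V -> W).
  by apply: (@diff_unique _ _ _ f (\0 : {linear V -> W})) => //; apply: cst_continuous.
by apply/diff_locallyP; rewrite d0; split => //; apply: cst_continuous.
Qed.

Section PartialDerivatives.
Context {R : realType} {d : nat}.
Implicit Types (f : 'cV[R]_d -> R) (x h : 'cV[R]_d) (U : set 'cV[R]_d).

Lemma cV_norm_le h (e : R) : 0 <= e -> (forall a, `|h a 0| <= e) -> `|h| <= e.
Proof.
move=> e0 H; rewrite /Num.Def.normr /= mx_normrE; apply: bigmax_le => // -[a b] _ /=.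
by rewrite (ord1 b).
Qed.

Lemma cV_norm_entry h a : `|h a 0| <= `|h|.
Proof.
rewrite [leRHS]/Num.Def.normr /= mx_normrE.
exact: (le_bigmax _ (fun i : 'I_d * 'I_1 => `|h i.1 i.2|) (a, 0)).
Qed.

Let head h k : 'cV[R]_d := \col_a (if (a < k)%N then h a 0 else 0).

(** The increment of [f] is split into increments parallel to the coordinate
    axes, each of which is a partial derivative at an intermediate point. *)
Lemma increment_bound f U x (c : 'I_d -> R) (e r : R) h :
  0 <= e -> (forall y, `|y - x| < r -> U y) ->
  (forall a y, U y -> derivable f y (delta_mx a 0)) ->
  (forall a y, `|y - x| < r -> `|'D_(delta_mx a 0) f y - c a| <= e) ->
  `|h| < r ->
  `|f (x + h) - f x - \sum_a h a 0 * c a| <= d%:R * e * `|h|.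
Proof.
move=> e0 hU hd hc hr.
have head0 : head h 0 = 0 by apply/colP => a; rewrite !mxE.
have headd : head h d = h by apply/colP => a; rewrite !mxE ltn_ord.
have headS (k : 'I_d) : head h k.+1 = head h k + h k 0 *: delta_mx k 0.
  apply/colP => a; rewrite !mxE eqxx andbT ltnS leq_eqVlt.
  have [->|ak] := eqVneq a k; first by rewrite eqxx ltnn add0r mulr1.
  by rewrite (inj_eq val_inj) (negbTE ak) /= mulr0 addr0.
have step (k : 'I_d) : `|f (x + head h k.+1) - f (x + head h k) - h k 0 * c k| <= e * `|h|.
  have near_x (u : R) : 0 <= u <= 1 -> `|x + head h k + u *: (h k 0 *: delta_mx k 0) - x| < r.
    move=> /andP[u0 u1]; apply: le_lt_trans hr.
    rewrite addrC !addrA addNr add0r; apply: cV_norm_le => // a; rewrite !mxE eqxx andbT.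
    have [->|ak] := eqVneq a k.
      rewrite ltnn add0r mulr1 normrM ger0_norm //.
      by apply: le_trans (cV_norm_entry h k); rewrite ler_piMl.
    rewrite !mulr0 addr0; case: ifP => _; first exact: cV_norm_entry.
    by rewrite normr0.
  pose g (u : R) : R := f (x + head h k + u *: (h k 0 *: delta_mx k 0)).
  have dg (u : R) : 0 <= u <= 1 -> is_derive u (1 : R) g
      (h k 0 * 'D_(delta_mx k 0) f (x + head h k + u *: (h k 0 *: delta_mx k 0))).
    move=> hu; apply: is_derive_along; apply: is_derive_scale_dir; apply: derivableP.
    exact/hd/hU/near_x.
  have [||u hu hg] := @MVT_segment R g
      (fun u : R => h k 0 * 'D_(delta_mx k 0) f (x + head h k + u *: (h k 0 *: delta_mx k 0))) 0 1 ler01.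
  - by move=> u; rewrite in_itv /= => /andP[u0 u1]; apply: dg; rewrite !ltW.
  - apply: continuous_in_subspaceT => u; rewrite inE /= in_itv /= => hu.
    by apply: differentiable_continuous; apply/derivable1_diffP; have [] := dg u hu.
  move: hg; rewrite subr0 mulr1 /g scale1r scale0r addr0 -addrA -headS => ->.
  rewrite -mulrBr normrM mulrC; apply: ler_pM => //; last exact: cV_norm_entry.
  by apply: hc; apply: near_x; move: hu; rewrite in_itv.
have -> : f (x + h) - f x - \sum_a h a 0 * c a =
    \sum_(k < d) (f (x + head h k.+1) - f (x + head h k) - h k 0 * c k).
  rewrite sumrB; congr (_ - _).
  rewrite -(big_mkord xpredT (fun k => f (x + head h k.+1) - f (x + head h k))).
  by rewrite telescope_sumr // headd head0 addr0.
apply: le_trans (ler_norm_sum _ _ _) _.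
apply: le_trans (ler_sum _ (fun k _ => step k)) _.
by rewrite sumr_const card_ord -mulrA mulr_natl.
Qed.

(** Subtracting the linear function given by the partial derivatives leaves a
    function that is flat at [x], by [increment_bound]. *)
Lemma partials_differentiable f U x : open U -> U x ->
  (forall a y, U y -> derivable f y (delta_mx a 0)) ->
  (forall a, {for x, continuous (fun y => 'D_(delta_mx a 0) f y)}) ->
  differentiable f x.
Proof.
move=> oU Ux hd hc; pose c a := 'D_(delta_mx a 0) f x.
pose ell (y : 'cV[R]_d) : R := \sum_a c a *: y a 0.
have ell_diff y : differentiable ell y.
  rewrite (_ : ell = \sum_a (c a \*: (fun y : 'cV[R]_d => y a 0 : R))); last first.
    by apply/funext => z; rewrite /ell fct_sumE.
  by apply: differentiable_sum => a; apply: differentiableZ; apply: differentiable_coord.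
suff dr : differentiable (f - ell : 'cV[R]_d -> R) x.
  by rewrite -[f](subrK ell); exact: differentiableD.
apply: (@flat_differentiable _ 'cV[R]_d R) => e e0.
have [r r0 hr] : exists2 r, 0 < r & forall y, `|y - x| < r ->
      U y /\ forall a, `|'D_(delta_mx a 0) f y - c a| <= e / (d%:R + 1).
    have : \forall y \near x, U y /\ forall a, `|'D_(delta_mx a 0) f y - c a| <= e / (d%:R + 1).
      apply: filterI; first exact: (open_nbhs_nbhs (conj oU Ux)).
      apply: (@filter_forall 'cV[R]_d 'I_d (fun a y => `|'D_(delta_mx a 0) f y - c a| <= e / (d%:R + 1)) (nbhs x)) => a; have := hc a => /cvgrPdist_le /(_ (e / (d%:R + 1))).
      rewrite divr_gt0 // ?ltr_wpDl // => /(_ isT); apply: filterS => y.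
      by rewrite distrC.
    move=> /nbhs_ballP[r r0 hr]; exists r => // y hy; apply: hr.
    by rewrite -ball_normE /= distrC.
  apply/nbhs_ballP; exists r => // h; rewrite -ball_normE /= sub0r normrN => hh.
  rewrite !fctE.
  have -> : f (h + x) - ell (h + x) - (f x - ell x) = f (x + h) - f x - \sum_a h a 0 * c a.
    have -> : ell (h + x) = ell x + \sum_a h a 0 * c a.
      rewrite /ell -big_split /=; apply: eq_bigr => a _.
      by rewrite mxE scalerDr addrC [_ *: h a 0]mulrC.
    by rewrite [h + x]addrC; ring.
  apply: le_trans (@increment_bound f U x c (e / (d%:R + 1)) r h _ _ hd _ hh) _.
  - by rewrite divr_ge0 ?addr_ge0 // ltW.
  - by move=> y /hr[].
  - by move=> a y /hr[].
  apply: ler_wpM2r => //; rewrite mulrC -mulrA ler_piMr ?(ltW e0) //.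
  by rewrite ler_pdivrMl ?ltr_wpDl // mulr1 lerDl.
Qed.

End PartialDerivatives.

(** * Smooth curves of matrices *)

Section SmoothCurves.
Context {R : realType}.
Implicit Types (O : set R) (f g : R -> R) (k : nat).

(** C^k functions of one variable; taking the derivative as a witness makes the
    class closed under the algebraic operations without any appeal to
    extensionality on the open set. *)
Fixpoint Ck_fun k O f : Prop :=
  match k with
  | 0 => forall t, O t -> {for t, continuous f}
  | k'.+1 => exists2 f' : R -> R,
      forall t, O t -> is_derive t (1 : R) f (f' t) & Ck_fun k' O f'
  end.

Definition smooth_fun O f := forall k, Ck_fun k O f.

Lemma is_derive_cont f t (l : R) : is_derive t (1 : R) f l -> {for t, continuous f}.
Proof. by move=> [h _]; apply: differentiable_continuous; apply/derivable1_diffP. Qed.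

Lemma Ck_fun_ext k O f g : open O -> (forall t, O t -> f t = g t) ->
  Ck_fun k O f -> Ck_fun k O g.
Proof.
move=> oO fg; have nfg t : O t -> \near t, f t = g t.
  by move=> Ot; apply: filterS fg _; apply: open_nbhs_nbhs.
case: k => [|k] /=.
  move=> cf t Ot; rewrite /prop_for /continuous_at -(fg t Ot).
  by apply: cvg_trans (cf t Ot); apply: near_eq_cvg; exact: nfg.
by move=> [f' hf cf']; exists f' => // t Ot; apply: near_eq_is_derive (nfg t Ot) (hf t Ot).
Qed.

Lemma Ck_funS k O f : Ck_fun k.+1 O f -> Ck_fun k O f.
Proof.
elim: k f => [f [f' hf _] t Ot|k IH f [f' hf cf']].
  exact: is_derive_cont (hf t Ot).
by exists f' => //; apply: IH.
Qed.

Lemma Ck_fun_derive k O f : open O -> Ck_fun k.+1 O f -> Ck_fun k O ('D_1 f).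
Proof.
move=> oO [f' hf cf']; apply: Ck_fun_ext cf' => // t Ot.
by have [_] := hf t Ot.
Qed.

Lemma Ck_fun_cst k O (c : R) : Ck_fun k O (fun=> c).
Proof.
elim: k c => [|k IH] c /=; first by move=> t _; apply: cvg_cst.
by exists (fun=> 0) => // t _; apply: is_derive_cst.
Qed.

Lemma Ck_funD k O f g : Ck_fun k O f -> Ck_fun k O g -> Ck_fun k O (fun t => f t + g t).
Proof.
elim: k f g => [|k IH] f g /=.
  by move=> cf cg t Ot; apply: cvgD; [apply: cf|apply: cg].
move=> [f' hf cf'] [g' hg cg']; exists (fun t => f' t + g' t); last exact: IH.
by move=> t Ot; apply: is_deriveD (hf t Ot) (hg t Ot).
Qed.

Lemma Ck_funM k O f g : Ck_fun k O f -> Ck_fun k O g -> Ck_fun k O (fun t => f t * g t).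
Proof.
elim: k f g => [|k IH] f g.
  by move=> cf cg t Ot; apply: cvgM; [apply: cf|apply: cg].
move=> hf0 hg0; have cf := Ck_funS hf0; have cg := Ck_funS hg0.
case: hf0 hg0 => f' hf cf' [g' hg cg']; exists (fun t => f' t * g t + f t * g' t).
  by move=> t Ot; apply: is_derive_mulR (hf t Ot) (hg t Ot).
by apply: Ck_funD; apply: IH.
Qed.

Lemma Ck_fun_sum k O (I : Type) (r : seq I) (F : I -> R -> R) :
  (forall i, Ck_fun k O (F i)) -> Ck_fun k O (fun t => \sum_(i <- r) F i t).
Proof.
move=> h; elim: r => [|i r IH].
  rewrite (_ : (fun t => _) = fun=> 0); first exact: Ck_fun_cst.
  by apply/funext => t; rewrite big_nil.
rewrite (_ : (fun t => _) = fun t => F i t + \sum_(j <- r) F j t).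
  exact: Ck_funD.
by apply/funext => t; rewrite big_cons.
Qed.

Lemma Ck_fun_sub k O (N : set R) f : N `<=` O -> Ck_fun k O f -> Ck_fun k N f.
Proof.
move=> s; elim: k f => [|k IH] f /=; first by move=> h t /s; apply: h.
by move=> [f' hf cf']; exists f'; [move=> t /s; apply: hf|apply: IH].
Qed.

Lemma Ck_fun_local k O f :
  (forall t, O t -> exists N : set R, [/\ open N, N t & Ck_fun k N f]) -> Ck_fun k O f.
Proof.
elim: k f => [|k IH] f h /=.
  by move=> t /h[N [_ Nt hO]]; apply: hO.
exists ('D_1 f).
  by move=> t /h[N [_ Nt [f' hf _]]]; have [h1 _] := hf t Nt; apply: derivableP.
apply: IH => t /h[N [oN Nt cf]]; exists N; split=> //; exact: Ck_fun_derive.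
Qed.

Lemma Ck_on_fun k O f : Ck_on k O f -> Ck_fun k O f.
Proof.
elim: k f => [//|k IH] f /= /(_ 1)[h1 h2]; exists ('D_1 f); last exact: IH.
by move=> t Ot; apply: derivableP; apply: h1.
Qed.

Lemma smooth_fun_derive O f : open O -> smooth_fun O f -> smooth_fun O ('D_1 f).
Proof. by move=> oO hf k; apply: Ck_fun_derive. Qed.

Lemma smooth_fun_is_derive O f t : smooth_fun O f -> O t -> is_derive t (1 : R) f ('D_1 f t).
Proof. by move=> /(_ 1)[f' hf _] /hf[h _]; apply: derivableP. Qed.

Lemma smooth_fun_cont O f t : smooth_fun O f -> O t -> {for t, continuous f}.
Proof. by move=> /(_ 0); apply. Qed.

End SmoothCurves.

Section SmoothOn.
Context {R : realType}.

Lemma Ck_on_ext {V W : normedModType R} k (U : set V) (f g : V -> W) : open U ->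
  (forall x, U x -> f x = g x) -> Ck_on k U f -> Ck_on k U g.
Proof.
move=> oU; elim: k f g => [|k IH] f g fg /=.
  move=> cf x Ux; rewrite /prop_for /continuous_at -(fg x Ux).
  apply: cvg_trans (cf x Ux); apply: near_eq_cvg.
  by apply: filterS fg _; apply: open_nbhs_nbhs.
have nfg x : U x -> \near x, f x = g x.
  by move=> Ux; apply: filterS fg _; apply: open_nbhs_nbhs.
move=> h v; have [h1 h2] := h v; split.
  by move=> x Ux; apply: near_eq_derivable (nfg x Ux) (h1 x Ux).
apply: IH h2 => x Ux; exact: near_eq_derive (nfg x Ux).
Qed.

Lemma Ck_fun_on k (O : set R) (f : R -> R) : open O -> Ck_fun k O f -> Ck_on k O f.
Proof.
move=> oO; elim: k f => [//|k IH] f [f' hf cf'] v.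
have hv t : O t -> is_derive t v f (v * f' t).
  by move=> Ot; have := @is_derive_scale_dir _ _ f t 1 v _ (hf t Ot); rewrite [_ *: 1]mulr1.
split; first by move=> t /hv[].
apply: IH; apply: (@Ck_fun_ext _ k O (fun t => v * f' t)) => //.
  by move=> t /hv[_].
by apply: Ck_funM => //; apply: Ck_fun_cst.
Qed.

Lemma mx_continuousP {T : topologicalType} m n (F : T -> 'M[R]_(m, n)) x :
  {for x, continuous F} <-> forall i j, {for x, continuous (fun y => F y i j : R)}.
Proof.
split=> [cF i j|cF].
  have h := @coord_continuous R m n i j.
  have h2 := continuous_comp cF (h (F x)).
  exact h2.
rewrite /continuous_at; apply/cvgrPdist_le => /= e e0.
have : \forall y \near x, forall ij : 'I_m * 'I_n, `|F x ij.1 ij.2 - F y ij.1 ij.2| <= e.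
  apply: (@filter_forall _ _ (fun (ij : 'I_m * 'I_n) y => `|F x ij.1 ij.2 - F y ij.1 ij.2| <= e)
     (nbhs x)) => -[i j] /=.
  by have /cvgrPdist_le := cF i j; apply.
apply: filterS => y hy; rewrite /Num.Def.normr /= mx_normrE.
by apply: bigmax_le => [|ij _]; [exact: ltW|have := hy ij; rewrite !mxE].
Qed.

Lemma Ck_on_mxP {V : normedModType R} m n k (U : set V) (F : V -> 'M[R]_(m, n)) : open U ->
  Ck_on k U F <-> forall i j, Ck_on k U (fun x => F x i j : R).
Proof.
move=> oU; elim: k F => [|k IH] F /=.
  split=> [h i j x Ux|h x Ux]; first by have /mx_continuousP := h x Ux; apply.
  by apply/mx_continuousP => i j; apply: h.
split=> [h i j v|h v].
  have [h1 h2] := h v; split; first by move=> x Ux; have /derivable_mxP := h1 x Ux; apply.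
  apply: Ck_on_ext (proj1 (IH _) h2 i j) => // x Ux.
  by rewrite derive_mx ?mxE //; apply: h1.
have h1 x : U x -> derivable F x v.
  by move=> Ux; apply/derivable_mxP => i j; have [+ _] := h i j v; apply.
split=> //; apply/IH => i j; have [_] := h i j v.
by apply: Ck_on_ext => // x Ux; rewrite derive_mx ?mxE //; apply: h1.
Qed.

Section Chain.
Context {d : nat}.
Implicit Types (U : set 'cV[R]_d) (f : 'cV[R]_d -> R) (x : R -> 'cV[R]_d).

(** [Ck_on] speaks of directional derivatives only; differentiability comes from
    the continuity of the partial ones. *)
Lemma Ck_on_differentiable U f y : open U -> Ck_on 1 U f -> U y -> differentiable f y.
Proof.
move=> oU h Uy; apply: (partials_differentiable oU Uy) => [a z Uz|a].
  by have [+ _] := h (delta_mx a 0); apply.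
by have [_] := h (delta_mx a 0); apply.
Qed.

Lemma derive_partials f y u : differentiable f y ->
  'D_u f y = \sum_a u a 0 * 'D_(delta_mx a 0) f y.
Proof.
move=> df; rewrite deriveE //.
have -> : u = \sum_a u a 0 *: delta_mx a 0.
  by rewrite {1}[u]matrix_sum_delta; apply: eq_bigr => a _; rewrite big_ord1.
rewrite linear_sum; apply: eq_bigr => a _; rewrite linearZ /= deriveE //.
congr (_ * _); rewrite summxE (bigD1 a) //= !mxE !eqxx mulr1 big1 ?addr0 // => b ba.
by rewrite !mxE eq_sym (negbTE ba) mulr0.
Qed.

Lemma mderive_curve x t (x' : 'cV[R]_d) : mderive x t x' -> is_derive t (1 : R) x x'.
Proof.
move=> h; have dx : derivable x t 1 by apply/derivable_mxP => i j; have [] := h i j.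
split=> //; rewrite derive_mx //; apply/matrixP => i j; rewrite mxE.
by have [_] := h i j.
Qed.

Lemma is_derive_chain f x t (x' : 'cV[R]_d) : differentiable f (x t) -> mderive x t x' ->
  is_derive t (1 : R) (fun s => f (x s)) ('D_x' f (x t)).
Proof.
move=> df /mderive_curve[dx ex].
have dx1 : differentiable x t by apply/derivable1_diffP.
have dc : differentiable (f \o x) t by apply: differentiable_comp.
split; first exact/derivable1_diffP.
have e1 : 'd x t 1 = x' by rewrite -ex deriveE.
by rewrite (_ : (fun s => _) = f \o x) // [LHS]deriveE // diff_comp //= e1 deriveE.
Qed.

(** The derivative of [f] along the curve is a sum of products of derivatives of
    the curve with partial derivatives of [f] along it; these are again of the
    form considered, one order lower. *)
Lemma smooth_fun_comp U f O x : open U -> open O -> smooth_on U f ->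
  (forall a, smooth_fun O (fun t => x t a 0)) -> (forall t, O t -> U (x t)) ->
  smooth_fun O (fun t => f (x t)).
Proof.
move=> oU oO + hx xU k; elim: k f => [|k IH] f hf.
  move=> t Ot; apply: (@continuous_comp _ _ _ x f); last exact: (hf 0 _ (xU t Ot)).
  by apply/mx_continuousP => i j; rewrite (ord1 j); apply: smooth_fun_cont Ot.
exists (fun t => \sum_a 'D_1 (fun s => x s a 0) t * 'D_(delta_mx a 0) f (x t)).
  move=> t Ot; have df := Ck_on_differentiable oU (hf 1) (xU t Ot).
  have hd : mderive x t (\col_a 'D_1 (fun s => x s a 0) t).
    by move=> a b; rewrite mxE (ord1 b); apply: smooth_fun_is_derive Ot.
  have := is_derive_chain df hd; rewrite derive_partials //.
  by move=> H; apply: is_derive_eq H _; apply: eq_bigr => a _; rewrite mxE.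
apply: Ck_fun_sum => a; apply: Ck_funM; first exact: smooth_fun_derive.
by apply: (IH ('D_(delta_mx a 0) f)) => j; have [_] := hf j.+1 (delta_mx a 0).
Qed.

End Chain.
End SmoothOn.

Section SmoothMatrices.
Context {R : realType}.
Implicit Types O : set R.

Definition smooth_mx O m n (F : R -> 'M[R]_(m, n)) : Prop :=
  forall i j, smooth_fun O (fun t => F t i j).

Lemma smooth_mxM O m n p (F : R -> 'M[R]_(m, n)) (G : R -> 'M[R]_(n, p)) :
  smooth_mx O F -> smooth_mx O G -> smooth_mx O (fun t => F t *m G t).
Proof.
move=> hF hG i j k; rewrite (_ : (fun t => _) = fun t => \sum_l F t i l * G t l j).
  by apply: Ck_fun_sum => l; apply: Ck_funM; [apply: hF|apply: hG].
by apply/funext => t; rewrite mxE.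
Qed.

Lemma smooth_mxD O m n (F G : R -> 'M[R]_(m, n)) :
  smooth_mx O F -> smooth_mx O G -> smooth_mx O (fun t => F t + G t).
Proof.
move=> hF hG i j k; rewrite (_ : (fun t => _) = fun t => F t i j + G t i j).
  by apply: Ck_funD; [apply: hF|apply: hG].
by apply/funext => t; rewrite mxE.
Qed.

Lemma smooth_mxT O m n (F : R -> 'M[R]_(m, n)) :
  smooth_mx O F -> smooth_mx O (fun t => (F t)^T).
Proof.
move=> hF i j k; rewrite (_ : (fun t => _) = fun t => F t j i); first exact: hF.
by apply/funext => t; rewrite mxE.
Qed.

Lemma smooth_mx_cst O m n (A : 'M[R]_(m, n)) : smooth_mx O (fun=> A).
Proof. by move=> i j k; apply: Ck_fun_cst. Qed.

Lemma smooth_mxZ O m n (c : R -> R) (F : R -> 'M[R]_(m, n)) :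
  smooth_fun O c -> smooth_mx O F -> smooth_mx O (fun t => c t *: F t).
Proof.
move=> hc hF i j k; rewrite (_ : (fun t => _) = fun t => c t * F t i j).
  by apply: Ck_funM; [apply: hc|apply: hF].
by apply/funext => t; rewrite mxE.
Qed.

Lemma smooth_mx_sum O m n (I : Type) (r : seq I) (F : I -> R -> 'M[R]_(m, n)) :
  (forall i, smooth_mx O (F i)) -> smooth_mx O (fun t => \sum_(i <- r) F i t).
Proof.
move=> h i j k; rewrite (_ : (fun t => _) = fun t => \sum_(l <- r) F l t i j).
  by apply: Ck_fun_sum => l; apply: h.
by apply/funext => t; rewrite summxE.
Qed.

Lemma smooth_mx_ext O m n (F G : R -> 'M[R]_(m, n)) : open O ->
  (forall t, O t -> F t = G t) -> smooth_mx O F -> smooth_mx O G.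
Proof.
by move=> oO FG hF i j k; apply: Ck_fun_ext (hF i j k) => // t Ot; rewrite FG.
Qed.

Lemma smooth_mx_sub O (N : set R) m n (F : R -> 'M[R]_(m, n)) :
  N `<=` O -> smooth_mx O F -> smooth_mx N F.
Proof. by move=> s hF i j k; apply: Ck_fun_sub (hF i j k). Qed.

Lemma smooth_mx_local O m n (F : R -> 'M[R]_(m, n)) :
  (forall t, O t -> exists N : set R, [/\ open N, N t & smooth_mx N F]) -> smooth_mx O F.
Proof.
move=> h i j k; apply: Ck_fun_local => t /h[N [oN Nt hF]].
by exists N; split=> //; apply: hF.
Qed.

Definition dmx m n (F : R -> 'M[R]_(m, n)) (t : R) : 'M[R]_(m, n) :=
  \matrix_(i, j) 'D_1 (fun s => F s i j : R) t.

Lemma smooth_dmx O m n (F : R -> 'M[R]_(m, n)) : open O -> smooth_mx O F ->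
  smooth_mx O (dmx F).
Proof.
move=> oO hF i j; rewrite (_ : (fun t => _) = 'D_1 (fun s => F s i j : R)).
  by apply: smooth_fun_derive.
by apply/funext => t; rewrite mxE.
Qed.

Lemma smooth_mderive O m n (F : R -> 'M[R]_(m, n)) t : smooth_mx O F -> O t ->
  mderive F t (dmx F t).
Proof. by move=> hF Ot i j; rewrite mxE; apply: smooth_fun_is_derive Ot. Qed.

Lemma mderive_dmx m n (F : R -> 'M[R]_(m, n)) t F' : mderive F t F' -> dmx F t = F'.
Proof. by move=> h; apply/matrixP => i j; rewrite mxE; have [_] := h i j. Qed.

Lemma mderive_near m n (F G : R -> 'M[R]_(m, n)) O t F' : open O -> O t ->
  (forall s, O s -> F s = G s) -> mderive F t F' -> mderive G t F'.
Proof.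
move=> oO Ot FG h i j; apply: near_eq_is_derive (h i j).
by apply: filterS (open_nbhs_nbhs (conj oO Ot)) => s Os; rewrite FG.
Qed.

Lemma smooth_onP O m n (F : R -> 'M[R]_(m, n)) : open O -> smooth_on O F <-> smooth_mx O F.
Proof.
move=> oO; split=> [h i j k|h k].
  by apply: Ck_on_fun; apply: (proj1 (Ck_on_mxP _ _ oO)).
by apply/Ck_on_mxP => // i j; apply: Ck_fun_on => //; apply: h.
Qed.

Lemma smooth_mx_comp d (U : set 'cV[R]_d) O m n (f : 'cV[R]_d -> 'M[R]_(m, n))
    (x : R -> 'cV[R]_d) : open U -> open O -> smooth_on U f -> smooth_mx O x ->
  (forall t, O t -> U (x t)) -> smooth_mx O (fun t => f (x t)).
Proof.
move=> oU oO hf hx xU i j; apply: (@smooth_fun_comp _ _ U (fun y => f y i j)) => //.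
by move=> k; apply: (proj1 (Ck_on_mxP _ _ oU)).
Qed.

(** If [P] solves a linear equation with smooth coefficients then it is smooth:
    each derivative of [P] is expressed by lower ones. *)
Lemma smooth_linear_ode m n (P : R -> 'M[R]_(m, n)) (A : R -> 'M[R]_m) :
  smooth_mx setT A -> (forall t, mderive P t (A t *m P t)) -> smooth_mx setT P.
Proof.
move=> hA hP i j k; elim: k i j => [|k IH] i j.
  by move=> t _; apply: is_derive_cont (hP t i j).
exists (fun t => \sum_l A t i l * P t l j).
  by move=> t _; have := hP t i j; rewrite mxE.
by apply: Ck_fun_sum => l; apply: Ck_funM; [apply: hA|apply: IH].
Qed.

End SmoothMatrices.

(** * Primitives *)

Section Primitive.
Context {R : realType}.
Implicit Types (f F : R -> R).
Local Notation mu := (@lebesgue_measure R).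

Lemma zero_derive_cst_on F (a b : R) : (forall t, a < t < b -> is_derive t (1 : R) F 0) ->
  forall s t, a < s < b -> a < t < b -> F s = F t.
Proof.
move=> dF; suff H s t : a < s < b -> a < t < b -> s < t -> F s = F t.
  move=> s t hs ht; have [st|ts|-> //] := ltgtP s t; first exact: H.
  by apply/esym; apply: H.
move=> /andP[as_ sb] /andP[at_ tb] st.
have dF' x : s <= x <= t -> is_derive x (1 : R) F 0.
  by move=> /andP[sx xt]; apply: dF; rewrite (lt_le_trans as_ sx) (le_lt_trans xt tb).
have [||x _] := @MVT_segment R F (fun=> 0) s t (ltW st).
- by move=> x; rewrite in_itv /= => /andP[x1 x2]; apply: dF'; rewrite !ltW.
- by apply: continuous_in_subspaceT => x; rewrite inE /= in_itv /= => /dF' /is_derive_cont.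
by rewrite mul0r => /eqP; rewrite subr_eq0 => /eqP.
Qed.

(** The primitives obtained by integration from [-n-1] agree up to constants on
    the overlaps of their intervals, and glue to one on the whole line. *)
Lemma primitive_exists f : continuous f ->
  exists2 F, F 0 = 0 & forall t, is_derive t (1 : R) F (f t).
Proof.
move=> cf.
pose Q (n : nat) (t : R) : R := (\int[mu]_(x in `[- n.+1%:R, t]) f x)%R.
pose G (n : nat) (t : R) : R := Q n t - Q n 0.
have dG n (t : R) : - n.+1%:R < t < n.+1%:R -> is_derive t (1 : R) (G n) (f t).
  move=> /andP[t1 t2].
  have fi : mu.-integrable `[- n.+1%:R, n.+1%:R] (EFin \o f).
    apply: continuous_compact_integrable; first exact: segment_compact.
    exact: continuous_subspaceT.
  have [h1 h2] := @continuous_FTC1_closed R f (- n.+1%:R) t n.+1%:R t2 fi t1 (cf t).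
  rewrite -[f t]subr0; apply: (@is_deriveB _ _ _ (Q n) (cst (Q n 0))).
  by split; [exact: h1|rewrite -derive1E h2].
have G0 n : G n 0 = 0 by rewrite /G subrr.
pose N (t : R) := Num.truncn `|t|.
have Nt (t : R) : - (N t).+1%:R < t < (N t).+1%:R.
  by rewrite -ltr_norml /N; apply: truncnS_gt.
pose F (t : R) : R := G (N t) t.
have FE n (t : R) : - n.+1%:R < t < n.+1%:R -> F t = G n t.
  move=> tn; pose m := minn (N t) n.
  have tm : - m.+1%:R < t < m.+1%:R by rewrite /m /minn; case: ifP.
  have leN : (m <= N t)%N by rewrite geq_minl.
  have len : (m <= n)%N by rewrite geq_minr.
  have wid k (s : R) : (m <= k)%N -> - m.+1%:R < s < m.+1%:R -> - k.+1%:R < s < k.+1%:R.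
    move=> mk /andP[s1 s2]; have h : m.+1%:R <= k.+1%:R :> R by rewrite ler_nat.
    by rewrite (lt_le_trans s2 h) andbT (le_lt_trans _ s1) // lerN2.
  have h := @zero_derive_cst_on (fun s => G (N t) s - G n s) (- m.+1%:R) m.+1%:R.
  have m0 : - m.+1%:R < (0 : R) < m.+1%:R by rewrite oppr_lt0 ltr0n.
  have /eqP : G (N t) t - G n t = G (N t) 0 - G n 0.
    apply: h => // s sm; rewrite -(subrr (f s)).
    by apply: is_deriveB; apply: dG; apply: wid sm.
  by rewrite !G0 subrr subr_eq0 => /eqP.
exists F; first by rewrite /F G0.
move=> t; apply: near_eq_is_derive (dG _ _ (Nt t)).
near=> s; rewrite -FE //; apply/andP; split; near: s.
  by apply: lt_nbhsr; have /andP[] := Nt t.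
by apply: lt_nbhsl; have /andP[] := Nt t.
Unshelve. all: by end_near. Qed.

Lemma is_derive_reflect F (t l : R) : is_derive (- t) (1 : R) F l ->
  is_derive t (1 : R) (fun s => F (- s)) (- l).
Proof.
move=> h; have h1 := is_derive_opp1 t.
rewrite (_ : (fun s => _) = F \o (fun s => - s)) //.
by apply: is_derive_eq; rewrite /GRing.scale /=; ring.
Qed.

(** Estimates against the weight [expR (L * `|t|)] make integration a
    contraction when [L] is large. *)
Lemma weighted_primitive_bound f F (T L c : R) : 0 < L -> 0 <= c -> F 0 = 0 ->
  (forall t, is_derive t (1 : R) F (f t)) ->
  (forall t, `|t| <= T -> `|f t| <= c * expR (L * `|t|)) ->
  forall t, `|t| <= T -> `|F t| <= c / L * expR (L * `|t|).
Proof.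
move=> L0 c0 F0 dF hf.
have half (g G : R -> R) : G 0 = 0 -> (forall t, is_derive t (1 : R) G (g t)) ->
    (forall t, 0 <= t -> t <= T -> g t <= c * expR (L * t)) ->
    forall t, 0 <= t -> t <= T -> G t <= c / L * expR (L * t).
  move=> G0 dG hg t t0 tT.
  pose H (s : R) : R := c / L * expR (L * s) - G s.
  have dH (s : R) : is_derive s (1 : R) H (c * expR (L * s) - g s).
    rewrite /H; apply: (@is_deriveB _ _ _ (fun s => c / L * expR (L * s)) G) => //.
    have dl : is_derive s (1 : R) (fun s : R => L * s) L.
      rewrite (_ : (fun s => _) = L \*: (@id R)) //.
      by apply: is_derive_eq; rewrite /GRing.scale /= mulr1.
    rewrite (_ : (fun s => _) = (c / L) \*: (expR \o (fun s : R => L * s))) //.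
    apply: is_derive_eq; rewrite /GRing.scale /=.
    by field; rewrite gt_eqF.
  have := @ger0_derive1_le_cc R H 0 t.
  have h0 : 0 <= H 0 by rewrite /H G0 subr0 mulr0 expR0 mulr1 divr_ge0 // ltW.
  move=> /(_ _ _ _ 0 t) hh; rewrite -subr_ge0; apply: le_trans h0 _; apply: hh => //.
  - move=> s; rewrite in_itv /= => /andP[s0 st]; rewrite derive1E; have [_ ->] := dH s.
    by rewrite subr_ge0; apply: hg; [exact: ltW|exact: le_trans (ltW st) tT].
  - by apply: continuous_subspaceT => s; apply: is_derive_cont (dH s).
  - by rewrite in_itv /= lexx.
  - by rewrite in_itv /= lexx t0.
have both (g G : R -> R) : G 0 = 0 -> (forall t, is_derive t (1 : R) G (g t)) ->
    (forall t, 0 <= t -> t <= T -> `|g t| <= c * expR (L * t)) ->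
    forall t, 0 <= t -> t <= T -> `|G t| <= c / L * expR (L * t).
  move=> G0 dG hg t t0 tT; rewrite ler_norml; apply/andP; split.
    rewrite lerNl; apply: (half (fun t => - g t) (fun t => - G t)) => //.
    - by rewrite G0 oppr0.
    - by move=> s s0 sT; apply: le_trans (hg s s0 sT); rewrite -normrN ler_norm.
  apply: half G0 dG _ _ t0 tT => s s0 sT; apply: le_trans (hg s s0 sT); exact: ler_norm.
move=> t tT; have [t0|t0] := leP 0 t.
  rewrite ger0_norm // in tT *; apply: (both f F) => // s s0 sT.
  by have := hf s; rewrite ger0_norm // => /(_ sT).
rewrite ltr0_norm // in tT *.
have h := @both (fun s => - f (- s)) (fun s => F (- s)).
rewrite -[F t](congr1 F (opprK t)); apply: h => //.
- by rewrite oppr0.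
- by move=> s; apply: is_derive_reflect.
- move=> s s0 sT; have := hf (- s); rewrite !normrN (ger0_norm s0) => h1.
  exact: h1.
- by rewrite oppr_ge0 ltW.
Qed.

(** The sequences [u k - 2 D / 2 ^ k] and [u k + 2 D / 2 ^ k] are nested, and the
    supremum of the first lies between them. *)
Lemma geometric_limit (u : nat -> R) (D : R) :
  (forall k, `|u k.+1 - u k| <= D * 2^-1 ^+ k) ->
  exists l, forall k, `|l - u k| <= 2 * D * 2^-1 ^+ k.
Proof.
move=> hu; have D0 : 0 <= D.
  by have := hu 0%N; rewrite expr0 mulr1; apply: le_trans.
pose a k := u k - 2 * D * 2^-1 ^+ k; pose b k := u k + 2 * D * 2^-1 ^+ k.
have step k : `|u k.+1 - u k| <= D * 2^-1 ^+ k := hu k.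
have aS k : a k <= a k.+1.
  have := step k; rewrite ler_norml => /andP[h _].
  by rewrite /a exprS; move: h; set e := 2^-1 ^+ k; lra.
have bS k : b k.+1 <= b k.
  have := step k; rewrite ler_norml => /andP[_ h].
  by rewrite /b exprS; move: h; set e := 2^-1 ^+ k; lra.
have amono j k : (j <= k)%N -> a j <= a k by apply: (@homo_leq _ a <=%R) => //; exact: le_trans.
have bmono j k : (j <= k)%N -> b k <= b j.
  by apply: (@homo_leq _ b (fun x y => y <= x)) => // x y z h1 h2; apply: le_trans h2 h1.
have ab j k : a j <= b k.
  apply: le_trans (amono j (maxn j k) (leq_maxl _ _)) _.
  apply: le_trans (bmono k (maxn j k) (leq_maxr _ _)).
  rewrite lerBlDr -addrA lerDl -mulr2n; apply: mulrn_wge0.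
  by rewrite !mulr_ge0 // exprn_ge0 // invr_ge0.
have hsup : has_sup (range a).
  by split; [exists (a 0%N); exists 0%N|exists (b 0%N) => _ [k _ <-]].
exists (sup (range a)) => k.
have h1 : a k <= sup (range a) by apply: ub_le_sup; [exact: hsup.2|exists k].
have h2 : sup (range a) <= b k by apply: ge_sup; [exact: hsup.1|move=> _ [j _ <-]].
by rewrite ler_norml; move: h1 h2; rewrite /a /b; lra.
Qed.

End Primitive.

(** * Linear differential equations *)

Section LinearODE.
Context {R : realType} {m n : nat}.
Variables (A : R -> 'M[R]_m) (P0 : 'M[R]_(m, n)).

Definition mcontinuous p q (F : R -> 'M[R]_(p, q)) : Prop :=
  forall i j, continuous (fun t => F t i j : R).

Hypothesis cA : mcontinuous A.
Implicit Types (G H : R -> 'M[R]_(m, n)).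

Lemma mderive_continuous p q (F F' : R -> 'M[R]_(p, q)) :
  (forall t, mderive F t (F' t)) -> mcontinuous F.
Proof. by move=> h i j t; apply: is_derive_cont (h t i j). Qed.

Lemma small_half (D e : R) : 0 < e -> exists k, D * 2^-1 ^+ k < e.
Proof.
move=> e0; have [D0|D0] := leP D 0.
  by exists 0%N; rewrite expr0 mulr1; apply: le_lt_trans e0.
exists (Num.truncn (D / e)); set k := Num.truncn _.
have h : D / e < k.+1%:R by apply: truncnS_gt.
rewrite exprVn ltr_pdivrMr ?exprn_gt0 // mulrC -ltr_pdivrMr //.
apply: lt_le_trans h _; rewrite -natrX ler_nat.
exact: ltn_expl.
Qed.

Lemma small_eq0 (x D : R) : (forall k, `|x| <= D * 2^-1 ^+ k) -> x = 0.
Proof.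
move=> h; apply/eqP; rewrite -normr_le0; apply/ler_addgt0Pl => e e0.
have [k hk] := small_half D e0.
by rewrite addr0; apply: le_trans (h k) (ltW hk).
Qed.

Lemma segment_bound (f : R -> R) (T : R) : continuous f ->
  exists2 K, 0 < K & forall t, `|t| <= T -> `|f t| <= K.
Proof.
move=> cf; have [T0|T0] := leP 0 T; last first.
  by exists 1 => // t tT; have := le_lt_trans tT T0; rewrite normr_lt0.
have [||c _ hc] := @EVT_max R (fun t => `|f t|) (- T) T.
- by rewrite ge0_cp.
- apply: continuous_subspaceT => t.
  exact: (@continuous_comp _ _ _ f (fun x : R => `|x|) t (cf t) (@norm_continuous _ R (f t))).
exists (`|f c| + 1); first by rewrite ltr_wpDl.
move=> t; rewrite ler_norml => tT; apply: le_trans (hc t _) _; last by rewrite lerDl.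
by rewrite in_itv.
Qed.

Lemma mx_segment_bound p q (F : R -> 'M[R]_(p, q)) (T : R) : mcontinuous F ->
  exists2 K, 0 < K & forall t i j, `|t| <= T -> `|F t i j| <= K.
Proof.
move=> cF; have /choice[K hK] ij : exists K : R, 0 < K /\ forall t, `|t| <= T -> `|F t ij.1 ij.2| <= K.
  by have [K K0 hK] := segment_bound T (cF ij.1 ij.2); exists K.
exists (1 + \sum_ij K ij).
  by apply: ltr_wpDr => //; apply: sumr_ge0 => ij _; apply: ltW; have [] := hK ij.
move=> t i j tT; have [_ h] := hK (i, j); apply: le_trans (h t tT) _.
rewrite (bigD1 (i, j)) //= addrCA lerDl addr_ge0 //.
by apply: sumr_ge0 => ij _; apply: ltW; have [] := hK ij.
Qed.

Definition picard G : R -> 'M[R]_(m, n) :=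
  xget (fun=> P0) [set H | H 0 = P0 /\ forall t, mderive H t (A t *m G t)].

Lemma picardP G : mcontinuous G ->
  picard G 0 = P0 /\ forall t, mderive (picard G) t (A t *m G t).
Proof.
move=> cG; rewrite /picard.
suff [H hH] : exists H, H 0 = P0 /\ forall t, mderive H t (A t *m G t).
  by have := @xgetPex _ (fun=> P0) [set H | H 0 = P0 /\ forall t, mderive H t (A t *m G t)] (ex_intro _ H hH).
have /choice[F hF] ij : exists F : R -> R, F 0 = 0 /\
    forall t, is_derive t (1 : R) F ((A t *m G t) ij.1 ij.2).
  have [|F F0 dF] := @primitive_exists R (fun t => (A t *m G t) ij.1 ij.2); last by exists F.
  rewrite (_ : (fun t => _) = fun t => \sum_l A t ij.1 l * G t l ij.2).
    move=> t; apply: (@Ck_fun_sum R 0 setT) => // l.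
    by apply: (@Ck_funM R 0 setT) => s _; [apply: cA|apply: cG].
  by apply/funext => t; rewrite mxE.
exists (fun t => P0 + \matrix_(i, j) F (i, j) t); split.
  by apply/matrixP => i j; rewrite !mxE (hF (i, j)).1 addr0.
move=> t i j; have := (hF (i, j)).2 t => /= h.
rewrite (_ : (fun s => _) = cst (P0 i j) + F (i, j)); last first.
  by apply/funext => s; rewrite !mxE.
by apply: is_derive_eq; rewrite add0r.
Qed.

(** With respect to the weight [expR (L * `|t|)] the Picard operator halves
    distances, for [L] twice a bound of the coefficients. *)
Lemma picard_contraction (T : R) : exists2 L, 0 < L &
  forall G1 G2 H1 H2 (c : R), 0 <= c -> H1 0 = H2 0 ->
  (forall t, mderive H1 t (A t *m G1 t)) -> (forall t, mderive H2 t (A t *m G2 t)) ->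
  (forall t i j, `|t| <= T -> `|G1 t i j - G2 t i j| <= c * expR (L * `|t|)) ->
  forall t i j, `|t| <= T -> `|H1 t i j - H2 t i j| <= c / 2 * expR (L * `|t|).
Proof.
have [K K0 hK] := mx_segment_bound T cA.
have m1 : 0 < m%:R + 1 :> R by rewrite ltr_wpDl.
exists (2 * (m%:R + 1) * K); first by rewrite !mulr_gt0.
set L := 2 * _ * K => G1 G2 H1 H2 c c0 H0 dH1 dH2 hc t i j tT.
have -> : c / 2 = ((m%:R + 1) * K * c) / L by rewrite /L; field; rewrite !gt_eqF.
apply: (@weighted_primitive_bound R (fun t => (A t *m (G1 t - G2 t)) i j)
  (fun t => H1 t i j - H2 t i j) T L) => //.
- by rewrite /L !mulr_gt0.
- by rewrite !mulr_ge0 // ltW.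
- by rewrite H0 subrr.
- move=> s; rewrite mulmxBr; have := is_deriveB (dH1 s i j) (dH2 s i j).
  by rewrite [X in is_derive _ _ _ X -> _](_ : _ = (A s *m G1 s - A s *m G2 s) i j) ?mxE // !mxE.
move=> s sT; rewrite mxE; apply: le_trans (ler_norm_sum _ _ _) _.
apply: (@le_trans _ _ (\sum_(l < m) K * (c * expR (L * `|s|)))).
  apply: ler_sum => l _; rewrite normrM; apply: ler_pM => //; first exact: hK.
  by rewrite !mxE; apply: hc.
rewrite sumr_const card_ord -[leLHS]mulr_natl !mulrA; apply: ler_wpM2r; first exact: expR_ge0.
by rewrite ler_wpM2r // ler_wpM2r ?(ltW K0) // lerDl.
Qed.

(** Linear equations with continuous coefficients have global solutions: the
    Picard iterates converge geometrically, uniformly on bounded intervals. *)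
Theorem linear_ode : exists2 P, P 0 = P0 & forall t, mderive P t (A t *m P t).
Proof.
pose p k := iter k picard (fun=> P0).
have pS k : p k.+1 = picard (p k) by [].
have cp k : mcontinuous (p k).
  elim: k => [|k IH]; first by move=> i j t; apply: cvg_cst.
  by rewrite pS; apply: mderive_continuous (picardP IH).2.
have p0 k : p k 0 = P0 by case: k => // k; rewrite pS (picardP (cp k)).1.
have dp k t : mderive (p k.+1) t (A t *m p k t) := (picardP (cp k)).2 t.
(* the iterates differ by geometrically decreasing amounts, uniformly for
   [`|t| <= T] *)
have unif T : exists2 D, 0 <= D & forall t i j k, `|t| <= T ->
    `|p k.+1 t i j - p k t i j| <= D * 2^-1 ^+ k.
  have [L L0 hL] := picard_contraction T.
  have cd : mcontinuous (fun t => p 1%N t - p 0%N t).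
    move=> i j; rewrite (_ : (fun t => _) = fun t => p 1%N t i j - p 0%N t i j).
      by move=> t; apply: cvgB; apply: cp.
    by apply/funext => t; rewrite !mxE.
  have [c c0 hc] := mx_segment_bound T cd.
  have bound k t i j : `|t| <= T ->
      `|p k.+1 t i j - p k t i j| <= c * 2^-1 ^+ k * expR (L * `|t|).
    elim: k t i j => [|k IH] t i j tT.
      have := hc t i j tT; rewrite !mxE expr0 mulr1 => h; apply: le_trans h _.
      by rewrite ler_peMr ?(ltW c0) // -expR0 ler_expR mulr_ge0 // ltW.
    rewrite exprSr mulrA; apply: (hL (p k.+1) (p k)) => //.
      by rewrite mulr_ge0 ?(ltW c0) // exprn_ge0 // invr_ge0.
    by rewrite !p0.
  exists (c * expR (L * T)); first by rewrite mulr_ge0 ?(ltW c0) // expR_ge0.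
  move=> t i j k tT; apply: le_trans (bound k t i j tT) _.
  rewrite mulrAC ler_wpM2r ?exprn_ge0 ?invr_ge0 // ler_wpM2l ?(ltW c0) //.
  by rewrite ler_expR ler_wpM2l // ltW.
pose lims t i j := [set l : R | exists D, forall k, `|l - p k t i j| <= D * 2^-1 ^+ k].
pose P t : 'M[R]_(m, n) := \matrix_(i, j) xget 0 (lims t i j).
have limP T : exists2 D, 0 <= D & forall t i j k, `|t| <= T ->
    `|P t i j - p k t i j| <= D * 2^-1 ^+ k.
  have [D D0 hD] := unif T; exists (2 * D); first by rewrite mulr_ge0.
  move=> t i j k tT.
  have [l hl] := geometric_limit (fun k => hD t i j k tT).
  have [D' hD'] : lims t i j (P t i j) by rewrite mxE; apply: (xgetPex 0); exists l, (2 * D).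
  suff -> : P t i j = l by [].
  apply/eqP; rewrite -subr_eq0; apply/eqP; apply: (@small_eq0 _ (D' + 2 * D)) => k'.
  rewrite mulrDl; apply: le_trans (lerD (hD' k') (hl k')).
  by rewrite -(subrKA (p k' t i j)) [`|l - _|]distrC; exact: ler_normD.
have cP : mcontinuous P.
  move=> i j t; apply/cvgrPdist_le => /= e e0.
  have [D D0 hD] := limP (`|t| + 1).
  have e3 : 0 < e / 3 by rewrite divr_gt0.
  have [k hk] := small_half D e3.
  have /cvgrPdist_le /(_ _ e3) /= near_t := cp k i j t.
  near=> s.
  have st : `|s| <= `|t| + 1.
    have : `|t - s| < 1 by near: s; apply: cvgr_dist_lt; [exact: cvg_id|].
    rewrite distrC => st1; rewrite -[s](subrK t) addrC; apply: le_trans (ler_normD _ _) _.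
    by rewrite lerD2l ltW.
  have h1 := le_trans (hD t i j k (ler_wpDr ler01 (lexx _))) (ltW hk).
  have h2 := le_trans (hD s i j k st) (ltW hk).
  have h3 : `|p k t i j - p k s i j| <= e / 3 by near: s.
  have -> : P t i j - P s i j = (P t i j - p k t i j) + (p k t i j - p k s i j) - (P s i j - p k s i j).
    by ring.
  apply: le_trans (ler_normB _ _) _; have := ler_normD (P t i j - p k t i j) (p k t i j - p k s i j).
  by lra.
have [H0 dH] := picardP cP.
have PE : P = picard P.
  apply/funext => t; apply/matrixP => i j; apply/eqP; rewrite -subr_eq0; apply/eqP.
  have [L L0 hL] := picard_contraction `|t|.
  have [D D0 hD] := limP `|t|.
  apply: (@small_eq0 _ (D * expR (L * `|t|) + D)) => k.
  rewrite -(subrKA (p k.+1 t i j)); apply: le_trans (ler_normD _ _) _.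
  rewrite addrC mulrDl; apply: lerD; last first.
    apply: le_trans (hD t i j k.+1 (lexx _)) _; rewrite exprS ler_wpM2l //.
    by rewrite ler_piMl ?exprn_ge0 ?invr_ge0 // invf_le1 // ler1n.
  rewrite distrC; have := hL P (p k) (picard P) (p k.+1) (D * 2^-1 ^+ k).
  have e0 : 0 <= 2^-1 ^+ k :> R by rewrite exprn_ge0 // invr_ge0.
  move=> /(_ (mulr_ge0 D0 e0)); rewrite H0 p0 => /(_ erefl dH (dp k)) h.
  apply: le_trans (h _ t i j (lexx _)) _.
    move=> s i' j' sT; apply: le_trans (hD s i' j' k sT) _.
    by rewrite ler_peMr ?mulr_ge0 // -expR0 ler_expR mulr_ge0 // ltW.
  have : 0 <= D * 2^-1 ^+ k * expR (L * `|t|) by rewrite !mulr_ge0 ?expR_ge0.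
  by set x := 2^-1 ^+ k; set e := expR _; lra.
by exists P => // [|t]; [rewrite PE|rewrite {1}PE].
Unshelve. all: by end_near. Qed.

End LinearODE.

(** * Orthonormal frames along a loop *)

Section ChartChanges.
Context {R : realType} {d : nat} (M : oriented_manifold R d).
Implicit Types (i j k : chart_index M) (p : M).
Local Notation T i j := (fun x : 'cV[R]_d => chart M i (cinv M j x)).
Local Notation W i j := (chart M j @` (chart_dom M i `&` chart_dom M j)).

Lemma overlap_near i j p : chart_dom M i p -> chart_dom M j p ->
  \forall x \near chart M j p, W i j x.
Proof.
move=> ip jp.
have c : (chart M j @` chart_dom M j) (chart M j p) by exists p.
have h1 : \forall x \near chart M j p, (chart M j @` chart_dom M j) x.
  have oj : open (chart M j @` chart_dom M j) := @image_open R d M j.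
  exact: (open_nbhs_nbhs (conj oj c)).
have h2 : \forall x \near chart M j p, chart_dom M i (cinv M j x).
  have := cinv_continuous c; rewrite /prop_for /continuous_at (chartK jp) => h.
  apply: h; have oi : open (chart_dom M i) := @dom_open R d M i.
  exact: (open_nbhs_nbhs (conj oi ip)).
apply: filterS2 h1 h2 => x [q jq <-]; rewrite (chartK jq) => iq.
by exists q.
Qed.

Lemma overlap_open i j : open (W i j).
Proof.
rewrite openE => x [p [ip jp] <-]; exact: overlap_near.
Qed.

Lemma transition_differentiable i j p a : chart_dom M i p -> chart_dom M j p ->
  differentiable (fun x => T i j x a 0 : R) (chart M j p).
Proof.
move=> ip jp; apply: (@Ck_on_differentiable R d (W i j)); first exact: overlap_open.
  have := @transition_smooth R d M i j 1%N; move/(Ck_on_mxP _ _ (@overlap_open i j)).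
  by apply.
by exists p.
Qed.

Lemma jacE i j p a l : chart_dom M i p -> chart_dom M j p ->
  jac i j p a l = 'D_(delta_mx l 0) (fun x => T i j x a 0 : R) (chart M j p).
Proof.
move=> ip jp; rewrite /jac /jacx /jacobian_cv mxE derive_mx ?mxE //.
apply/derivable_mxP => b c; rewrite (ord1 c).
exact: diff_derivable (transition_differentiable b ip jp).
Qed.

(** The chain rule, applicable since transition maps have continuous partial
    derivatives. *)
Lemma mderive_transition i j p (x : R -> 'cV[R]_d) t x' :
  chart_dom M i p -> chart_dom M j p -> x t = chart M j p -> mderive x t x' ->
  mderive (fun s => T i j (x s)) t (jac i j p *m x').
Proof.
move=> ip jp xt dx a b; rewrite (ord1 b) mxE.
have df : differentiable (fun y => T i j y a 0 : R) (x t).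
  by rewrite xt; apply: transition_differentiable.
have := is_derive_chain df dx; rewrite derive_partials // => h.
apply: (is_derive_eq h); rewrite xt; apply: eq_bigr => l _.
by rewrite (jacE a l ip jp) mulrC.
Qed.

Lemma mderive_line (x v : 'cV[R]_d) : mderive (fun s : R => x + s *: v) 0 v.
Proof.
move=> a b; rewrite (_ : (fun s => _) = cst (x a b) + v a b \*: (@id R)); last first.
  by apply/funext => s; rewrite !mxE !fctE /GRing.scale /= mulrC.
by apply: is_derive_eq; rewrite add0r /GRing.scale /= mulr1.
Qed.

Lemma jac_along i j p v : chart_dom M i p -> chart_dom M j p ->
  mderive (fun s : R => T i j (chart M j p + s *: v)) 0 (jac i j p *m v).
Proof.
move=> ip jp; apply: (@mderive_transition i j p (fun s : R => chart M j p + s *: v) 0 v ip jp).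
  by rewrite scale0r addr0.
exact: mderive_line.
Qed.

Lemma mderive_near_eq m n (F G : R -> 'M[R]_(m, n)) t F' :
  (\forall s \near t, F s = G s) -> mderive F t F' -> mderive G t F'.
Proof.
move=> FG h i j; apply: near_eq_is_derive (h i j).
by apply: filterS FG => s ->.
Qed.

Lemma line_near (x v : 'cV[R]_d) (P : 'cV[R]_d -> Prop) :
  (\forall y \near x, P y) -> \forall s \near (0 : R), P (x + s *: v).
Proof.
move=> h; have c : {for (0 : R), continuous (fun s : R => x + s *: v)}.
  by apply/mx_continuousP => a b; apply: is_derive_cont (mderive_line x v a b).
have := c P; rewrite scale0r addr0; apply; exact: h.
Qed.

(** Near the point the transition map is the identity; Jacobians are compared by
    differentiating along coordinate lines. *)
Lemma jac_id i p : chart_dom M i p -> jac i i p = 1%:M.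
Proof.
move=> ip; apply/matrixP => a l.
have h : mderive (fun s : R => chart M i p + s *: delta_mx l 0) 0 (jac i i p *m delta_mx l 0).
  apply: mderive_near_eq (jac_along (delta_mx l 0) ip ip).
  apply: (@line_near _ _ (fun y => T i i y = y)).
  by apply: filterS (overlap_near ip ip) => _ [q [iq _] <-]; rewrite (chartK iq).
have e := mderive_uniq h (@mderive_line (chart M i p) (delta_mx l 0)).
have := congr1 (fun A : 'cV[R]_d => A a 0) e; rewrite -colE !mxE eqxx andbT => ->.
by [].
Qed.

(** Near the point the transition maps compose; the Jacobian of the composite is
    found by applying [mderive_transition] to the image of a coordinate line. *)
Lemma jac_cocycle i j k p : chart_dom M i p -> chart_dom M j p -> chart_dom M k p ->
  jac i k p = jac i j p *m jac j k p.
Proof.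
move=> ip jp kp; apply/matrixP => a l.
pose v : 'cV[R]_d := delta_mx l 0.
have h1 := jac_along v ip kp.
have h2 : mderive (fun s : R => T i k (chart M k p + s *: v)) 0 (jac i j p *m (jac j k p *m v)).
  have h3 := @mderive_transition i j p _ 0 _ ip jp _ (jac_along v jp kp).
  apply: mderive_near_eq (h3 _); last by rewrite scale0r addr0 (chartK kp).
  apply: (@line_near _ _ (fun y => T i j (T j k y) = T i k y)).
  by apply: filterS (overlap_near jp kp) => _ [q [jq kq] <-]; rewrite (chartK kq) (chartK jq).
have := congr1 (fun A : 'cV[R]_d => A a 0) (mderive_uniq h1 h2).
by rewrite mulmxA -!colE !mxE.
Qed.

End ChartChanges.

Section FrameAlong.
Context {R : realType} {d : nat} {M : oriented_manifold R d}.
Variables (g : riemannian_metric M) (nabla : connection M).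
Variable gamma : R -> M.
Hypothesis gamma_loop : smooth_loop gamma.
Implicit Types (i j k : chart_index M) (F : R -> 'M[R]_d).

Local Notation O i := (gamma @^-1` chart_dom M i).
Local Notation X i := (fun t => chart M i (gamma t)).
Local Notation U i := (chart M i @` chart_dom M i).
Local Notation G i := (fun t => gram g i (X i t)).
Local Notation om i := (fun t => conn_form (chris nabla) i (X i t) (dmx (X i) t)).

Definition in_chart m i (F : R -> 'M[R]_(d, m)) t : 'M[R]_(d, m) :=
  to_chart i (gamma t) *m F t.

Definition frame_along F : Prop :=
  [/\ forall t, (F t)^T *m metric_at g (gamma t) *m F t = 1%:M,
      forall t, F (t + 2 * pi) = F t & smooth_along gamma F].

Let cgamma : continuous gamma. Proof. by case: gamma_loop. Qed.
Let pgamma t : gamma (t + 2 * pi) = gamma t. Proof. by case: gamma_loop. Qed.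

Lemma chart_pre_open i : open (O i).
Proof. by apply: open_comp; [move=> t _; exact: cgamma|exact: (@dom_open R d M i)]. Qed.

Lemma curve_smooth i : smooth_mx (O i) (X i).
Proof. by apply/smooth_onP; [exact: chart_pre_open|case: gamma_loop]. Qed.

Lemma curve_dom i t : O i t -> U i (X i t).
Proof. by move=> Oit; exists (gamma t). Qed.

Lemma along_smooth m i (F : R -> 'M[R]_(d, m)) : smooth_along gamma F ->
  smooth_mx (O i) (in_chart i F).
Proof. by move=> h; apply/smooth_onP; [exact: chart_pre_open|exact: h]. Qed.

Lemma smooth_alongP m (F : R -> 'M[R]_(d, m)) :
  (forall i, smooth_mx (O i) (in_chart i F)) -> smooth_along gamma F.
Proof. by move=> h i; apply/(smooth_onP _ (@chart_pre_open i)); apply: h. Qed.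

Lemma in_chart_change m i j (F : R -> 'M[R]_(d, m)) t : O i t -> O j t ->
  in_chart j F t = jac j i (gamma t) *m in_chart i F t.
Proof.
move=> it jt; rewrite /in_chart mulmxA /to_chart -(@jac_cocycle R d M j i) //.
exact: dom_chart_at.
Qed.

Lemma in_chart_at m (F : R -> 'M[R]_(d, m)) t : in_chart (chart_at M (gamma t)) F t = F t.
Proof. by rewrite /in_chart /to_chart jac_id ?mul1mx //; exact: dom_chart_at. Qed.

Lemma gram_curve_smooth i : smooth_mx (O i) (G i).
Proof.
apply: (@smooth_mx_comp R d (U i) (O i) d d (gram g i) (X i)).
- exact: image_open.
- exact: chart_pre_open.
- exact: gram_smooth.
- exact: curve_smooth.
- exact: curve_dom.
Qed.

Lemma conn_curve_smooth i : smooth_mx (O i) (om i).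
Proof.
apply: smooth_mx_sum => a; apply: smooth_mxZ.
  exact: (smooth_dmx (@chart_pre_open i) (@curve_smooth i)).
apply: (@smooth_mx_comp R d (U i) (O i) d d (chris nabla i a) (X i)).
- exact: image_open.
- exact: chart_pre_open.
- exact: chris_smooth.
- exact: curve_smooth.
- exact: curve_dom.
Qed.

Lemma metric_in_chart i t m (F : R -> 'M[R]_(d, m)) : O i t ->
  (in_chart i F t)^T *m G i t *m in_chart i F t = (F t)^T *m metric_at g (gamma t) *m F t.
Proof.
move=> it; rewrite /in_chart /to_chart trmx_mul /metric_at.
rewrite (gram_change g it (dom_chart_at (gamma t))); by rewrite !mulmxA.
Qed.

Lemma chart_curve_derive i j t : O i t -> O j t ->
  dmx (X j) t = jac j i (gamma t) *m dmx (X i) t.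
Proof.
move=> it jt; apply: mderive_dmx.
have h := @mderive_transition R d M j i (gamma t) (X i) t _ jt it erefl
   (smooth_mderive (@curve_smooth i) it).
apply: (@mderive_near _ _ _ _ _ (O i) _ _ (@chart_pre_open i) it _ h) => s si.
by rewrite (chartK si).
Qed.

(** The directional derivative is the one that occurs in [conn_change], with the
    velocity of the curve as argument. *)
Lemma jac_curve_derive i j t : O i t -> O j t ->
  mderive (fun s => jac j i (gamma s)) t ('D_(dmx (X i) t) (jacx j i) (X i t)).
Proof.
move=> it jt.
pose Wd := chart M i @` (chart_dom M j `&` chart_dom M i).
have oW : open Wd by exact: overlap_open.
have WX : Wd (X i t) by exists (gamma t).
have sm a : smooth_on Wd (fun x => chart M j (cinv M i x) a 0 : R).
  move=> k; have := @transition_smooth R d M j i k; move/(Ck_on_mxP _ _ oW).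
  by apply.
have jxE x a l : Wd x -> jacx j i x a l = 'D_(delta_mx l 0) (fun x => chart M j (cinv M i x) a 0 : R) x.
  by move=> [p [jp ip] <-]; rewrite -(jacE a l jp ip).
have dj a l : Ck_on 1 Wd (fun x => jacx j i x a l : R).
  apply: (@Ck_on_ext R _ _ 1 Wd ('D_(delta_mx l 0) (fun x => chart M j (cinv M i x) a 0 : R))) => //.
    by move=> x Wx; rewrite jxE.
  by have [_] := sm a 2%N (delta_mx l 0).
have dd a l : differentiable (fun x => jacx j i x a l : R) (X i t).
  exact: (Ck_on_differentiable oW (dj a l) WX).
move=> a l; rewrite derive_mx; last first.
  by apply/derivable_mxP => b c; apply: diff_derivable (dd b c).
rewrite mxE; exact: (is_derive_chain (dd a l) (smooth_mderive (@curve_smooth i) it)).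
Qed.

(** Metric compatibility, contracted with the velocity of the curve. *)
Lemma gram_curve_derive i t : metric_compatible g nabla -> O i t ->
  mderive (G i) t ((om i t)^T *m G i t + G i t *m om i t).
Proof.
move=> mc it; have WX := @curve_dom i t it.
have oU : open (U i) := @image_open R d M i.
have dg a b : differentiable (fun x => gram g i x a b : R) (X i t).
  apply: (Ck_on_differentiable oU _ WX).
  by have := gram_smooth g i 1; move/(Ck_on_mxP _ _ oU); apply.
have dG : derivable (gram g i) (X i t) (dmx (X i) t).
  by apply/derivable_mxP => a b; apply: diff_derivable (dg a b).
have -> : (om i t)^T *m G i t + G i t *m om i t =
    \sum_c dmx (X i) t c 0 *: 'D_(delta_mx c 0) (gram g i) (X i t).
  rewrite /conn_form linear_sum mulmx_suml mulmx_sumr -big_split /=.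
  apply: eq_bigr => c _; rewrite (mc i (gamma t) c it) scalerDr.
  by rewrite linearZ /= -scalemxAl -scalemxAr.
move=> a b; rewrite summxE.
have := is_derive_chain (dg a b) (smooth_mderive (@curve_smooth i) it).
rewrite derive_partials // => h; apply: (is_derive_eq h); apply: eq_bigr => c _.
rewrite [RHS]mxE derive_mx; last first.
  by apply/derivable_mxP => a' b'; apply: diff_derivable (dg a' b').
by rewrite [Y in _ = _ * Y]mxE.
Qed.

(** The covariant derivative along the curve, column by column and in the
    coordinates of chart [i]. *)
Definition cov m i (F : R -> 'M[R]_(d, m)) t : 'M[R]_(d, m) :=
  dmx (in_chart i F) t + om i t *m in_chart i F t.

(** The derivative of the Jacobian along the curve cancels against the
    inhomogeneous term of [conn_change]. *)
Lemma cov_change m i j (F : R -> 'M[R]_(d, m)) t : smooth_along gamma F -> O i t -> O j t ->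
  cov j F t = jac j i (gamma t) *m cov i F t.
Proof.
move=> sF it jt; have sFi := along_smooth i sF.
have := mderiveM (jac_curve_derive it jt) (smooth_mderive sFi it).
move=> h; have /mderive_dmx e : mderive (in_chart j F) t
    ('D_(dmx (X i) t) (jacx j i) (X i t) *m in_chart i F t + jac j i (gamma t) *m dmx (in_chart i F) t).
  apply: (@mderive_near _ _ _ _ _ (O i `&` O j) _ _ _ (conj it jt) _ h).
    by apply: openI; exact: chart_pre_open.
  by move=> s [si sj]; rewrite (in_chart_change F si sj).
rewrite /cov e mulmxDr mulmxA (in_chart_change F it jt).
rewrite (conn_change nabla (dmx (X i) t) it jt) -(chart_curve_derive it jt).
by rewrite mulmxDl !mulmxA [RHS]addrCA [RHS]addrA.
Qed.

(** The matrix [A] with [nabla F = F A]: for an orthonormal frame, the transpose of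
    [F] times the Gram matrix inverts [F]. *)
Definition conn_matrix F t : 'M[R]_d :=
  let i := chart_at M (gamma t) in (in_chart i F t)^T *m G i t *m cov i F t.

(** Both factors transform under a change of chart, by inverse Jacobians; hence the
    matrix can be computed in a fixed chart, where it depends smoothly on [t]. *)
Lemma conn_matrixE F i t : smooth_along gamma F -> O i t ->
  conn_matrix F t = (in_chart i F t)^T *m G i t *m cov i F t.
Proof.
move=> sF it; have jt : O (chart_at M (gamma t)) t by exact: dom_chart_at.
rewrite /conn_matrix (cov_change sF it jt) (in_chart_change F it jt) trmx_mul.
by rewrite (gram_change g jt it) !mulmxA.
Qed.

Lemma frame_inverse F i t : frame_along F -> O i t ->
  in_chart i F t *m ((in_chart i F t)^T *m G i t) = 1%:M.
Proof. by move=> [h _ _] it; apply: mulmx1C; rewrite metric_in_chart. Qed.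

Lemma cov_frame F i t : frame_along F -> O i t ->
  cov i F t = in_chart i F t *m conn_matrix F t.
Proof.
move=> hF it; rewrite (conn_matrixE _ it); last by case: hF.
by rewrite mulmxA frame_inverse // mul1mx.
Qed.

Lemma conn_matrix_smooth F : frame_along F -> smooth_mx setT (conn_matrix F).
Proof.
move=> [_ _ sF]; apply: smooth_mx_local => t _.
pose i := chart_at M (gamma t); exists (O i); split.
- exact: chart_pre_open.
- exact: dom_chart_at.
have sFi := along_smooth i sF.
apply: (@smooth_mx_ext _ _ _ _ (fun t => (in_chart i F t)^T *m G i t *m cov i F t)).
- exact: chart_pre_open.
- by move=> s si; rewrite (conn_matrixE sF si).
apply: smooth_mxM; first by apply: smooth_mxM; [exact: smooth_mxT|exact: gram_curve_smooth].
apply: smooth_mxD; first exact: (smooth_dmx (@chart_pre_open i)).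
by apply: smooth_mxM => //; exact: conn_curve_smooth.
Qed.

Lemma compat_antisym (Fi D G0 o : 'M[R]_d) : G0^T = G0 ->
  (D^T *m G0 + Fi^T *m (o^T *m G0 + G0 *m o)) *m Fi + Fi^T *m G0 *m D = 0 ->
  (Fi^T *m G0 *m (D + o *m Fi))^T = - (Fi^T *m G0 *m (D + o *m Fi)).
Proof.
move=> sG e; apply/eqP; rewrite -addr_eq0 -[Y in _ == Y]e; apply/eqP.
rewrite !trmx_mul trmxK sG linearD /= trmx_mul !mulmxDl !mulmxDr !mulmxDl !mulmxA.
by rewrite -!addrA; congr (_ + _); congr (_ + _); rewrite addrC.
Qed.

(** The derivative of the orthonormality relation vanishes, and metric
    compatibility turns it into the sum of the connection matrix and its
    transpose. *)
Lemma conn_matrix_antisym F t : metric_compatible g nabla -> frame_along F ->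
  (conn_matrix F t)^T = - conn_matrix F t.
Proof.
move=> mc hF; have [hO _ sF] := hF; pose i := chart_at M (gamma t).
have it : O i t by exact: dom_chart_at.
have sFi := along_smooth i sF; have dF := smooth_mderive sFi it.
have h := mderiveM (mderiveM (mderiveT dF) (gram_curve_derive mc it)) dF.
have h1 : mderive (fun s => (in_chart i F s)^T *m G i s *m in_chart i F s) t 0.
  apply: (@mderive_near _ _ _ (fun=> 1%:M) _ (O i) _ _ (@chart_pre_open i) it).
    by move=> s si; rewrite metric_in_chart // hO.
  exact: mderive_cst.
have e := mderive_uniq h h1.
rewrite (conn_matrixE sF it) /cov; exact: (compat_antisym (gram_sym g it) e).
Qed.

Lemma dmx_periodic m n (F : R -> 'M[R]_(m, n)) t :
  (forall s, F (s + 2 * pi) = F s) -> dmx F (t + 2 * pi) = dmx F t.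
Proof.
move=> pF; apply/matrixP => a b; rewrite !mxE; rewrite /derive.
suff -> : (fun h : R => h^-1 *: (F (h *: (1 : R) + (t + 2 * pi)) a b - F (t + 2 * pi) a b)) =
  (fun h : R => h^-1 *: (F (h *: (1 : R) + t) a b - F t a b)) by [].
by apply/funext => h; rewrite addrA !pF.
Qed.

Lemma conn_matrix_periodic F t : frame_along F ->
  conn_matrix F (t + 2 * pi) = conn_matrix F t.
Proof.
move=> [_ pF _]; rewrite /conn_matrix /cov pgamma; set i := chart_at M _.
have pX s : X i (s + 2 * pi) = X i s by rewrite pgamma.
have pFi s : in_chart i F (s + 2 * pi) = in_chart i F s by rewrite /in_chart pgamma pF.
by rewrite (dmx_periodic _ pX) (dmx_periodic _ pFi) pFi.
Qed.

Lemma rotate_algebra (Fi A o Q B : 'M[R]_d) :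
  (Fi *m A - o *m Fi) *m Q + Fi *m (Q *m B - A *m Q) = - o *m (Fi *m Q) + Fi *m Q *m B.
Proof. by rewrite mulmxBl mulmxBr !mulmxA !mulNmx addrC subrKA addrC. Qed.

(** The hypothesis on [Q] is the gauge transformation from the connection matrix of
    [F] to the constant [B]. *)
Lemma cov_rotate F (Q : R -> 'M[R]_d) B i t : frame_along F -> O i t ->
  mderive Q t (Q t *m B - conn_matrix F t *m Q t) ->
  mderive (in_chart i (fun s => F s *m Q s)) t
     (- om i t *m in_chart i (fun s => F s *m Q s) t + in_chart i (fun s => F s *m Q s) t *m B).
Proof.
move=> hF it dQ; have [_ _ sF] := hF; have sFi := along_smooth i sF.
have h := mderiveM (smooth_mderive sFi it) dQ.
have E : in_chart i (fun s => F s *m Q s) = fun s => in_chart i F s *m Q s.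
  by apply/funext => s; rewrite /in_chart mulmxA.
rewrite E; apply: (mderive_eq h).
have -> : dmx (in_chart i F) t = in_chart i F t *m conn_matrix F t - om i t *m in_chart i F t.
  by rewrite -(cov_frame hF it) /cov addrK.
exact: rotate_algebra.
Qed.

End FrameAlong.

(** * Trivialization of the fibre by a frame *)

Section MeasurableCover.
Context {R : realType}.

(** The line is a countable union of rational intervals on each of which [f] is
    measurable. *)
Lemma measurable_fun_local (f : R -> R) :
  (forall t, exists N : set R, [/\ open N, N t & measurable_fun N f]) -> measurable_fun setT f.
Proof.
move=> hf _ Y mY; rewrite setTI.
pose good (a b : rat) := exists2 N : set R, `]ratr a, ratr b[ `<=` N & open N /\ measurable_fun N f.
pose S a b : set R := [set t | good a b /\ (t \in `]ratr a, ratr b[) /\ Y (f t)].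
have -> : f @^-1` Y = \bigcup_a \bigcup_b S a b.
  apply/seteqP; split=> [t Yt|t [a _ [b _ [_ [_ h]]]]]; last exact: h.
  have [N [oN Nt mN]] := hf t.
  have /nbhs_ballP[e e0 he] := open_nbhs_nbhs (conj oN Nt).
  have [|a ha] := @rat_in_itvoo R (t - e) t; first by rewrite ltrBlDr ltrDl.
  have [|b hb] := @rat_in_itvoo R t (t + e); first by rewrite ltrDl.
  move: ha hb; rewrite !in_itv /= => /andP[a1 a2] /andP[b1 b2].
  exists a => //; exists b => //; split; last by rewrite in_itv /= a2 b1.
  exists N => // s; rewrite /= in_itv /= => /andP[s1 s2]; apply: he.
  rewrite -ball_normE /= ltr_norml; apply/andP; split.
    by rewrite -subr_gt0; move: s1 s2 a1 b2; set x := ratr a; set y := ratr b; lra.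
  by move: s1 s2 a1 b2; set x := ratr a; set y := ratr b; lra.
apply: bigcupT_measurable_rat => a; apply: bigcupT_measurable_rat => b.
have [[N sN [oN mN]]|ng] := pselect (good a b); last first.
  rewrite (_ : S a b = set0); first exact: measurable0.
  by apply/seteqP; split=> // t [].
have mi : measurable (`]ratr a, ratr b[%classic : set R) by exact: measurable_itv.
have h := measurable_funS (open_measurable oN) sN mN.
move: (h mi Y mY).
congr measurable; apply/seteqP; split=> t; last by move=> [_ []].
by move=> [h1 h2]; split => //; exists N.
Qed.

End MeasurableCover.

Section FrameLift.
Context {R : realType} {d : nat} {M : oriented_manifold R d}.
Variables (g : riemannian_metric M) (gamma : R -> M).
Hypothesis gamma_loop : smooth_loop gamma.
Variable F : R -> 'M[R]_d.
Hypothesis hF : frame_along g gamma F.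
Local Notation C := R[i].
Local Notation V := (fockV R d).
Local Notation H := (fibreH g gamma).
Local Notation met := (fun t => metric_at g (gamma t)).

(** For [F] the frame of a spin loop [phi], this is [assoc gamma phi]; only the
    frame matters. *)
Definition lift (v : R -> 'cV[C]_d) : R -> 'cV[C]_d := fun t => cplx (F t) *m v t.
(** The transpose of an orthonormal frame times the Gram matrix is its inverse, and
    in this form it evidently depends smoothly on [t]. *)
Definition unlift (s : R -> 'cV[C]_d) : R -> 'cV[C]_d :=
  fun t => cplx ((F t)^T *m met t) *m s t.

Lemma liftK : cancel lift unlift.
Proof.
move=> v; apply/funext => t; rewrite /unlift /lift mulmxA -cplxM.
by have [h _ _] := hF; rewrite h cplx1 mul1mx.
Qed.

Lemma unliftK : cancel unlift lift.
Proof.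
move=> v; apply/funext => t; rewrite /unlift /lift mulmxA -cplxM.
have [h _ _] := hF; have := h t => /mulmx1C ->.
by rewrite cplx1 mul1mx.
Qed.

Lemma herm_lift t (x y : 'cV[C]_d) :
  herm (met t) (cplx (F t) *m x) (cplx (F t) *m y) = herm 1%:M x y.
Proof.
have [h _ _] := hF; rewrite /herm trmx_mul conjmxM conjmx_cplx -(h t) !cplxM.
have -> : (cplx (F t))^T = cplx (F t)^T by apply/matrixP => i j; rewrite !mxE.
by rewrite !mulmxA.
Qed.

Lemma herm_unlift t (x y : R -> 'cV[C]_d) :
  herm (met t) (x t) (y t) = herm 1%:M (unlift x t) (unlift y t).
Proof. by rewrite -{1}[x]unliftK -{1}[y]unliftK herm_lift. Qed.

Lemma dot_unlift (x y : R -> 'cV[C]_d) : hdot H x y = hdot V (unlift x) (unlift y).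
Proof.
change (L2_dot met x y = L2_dot (fun=> 1%:M) (unlift x) (unlift y)).
by congr cintegral; apply/funext => t; rewrite herm_unlift.
Qed.

Lemma cmeasurable_mulmx (E : set R) (B : R -> 'M[R]_d) (u : R -> 'cV[C]_d) :
  (forall i j, measurable_fun E (fun t => B t i j : R)) -> cmeasurable E u ->
  cmeasurable E (fun t => cplx (B t) *m u t).
Proof.
move=> mB mu k.
have ReE t : complex.Re ((cplx (B t) *m u t) k 0) = \sum_l B t k l * complex.Re (u t l 0).
  rewrite mxE (raddf_sum (@complex.Re R : Rcomplex R -> R)) /=; apply: eq_bigr => l _.
  by rewrite mxE; case: (u t l 0) => a b /=; rewrite mul0r subr0.
have ImE t : complex.Im ((cplx (B t) *m u t) k 0) = \sum_l B t k l * complex.Im (u t l 0).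
  rewrite mxE (raddf_sum (@complex.Im R : Rcomplex R -> R)) /=; apply: eq_bigr => l _.
  by rewrite mxE; case: (u t l 0) => a b /=; rewrite mul0r addr0.
split.
  rewrite (_ : (fun t => _) = fun t => \sum_l B t k l * complex.Re (u t l 0)); last exact/funext.
  by apply: measurable_sum => l; apply: measurable_funM => //; case: (mu l).
rewrite (_ : (fun t => _) = fun t => \sum_l B t k l * complex.Im (u t l 0)); last exact/funext.
by apply: measurable_sum => l; apply: measurable_funM => //; case: (mu l).
Qed.

Lemma smooth_mx_measurable (O : set R) m n (B : R -> 'M[R]_(m, n)) : open O -> smooth_mx O B ->
  forall i j, measurable_fun O (fun t => B t i j : R).
Proof.
move=> oO sB i j; apply: open_continuous_measurable_fun => // t; rewrite inE => Ot.
exact: smooth_fun_cont (sB i j) Ot.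
Qed.

Local Notation O i := (gamma @^-1` chart_dom M i).

(** Measurability of sections is defined chart by chart, on an open cover of the
    line; in each chart the frame and its inverse are continuous. *)
Lemma cmeasurable_unlift s : (forall i, cmeasurable (O i)
    (fun t => cplx (to_chart i (gamma t)) *m s t)) <-> cmeasurable setT (unlift s).
Proof.
have [hO _ sF] := hF; split=> h; last first.
  move=> i; rewrite (_ : (fun t => _) = fun t => cplx (in_chart gamma i F t) *m unlift s t).
    apply: cmeasurable_mulmx.
      exact: (smooth_mx_measurable (chart_pre_open gamma_loop (i := i)) (along_smooth gamma_loop i sF)).
    by move=> k; have [h1 h2] := h k; split; apply: measurable_funS h1 || apply: measurable_funS h2.
  apply/funext => t; rewrite /in_chart cplxM -mulmxA; congr (_ *m _).
  by have := congr1 (fun u : R -> 'cV[C]_d => u t) (unliftK s).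
have loc i : cmeasurable (O i) (unlift s).
  rewrite (_ : unlift s = fun t => unlift s t) //.
  pose B t := (in_chart gamma i F t)^T *m gram g i (chart M i (gamma t)).
  have sB : smooth_mx (O i) B.
    apply: smooth_mxM; first by apply: smooth_mxT; exact: (along_smooth gamma_loop i sF).
    exact: gram_curve_smooth.
  have hB := cmeasurable_mulmx (smooth_mx_measurable (chart_pre_open gamma_loop (i := i)) sB) (h i).
  have E t : O i t -> unlift s t = cplx (B t) *m (cplx (to_chart i (gamma t)) *m s t).
    move=> it; rewrite /unlift mulmxA -cplxM /B /in_chart /metric_at.
    by rewrite (gram_change g it (dom_chart_at (gamma t))) trmx_mul !mulmxA.
  move=> k; have [h1 h2] := hB k; split.
    by apply: eq_measurable_fun h1 => t; rewrite inE => it; rewrite -E.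
  by apply: eq_measurable_fun h2 => t; rewrite inE => it; rewrite -E.
move=> k; split; apply: measurable_fun_local => t;
  exists (O (chart_at M (gamma t))); split;
  by [exact: chart_pre_open|exact: dom_chart_at|case: (loc (chart_at M (gamma t)) k)].
Qed.

Lemma mem_unlift s : hmem H s <-> hmem V (unlift s).
Proof.
have [_ pF _] := hF; have [_ pg _] := gamma_loop.
have aE : antiperiodic s <-> antiperiodic (unlift s).
  split=> h t; first by rewrite /unlift h pg pF mulmxN.
  by rewrite -[s]unliftK /lift h pF mulmxN.
have fE : L2_finite met s <-> L2_finite (fun=> 1%:M) (unlift s).
  rewrite /L2_finite (_ : (fun t : R => _) =
    (fun t => (complex.Re (herm 1%:M (unlift s t) (unlift s t)))%:E)) //.
  by apply/funext => t; rewrite herm_unlift.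
change ([/\ antiperiodic s, forall i, cmeasurable (O i) (fun t => cplx (to_chart i (gamma t)) *m s t)
   & L2_finite met s] <-> [/\ antiperiodic (unlift s), cmeasurable setT (unlift s)
   & L2_finite (fun=> 1%:M) (unlift s)]).
have mE := cmeasurable_unlift s.
split=> -[h1 h2 h3].
  by split; [exact: (proj1 aE h1)|exact: (proj1 mE h2)|exact: (proj1 fE h3)].
by split; [exact: (proj2 aE h1)|exact: (proj2 mE h2)|exact: (proj2 fE h3)].
Qed.

Lemma unlift_lin (c : C) (x y : R -> 'cV[C]_d) :
  unlift (c *: x + y) = c *: unlift x + unlift y.
Proof.
apply/funext => t; rewrite /unlift.
change (cplx ((F t)^T *m met t) *m (c *: x t + y t) =
  c *: (cplx ((F t)^T *m met t) *m x t) + cplx ((F t)^T *m met t) *m y t).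
by rewrite mulmxDr -scalemxAr.
Qed.

Lemma unlift_conj (x : R -> 'cV[C]_d) : unlift (fun t => conjmx (x t)) = fun t => conjmx (unlift x t).
Proof. by apply/funext => t; rewrite /unlift conjmxM conjmx_cplx. Qed.

Local Notation dotH := (L2_dot met).
Local Notation dotV := (L2_dot (fun=> 1%:M)).

Lemma dot_plain (x y : R -> 'cV[C]_d) : dotH x y = dotV (unlift x) (unlift y).
Proof. exact: (dot_unlift x y). Qed.

Lemma unliftB (x y : R -> 'cV[C]_d) : unlift (x - y) = unlift x - unlift y.
Proof.
have := unlift_lin (-1) y x; rewrite scaleN1r scaleN1r addrC => ->.
by rewrite addrC.
Qed.

Let hV : is_hilbert V := fock_hilbert R d.

Lemma nrm2_unliftB (x y : R -> 'cV[C]_d) (e : R) :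
  (nrm2 ((x : hvec H) - y) <= e -> nrm2 ((unlift x : hvec V) - unlift y) <= e) /\
  (nrm2 ((unlift x : hvec V) - unlift y) < e -> nrm2 ((x : hvec H) - y) < e).
Proof.
have E : complex.Re (dotH (x - y) (x - y)) = complex.Re (dotV (unlift x - unlift y) (unlift x - unlift y)).
  by rewrite dot_plain unliftB.
split=> h.
  change (complex.Re (dotV (unlift x - unlift y) (unlift x - unlift y)) <= e).
  by rewrite -E.
change (complex.Re (dotH (x - y) (x - y)) < e).
by rewrite E.
Qed.

Lemma mem_unlift1 s : hmem H s -> hmem V (unlift s).
Proof. exact: (proj1 (mem_unlift s)). Qed.

Lemma mem_unlift2 s : hmem V (unlift s) -> hmem H s.
Proof. exact: (proj2 (mem_unlift s)). Qed.

Lemma mem_lift v : hmem V v -> hmem H (lift v).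
Proof. by move=> mv; apply: mem_unlift2; rewrite liftK; exact: mv. Qed.

(** The frame identifies the fibre with the Fock space, pointwise and without
    exceptional null sets, and transports all axioms. *)
Lemma fibre_hilbert : is_hilbert H.
Proof.
have u0 : unlift 0 = 0.
  by apply/funext => t; rewrite /unlift [X in _ *m X](_ : _ = 0); [exact: mulmx0|].
split.
- apply: mem_unlift2; rewrite u0; exact: (hmem0 hV).
- move=> c x y mx my; apply: mem_unlift2.
  change (hmem V (unlift (c *: (x : R -> 'cV[C]_d) + (y : R -> 'cV[C]_d)))).
  rewrite (unlift_lin c x y); exact: (hmem_lin hV c (mem_unlift1 mx) (mem_unlift1 my)).
- move=> c x y z mx my mz.
  change (dotH (c *: (x : R -> 'cV[C]_d) + (y : R -> 'cV[C]_d)) z = c * dotH x z + dotH y z).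
  rewrite !dot_plain unlift_lin.
  exact: (hdot_lin hV c (mem_unlift1 mx) (mem_unlift1 my) (mem_unlift1 mz)).
- move=> x y mx my; change (dotH y x = conjc (dotH x y)); rewrite !dot_plain.
  exact: (hdot_sym hV (mem_unlift1 mx) (mem_unlift1 my)).
- move=> x mx; change (0 <= complex.Re (dotH x x)); rewrite dot_plain.
  exact: (nrm2_ge0 hV (mem_unlift1 mx)).
- move=> u mu hu.
  have mu' n : hmem V (unlift (u n)) := mem_unlift1 (mu n).
  have hu' n : nrm2 ((unlift (u n.+1) : hvec V) - unlift (u n)) <= 4^-1 ^+ n.
    by move: (hu n); exact: (nrm2_unliftB (u n.+1) (u n) (4^-1 ^+ n)).1.
  have [x mx hx] := hcomplete hV mu' hu'.
  exists (lift x); first exact: mem_lift.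
  move=> e e0; have [N hN] := hx e e0; exists N => n Nn.
  apply: (nrm2_unliftB (lift x) (u n) e).2; rewrite liftK; exact: (hN n Nn).
- move=> x mx; apply: mem_unlift2.
  change (hmem V (unlift (fun t => conjmx ((x : R -> 'cV[C]_d) t)))); rewrite unlift_conj.
  exact: (hconj_mem hV (mem_unlift1 mx)).
- move=> c x y; apply/funext => t.
  exact: (conjmx_lin c ((x : R -> 'cV[C]_d) t) ((y : R -> 'cV[C]_d) t)).
- move=> x; apply/funext => t; exact: (conjmxK ((x : R -> 'cV[C]_d) t)).
- move=> x y mx my.
  change (dotH (fun t => conjmx ((x : R -> 'cV[C]_d) t)) (fun t => conjmx ((y : R -> 'cV[C]_d) t))
    = conjc (dotH x y)).
  rewrite !dot_plain !unlift_conj.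
  exact: (hdot_conj hV (mem_unlift1 mx) (mem_unlift1 my)).
Qed.

Lemma lift_lin (c : C) (x y : R -> 'cV[C]_d) : lift (c *: x + y) = c *: lift x + lift y.
Proof. by apply: (can_inj unliftK); rewrite unlift_lin !liftK. Qed.

Lemma lift_orthogonal : @orthogonal_map R V H lift.
Proof.
have hH := fibre_hilbert.
split.
- exact: mem_lift.
- move=> c x y _ _.
  change (complex.Re (dotH (lift (c *: (x : R -> 'cV[C]_d) + (y : R -> 'cV[C]_d)) - (c *: lift x + lift y))
     (lift (c *: (x : R -> 'cV[C]_d) + (y : R -> 'cV[C]_d)) - (c *: lift x + lift y))) = 0).
  rewrite lift_lin; exact: (heq_refl hH (c *: lift x + lift y)).
- move=> x y _ _; change (dotH (lift x) (lift y) = dotV x y); rewrite dot_plain !liftK; reflexivity.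
- move=> y my; exists (unlift y); first exact: mem_unlift1.
  have E := unliftK y; change (complex.Re (dotH (lift (unlift y) - y) (lift (unlift y) - y)) = 0).
  rewrite E; exact: (heq_refl hH y).
- move=> x mx.
  have -> : lift (hconj V x) = hconj H (lift x).
    apply: (can_inj unliftK); rewrite liftK.
    change ((hconj V x : R -> 'cV[C]_d) = unlift (fun t => conjmx (lift x t))).
    by rewrite unlift_conj liftK.
  exact: (heq_refl hH).
Qed.

End FrameLift.

(** * Frames with constant connection matrix *)

Section Determinant.
Context {R : realType}.

Lemma Ck_fun_prod k (O : set R) (I : Type) (r : seq I) (F : I -> R -> R) :
  (forall i, Ck_fun k O (F i)) -> Ck_fun k O (fun t => \prod_(i <- r) F i t).
Proof.
move=> h; elim: r => [|i r IH].
  rewrite (_ : (fun t => _) = fun=> 1); first exact: Ck_fun_cst.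
  by apply/funext => t; rewrite big_nil.
rewrite (_ : (fun t => _) = fun t => F i t * \prod_(j <- r) F j t).
  exact: Ck_funM.
by apply/funext => t; rewrite big_cons.
Qed.

Lemma smooth_det d (O : set R) (P : R -> 'M[R]_d) : smooth_mx O P ->
  smooth_fun O (fun t => \det (P t)).
Proof.
move=> sP k; rewrite /determinant; apply: Ck_fun_sum => s; apply: Ck_funM.
  exact: Ck_fun_cst.
by apply: Ck_fun_prod => i; apply: sP.
Qed.

(** The determinant of a smooth curve of orthogonal matrices squares to one, so
    its derivative vanishes. *)
Lemma det_orthogonal_curve d (P : R -> 'M[R]_d) : smooth_mx setT P ->
  (forall t, (P t)^T *m P t = 1%:M) -> forall s t, \det (P s) = \det (P t).
Proof.
move=> sP hP; pose f t := \det (P t).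
have f2 t : f t * f t = 1 by rewrite /f -{1}det_tr -det_mulmx hP det1.
have df t : is_derive t (1 : R) f ('D_1 f t) := smooth_fun_is_derive (smooth_det sP) I.
have f0 t : f t != 0 by apply/eqP => h; have := f2 t; rewrite h mul0r => /esym/eqP; rewrite oner_eq0.
have df0 t : is_derive t (1 : R) f 0.
  suff : 'D_1 f t = 0 by move=> h; have := df t; rewrite h.
  have h1 := is_derive_mulR (df t) (df t).
  have [_ h2] : is_derive t (1 : R) (fun s => f s * f s) 0.
    rewrite (_ : (fun s => _) = cst 1); first exact: is_derive_cst.
    by apply/funext => s; rewrite f2.
  have [_] := h1; rewrite h2 => /esym/eqP.
  rewrite mulrC -mulr2n -mulrnAl mulf_eq0 => /orP[|/eqP //].
  by rewrite mulrn_eq0 /= (negbTE (f0 t)).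
by move=> s t; exact: (@is_derive_0_is_cst _ f).
Qed.

End Determinant.

Section Adapted.
Context {R : realType} {d : nat} {M : oriented_manifold R d}.
Variables (g : riemannian_metric M) (nabla : connection M) (gamma : R -> M).
Hypothesis gamma_loop : smooth_loop gamma.

(** The bound on the spectrum of [B] keeps the shifts of the half-integer
    eigenvalues within 1/2, so that no mode of nonnegative frequency gets a
    negative eigenvalue. *)
Record adapted_frame (F : R -> 'M[R]_d) (B : 'M[R]_d) : Prop := AdaptedFrame {
  af_frame : frame_along g gamma F;
  af_antisym : B^T = - B;
  af_bound : forall (v : 'cV[R[i]]_d) (b : R), v != 0 ->
    cplx B *m v = Complex 0 b *: v -> `|b| <= 2^-1;
  af_cov : forall i t, chart_dom M i (gamma t) ->
    mderive (in_chart gamma i F) t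
      (- conn_form (chris nabla) i (chart M i (gamma t)) (dmx (fun t => chart M i (gamma t)) t)
         *m in_chart gamma i F t + in_chart gamma i F t *m B) }.

(** Parallel transport [P] solves a linear equation with antisymmetric periodic
    coefficients, hence is a curve of rotations with [P(t + 2 pi) = P(t) P(2 pi)].
    If [E] is a one-parameter group through the holonomy [P(2 pi)], then
    [P(t) E(- t)] is periodic and makes the connection matrix constant. *)
Lemma adapted_frame_exists F : metric_compatible g nabla -> frame_along g gamma F ->
  exists Q B, [/\ smooth_mx setT Q, forall t, Q (t + 2 * pi) = Q t
    & adapted_frame (fun t => F t *m Q t) B].
Proof.
move=> mc hF; have [a aE] : exists a, a = conn_matrix g nabla gamma F by eexists.
have sa : smooth_mx setT a by rewrite aE; exact: (conn_matrix_smooth nabla gamma_loop hF).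
have aT t : (a t)^T = - a t by rewrite aE; exact: (conn_matrix_antisym gamma_loop t mc hF).
have pa t : a (t + 2 * pi) = a t.
  by rewrite aE; exact: (conn_matrix_periodic nabla gamma_loop t hF).
have sNa : smooth_mx setT (fun t => - a t).
  rewrite (_ : (fun t => _) = fun t => (-1) *: a t); last by apply/funext => t; rewrite scaleN1r.
  by apply: smooth_mxZ => // k; apply: Ck_fun_cst.
have cNa : mcontinuous (fun t => - a t) by move=> i j t; apply: smooth_fun_cont (sNa i j) I.
have [P P0 dP] := linear_ode 1%:M cNa.
have sP : smooth_mx setT P := smooth_linear_ode sNa dP.
have dPT t : mderive (fun s => (P s)^T) t ((P t)^T *m a t).
  by apply: mderive_eq (mderiveT (dP t)) _; rewrite trmx_mul linearN /= aT opprK.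
have PTP t : (P t)^T *m P t = 1%:M.
  have h s : mderive (fun s => (P s)^T *m P s) s 0.
    apply: mderive_eq (mderiveM (dPT s) (dP s)) _.
    by rewrite mulNmx mulmxN mulmxA subrr.
  by rewrite (mderive0_cst h t 0) P0 trmx1 mulmx1.
have PPT t : P t *m (P t)^T = 1%:M by apply: mulmx1C.
have Pper t : P (t + 2 * pi) = P t *m P (2 * pi).
  have h s : mderive (fun s => (P s)^T *m P (s + 2 * pi)) s 0.
    apply: mderive_eq (mderiveM (dPT s) (mderive_shift (dP (s + 2 * pi)))) _.
    by rewrite pa mulNmx mulmxN mulmxA subrr.
  have := mderive0_cst h t 0; rewrite P0 trmx1 mul1mx add0r => <-.
  by rewrite mulmxA PPT mul1mx.
have dA : \det (P (2 * pi)) = 1 by rewrite (det_orthogonal_curve sP PTP (2 * pi) 0) P0 det1.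
have [E [B0 [B0T E0 E2 dE bB0]]] := rotation_log (PTP (2 * pi)) dA.
have dEm t : mderive (fun s => E (- s)) t (- (B0 *m E (- t))) := mderive_opp (dE (- t)).1.
have EEm t : E t *m E (- t) = 1%:M.
  have h s : mderive (fun s => E s *m E (- s)) s 0.
    apply: mderive_eq (mderiveM (dE s).1 (dEm s)) _.
    by rewrite mulmxN mulmxA (dE s).2 subrr.
  by rewrite (mderive0_cst h t 0) oppr0 E0 mulmx1.
have EmE t : E (- t) *m E t = 1%:M by apply: mulmx1C.
have ETE t : (E t)^T *m E t = 1%:M.
  have h s : mderive (fun s => (E s)^T *m E s) s 0.
    apply: mderive_eq (mderiveM (mderiveT (dE s).1) (dE s).1) _.
    by rewrite trmx_mul B0T mulmxN mulNmx mulmxA addNr.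
  by rewrite (mderive0_cst h t 0) E0 trmx1 mulmx1.
(* [E] commutes with the holonomy [P (2 * pi) = E (2 * pi)] *)
have Eper t : P (2 * pi) *m E (- (t + 2 * pi)) = E (- t).
  have h s : mderive (fun s => E s *m P (2 * pi) *m E (- (s + 2 * pi))) s 0.
    have h1 := mderive_shift (dEm (s + 2 * pi)).
    apply: mderive_eq (mderiveM (mderiveM (dE s).1 (mderive_cst _ _)) h1) _.
    rewrite mulmx0 addr0 mulmxN !mulmxA -E2 (dE s).2 -[E s *m B0 *m _]mulmxA.
    by rewrite (dE (2 * pi)).2 !mulmxA subrr.
  have := mderive0_cst h t 0; rewrite E0 mul1mx add0r -E2 EEm => e.
  rewrite -[LHS]mul1mx -(EmE t) -!mulmxA; move: e; rewrite -mulmxA => ->.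
  by rewrite mulmx1.
pose Q t := P t *m E (- t).
have dQ t : mderive Q t (Q t *m (- B0) - a t *m Q t).
  apply: mderive_eq (mderiveM (dP t) (dEm t)) _.
  rewrite /Q !mulmxN mulNmx -!mulmxA -(dE (- t)).2.
  by rewrite addrC mulNmx mulmxA.
have sE : smooth_mx setT (fun t => E (- t)).
  apply: (@smooth_linear_ode _ _ _ _ (fun=> - B0)); first exact: smooth_mx_cst.
  by move=> t; rewrite mulNmx.
have sQ : smooth_mx setT Q by apply: smooth_mxM.
have Qper t : Q (t + 2 * pi) = Q t by rewrite /Q Pper -mulmxA Eper.
exists Q, (- B0); split=> //; split.
- have [hO pF sF] := hF; split.
  + move=> t; have -> : (F t *m Q t)^T *m metric_at g (gamma t) *m (F t *m Q t) =
      (Q t)^T *m ((F t)^T *m metric_at g (gamma t) *m F t) *m Q t.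
      by rewrite trmx_mul !mulmxA.
    by rewrite hO mulmx1 /Q trmx_mul -mulmxA [(P t)^T *m _]mulmxA PTP mul1mx ETE.
  + by move=> t; rewrite pF Qper.
  + apply: (smooth_alongP gamma_loop) => i.
    rewrite (_ : in_chart gamma i _ = fun t => in_chart gamma i F t *m Q t).
      apply: smooth_mxM; first exact: (along_smooth gamma_loop i sF).
      exact: smooth_mx_sub sQ.
    by apply/funext => t; rewrite /in_chart mulmxA.
- by rewrite linearN /= B0T.
- move=> v b v0 hv; rewrite -normrN; apply: bB0 v0 _.
  by rewrite -[B0]opprK cplxN mulNmx hv -scaleNr; congr (_ *: v); apply/eqP; rewrite eq_complex /= oppr0 !eqxx.
- by move=> i t it; apply: (cov_rotate gamma_loop hF it); have := dQ t; rewrite aE.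
Qed.

End Adapted.

(** * The Dirac operator in an adapted frame *)

Section VectorDerivative.
Context {R : realType} {d : nat}.
Local Notation C := R[i].
Implicit Types v : R -> 'cV[C]_d.

Definition cvderive v t (l : 'cV[C]_d) : Prop :=
  forall k, is_cderive (fun s => v s k 0) t (l k 0).

Lemma cderiveE v t l : cvderive v t l -> cderive v t = l.
Proof.
move=> h; apply/colP => k; rewrite mxE; have [[_ a1] [_ a2]] := h k.
by apply/eqP; rewrite eq_complex /= -a1 -a2 !eqxx.
Qed.

Lemma cvderive_mul (G : R -> 'M[R]_d) G' v t l : mderive G t G' -> cvderive v t l ->
  cvderive (fun s => cplx (G s) *m v s) t (cplx G' *m v t + cplx (G t) *m l).
Proof.
move=> hG hv k.
have -> : (cplx G' *m v t + cplx (G t) *m l) k 0 =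
    \sum_j ((G' k j)%:C%C * v t j 0 + (G t k j)%:C%C * l j 0).
  rewrite !mxE -big_split /=; apply: eq_bigr => j _; by rewrite !mxE.
rewrite (_ : (fun s => _) = fun s => \sum_j (G s k j)%:C%C * v s j 0).
  by apply: is_cderive_sum => j; apply: is_cderiveM; [exact: is_cderive_real|exact: hv].
by apply/funext => s; rewrite mxE; apply: eq_bigr => j _; rewrite mxE.
Qed.

Lemma cvderive_osc n (w : 'cV[C]_d) t :
  cvderive (osc n w) t (Complex 0 (- (n%:~R + 2^-1)) *: osc n w t).
Proof.
move=> k; rewrite (_ : (fun s => _) = fun s => w k 0 * ce (- (n%:~R + 2^-1) * s)).
  rewrite (_ : (_ *: osc n w t) k 0 = w k 0 * (Complex 0 (- (n%:~R + 2^-1)) * ce (- (n%:~R + 2^-1) * t))).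
    exact: is_cderiveZ (is_cderive_ce _ t).
  by rewrite /osc 2!mxE mulNr [RHS]mulrCA [w k 0 * _]mulrC.
by apply/funext => s; rewrite /osc mxE mulNr mulrC.
Qed.

Lemma smooth_cos_sin (a : R) k :
  Ck_fun k setT (fun s : R => cos (a * s)) /\ Ck_fun k setT (fun s : R => sin (a * s)).
Proof.
have dl t : is_derive t (1 : R) (fun s : R => a * s) a.
  rewrite (_ : (fun s => _) = a \*: (@id R)) //.
  by apply: is_derive_eq; rewrite /GRing.scale /= mulr1.
have dc t : is_derive t (1 : R) (fun s : R => cos (a * s)) ((- a) * sin (a * t)).
  have h := dl t; rewrite (_ : (fun s => _) = cos \o (fun s => a * s)) //.
  by apply: is_derive_eq; rewrite /GRing.scale /=; ring.
have ds t : is_derive t (1 : R) (fun s : R => sin (a * s)) (a * cos (a * t)).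
  have h := dl t; rewrite (_ : (fun s => _) = sin \o (fun s => a * s)) //.
  by apply: is_derive_eq; rewrite /GRing.scale /=; ring.
elim: k => [|k [IHc IHs]].
  by split=> t _; [exact: is_derive_cont (dc t)|exact: is_derive_cont (ds t)].
split; [exists (fun t => (- a) * sin (a * t))|exists (fun t => a * cos (a * t))] => //.
  by apply: Ck_funM IHs; apply: Ck_fun_cst.
by apply: Ck_funM IHc; apply: Ck_fun_cst.
Qed.

Definition csmooth (O : set R) v : Prop :=
  smooth_mx O (fun t => map_mx (@complex.Re R) (v t)) /\
  smooth_mx O (fun t => map_mx (@complex.Im R) (v t)).

Lemma csmooth_osc n (w : 'cV[C]_d) O : csmooth O (osc n w).
Proof.
have h k : Ck_fun k O (fun s : R => cos (- (n%:~R + 2^-1) * s)) /\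
           Ck_fun k O (fun s : R => sin (- (n%:~R + 2^-1) * s)).
  by have [h1 h2] := smooth_cos_sin (- (n%:~R + 2^-1)) k; split; apply: Ck_fun_sub h1 || apply: Ck_fun_sub h2.
split=> i j k; have [hc hs] := h k.
  rewrite (_ : (fun t => _) = fun t => complex.Re (w i j) * cos (- (n%:~R + 2^-1) * t)
     + (- complex.Im (w i j)) * sin (- (n%:~R + 2^-1) * t)).
    by apply: Ck_funD; apply: Ck_funM => //; apply: Ck_fun_cst.
  apply/funext => t; rewrite /osc !mxE -mulNr /ce; case: (w i j) => x y /=; ring.
rewrite (_ : (fun t => _) = fun t => complex.Im (w i j) * cos (- (n%:~R + 2^-1) * t)
   + complex.Re (w i j) * sin (- (n%:~R + 2^-1) * t)).
  by apply: Ck_funD; apply: Ck_funM => //; apply: Ck_fun_cst.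
apply/funext => t; rewrite /osc !mxE -mulNr /ce; case: (w i j) => x y /=; ring.
Qed.

Lemma Re_mulmx (G : 'M[R]_d) (x : 'cV[C]_d) :
  map_mx (@complex.Re R) (cplx G *m x) = G *m map_mx (@complex.Re R) x.
Proof.
apply/colP => k; rewrite !mxE (raddf_sum (@complex.Re R : Rcomplex R -> R)) /=.
apply: eq_bigr => l _; rewrite !mxE; case: (x l 0) => a b /=; by rewrite mul0r subr0.
Qed.

Lemma Im_mulmx (G : 'M[R]_d) (x : 'cV[C]_d) :
  map_mx (@complex.Im R) (cplx G *m x) = G *m map_mx (@complex.Im R) x.
Proof.
apply/colP => k; rewrite !mxE (raddf_sum (@complex.Im R : Rcomplex R -> R)) /=.
apply: eq_bigr => l _; rewrite !mxE; case: (x l 0) => a b /=; by rewrite mul0r addr0.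
Qed.

Lemma csmooth_cvderive v t : csmooth setT v -> cvderive v t (cderive v t).
Proof.
move=> [hr hi] k; rewrite mxE; split => /=.
  have := smooth_mderive hr I => /(_ t) /(_ k 0); rewrite mxE => h.
  rewrite (_ : (fun s => complex.Re (v s k 0)) = fun s => map_mx (@complex.Re R) (v s) k 0) //.
  by apply/funext => s; rewrite mxE.
have := smooth_mderive hi I => /(_ t) /(_ k 0); rewrite mxE => h.
rewrite (_ : (fun s => complex.Im (v s k 0)) = fun s => map_mx (@complex.Im R) (v s) k 0) //.
by apply/funext => s; rewrite mxE.
Qed.

End VectorDerivative.

Section DiracInFrame.
Context {R : realType} {d : nat} {M : oriented_manifold R d}.
Variables (g : riemannian_metric M) (nabla : connection M) (gamma : R -> M).
Hypothesis gamma_loop : smooth_loop gamma.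
Variables (F : R -> 'M[R]_d) (B : 'M[R]_d).
Hypothesis hFB : adapted_frame g nabla gamma F B.
Local Notation C := R[i].
Let hF : frame_along g gamma F := af_frame hFB.

(** The connection form cancels against the derivative of the frame, which leaves
    the constant matrix [B]. *)
Lemma covariant_derivative_lift (v : R -> 'cV[C]_d) t l : cvderive v t l ->
  covariant_derivative nabla gamma (lift F v) t = cplx (F t) *m (l + cplx B *m v t).
Proof.
move=> hv; rewrite /covariant_derivative.
set i := chart_at M (gamma t).
have it : chart_dom M i (gamma t) by exact: dom_chart_at.
have hd := smooth_mderive (curve_smooth gamma_loop i) it.
have [_ ->] := mderive_curve hd.
have E : (fun r => cplx (to_chart i (gamma r)) *m lift F v r) =
    (fun r => cplx (in_chart gamma i F r) *m v r).
  by apply/funext => r; rewrite /lift /in_chart cplxM mulmxA.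
rewrite E (cderiveE (cvderive_mul (af_cov hFB it) hv)) /lift.
rewrite (in_chart_at gamma F t); move: (conn_form _ _ _ _) => om.
rewrite cplxD !cplxM cplxN mulmxDl mulmxDr !mulmxA !mulNmx.
by rewrite addrC !addrA addrN add0r addrC.
Qed.

Lemma dirac_lift (v : R -> 'cV[C]_d) t l : cvderive v t l ->
  dirac_operator nabla gamma (lift F v) t = cplx (F t) *m (Complex 0 1 *: (l + cplx B *m v t)).
Proof. by move=> hv; rewrite /dirac_operator (covariant_derivative_lift hv) -scalemxAr. Qed.

Lemma smooth_lift v : csmooth setT v -> smooth_section gamma (lift F v).
Proof.
have [_ _ sF] := hF => -[hr hi]; split; apply: (smooth_alongP gamma_loop) => i.
  rewrite (_ : in_chart gamma i _ = fun t => in_chart gamma i F t *m map_mx (@complex.Re R) (v t)).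
    apply: smooth_mxM; first exact: (along_smooth gamma_loop i sF).
    exact: smooth_mx_sub hr.
  by apply/funext => t; rewrite /in_chart /lift Re_mulmx mulmxA.
rewrite (_ : in_chart gamma i _ = fun t => in_chart gamma i F t *m map_mx (@complex.Im R) (v t)).
  apply: smooth_mxM; first exact: (along_smooth gamma_loop i sF).
  exact: smooth_mx_sub hi.
by apply/funext => t; rewrite /in_chart /lift Im_mulmx mulmxA.
Qed.

Lemma smooth_unlift s : smooth_section gamma s -> csmooth setT (unlift g gamma F s).
Proof.
have [_ _ sF] := hF => -[hr hi].
have loc (f : R -> 'cV[R]_d) : smooth_along gamma f ->
    smooth_mx setT (fun t => ((F t)^T *m metric_at g (gamma t)) *m f t).
  move=> hf; apply: smooth_mx_local => t _; set i := chart_at M (gamma t).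
  exists (gamma @^-1` chart_dom M i); split.
  - exact: chart_pre_open.
  - exact: dom_chart_at.
  apply: (@smooth_mx_ext _ _ _ _ (fun t => ((in_chart gamma i F t)^T *m
     gram g i (chart M i (gamma t))) *m in_chart gamma i f t)).
  - exact: chart_pre_open.
  - move=> r ir; rewrite /in_chart /metric_at (gram_change g ir (dom_chart_at (gamma r))).
    by rewrite trmx_mul !mulmxA.
  apply: smooth_mxM; last exact: (along_smooth gamma_loop i hf).
  apply: smooth_mxM; last exact: gram_curve_smooth.
  by apply: smooth_mxT; exact: (along_smooth gamma_loop i sF).
split; [have := loc _ hr|have := loc _ hi].
  by congr smooth_mx; apply/funext => t; rewrite /unlift Re_mulmx.
by congr smooth_mx; apply/funext => t; rewrite /unlift Im_mulmx.
Qed.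

Lemma lift_inj t (x y : 'cV[C]_d) : cplx (F t) *m x = cplx (F t) *m y -> x = y.
Proof.
have [h _ _] := hF => e; have := congr1 (mulmx (cplx ((F t)^T *m metric_at g (gamma t)))) e.
by rewrite !mulmxA -!cplxM h cplx1 !mul1mx.
Qed.

(** The mode of frequency [n + 1/2] contributes [n + 1/2], the eigenvalue [i b] of
    [B] contributes [- b]. *)
Lemma dirac_eigen_osc n (w : 'cV[C]_d) (b : R) : w != 0 ->
  cplx B *m w = Complex 0 b *: w ->
  dirac_eigenvector nabla gamma (n%:~R + 2^-1 - b) (lift F (osc n w)).
Proof.
move=> w0 hw; have [_ pF _] := hF; split.
- exact/smooth_lift/csmooth_osc.
- by move=> t; rewrite /lift pF osc_antiperiodic mulmxN.
- move=> h; have : lift F (osc n w) 0 = 0 by rewrite h.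
  rewrite /lift -(mulmx0 _ (cplx (F 0))) => /lift_inj.
  rewrite /osc mulr0 oppr0 ce0 scale1r => e; by rewrite e eqxx in w0.
move=> t; rewrite (dirac_lift (cvderive_osc n w t)) /lift scalemxAr; congr (_ *m _).
have -> : cplx B *m osc n w t = Complex 0 b *: osc n w t.
  by rewrite /osc -scalemxAr hw scalerA mulrC -scalerA.
rewrite -scalerDl scalerA; congr (_ *: _).
by apply/eqP; rewrite eq_complex /=; apply/andP; split; apply/eqP; ring.
Qed.

(** In the adapted frame the eigenvalue equation is an ordinary differential
    equation with constant coefficients. *)
Lemma dirac_eigen_ode (lambda : R) s : dirac_eigenvector nabla gamma lambda s ->
  let v := unlift g gamma F s in
  [/\ antiperiodic v, lift F v = s & forall t,
    cvderive v t (- (cplx B *m v t) + Complex 0 (- lambda) *: v t)].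
Proof.
move=> [ss as_ _ hs]; have [_ pF _] := hF; have [_ pg _] := gamma_loop; split.
- by move=> t; rewrite /unlift as_ pg pF mulmxN.
- exact: (unliftK hF).
move=> t; set v := unlift g gamma F s.
have hv := csmooth_cvderive t (smooth_unlift ss).
have := hs t; rewrite -[s in LHS](unliftK hF) (dirac_lift hv) -[s t](congr1 (fun u : R -> 'cV[C]_d => u t) (unliftK hF s)).
rewrite -/v /lift scalemxAr => /lift_inj e.
suff <- : cderive v t = - (cplx B *m v t) + Complex 0 (- lambda) *: v t by [].
apply/eqP; rewrite addrC -subr_eq opprK; apply/eqP.
have := congr1 (fun z => Complex 0 (-1) *: z) e.
have i2 (z : 'cV[C]_d) : Complex 0 (-1) *: (Complex 0 1 *: z) = z.
  rewrite scalerA (_ : _ * _ = 1) ?scale1r //.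
  by apply/eqP; rewrite eq_complex /=; apply/andP; split; apply/eqP; ring.
rewrite i2 => ->; rewrite scalerA; congr (_ *: _).
by apply/eqP; rewrite eq_complex /=; apply/andP; split; apply/eqP; ring.
Qed.

End DiracInFrame.

(** * Eigenvalues and orthogonality *)

Section AntisymmetricSpectrum.
Context {R : realType} {d' : nat}.
Local Notation d := d'.+1.
Local Notation C := R[i].
Implicit Types B : 'M[R]_d.

Lemma herm_antisym B (x y : 'cV[C]_d) : B^T = - B ->
  herm 1%:M (cplx B *m x) y = - herm 1%:M x (cplx B *m y).
Proof.
move=> BT; rewrite /herm trmx_mul conjmxM conjmx_cplx cplx1 !mulmx1 mulmxA.
have -> : (cplx B)^T = - cplx B by rewrite -cplxN -BT; apply/matrixP => i j; rewrite !mxE.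
by rewrite mulmxN mulNmx mxE.
Qed.

(** The multiplicities agree because the matrix [i (f(B) - f(- B))], for [f] the
    indicator of [i c], is real: its trace is [i] times their difference. *)
Lemma antisym_eigen_frame B : B^T = - B ->
  exists (w : 'I_d -> 'cV[C]_d) (beta : 'I_d -> R),
    [/\ unitary_frame w, forall j, cplx B *m w j = Complex 0 (beta j) *: w j
      & forall c : R, #|[pred j | beta j == c]| = #|[pred j | beta j == - c]|].
Proof.
move=> BT; have [|W [mu eb]] := @eigenbasis_exists _ _ B; first by rewrite BT mulmxN mulNmx.
have mu_im j : mu j = Complex 0 (complex.Im (mu j)).
  have : @fcalc R d W mu (fun z => conjc z) = @fcalc R d W mu (fun z => -1 * z).
    rewrite -fcalcZ scaleN1r (fcalc_id eb) -cplxN -BT -cplxT -(fcalc_id eb).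
    by rewrite fcalc_adj.
  move=> /(fcalc_inj eb) /(_ j); case: (mu j) => a b /eqP; rewrite mulN1r eq_complex /=.
  by move=> /andP[/eqP h _]; apply/eqP; rewrite eq_complex /= eqxx andbT; apply/eqP; lra.
have W1 := eb_unitary eb; have W2 : W *m conjmx W^T = 1%:M by apply: mulmx1C.
exists (fun j => col j W), (fun j => complex.Im (mu j)); split.
- split=> [i j|v].
    transitivity (conjc ((1%:M : 'M[C]_d) i j)); last by rewrite mxE rmorph_nat.
    rewrite -W1 herm1E mxE rmorph_sum; apply: eq_bigr => k _.
    by rewrite !mxE /= conjcM conjcK.
  rewrite -[LHS]mul1mx -W2 -mulmxA; apply/colP => k; rewrite mxE summxE.
  apply: eq_bigr => j _; rewrite [RHS]mxE [col j W k 0]mxE mulrC; congr (_ * _).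
  rewrite herm1E mxE; apply: eq_bigr => l _; by rewrite !mxE mulrC.
- move=> j; rewrite -mu_im; apply/colP => k.
  have := congr1 (fun A : 'M[C]_d => A k j) (eb_eigen eb).
  rewrite mul_mx_diag [LHS]mxE [RHS]mxE [(\row__ _) 0 j]mxE mulrC => e.
  rewrite [LHS]mxE [RHS]mxE [col j W k 0]mxE -e; apply: eq_bigr => l _.
  by rewrite [col j W l 0]mxE.
move=> c; pose f (z : C) : C := (z == Complex 0 c)%:R.
pose h (z : C) : C := Complex 0 1 * (f z - f (conjc z)).
have [A hA] : exists A, @fcalc R d W mu h = cplx A.
  apply: (fcalc_real eb) => z; rewrite /h conjcK conjcM.
  have -> : conjc (f z - f (conjc z)) = f z - f (conjc z).
    by rewrite rmorphB /= /f !rmorph_nat.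
  have -> : conjc (Complex 0 1 : C) = - Complex 0 1 by apply/eqP; rewrite eq_complex /= oppr0 !eqxx.
  by rewrite mulNr -mulrN opprB.
have tr : \sum_j h (mu j) = (\tr A)%:C%C.
  have := congr1 (@mxtrace _ d) hA; rewrite /fcalc mxtrace_mulC mulmxA W1 mul1mx.
  rewrite mxtrace_diag; under eq_bigr do rewrite mxE.
  move=> ->; rewrite /mxtrace rmorph_sum; by apply: eq_bigr => j _; rewrite mxE.
have fE (P : pred 'I_d) : \sum_j ((P j)%:R : C) = (#|[pred j | P j]|%:R : R)%:C%C.
  rewrite -natr_sum rmorph_nat; congr _%:R.
  by rewrite -sum1_card [RHS]big_mkcond /=; apply: eq_bigr => j _; rewrite inE; case: (P j).
have : (#|[pred j | complex.Im (mu j) == c]|%:R : R) = #|[pred j | complex.Im (mu j) == - c]|%:R.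
  have e1 j : f (mu j) = (complex.Im (mu j) == c)%:R.
    by rewrite /f mu_im eq_complex /= eqxx.
  have e2 j : f (conjc (mu j)) = (complex.Im (mu j) == - c)%:R.
    by rewrite /f mu_im eq_complex /= eqxx eqr_oppLR.
  move: tr; rewrite /h -mulr_sumr sumrB; under eq_bigr do rewrite e1.
  under [X in _ - X]eq_bigr do rewrite e2.
  rewrite !fE -rmorphB /= => /(congr1 (@complex.Im R)) /=; rewrite mul0r mul1r add0r.
  by move/eqP; rewrite subr_eq0 => /eqP.
by move/eqP; rewrite eqr_nat => /eqP.
Qed.

End AntisymmetricSpectrum.

Section FourierOrthogonality.
Context {R : realType} {d : nat}.
Local Notation C := R[i].
Local Notation V := (fockV R d).
Local Notation D := (`[0, 2 * pi]%classic : set R).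

Lemma cvderive_herm (u v : R -> 'cV[C]_d) t l m : cvderive u t l -> cvderive v t m ->
  is_cderive (fun s => herm 1%:M (u s) (v s)) t (herm 1%:M l (v t) + herm 1%:M (u t) m).
Proof.
move=> hu hv; rewrite !herm1E -big_split /=.
rewrite (_ : (fun s => _) = fun s => \sum_k u s k 0 * conjc (v s k 0)).
  by apply: is_cderive_sum => k; apply: is_cderiveM; [exact: hu|apply: is_cderive_conj; exact: hv].
by apply/funext => s; rewrite herm1E.
Qed.

Lemma cvderive_fock_mem (v v' : R -> 'cV[C]_d) : antiperiodic v ->
  (forall t, cvderive v t (v' t)) -> hmem V v.
Proof.
move=> av hv; have cv k : ccontinuous (fun t => v t k 0).
  exact: (@cderive_continuous R (fun t => v t k 0) (fun t => v' t k 0) (fun t => hv t k)).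
apply/fock_memP; split=> //.
  by move=> k; have [c1 c2] := cv k; split; apply: continuous_measurable_fun.
apply: (@continuous_integrable R (fun t => nsq (v t))) => t.
apply: (@Ck_fun_sum R 0 setT _ _ (fun k t => csq (v t k 0))) => // k; rewrite /csq.
have [c1 c2] := cv k.
by apply: (@Ck_funD R 0); [apply: (@Ck_funM R 0)|apply: (@Ck_funM R 0)] => s _; (exact: c1 || exact: c2).
Qed.

(** The pointwise product of [v] with the mode is periodic, and its derivative is a
    multiple of it by [i] times the difference of the eigenvalues; integration
    over a period gives zero. *)
Lemma eigen_orthogonal (B : 'M[R]_d) (lambda b : R) (v : R -> 'cV[C]_d) n (w : 'cV[C]_d) :
  (forall x y : 'cV[C]_d, herm 1%:M (cplx B *m x) y = - herm 1%:M x (cplx B *m y)) ->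
  antiperiodic v ->
  (forall t, cvderive v t (- (cplx B *m v t) + Complex 0 (- lambda) *: v t)) ->
  cplx B *m w = Complex 0 b *: w -> n%:~R + 2^-1 - b != lambda ->
  hdot V v (osc n w) = 0.
Proof.
move=> hB av hv hw ne.
pose h t := herm 1%:M (v t) (osc n w t).
pose kap : C := Complex 0 (n%:~R + 2^-1 - b - lambda).
have Bo t : cplx B *m osc n w t = Complex 0 b *: osc n w t.
  by rewrite /osc -scalemxAr hw scalerA mulrC -scalerA.
have hZl c (x y : 'cV[C]_d) : herm 1%:M (c *: x) y = c * herm 1%:M x y.
  by rewrite -[y in LHS]scale1r herm1Z rmorph1 mulr1.
have hZr c (x y : 'cV[C]_d) : herm 1%:M x (c *: y) = conjc c * herm 1%:M x y.
  by rewrite -[x in LHS]scale1r herm1Z mul1r.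
have dh t : is_cderive h t (kap * h t).
  have := cvderive_herm (hv t) (cvderive_osc n w t).
  rewrite -scaleN1r herm1_lin hB Bo !hZr hZl; set z := herm 1%:M (v t) (osc n w t).
  have -> : kap * h t = -1 * - (conjc (Complex 0 b) * z) + Complex 0 (- lambda) * z
      + conjc (Complex 0 (- (n%:~R + 2^-1))) * z.
    have -> : kap = conjc (Complex 0 b) + Complex 0 (- lambda) + conjc (Complex 0 (- (n%:~R + 2^-1))).
      by apply/eqP; rewrite eq_complex /=; apply/andP; split; apply/eqP; ring.
    rewrite -[h t]/z; ring.
  rewrite (_ : z = conjc (ce (- ((n%:~R + 2^-1) * t))) * herm 1%:M (v t) w); last by rewrite -hZr.
  by congr is_cderive; ring.
have ch : ccontinuous h := cderive_continuous dh.
have := @cintegral_derive R h (fun t => kap * h t) dh (ccontinuousM (ccontinuous_cst _) ch).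
have -> : h (2 * pi) = h 0.
  have hN (x y : 'cV[C]_d) : herm 1%:M (- x) (- y) = herm 1%:M x y.
    by rewrite -(scaleN1r x) -(scaleN1r y) herm1Z rmorphN rmorph1 mulrN mulr1 opprK mul1r.
  have p1 : v (2 * pi) = - v 0 by rewrite -[LHS](congr1 v (add0r _)) av.
  have p2 : osc n w (2 * pi) = - osc n w 0.
    exact: etrans (congr1 (osc n w) (esym (add0r _))) (osc_antiperiodic n w 0).
  change (herm 1%:M (v (2 * pi)) (osc n w (2 * pi)) = herm 1%:M (v 0) (osc n w 0)).
  by rewrite p1 p2; exact: hN.
rewrite subrr cintegralZ; last exact: ccontinuous_cintegrable.
move=> /eqP; rewrite mulf_eq0 => /orP[|/eqP //].
by rewrite eq_complex /= eqxx /= subr_eq0 (negbTE ne).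
Qed.

End FourierOrthogonality.

(** * The Dirac sublagrangian *)

Section DiracSpectrum.
Context {R : realType} {d' : nat} {M : oriented_manifold R d'.+1}.
Local Notation d := d'.+1.
Local Notation C := R[i].
Local Notation freq := (@freq d').
Local Notation comp := (@comp d').
Variables (g : riemannian_metric M) (nabla : connection M) (gamma : R -> M).
Hypothesis gamma_loop : smooth_loop gamma.
Variables (F : R -> 'M[R]_d) (B : 'M[R]_d).
Hypothesis hFB : adapted_frame g nabla gamma F B.
Local Notation V := (fockV R d).
Local Notation H := (fibreH g gamma).
Let hF : frame_along g gamma F := af_frame hFB.
Let hV : is_hilbert V := fock_hilbert R d.
Let hH : is_hilbert H := fibre_hilbert gamma_loop hF.
Let hu : @orthogonal_map R V H (lift F) := lift_orthogonal gamma_loop hF.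

Section Frame.
Variables (w : 'I_d -> 'cV[C]_d) (beta : 'I_d -> R).
Hypothesis hw : unitary_frame w.
Hypothesis hB : forall j, cplx B *m w j = Complex 0 (beta j) *: w j.
Hypothesis hcard : forall c : R, #|[pred j | beta j == c]| = #|[pred j | beta j == - c]|.

Local Notation e := (fock_basis w).
Let lam k : R := (freq k)%:~R + 2^-1 - beta (comp k).
Let P k := 0 < lam k.
Let he : hilbert_basis e := fock_basisP hw.
Let E : nat -> hvec H := (lift F : hvec V -> hvec H) \o e.
Let hE : hilbert_basis E := om_basis hV hH hu he.

Let w_neq0 j : w j != 0.
Proof.
apply/eqP => h; have := hw.1 j j; rewrite h eqxx herm1E big1 => [/esym/eqP|k _].
  by rewrite oner_eq0.
by rewrite mxE mul0r.
Qed.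

Lemma beta_bound j : `|beta j| <= 2^-1.
Proof. exact: (af_bound hFB (w_neq0 j) (hB j)). Qed.

(** Conjugation sends the frequency [n] to [- n - 1] and an eigenvector of [B] for
    [i b] to one for [- i b], hence negates the Dirac eigenvalue. *)
Lemma lam_mirror k l : lam k + lam l != 0 -> hdot H (hconj H (E k)) (E l) = 0.
Proof.
move=> kl; transitivity (hdot V (hconj V (e k)) (e l)).
  exact: (dot_conj_image hV hH hu (fock_basis_mem w k) (fock_basis_mem w l)).
rewrite (fock_basis_conj w w k l); case: eqP => // ekl.
have bn : beta (comp k) + beta (comp l) != 0.
  apply: contra_neq kl => b0; rewrite /lam -ekl rmorphB /= rmorphN /=.
  by move: b0; set x := beta _; set y := beta _; lra.
have Bc : cplx B *m conjmx (w (comp k)) = Complex 0 (- beta (comp k)) *: conjmx (w (comp k)).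
  by rewrite -(conjmx_cplx B) -conjmxM hB conjmxZ.
have hZl c (x y : 'cV[C]_d) : herm 1%:M (c *: x) y = c * herm 1%:M x y.
  by rewrite -[y in LHS]scale1r herm1Z rmorph1 mulr1.
have hZr c (x y : 'cV[C]_d) : herm 1%:M x (c *: y) = conjc c * herm 1%:M x y.
  by rewrite -[x in LHS]scale1r herm1Z mul1r.
have := herm_antisym (conjmx (w (comp k))) (w (comp l)) (af_antisym hFB).
rewrite Bc hB hZl hZr => /eqP; rewrite -subr_eq0 opprK -mulrDl mulf_eq0 => /orP[|/eqP //].
rewrite eq_complex /= addr0 eqxx /= => /eqP h.
by case/eqP: bn; move: h; set x := beta _; set y := beta _; lra.
Qed.

Local Notation Eplus := (closed_span (subfamily E (fun k => 0 < lam k))).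

Lemma basis_eigenvector k : dirac_eigenvector nabla gamma (lam k) (E k).
Proof.
have -> : E k = lift F (osc (freq k) ((@oscn R) *: w (comp k))).
  congr lift; rewrite /fock_basis; apply/funext => t.
  change ((@oscn R) *: osc (freq k) (w (comp k)) t = osc (freq k) ((@oscn R) *: w (comp k)) t).
  by rewrite /osc !scalerA mulrC.
apply: (dirac_eigen_osc gamma_loop hFB); first by rewrite scaler_eq0 negb_or oscn_neq0 w_neq0.
by rewrite -scalemxAr hB !scalerA mulrC.
Qed.

(** By [eigen_orthogonal] every eigenvector is orthogonal to the modes with other
    eigenvalues. *)
Lemma eigenvector_in_span lambda s : 0 < lambda -> dirac_eigenvector nabla gamma lambda s ->
  Eplus s.
Proof.
move=> l0 hs; have [av ls hv] := dirac_eigen_ode gamma_loop hFB hs.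
set v := unlift g gamma F s in av ls hv.
have mv : hmem V v := cvderive_fock_mem av hv.
have cv : closed_span (subfamily e P) (v : hvec V).
  apply: (basis_subfamily hV he mv) => k nk.
  rewrite (dot_fock_basisr w k mv) (eigen_orthogonal (lambda := lambda) (b := beta (comp k)) _ av hv (hB _)).
  - by rewrite mulr0.
  - by move=> x y; exact: (herm_antisym x y (af_antisym hFB)).
  - by apply: contra nk => /eqP; rewrite /P /lam => ->.
have := himage_sub hH hu (closed_span_mem (A := subfamily e P)) cv.
rewrite ls (himage_subfamily hV hH he P hu); exact.
Qed.

Lemma Eig_pos_span : Eig_pos g nabla gamma = Eplus.
Proof.
have oE := basis_orthonormal hE.
have [_ cl] := closed_span_closed hH (@subfamily_mem _ _ _ oE (fun k => 0 < lam k)).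
apply/seteqP; split.
  apply: (subset_trans _ cl); apply: closed_spanS => s [lambda l0 hs].
  exact: (eigenvector_in_span l0 hs).
apply: closed_spanS => _ [k k0 <-]; exists (lam k) => //; exact: basis_eigenvector.
Qed.

(** If [n + 1/2 - b > 0] with [b >= - 1/2], then [n > -1]. *)
Lemma Eplus_sub : Eplus `<=` himage (lift F : hvec V -> hvec H) (fockL R d).
Proof.
rewrite (fockL_subfamily hw) (himage_subfamily hV hH he _ hu).
apply: closed_spanS => _ [k k0 <-]; exists k; last by [].
rewrite /mkset; have := beta_bound (comp k); rewrite ler_norml => /andP[b1 b2].
have h : (-1 : R) < (freq k)%:~R by move: k0; rewrite /= /lam; lra.
have : (-1 < freq k :> int) by rewrite -(ltr_int R).
by lia.
Qed.

Lemma lam_eq0 k : lam k = 0 <->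
  (freq k = 0 /\ beta (comp k) = 2^-1) \/ (freq k = -1 /\ beta (comp k) = - 2^-1).
Proof.
split; last by rewrite /lam => -[[-> ->]|[-> ->]]; rewrite ?mulrN1z; lra.
have := beta_bound (comp k); rewrite ler_norml /lam => /andP[b1 b2] l0.
have h1 : (-1 : R) <= (freq k)%:~R by lra.
have h2 : (freq k)%:~R <= (0 : R) by lra.
have g1 : (-1 <= freq k :> int) by rewrite -(ler_int R).
have g2 : (freq k <= 0 :> int) by rewrite -(ler_int R).
have [fk|fk] : freq k = 0 \/ freq k = -1 by lia.
  by left; split=> //; move: l0; rewrite fk; lra.
by right; split=> //; move: l0; rewrite fk rmorphN1; lra.
Qed.

(** A zero mode has frequency 0 and [beta] equal to 1/2, or frequency -1 and
    [beta] equal to -1/2 ([lam_eq0]). *)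
Let zeros : seq nat := [seq enum_index 0 j | j <- enum [pred j | beta j == 2^-1]] ++
                       [seq enum_index (-1) j | j <- enum [pred j | beta j == - 2^-1]].

Lemma mem_zeros k : lam k = 0 <-> k \in zeros.
Proof.
rewrite lam_eq0 mem_cat; split=> [[[fk bk]|[fk bk]]|/orP[]/mapP[j]].
- by apply/orP; left; apply/mapP; exists (comp k); rewrite ?mem_enum ?inE ?bk // -fk enum_freq.
- by apply/orP; right; apply/mapP; exists (comp k); rewrite ?mem_enum ?inE ?bk // -fk enum_freq.
- by rewrite mem_enum inE => /eqP bj ->; left; rewrite freq_enum comp_enum.
- by rewrite mem_enum inE => /eqP bj ->; right; rewrite freq_enum comp_enum.
Qed.

Lemma zeros_uniq : uniq zeros.
Proof.
have inj n : injective (@enum_index d' n) by move=> i j /(congr1 comp); rewrite !comp_enum.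
rewrite cat_uniq !map_inj_uniq ?enum_uniq //= andbT; apply/hasPn => _ /mapP[j _ ->].
by apply/negP => /mapP[i _] /(congr1 freq); rewrite !freq_enum.
Qed.

Lemma size_zeros : size zeros = (#|[pred j | beta j == 2^-1]|).*2.
Proof. by rewrite size_cat !size_map -!cardE -hcard addnn. Qed.

(** By symmetry of the spectrum of [B], there are as many zero modes of frequency
    [0] as of frequency [-1]; hence their number is even. *)
Lemma Eplus_sublagrangian : sublagrangian Eplus.
Proof.
pose m := #|[pred j | beta j == 2^-1]|.
apply: (@sublagrangian_Eplus R H hH E hE lam lam_mirror m (fun i : 'I_m.*2 => nth 0%N zeros i)).
  move=> i j /eqP; rewrite nth_uniq ?zeros_uniq ?size_zeros ?ltn_ord // => /eqP h.
  exact: val_inj.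
move=> k; rewrite mem_zeros; split=> [kz|[i <-]]; last by rewrite mem_nth // size_zeros.
have h : (index k zeros < m.*2)%N by rewrite -size_zeros index_mem.
by exists (Ordinal h); rewrite /= nth_index.
Qed.

Lemma Eplus_equivalent L1 L2 : lagrangian L1 -> lagrangian L2 ->
  Eplus `<=` L1 -> Eplus `<=` L2 -> equivalent L1 L2.
Proof.
apply: (@equivalent_Eplus R H hH E hE lam lam_mirror L1 L2 (\max_(k <- zeros) k).+1) => k.
by move=> /mem_zeros kz; rewrite ltnS; apply: (@leq_bigmax_seq _ zeros xpredT id).
Qed.

End Frame.

(** In an adapted frame the Dirac sublagrangian is spanned by part of the Fourier
    basis of the image of [fockL], from which it differs by finitely many modes. *)
Theorem dirac_spectrum :
  [/\ sublagrangian (Eig_pos g nabla gamma),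
      lagrangian (himage (lift F : hvec V -> hvec H) (fockL R d)),
      Eig_pos g nabla gamma `<=` himage (lift F : hvec V -> hvec H) (fockL R d)
    & forall L1 L2, lagrangian L1 -> lagrangian L2 -> Eig_pos g nabla gamma `<=` L1 ->
        Eig_pos g nabla gamma `<=` L2 -> equivalent L1 L2].
Proof.
have [w [beta [hw hB hc]]] := antisym_eigen_frame (af_antisym hFB).
rewrite (Eig_pos_span hw hB); split.
- exact: (Eplus_sublagrangian hw hB hc).
- exact: (lagrangian_fockL_image hH hu).
- exact: (Eplus_sub hw hB).
- by move=> L1 L2; exact: (Eplus_equivalent hw hB).
Qed.

End DiracSpectrum.

(** * Change of frame along the loop *)

Section FourierDecay.
Context {R : realType}.
Local Notation mu := (@lebesgue_measure R).
Local Notation D := (`[0, 2 * pi]%classic : set R).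
Implicit Types (f q : R -> R) (k : int).

Let mD : @measurable _ (measurableTypeR R) D. Proof. exact: measurable_itv. Qed.

Lemma Rintegral_bound f (K : R) : continuous f -> (forall t, `|t| <= 2 * pi -> `|f t| <= K) ->
  `|\int[mu]_(t in D) f t| <= 2 * pi * K.
Proof.
move=> cf hf.
have ck (c : R) : \int[mu]_(t in D) c = c * (2 * pi).
  have dc t : is_derive t (1 : R) (fun s : R => c * s) c.
    rewrite (_ : (fun s => _) = c \*: (@id R)) //.
    by apply: is_derive_eq; rewrite /GRing.scale /= mulr1.
  have cc : continuous (fun _ : R => c) by move=> t; apply: cvg_cst.
  by rewrite (Rintegral_derive dc cc) mulr0 subr0.
have ic (c : R) : mu.-integrable D (EFin \o (fun=> c)).
  by apply: continuous_integrable => t; apply: cvg_cst.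
have hD t : D t -> - K <= f t <= K.
  rewrite /= in_itv /= => /andP[t0 t1]; rewrite -ler_norml; apply: hf.
  by rewrite ger0_norm.
have e1 : - (2 * pi * K) = \int[mu]_(t in D) (- K) by rewrite ck; ring.
have e2 : 2 * pi * K = \int[mu]_(t in D) K by rewrite ck; ring.
rewrite ler_norml; apply/andP; split; [rewrite e1|rewrite e2].
  by apply: le_Rintegral => //; [exact: continuous_integrable|move=> t /hD /andP[]].
by apply: le_Rintegral => //; [exact: continuous_integrable|move=> t /hD /andP[]].
Qed.

(** The boundary terms cancel by periodicity. *)
Lemma fourier_by_parts q q' k : (forall t, is_derive t (1 : R) q (q' t)) -> continuous q' ->
  q (2 * pi) = q 0 ->
  Complex 0 k%:~R * cintegral (fun t => (q t)%:C%C * ce (k%:~R * t)) =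
  - cintegral (fun t => (q' t)%:C%C * ce (k%:~R * t)).
Proof.
move=> dq cq' pq.
have cq : continuous q by move=> t; apply: is_derive_cont (dq t).
have creal f : continuous f -> ccontinuous (fun t => (f t)%:C%C).
  by move=> cf; split=> //= t; apply: cvg_cst.
have c0 := ccontinuousM (creal q cq) (ccontinuous_ce k%:~R).
have c1 := ccontinuousM (creal q' cq') (ccontinuous_ce k%:~R).
have c2 := ccontinuousM (ccontinuous_cst (Complex 0 k%:~R)) c0.
have dh t : is_cderive (fun t => (q t)%:C%C * ce (k%:~R * t)) t
   ((q' t)%:C%C * ce (k%:~R * t) + Complex 0 k%:~R * ((q t)%:C%C * ce (k%:~R * t))).
  have := is_cderiveM (is_cderive_real (dq t)) (is_cderive_ce k%:~R t).
  by congr is_cderive; ring.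
have := cintegral_derive dh (ccontinuousD c1 c2).
rewrite cintegralD; [|exact: ccontinuous_cintegrable|exact: ccontinuous_cintegrable].
rewrite cintegralZ; last exact: ccontinuous_cintegrable.
rewrite ce2pi_int mulr0 ce0 pq subrr => /eqP; rewrite addrC addr_eq0 => /eqP ->.
by [].
Qed.

(** Two integrations by parts bring out the fourth power of [k]; the integrand
    that remains is bounded by the second derivative. *)
Lemma fourier_decay q q1 q2 (K : R) k : (forall t, is_derive t (1 : R) q (q1 t)) ->
  (forall t, is_derive t (1 : R) q1 (q2 t)) -> continuous q2 ->
  q (2 * pi) = q 0 -> q1 (2 * pi) = q1 0 -> (forall t, `|t| <= 2 * pi -> `|q2 t| <= K) ->
  csq (cintegral (fun t => (q t)%:C%C * ce (k%:~R * t))) * k%:~R ^+ 4 <=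
  2 * (2 * pi * K) ^+ 2.
Proof.
move=> dq dq1 cq2 p p1 hK.
have cq1 : continuous q1 by move=> t; apply: is_derive_cont (dq1 t).
have e1 := fourier_by_parts k dq cq1 p; have e2 := fourier_by_parts k dq1 cq2 p1.
set I0 := cintegral _ in e1 *; set I2 := cintegral (fun t => (q2 t)%:C%C * _) in e2.
have -> : csq I0 * k%:~R ^+ 4 = csq I2.
  have -> : I2 = Complex 0 k%:~R * (Complex 0 k%:~R * I0) by rewrite e1 mulrN e2 opprK.
  by rewrite !csqM /csq /= !expr0n /= !add0r; ring.
have b0 : 0 <= 2 * pi * K.
  have := hK 0; rewrite normr0 => /(_ (mulr_ge0 (ler0n _ 2) (pi_ge0 R))) h.
  by rewrite !mulr_ge0 ?pi_ge0 // (le_trans _ h).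
have part (s : R -> R) : (forall t, `|s t| <= 1) -> continuous s ->
    (\int[mu]_(t in D) (q2 t * s t)) ^+ 2 <= (2 * pi * K) ^+ 2.
  move=> s1 cs; rewrite -real_normK ?num_real // ler_pXn2r ?nnegrE //.
  apply: Rintegral_bound => [t|t ht]; first by apply: cvgM; [exact: cq2|exact: cs].
  by rewrite normrM -[K]mulr1; apply: ler_pM => //; exact: hK.
have dl t : is_derive t (1 : R) (fun s : R => k%:~R * s) k%:~R.
  rewrite (_ : (fun s => _) = k%:~R \*: (@id R)) //.
  by apply: is_derive_eq; rewrite /GRing.scale /= mulr1.
have [cc cs] := ccontinuous_ce (k%:~R : R).
rewrite mulr2n mulrDl mul1r /csq /I2 /cintegral /=; apply: lerD.
  rewrite (@eq_Rintegral _ _ _ mu D (fun t => q2 t * cos (k%:~R * t))); last first.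
    by move=> t _; rewrite /= mul0r subr0.
  by apply: part => // t; rewrite ler_norml cos_geN1 cos_le1.
rewrite (@eq_Rintegral _ _ _ mu D (fun t => q2 t * sin (k%:~R * t))); last first.
  by move=> t _; rewrite /= mul0r addr0.
by apply: part => // t; rewrite ler_norml sin_geN1 sin_le1.
Qed.

End FourierDecay.

Section FrameChange.
Context {R : realType} {d' : nat} {M : oriented_manifold R d'.+1}.
Local Notation d := d'.+1.
Variables (g : riemannian_metric M) (gamma : R -> M).
Hypothesis gamma_loop : smooth_loop gamma.
Local Notation V := (fockV R d).
Local Notation H := (fibreH g gamma).

(** The inner products between the two systems of modes are the Fourier
    coefficients of the entries of [Q], which decay rapidly since [Q] is smooth. *)
Lemma equivalent_frame_change F (Q : R -> 'M[R]_d) : frame_along g gamma F ->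
  frame_along g gamma (fun t => F t *m Q t) -> smooth_mx setT Q ->
  (forall t, Q (t + 2 * pi) = Q t) ->
  equivalent (himage (lift (fun t => F t *m Q t) : hvec V -> hvec H) (fockL R d))
             (himage (lift F : hvec V -> hvec H) (fockL R d)).
Proof.
move=> hF hFQ sQ pQ.
have hH := fibre_hilbert gamma_loop hF.
have sQ1 := smooth_dmx openT sQ; have sQ2 := smooth_dmx openT sQ1.
have p1 t : dmx Q (t + 2 * pi) = dmx Q t := dmx_periodic t pQ.
have cQ2 : mcontinuous (dmx (dmx Q)) by move=> i j t; apply: smooth_fun_cont (sQ2 i j) I.
have [K K0 hK] := mx_segment_bound (2 * pi) cQ2.
apply: (equivalent_fockL_images hH (lift_orthogonal gamma_loop hF)
  (lift_orthogonal gamma_loop hFQ) (C := 2 * (2 * pi * K) ^+ 2)).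
  by rewrite mulr_ge0 // sqr_ge0.
move=> n m i j nm.
have -> : hdot H (lift (fun t => F t *m Q t) (osc n (std_frame i))) (lift F (osc m (std_frame j))) =
    cintegral (fun t => (Q t j i)%:C%C * ce ((m - n)%:~R * t)).
  rewrite (dot_unlift hF (lift (fun t => F t *m Q t) (osc n (std_frame i)))
    (lift F (osc m (std_frame j)))) (liftK hF (osc m (std_frame j))).
  have -> : lift (fun t => F t *m Q t) (osc n (std_frame i)) =
      lift F (fun t => cplx (Q t) *m osc n (std_frame i) t).
    by apply/funext => t; rewrite /lift cplxM mulmxA.
  rewrite (liftK hF (fun t => cplx (Q t) *m osc n (std_frame i) t)).
  change (cintegral (fun t => herm 1%:M (cplx (Q t) *m osc n (std_frame i) t)
     (osc m (std_frame j) t)) = cintegral (fun t => (Q t j i)%:C%C * ce ((m - n)%:~R * t))).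
  congr cintegral; apply/funext => t.
  have -> : cplx (Q t) *m osc n (std_frame i) t = osc n (cplx (Q t) *m std_frame i) t.
    by rewrite /osc scalemxAr.
  rewrite (herm_osc n m (cplx (Q t) *m std_frame i) (std_frame j) t) herm_std.
  by rewrite /std_frame -colE !mxE.
have -> : (n - m)%:~R ^+ 4 = (m - n)%:~R ^+ 4 :> R.
  by rewrite -opprB rmorphN /= -mulN1r exprMn -signr_odd /= expr0 mul1r.
apply: (@fourier_decay R (fun t => Q t j i) (fun t => dmx Q t j i) (fun t => dmx (dmx Q) t j i)).
- by move=> t; exact: (smooth_mderive sQ I).
- by move=> t; exact: (smooth_mderive sQ1 I).
- exact: cQ2.
- by rewrite -[2 * pi]add0r pQ.
- by rewrite -[2 * pi]add0r p1.
- by move=> t; apply: hK.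
Qed.

End FrameChange.

(** * Equality of the two classes *)

Lemma lagrangian_fockL (R : realType) (d' : nat) : lagrangian (fockL R d'.+1).
Proof.
have hs := @std_frame_unitary R d'; rewrite (fockL_subfamily hs).
apply: (lagrangian_subfamily (fock_hilbert R d'.+1) (fock_basisP hs)) => k l kl.
rewrite fock_basis_conj; case: eqP => // e; move: kl; rewrite -e.
by case: (lerP 0 (freq k)) => h; lia.
Qed.

Theorem proposition6p2p5 (R : realType) (d : nat)
    (d_ge1 : (1 <= d)%N) (d_neq4 : d <> 4%N)
    (M : oriented_manifold R d) (g : riemannian_metric M)
    (S : spin_structure g)
    (nabla : connection M) (nablaLC : levi_civita g nabla)
    (gamma : R -> M) (gamma_loop : smooth_loop gamma)
    (nu : hvec (fockV R d) -> hvec (fibreH g gamma))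
    (nu_frame : OL_frames S gamma nu) :
  sublagrangian (Eig_pos g nabla gamma) /\
  eq_class (himage nu (fockL R d)) = sublagrangian_class (Eig_pos g nabla gamma).
Proof.
case: d d_ge1 {d_neq4} => [//|d'] _ in M g S nabla nablaLC gamma gamma_loop nu nu_frame *.
have [phi [h [[_ pphi base sphi] rh nuE]]] := nu_frame.
pose F t := spin_frame (phi t).
have hF : frame_along g gamma F.
  split; [|by move=> t; rewrite /F pphi|exact: sphi].
  by move=> t; have [+ _] := spin_frameP (phi t); rewrite base.
have [Q [B [sQ pQ hFB]]] := adapted_frame_exists gamma_loop nablaLC.2 hF.
have hFQ := af_frame hFB.
have hV := fock_hilbert R d'.+1.
have hH := fibre_hilbert gamma_loop hF.
have hu := lift_orthogonal gamma_loop hF.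
have [subE lag1 E1 eqE] := dirac_spectrum gamma_loop hFB.
split; first exact: subE.
set L1 := himage _ _ in lag1 E1.
set L0 := himage (lift F : hvec (fockV R d'.+1) -> hvec (fibreH g gamma)) (fockL R d'.+1).
have lagV := lagrangian_fockL R d'.
have pL0 : projective L0 := lagrangian_projective hH (lagrangian_fockL_image hH hu).
have pL1 := lagrangian_projective hH lag1.
have lagnu : lagrangian (himage nu (fockL R d'.+1)).
  by rewrite nuE; apply: (lagrangian_fockL_image hH); exact: (om_comp hV hH rh.1 hu).
have pnu := lagrangian_projective hH lagnu.
(* [nu] is the composite of [lift F] with an element of the restricted group *)
have nu0 : equivalent (himage nu (fockL R d'.+1)) L0.
  by rewrite nuE; exact: (equivalent_restricted_image hV hH lagV rh hu).
have e10 : equivalent L1 L0 := equivalent_frame_change gamma_loop hF hFQ sQ pQ.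
have nu1 : equivalent (himage nu (fockL R d'.+1)) L1.
  exact: (equivalent_trans hH pnu pL0 pL1 nu0 (equivalent_sym hH pL1 pL0 e10)).
apply/seteqP; split=> L' [lag' e'].
  split; [exact: lag'|exists L1; split; [exact: lag1|exact: E1|]].
  exact: (equivalent_trans hH (lagrangian_projective hH lag') pnu pL1 e' nu1).
split; first exact: lag'.
have [L2 [lag2 E2 e2]] := e'.
have pL' := lagrangian_projective hH lag'; have pL2 := lagrangian_projective hH lag2.
apply: (equivalent_trans hH pL' pL2 pnu e2).
apply: (equivalent_trans hH pL2 pL1 pnu (eqE _ _ lag2 lag1 E2 E1)).
exact: (equivalent_sym hH pnu pL1 nu1).
Qed.
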